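(* Let $(S,\mathfrak n)$ be a commutative noetherian local ring, let $\omega\in\mathfrak n$ be a non-zerodivisor, and let $R=S/(\omega)$. Then: (1) The functor $T:\underline{\mathsf{Mon}}(\omega,\mathcal G)\to\mathsf{D_{sg}}(R)$ sending each object $(G\xrightarrow{f}P)$ to $\operatorname{Coker}f$, viewed as a stalk complex, is a fully faithful triangle functor. Moreover, $T$ is dense if and only if $R$ (and so, $S$) is Gorenstein. (2) The fully faithful triangle functor $T\circ\underline{i}:\underline{\mathsf{Mon}}(\omega,\mathcal P)\to\mathsf{D_{sg}}(R)$ is dense if and only if $S$ is a regular ring. Here $\underline{i}:\underline{\mathsf{Mon}}(\omega,\mathcal P)\to\underline{\mathsf{Mon}}(\omega,\mathcal G)$ is the fully faithful triangle functor induced by the inclusion $\mathsf{Mon}(\omega,\mathcal P)\subseteq\mathsf{Mon}(\omega,\mathcal G)$.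
   Context: All modules are finitely generated. $\mathcal P(S)$ (resp. $\mathcal G(S)$) denotes the category of finitely generated projective (resp. Gorenstein projective) $S$-modules. $\mathsf{Mor}(S)$ is the abelian category whose objects are $S$-homomorphisms $(M\xrightarrow{f}N)$ of finitely generated $S$-modules, a morphism $(M\xrightarrow{f}N)\to(M'\xrightarrow{f'}N')$ being a pair $(\psi_1,\psi_0)$ of $S$-homomorphisms $\psi_1:M\to M'$, $\psi_0:N\to N'$ with $\psi_0f=f'\psi_1$. $\mathsf{Mon}(\omega,\mathcal G)$ is the full subcategory of $\mathsf{Mor}(S)$ whose objects are the monomorphisms $(G\xrightarrow{f}P)$ with $G\in\mathcal G(S)$, $P\in\mathcal P(S)$ and $\omega\cdot\operatorname{Coker}f=0$ (so $\operatorname{Coker}f$ is an $R$-module); $\mathsf{Mon}(\omega,\mathcal P)$ is the full subcategory of those objects $(P\xrightarrow{f}Q)$ with $P,Q\in\mathcal P(S)$. Each of these two categories is an exact category in the sense of Quillen, with conflations the short exact sequences of $\mathsf{Mor}(S)$ (i.e. componentwise exact) all of whose terms lie in the category; each is Frobenius, and they have the same projective objects. The stable category $\underline{\mathcal A}$ of a Frobenius category $\mathcal A$ has the same objects, with morphisms taken modulo those factoring through projective objects; it carries its standard (Happel) triangulated structure, whose shift is the inverse of the syzygy functor. $\mathsf{D_{sg}}(R)$, the singularity category of $R$, is the Verdier quotient of the bounded derived category $\mathsf{D^b}(R)$ of finitely generated $R$-modules by the full subcategory of perfect complexes. On morphisms $T$ is induced by the map induced on cokernels. A functor is dense if it is essentially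 surjective on objects. *)

(* Defs.v *)
From HB Require Import structures.
From mathcomp Require Import all_boot all_order all_algebra.
From mathcomp Require Import generic_quotient ring_quotient.
From mathcomp Require Import boolp.
From mathcomp Require Import zify.

Set Implicit Arguments.
Unset Strict Implicit.
Unset Printing Implicit Defensive.

Import GRing.Theory Num.Theory Order.TTheory.

Local Open Scope ring_scope.
Local Open Scope quotient_scope.

(** * Categories, functors, triangulated data *)

(* Hom-sets are types with an explicit equality [heq]; a quotient of Hom-sets
   is taken by coarsening [heq]. *)
Record category := Category {
  obj :> Type;
  Mor : obj -> obj -> Type;
  heq : forall X Y, Mor X Y -> Mor X Y -> Prop;
  idm : forall X, Mor X X;
  comp : forall X Y Z, Mor Y Z -> Mor X Y -> Mor X Z;
  heq_refl : forall X Y (f : Mor X Y), heq f f;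
  heq_sym : forall X Y (f g : Mor X Y), heq f g -> heq g f;
  heq_trans : forall X Y (f g h : Mor X Y), heq f g -> heq g h -> heq f h;
  comp_heq : forall X Y Z (g g' : Mor Y Z) (f f' : Mor X Y),
    heq g g' -> heq f f' -> heq (comp g f) (comp g' f');
  compA : forall X Y Z W (h : Mor Z W) (g : Mor Y Z) (f : Mor X Y),
    heq (comp h (comp g f)) (comp (comp h g) f);
  comp1m : forall X Y (f : Mor X Y), heq (comp (idm Y) f) f;
  compm1 : forall X Y (f : Mor X Y), heq (comp f (idm X)) f }.

Arguments Mor {c}.
Arguments heq {c X Y}.
Arguments idm {c}.
Arguments comp {c X Y Z}.

Notation "f ≡ g" := (heq f g) (at level 70, no associativity).
Notation "g ∘ f" := (comp g f) (at level 40, left associativity).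

Definition is_iso (C : category) (X Y : C) (f : Mor X Y) : Prop :=
  exists g : Mor Y X, g ∘ f ≡ idm X /\ f ∘ g ≡ idm Y.

Definition isom (C : category) (X Y : C) : Prop :=
  exists f : Mor X Y, is_iso f.

Lemma isom_sym (C : category) (X Y : C) : isom X Y -> isom Y X.
Proof. by case=> f [g [gf fg]]; exists g, f. Qed.

Lemma isom_trans (C : category) (X Y Z : C) : isom X Y -> isom Y Z -> isom X Z.
Proof.
have aux (A B D : C) (f : Mor A B) (g : Mor B A) (h : Mor B D) (k : Mor D B) :
    g ∘ f ≡ idm A -> k ∘ h ≡ idm B -> (g ∘ k) ∘ (h ∘ f) ≡ idm A.
  move=> gf kh; apply: heq_trans gf; apply: heq_trans (heq_sym (compA _ _ _)) _.
  apply: comp_heq (heq_refl _) _; apply: heq_trans (compA _ _ _) _.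
  by apply: heq_trans (comp1m _); apply: comp_heq (heq_refl _).
by case=> f [g [gf fg]] [h [k [kh hk]]]; exists (h ∘ f), (g ∘ k); split; apply: aux.
Qed.

Record is_functor (C D : category) (F0 : C -> D)
    (F1 : forall X Y : C, Mor X Y -> Mor (F0 X) (F0 Y)) : Prop := IsFunctor {
  functor_heq : forall X Y (f g : Mor X Y), f ≡ g -> F1 X Y f ≡ F1 X Y g;
  functor_id : forall X, F1 X X (idm X) ≡ idm (F0 X);
  functor_comp : forall X Y Z (g : Mor Y Z) (f : Mor X Y),
    F1 X Z (g ∘ f) ≡ F1 Y Z g ∘ F1 X Y f }.

Lemma functor_iso (C D : category) (F0 : C -> D)
    (F1 : forall X Y : C, Mor X Y -> Mor (F0 X) (F0 Y)) (X Y : C) (f : Mor X Y) :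
  is_functor F1 -> is_iso f -> is_iso (F1 X Y f).
Proof.
case=> Fe Fi Fc [g [gf fg]]; exists (F1 _ _ g); split.
  by apply: heq_trans (heq_sym (Fc _ _ _ _ _)) _; apply: heq_trans (Fi _); apply: Fe.
by apply: heq_trans (heq_sym (Fc _ _ _ _ _)) _; apply: heq_trans (Fi _); apply: Fe.
Qed.

Definition fully_faithful (C D : category) (F0 : C -> D)
    (F1 : forall X Y : C, Mor X Y -> Mor (F0 X) (F0 Y)) : Prop :=
  forall X Y : C,
    (forall f g : Mor X Y, F1 X Y f ≡ F1 X Y g -> f ≡ g) /\
    (forall h : Mor (F0 X) (F0 Y), exists f : Mor X Y, F1 X Y f ≡ h).

Definition dense (C D : category) (F0 : C -> D) : Prop :=
  forall Y : D, exists X : C, isom (F0 X) Y.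

(* A category with a shift functor and a class of distinguished triangles
   X -> Y -> Z -> Sh X. *)
Record tricat := Tricat {
  tcat :> category;
  sh0 : tcat -> tcat;
  sh1 : forall X Y : tcat, Mor X Y -> Mor (sh0 X) (sh0 Y);
  sh_functor : is_functor sh1;
  dist : forall X Y Z : tcat,
    Mor X Y -> Mor Y Z -> Mor Z (sh0 X) -> Prop }.

Arguments sh0 {t}.
Arguments sh1 {t X Y}.
Arguments dist {t X Y Z}.

(* A triangle functor: a functor together with a natural isomorphism
   F Sh -> Sh F carrying distinguished triangles to distinguished triangles. *)
Definition triangle_functor (C D : tricat) (F0 : C -> D)
    (F1 : forall X Y : C, Mor X Y -> Mor (F0 X) (F0 Y)) : Prop :=
  is_functor F1 /\
  exists xi : forall X : C, Mor (F0 (sh0 X)) (sh0 (F0 X)),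
    [/\ forall X, is_iso (xi X),
        forall (X Y : C) (f : Mor X Y),
          sh1 (F1 X Y f) ∘ xi X ≡ xi Y ∘ F1 _ _ (sh1 f)
      & forall (X Y Z : C) (u : Mor X Y) (v : Mor Y Z) (w : Mor Z (sh0 X)),
          dist u v w -> dist (F1 _ _ u) (F1 _ _ v) (xi X ∘ F1 _ _ w)].

(* The triangles isomorphic to one in the class [std]. *)
Definition iso_closure (C : category) (s0 : C -> C)
    (s1 : forall X Y : C, Mor X Y -> Mor (s0 X) (s0 Y))
    (std : forall X Y Z : C, Mor X Y -> Mor Y Z -> Mor Z (s0 X) -> Prop)
    (X Y Z : C) (u : Mor X Y) (v : Mor Y Z) (w : Mor Z (s0 X)) : Prop :=
  exists (X' Y' Z' : C) (u' : Mor X' Y') (v' : Mor Y' Z') (w' : Mor Z' (s0 X'))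
         (a : Mor X X') (b : Mor Y Y') (c : Mor Z Z'),
    [/\ std X' Y' Z' u' v' w', is_iso a, is_iso b & is_iso c] /\
    [/\ b ∘ u ≡ u' ∘ a, c ∘ v ≡ v' ∘ b & s1 X X' a ∘ w ≡ w' ∘ c].

(** * Localization of a category *)

Section Localization.
Variables (C : category) (W : forall X Y : C, Mor X Y -> Prop).

Inductive word : C -> C -> Type :=
| Arr X Y (f : Mor X Y) : word X Y
| Inv X Y (s : Mor X Y) of W s : word Y X
| Seq X Y Z of word Y Z & word X Y : word X Z.

Inductive word_eq : forall X Y, word X Y -> word X Y -> Prop :=
| weq_refl X Y (f : word X Y) : word_eq f f
| weq_sym X Y (f g : word X Y) : word_eq f g -> word_eq g f
| weq_trans X Y (f g h : word X Y) : word_eq f g -> word_eq g h -> word_eq f h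
| weq_seq X Y Z (g g' : word Y Z) (f f' : word X Y) :
    word_eq g g' -> word_eq f f' -> word_eq (Seq g f) (Seq g' f')
| weq_seqA X Y Z T (h : word Z T) (g : word Y Z) (f : word X Y) :
    word_eq (Seq h (Seq g f)) (Seq (Seq h g) f)
| weq_1seq X Y (f : word X Y) : word_eq (Seq (Arr (idm Y)) f) f
| weq_seq1 X Y (f : word X Y) : word_eq (Seq f (Arr (idm X))) f
| weq_arr X Y (f g : Mor X Y) : f ≡ g -> word_eq (Arr f) (Arr g)
| weq_arr_comp X Y Z (g : Mor Y Z) (f : Mor X Y) :
    word_eq (Arr (g ∘ f)) (Seq (Arr g) (Arr f))
| weq_invl X Y (s : Mor X Y) (Ws : W s) :
    word_eq (Seq (Inv Ws) (Arr s)) (Arr (idm X))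
| weq_invr X Y (s : Mor X Y) (Ws : W s) :
    word_eq (Seq (Arr s) (Inv Ws)) (Arr (idm Y)).

(* The Gabriel-Zisman localization C[W^-1]. *)
Definition localization : category :=
  @Category C word word_eq (fun X => Arr (idm X)) (@Seq)
    weq_refl weq_sym weq_trans weq_seq weq_seqA weq_1seq weq_seq1.

Section Induced.
Variables (F0 : C -> C) (F1 : forall X Y : C, Mor X Y -> Mor (F0 X) (F0 Y)).
Hypothesis FW : forall X Y (s : Mor X Y), W s -> W (F1 s).

Fixpoint word_map X Y (f : word X Y) : word (F0 X) (F0 Y) :=
  match f in word X Y return word (F0 X) (F0 Y) with
  | Arr _ _ f => Arr (F1 f)
  | Inv _ _ _ Ws => Inv (FW Ws)
  | Seq _ _ _ g f => Seq (word_map g) (word_map f)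
  end.

Lemma word_map_functor :
  is_functor F1 ->
  @is_functor localization localization F0 (fun X Y => @word_map X Y).
Proof.
case=> Fe Fi Fc; split=> /= [X Y f g|X|X Y Z g f].
- elim=> {X Y f g} /=.
  + by move=> *; apply: weq_refl.
  + by move=> *; apply: weq_sym.
  + by move=> X Y f g h _ + _; apply: weq_trans.
  + by move=> *; apply: weq_seq.
  + by move=> *; apply: weq_seqA.
  + move=> X Y f; apply: weq_trans (weq_1seq _).
    by apply: weq_seq (weq_refl _); apply: weq_arr.
  + move=> X Y f; apply: weq_trans (weq_seq1 _).
    by apply: weq_seq (weq_refl _) _; apply: weq_arr.
  + by move=> X Y f g fg; apply: weq_arr; apply: Fe.
  + move=> X Y Z g f; apply: weq_trans (weq_arr_comp _ _).
    exact/weq_arr/Fc.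
  + by move=> X Y s Ws; apply: weq_trans (weq_invl _) _; apply/weq_arr/heq_sym/Fi.
  + by move=> X Y s Ws; apply: weq_trans (weq_invr _) _; apply/weq_arr/heq_sym/Fi.
- exact/weq_arr/Fi.
- exact: weq_refl.
Qed.

End Induced.
End Localization.

(* The localization of [C], with the shift of [C]; its distinguished triangles
   are those isomorphic to the image of a distinguished triangle of [C]. *)
Section LocalizedTricat.
Variables (C : tricat) (W : forall X Y : C, Mor X Y -> Prop).
Hypothesis shW : forall X Y (s : Mor X Y), W s -> W (sh1 s).

Inductive loc_std : forall X Y Z : localization W,
    Mor X Y -> Mor Y Z -> Mor Z (sh0 (X : C)) -> Prop :=
| LocStd (X Y Z : C) (u : Mor X Y) (v : Mor Y Z) (w : Mor Z (sh0 X)) :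
    dist u v w -> loc_std (Arr W u) (Arr W v) (Arr W w).

Definition loc_tricat : tricat :=
  @Tricat (localization W) (fun X => sh0 (X : C)) _
    (word_map_functor shW (sh_functor C))
    (@iso_closure (localization W) (fun X => sh0 (X : C))
       (fun X Y => @word_map C W _ _ shW X Y) loc_std).

End LocalizedTricat.

(* The morphisms with a cone in [N]; the Verdier quotient by [N] is the
   localization at this class. *)
Definition cone_in (D : tricat) (N : D -> Prop) (X Y : D) (s : Mor X Y) : Prop :=
  exists (Z : D) (v : Mor Y Z) (w : Mor Z (sh0 X)), dist s v w /\ N Z.

(** * Modules *)

Section Modules.
Variable R : comNzRingType.

Definition finitely_generated (M : lmodType R) : Prop :=
  exists (n : nat) (e : 'I_n -> M),
    forall x : M, exists c : 'I_n -> R, x = \sum_i c i *: e i.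

Definition projective_module (P : lmodType R) : Prop :=
  forall (M N : lmodType R) (p : {linear M -> N}) (f : {linear P -> N}),
    (forall y, exists x, p x = y) ->
    exists g : {linear P -> M}, forall x, p (g x) = f x.

Definition injective_module (E : lmodType R) : Prop :=
  forall (M N : lmodType R) (i : {linear M -> N}) (f : {linear M -> E}),
    injective i -> exists g : {linear N -> E}, forall x, g (i x) = f x.

Definition exact_at (L M N : lmodType R)
    (f : {linear L -> M}) (g : {linear M -> N}) : Prop :=
  forall y, g y = 0 <-> exists x, f x = y.

Definition short_exact (L M N : lmodType R)
    (f : {linear L -> M}) (g : {linear M -> N}) : Prop :=
  [/\ injective f, exact_at f g & forall z, exists y, g y = z].

Record fgmod := FgMod {
  fg_mod :> lmodType R;
  fg_prop : finitely_generated fg_mod }.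

Definition lin (M N : lmodType R) (f : M -> N) (fL : linear f) : {linear M -> N} :=
  HB.pack f (GRing.isLinear.Build R M N *:%R f fL).

Arguments lin : simpl never.

Lemma linE (M N : lmodType R) (f : M -> N) (fL : linear f) x : lin fL x = f x.
Proof. by []. Qed.

Lemma fg_surj (M N : lmodType R) (p : {linear M -> N}) :
  (forall y, exists x, p x = y) -> finitely_generated M -> finitely_generated N.
Proof.
move=> ps [n [e eP]]; exists n, (fun i => p (e i)) => y.
have [x <-] := ps y; have [c ->] := eP x; exists c.
by rewrite linear_sum; apply: eq_bigr => i _; rewrite linearZ.
Qed.

Lemma fg_zero : finitely_generated 'rV[R]_0.
Proof.
exists 0%N, (fun=> 0) => x; exists (fun=> 0); rewrite big_ord0.
exact: thinmx0.
Qed.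

Definition fgmod0 : fgmod := FgMod fg_zero.

Lemma fgmod0_eq0 (x : fgmod0) : x = 0.
Proof. exact: thinmx0. Qed.

Lemma fg_pair (M N : lmodType R) :
  finitely_generated M -> finitely_generated N ->
  finitely_generated (M * N)%type.
Proof.
move=> [m [e eP]] [n [e' eP']]; exists (m + n)%N.
have L1 : linear (fun x : M => (x, 0) : M * N).
  by move=> a x y; apply/pair_equal_spec; rewrite /= scaler0 addr0.
have L2 : linear (fun y : N => (0, y) : M * N).
  by move=> a x y; apply/pair_equal_spec; rewrite /= scaler0 addr0.
exists (fun i => match split i with inl j => lin L1 (e j) | inr k => lin L2 (e' k) end).
move=> [x y]; have [c xE] := eP x; have [c' yE] := eP' y.
exists (fun i => match split i with inl j => c j | inr k => c' k end).
have -> : (x, y) = lin L1 x + lin L2 y.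
  by apply/pair_equal_spec; rewrite /= addr0 add0r.
rewrite big_split_ord {1}xE {1}yE !linear_sum; congr (_ + _).
- apply: eq_bigr => i _; rewrite linearZ.
  by have -> : split (lshift n i) = inl i := unsplitK (inl i).
- apply: eq_bigr => i _; rewrite linearZ.
  by have -> : split (rshift m i) = inr i := unsplitK (inr i).
Qed.

Definition fgmod_sum (M N : fgmod) : fgmod :=
  FgMod (fg_pair (fg_prop M) (fg_prop N)).

Lemma zero_linear (M N : lmodType R) : linear (fun _ : M => 0 : N).
Proof. by move=> a x y; rewrite scaler0 addr0. Qed.

Lemma id_linear (M : lmodType R) : linear (fun x : M => x).
Proof. by []. Qed.

Lemma comp_linear (L M N : lmodType R)
    (g : {linear M -> N}) (f : {linear L -> M}) :
  linear (fun x => g (f x)).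
Proof. by move=> a x y; rewrite !linearP. Qed.

Lemma projective_zero : projective_module fgmod0.
Proof.
move=> M N p f ps; exists (lin (@zero_linear fgmod0 M)) => x.
by rewrite (fgmod0_eq0 x) !linear0.
Qed.

Lemma projective_sum (P Q : lmodType R) :
  projective_module P -> projective_module Q ->
  projective_module (P * Q)%type.
Proof.
move=> hP hQ M N p f ps.
have L1 : linear (fun x : P => f (x, 0)).
  move=> a x y; rewrite -linearP; congr (f _).
  by apply/pair_equal_spec; rewrite /= scaler0 addr0.
have L2 : linear (fun y : Q => f (0, y)).
  move=> a x y; rewrite -linearP; congr (f _).
  by apply/pair_equal_spec; rewrite /= scaler0 addr0.
have [g1 g1E] := hP _ _ p (lin L1) ps.
have [g2 g2E] := hQ _ _ p (lin L2) ps.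
have L : linear (fun z : P * Q => g1 z.1 + g2 z.2).
  by move=> a x y; rewrite /= !linearP scalerDr addrACA.
exists (lin L) => -[x y]; rewrite !linE linearD g1E g2E !linE -linearD.
by congr (f _); apply/pair_equal_spec; rewrite /= addr0 add0r.
Qed.

(* [G] is a syzygy of a totally acyclic complex of finitely generated
   projective modules. *)
Definition gorenstein_projective (G : lmodType R) : Prop :=
  exists (P : int -> fgmod) (d : forall i, {linear P i -> P (i + 1)}),
    [/\ forall i, projective_module (P i),
        forall i, exact_at (d i) (d (i + 1)),
        forall (Q : fgmod) (i : int) (phi : {linear P (i + 1) -> Q}),
          projective_module Q -> (forall x, phi (d i x) = 0) ->
          exists psi : {linear P (i + 1 + 1) -> Q},
            forall x, psi (d (i + 1) x) = phi x
      & exists e : {linear G -> P 0}, injective e /\ exact_at e (d 0)].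

Lemma projective_gorenstein (P : fgmod) :
  projective_module P -> gorenstein_projective P.
Proof.
move=> hP.
have Ld : linear (fun z : fgmod_sum P P => (z.2, 0) : fgmod_sum P P).
  by move=> a x y; apply/pair_equal_spec; rewrite /= scaler0 addr0.
have ex : exact_at (lin Ld) (lin Ld).
  move=> [x y]; rewrite linE /=; split; first by case=> ->; exists (0, x).
  by case=> -[x' y'] [_ <-].
exists (fun=> fgmod_sum P P), (fun=> lin Ld); split=> //.
- by move=> _; apply: projective_sum.
- move=> Q _ phi hQ phi0.
  have L : linear (fun z : fgmod_sum P P => phi (0, z.1)).
    move=> a x y; rewrite -linearP; congr (phi _).
    by apply/pair_equal_spec; rewrite /= scaler0 addr0.
  exists (lin L) => -[x y]; rewrite !linE /=.
  rewrite -[LHS]add0r -(phi0 (0, x)) -linearD linE; congr (phi _).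
  by apply/pair_equal_spec; rewrite /= addr0 add0r.
- have L : linear (fun x : P => (x, 0) : fgmod_sum P P).
    by move=> a x y; apply/pair_equal_spec; rewrite /= scaler0 addr0.
  exists (lin L); split; first by move=> x y [].
  move=> [x y]; rewrite linE /=; split; first by case=> ->; exists x.
  by case=> x' [_ <-].
Qed.

Lemma gorenstein_sum (G H : lmodType R) :
  gorenstein_projective G -> gorenstein_projective H ->
  gorenstein_projective (G * H)%type.
Proof.
case=> [P [d [hP dE dQ [e [eI eE]]]]] [P' [d' [hP' dE' dQ' [e' [eI' eE']]]]].
have L i : linear (fun z : fgmod_sum (P i) (P' i) =>
                     (d i z.1, d' i z.2) : fgmod_sum (P (i + 1)) (P' (i + 1))).
  by move=> a x y; apply/pair_equal_spec; rewrite /= !linearP.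
exists (fun i => fgmod_sum (P i) (P' i)), (fun i => lin (@L i)); split.
- by move=> i; apply: projective_sum.
- move=> i [y y']; rewrite linE /=; split.
    by case=> /dE [x <-] /dE' [x' <-]; exists (x, x').
  by case=> -[x x'] [<- <-]; congr (_, _); [apply/dE; exists x|apply/dE'; exists x'].
- move=> Q i phi hQ phi0.
  have L1 : linear (fun x => phi (x, 0)).
    move=> a x y; rewrite -linearP; congr (phi _).
    by apply/pair_equal_spec; rewrite /= scaler0 addr0.
  have L2 : linear (fun y => phi (0, y)).
    move=> a x y; rewrite -linearP; congr (phi _).
    by apply/pair_equal_spec; rewrite /= scaler0 addr0.
  have [|psi1 E1] := dQ Q i (lin L1) hQ.
    by move=> x; rewrite linE -(phi0 (x, 0)) !linE /= linear0.
  have [|psi2 E2] := dQ' Q i (lin L2) hQ.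
    by move=> x; rewrite linE -(phi0 (0, x)) !linE /= linear0.
  have L3 : linear (fun z : fgmod_sum (P (i + 1 + 1)) (P' (i + 1 + 1)) =>
                      psi1 z.1 + psi2 z.2).
    by move=> a x y; rewrite /= !linearP scalerDr addrACA.
  exists (lin L3) => -[x y]; rewrite !linE /= E1 E2 !linE -linearD.
  by congr (phi _); apply/pair_equal_spec; rewrite /= addr0 add0r.
- have Le : linear (fun z : G * H =>
                      (e z.1, e' z.2) : fgmod_sum (P 0) (P' 0)).
    by move=> a x y; apply/pair_equal_spec; rewrite /= !linearP.
  exists (lin Le); split; first by move=> [x x'] [y y'] [/eI <- /eI' <-].
  move=> [y y']; rewrite !linE /=; split.
    by case=> /eE [x <-] /eE' [x' <-]; exists (x, x').
  by case=> -[x x'] [<- <-]; congr (_, _); [apply/eE; exists x|apply/eE'; exists x'].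
Qed.

End Modules.

Arguments lin : simpl never.

Arguments fgmod0 {R}.

(** * Bounded complexes and the singularity category *)

Section Complexes.
Variable R : comNzRingType.

Record cpx := Cpx {
  cobj :> int -> fgmod R;
  cd : forall i, {linear cobj i -> cobj (i + 1)};
  cdd : forall i x, cd (i + 1) (cd i x) = 0;
  cbdd : exists a b : int,
    forall i, (i < a) || (b < i) -> forall x : cobj i, x = 0 }.

Record cmap (X Y : cpx) := Cmap {
  cm :> forall i, {linear X i -> Y i};
  cmP : forall i x, cd Y i (cm i x) = cm (i + 1) (cd X i x) }.

Definition cmap_eq X Y (f g : cmap X Y) : Prop := forall i x, f i x = g i x.

Definition cmap_id X : cmap X X :=
  @Cmap X X (fun i => lin (@id_linear R (X i))) (fun _ _ => erefl).

Lemma cmap_compP X Y Z (g : cmap Y Z) (f : cmap X Y) i x :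
  cd Z i (lin (comp_linear (g i) (f i)) x) =
  lin (comp_linear (g (i + 1)) (f (i + 1))) (cd X i x).
Proof. by rewrite !linE !cmP. Qed.

Definition cmap_comp X Y Z (g : cmap Y Z) (f : cmap X Y) : cmap X Z :=
  Cmap (cmap_compP g f).

Definition cpx_category : category.
Proof.
refine (@Category cpx cmap cmap_eq cmap_id cmap_comp _ _ _ _ _ _ _) => //.
- by move=> X Y f g fg i x; rewrite fg.
- by move=> X Y f g h fg gh i x; rewrite fg gh.
- by move=> X Y Z g g' f f' gg ff i x; rewrite !linE ff gg.
Defined.

Lemma shift_linear (X : cpx) i : linear (fun x : X (i + 1) => - cd X (i + 1) x).
Proof. by move=> a x y; rewrite linearP opprD scalerN. Qed.

Lemma shift_cdd (X : cpx) i (x : X (i + 1)) :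
  lin (@shift_linear X (i + 1)) (lin (@shift_linear X i) x) = 0.
Proof. by rewrite !linE linearN opprK cdd. Qed.

Lemma shift_cbdd (X : cpx) : exists a b : int,
  forall i, (i < a) || (b < i) -> forall x : X (i + 1), x = 0.
Proof.
have [a [b ab]] := cbdd X; exists (a - 1), b => i iab; apply: ab.
by case/orP: iab => [ia|bi]; apply/orP; [left|right]; lia.
Qed.

(* X[1]. *)
Definition shift (X : cpx) : cpx :=
  @Cpx (fun i => X (i + 1)) (fun i => lin (@shift_linear X i))
    (@shift_cdd X) (shift_cbdd X).

Lemma shift_mapP X Y (f : cmap X Y) i (x : shift X i) :
  cd (shift Y) i (f (i + 1) x) = f (i + 1 + 1) (cd (shift X) i x).
Proof. by rewrite !linE cmP linearN. Qed.

Definition shift_map X Y (f : cmap X Y) : cmap (shift X) (shift Y) :=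
  @Cmap (shift X) (shift Y) (fun i => f (i + 1)) (shift_mapP f).

Lemma shift_functor : @is_functor cpx_category cpx_category shift shift_map.
Proof. by split=> // X Y f g fg i x; apply: fg. Qed.

Section Cone.
Variables (X Y : cpx) (f : cmap X Y).

Definition cone_obj i : fgmod R := fgmod_sum (X (i + 1)) (Y i).

Lemma cone_linear i :
  linear (fun z : cone_obj i =>
    (- cd X (i + 1) z.1, f (i + 1) z.1 + cd Y i z.2) : cone_obj (i + 1)).
Proof.
move=> a x y; apply/pair_equal_spec; split=> /=.
  by rewrite linearP opprD scalerN.
by rewrite !linearP scalerDr addrACA.
Qed.

Lemma cone_cdd i (z : cone_obj i) :
  lin (@cone_linear (i + 1)) (lin (@cone_linear i) z) = 0.
Proof.
case: z => x y; rewrite !linE /=; apply/pair_equal_spec; split.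
  by rewrite linearN opprK cdd.
by rewrite linearD cdd addr0 linearN -cmP addNr.
Qed.

Lemma cone_cbdd : exists a b : int,
  forall i, (i < a) || (b < i) -> forall z : cone_obj i, z = 0.
Proof.
have [a [b ab]] := cbdd X; have [a' [b' ab']] := cbdd Y.
exists (Num.min a a' - 1), (Num.max b b') => i iab [x y].
apply/pair_equal_spec; split; [apply: ab|apply: ab'].
  by case/orP: iab => ?; apply/orP; [left|right]; lia.
by case/orP: iab => ?; apply/orP; [left|right]; lia.
Qed.

Definition cone : cpx := @Cpx cone_obj (fun i => lin (@cone_linear i))
  cone_cdd cone_cbdd.

Lemma cone_in_linear i : linear (fun y : Y i => (0, y) : cone i).
Proof. by move=> a x y; apply/pair_equal_spec; rewrite /= scaler0 addr0. Qed.

Lemma cone_inP i y :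
  cd cone i (lin (@cone_in_linear i) y) = lin (@cone_in_linear (i + 1)) (cd Y i y).
Proof. by rewrite !linE /= !linear0 ?oppr0 add0r. Qed.

Definition cone_inl : cmap Y cone := @Cmap Y cone _ cone_inP.

Lemma cone_pr_linear i : linear (fun z : cone i => z.1 : shift X i).
Proof. by []. Qed.

Definition cone_pr : cmap cone (shift X) :=
  @Cmap cone (shift X) (fun i => lin (@cone_pr_linear i)) (fun _ _ => erefl).

End Cone.

Inductive cone_triangle : forall X Y Z : cpx_category,
    Mor X Y -> Mor Y Z -> Mor Z (shift X : cpx_category) -> Prop :=
| ConeTriangle X Y (f : cmap X Y) :
    @cone_triangle X Y (cone f) f (cone_inl f) (cone_pr f).

Definition cpx_tricat : tricat := Tricat shift_functor cone_triangle.

(* [f] induces bijections H^(i+1)(X) -> H^(i+1)(Y). *)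
Definition quasi_iso (X Y : cpx) (f : cmap X Y) : Prop :=
  forall i : int,
    (forall x : X (i + 1), cd X (i + 1) x = 0 ->
      (exists y : Y i, cd Y i y = f (i + 1) x) -> exists x', cd X i x' = x) /\
    (forall y : Y (i + 1), cd Y (i + 1) y = 0 ->
      exists (x : X (i + 1)) (y' : Y i),
        cd X (i + 1) x = 0 /\ y = f (i + 1) x + cd Y i y').

Lemma shift_quasi_iso (X Y : cpx_tricat) (f : Mor X Y) :
  quasi_iso f -> quasi_iso (sh1 f : cmap _ _).
Proof.
move=> qf i; have [q1 q2] := qf (i + 1).
have dE (Z : cpx) j (z : Z (j + 1)) : cd (shift Z) j z = - cd Z (j + 1) z by [].
split=> [x|y]; rewrite dE => /eqP; rewrite oppr_eq0 => /eqP dz.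
  move=> [y dy]; have [|x' dx'] := q1 x dz; last first.
    by exists (- x'); rewrite dE linearN opprK.
  by exists (- y); rewrite linearN -dE.
have [x [y' [dx yE]]] := q2 y dz; exists x, (- y').
by rewrite !dE dx oppr0 linearN opprK.
Qed.

(* D^b(R). *)
Definition Db : tricat := loc_tricat shift_quasi_iso.

Definition perfect (X : Db) : Prop :=
  exists P : cpx, (forall i, projective_module (P i)) /\ isom X (P : Db).

Lemma shift_perfect (X : Db) : perfect X -> perfect (sh0 X).
Proof.
case=> P [hP [f fI]]; exists (shift P); split=> [i|]; first exact: hP.
by exists (sh1 f); apply: functor_iso (sh_functor Db) fI.
Qed.

Lemma perfect_isom (X Y : Db) : isom X Y -> perfect Y -> perfect X.
Proof. by move=> XY [P [hP YP]]; exists P; split=> //; apply: isom_trans YP. Qed.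

Lemma arr_isom (X Y : cpx_category) : isom X Y -> isom (X : Db) (Y : Db).
Proof.
case=> f [g [gf fg]]; exists (Arr _ f), (Arr _ g).
by split; apply: weq_trans (weq_sym (weq_arr_comp _ _ _)) _; apply: weq_arr.
Qed.

Lemma cone_shift_isom (X Y : cpx) (f : cmap X Y) :
  @isom cpx_category (shift (cone f)) (cone (shift_map f)).
Proof.
have L i : linear (fun z : shift (cone f) i => (- z.1, z.2) : cone (shift_map f) i).
  by move=> a x y; apply/pair_equal_spec; rewrite /= opprD scalerN.
have L' i : linear (fun z : cone (shift_map f) i => (- z.1, z.2) : shift (cone f) i).
  by move=> a x y; apply/pair_equal_spec; rewrite /= opprD scalerN.
have dC (U V : cpx) (g : cmap U V) j (z : cone g j) :
    cd (cone g) j z = (- cd U (j + 1) z.1, g (j + 1) z.1 + cd V j z.2) by [].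
have dS (U : cpx) j (z : U (j + 1)) : cd (shift U) j z = - cd U (j + 1) z by [].
have P i x : cd (cone (shift_map f)) i (lin (L i) x) =
             lin (L (i + 1)) (cd (shift (cone f)) i x).
  rewrite dC !dS dC; case: x => x y; apply/pair_equal_spec; split.
    change (- - cd X (i + 1 + 1) (- x) = - - - cd X (i + 1 + 1) x).
    by rewrite (linearN (cd X _)) !opprK.
  change (f (i + 1 + 1) (- x) - cd Y (i + 1) y =
          - (f (i + 1 + 1) x + cd Y (i + 1) y)).
  by rewrite (linearN (f _)) opprD.
have P' i x : cd (shift (cone f)) i (lin (L' i) x) =
             lin (L' (i + 1)) (cd (cone (shift_map f)) i x).
  rewrite !dS !dC dS; case: x => x y; apply/pair_equal_spec; split.
    change (- - cd X (i + 1 + 1) (- x) = - - - cd X (i + 1 + 1) x).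
    by rewrite (linearN (cd X _)) !opprK.
  change (- (f (i + 1 + 1) (- x) + cd Y (i + 1) y) =
          f (i + 1 + 1) x - cd Y (i + 1) y).
  by rewrite (linearN (f _)) opprD opprK.
exists (@Cmap (shift (cone f)) (cone (shift_map f)) _ P).
exists (@Cmap (cone (shift_map f)) (shift (cone f)) _ P').
by split=> i -[x y]; apply/pair_equal_spec; rewrite /= opprK.
Qed.

Lemma shift_cone_in_perfect (X Y : Db) (s : Mor X Y) :
  cone_in perfect s -> cone_in perfect (sh1 s).
Proof.
case=> Z [v [w [[X' [Y' [Z' [u' [v' [w' [a [b [c [[std aI bI cI] [e1 _ _]]]]]]]]]]]
  pZ]]].
destruct std as [X' Y' Z' u' v' w' std]; destruct std as [X' Y' u'].
have [a' [a'a aa']] := functor_iso (sh_functor Db) (functor_iso (sh_functor Db) aI).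
pose f : cmap (shift X') (shift Y') := shift_map u'.
pose f' : @Mor Db (shift X') (shift Y') := @Arr cpx_category _ _ _ f.
pose i : @Mor Db (shift Y') (cone f) := @Arr cpx_category _ _ _ (cone_inl f).
pose p : @Mor Db (cone f) (shift (shift X')) :=
  @Arr cpx_category _ _ _ (cone_pr f).
pose sa := @sh1 Db _ _ a; pose sb := @sh1 Db _ _ b.
exists (cone f), (i ∘ sb), (a' ∘ p); split.
  exists (shift X'), (shift Y'), (cone f), f', i, p, sa, sb, (idm _).
  split; split.
  - exact: (@LocStd cpx_tricat).
  - exact: functor_iso (sh_functor Db) aI.
  - exact: functor_iso (sh_functor Db) bI.
  - by exists (idm _); split; apply: comp1m.
  - exact: (functor_heq (sh_functor Db) e1).
  - exact: comp1m.
  - apply: heq_trans (compA _ _ _) _; apply: heq_trans (heq_sym (compm1 _)).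
    by apply: heq_trans (comp1m _); apply: comp_heq (heq_refl _).
apply: perfect_isom (shift_perfect pZ).
apply: isom_trans (arr_isom (isom_sym (cone_shift_isom u'))) _.
by apply: isom_sym; exists (@sh1 Db _ _ c); apply: functor_iso (sh_functor Db) cI.
Qed.

(* D_sg(R). *)
Definition Dsg : tricat := loc_tricat shift_cone_in_perfect.

Section Stalk.

(* The complex [M] concentrated in degree 0. *)
Definition stalk_obj (M : fgmod R) (i : int) : fgmod R :=
  if i is Posz 0 then M else fgmod0.

Lemma stalk_cbdd M : exists a b : int,
  forall i, (i < a) || (b < i) -> forall x : stalk_obj M i, x = 0.
Proof.
by exists 0, 0 => -[[|n]|n] //= _ x; apply: fgmod0_eq0.
Qed.

Definition stalk (M : fgmod R) : cpx :=
  @Cpx (stalk_obj M) (fun i => lin (@zero_linear R _ _)) (fun _ _ => erefl)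
    (stalk_cbdd M).

Variables (M N : fgmod R) (f : {linear M -> N}).

Definition stalk_map_at (i : int) : {linear stalk M i -> stalk N i} :=
  match i return {linear stalk_obj M i -> stalk_obj N i} with
  | Posz 0 => f
  | Posz n.+1 => lin (@id_linear R _)
  | Negz n => lin (@id_linear R _)
  end.

Lemma stalk_mapP i x :
  cd (stalk N) i (stalk_map_at i x) = stalk_map_at (i + 1) (cd (stalk M) i x).
Proof. by rewrite !linE linear0. Qed.

Definition stalk_map : cmap (stalk M) (stalk N) := Cmap stalk_mapP.

End Stalk.
End Complexes.

(** * The morphism category and its exact subcategories *)

Section MorphismCategory.
Variable S : comNzRingType.

Record morobj := MorObj {
  msrc : fgmod S;
  mtgt : fgmod S;
  mmap : {linear msrc -> mtgt} }.

Record morhom (X Y : morobj) := MorHom {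
  mor1 : {linear msrc X -> msrc Y};
  mor0 : {linear mtgt X -> mtgt Y};
  mor_sq : forall x, mor0 (mmap X x) = mmap Y (mor1 x) }.

Definition mor_eq X Y (f g : morhom X Y) : Prop :=
  mor1 f =1 mor1 g /\ mor0 f =1 mor0 g.

Definition mor_id X : morhom X X :=
  @MorHom X X (lin (@id_linear S (msrc X))) (lin (@id_linear S (mtgt X)))
    (fun _ => erefl).

Lemma mor_comp_sq X Y Z (g : morhom Y Z) (f : morhom X Y) x :
  lin (comp_linear (mor0 g) (mor0 f)) (mmap X x) =
  mmap Z (lin (comp_linear (mor1 g) (mor1 f)) x).
Proof. by rewrite !linE !mor_sq. Qed.

Definition mor_comp X Y Z (g : morhom Y Z) (f : morhom X Y) : morhom X Z :=
  MorHom (mor_comp_sq g f).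

Definition mor_zero : morobj := MorObj (lin (@zero_linear S fgmod0 fgmod0)).

Lemma mor_sum_linear (X Y : morobj) :
  linear (fun z : fgmod_sum (msrc X) (msrc Y) =>
    (mmap X z.1, mmap Y z.2) : fgmod_sum (mtgt X) (mtgt Y)).
Proof. by move=> a x y; apply/pair_equal_spec; rewrite /= !linearP. Qed.

Definition mor_sum (X Y : morobj) : morobj := MorObj (lin (@mor_sum_linear X Y)).

(* The class of objects of an additive full subcategory of Mor(S). *)
Record addsub := AddSub {
  in_sub :> morobj -> Prop;
  sub_zero : in_sub mor_zero;
  sub_sum : forall X Y, in_sub X -> in_sub Y -> in_sub (mor_sum X Y) }.

Section ExactSub.
Variable A : addsub.

Record subobj := SubObj {
  so_obj :> morobj;
  so_prop : A so_obj }.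

(* The exact structure: componentwise short exact sequences with all terms in
   the subcategory. *)
Definition conflation (X Y Z : subobj) (i : morhom X Y) (p : morhom Y Z) : Prop :=
  short_exact (mor1 i) (mor1 p) /\ short_exact (mor0 i) (mor0 p).

Definition proj_obj (Q : subobj) : Prop :=
  forall (X Y Z : subobj) (i : morhom X Y) (p : morhom Y Z) (f : morhom Q Z),
    conflation i p -> exists g : morhom Q Y, mor_eq (mor_comp p g) f.

Definition inj_obj (I : subobj) : Prop :=
  forall (X Y Z : subobj) (i : morhom X Y) (p : morhom Y Z) (f : morhom X I),
    conflation i p -> exists g : morhom Y I, mor_eq (mor_comp g i) f.

(* [f - g] factors through a projective object. *)
Definition stable_eq (X Y : subobj) (f g : morhom X Y) : Prop :=
  exists (Q : subobj) (a : morhom X Q) (b : morhom Q Y),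
    [/\ proj_obj Q,
        forall x, mor1 f x - mor1 g x = mor1 b (mor1 a x)
      & forall x, mor0 f x - mor0 g x = mor0 b (mor0 a x)].

Lemma mor_eq_stable (X Y : subobj) (f g : morhom X Y) :
  mor_eq f g -> stable_eq f g.
Proof.
move=> [fg1 fg0].
pose O := SubObj (sub_zero A).
have sq1 x : lin (@zero_linear S _ (mtgt O)) (mmap X x) =
             mmap O (lin (@zero_linear S _ (msrc O)) x) by [].
have sq2 x : lin (@zero_linear S _ (mtgt Y)) (mmap O x) =
             mmap Y (lin (@zero_linear S (msrc O) (msrc Y)) x).
  by rewrite !linE linear0.
exists O, (MorHom sq1), (MorHom sq2); split=> [|x|x]; first last.
- by rewrite fg0 subrr.
- by rewrite fg1 subrr.
move=> X' Y' Z' i p h _.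
have sq3 x : lin (@zero_linear S _ (mtgt Y')) (mmap O x) =
             mmap Y' (lin (@zero_linear S (msrc O) (msrc Y')) x).
  by rewrite !linE linear0.
by exists (MorHom sq3); split=> x /=; rewrite (fgmod0_eq0 x) !linear0.
Qed.

Lemma proj_obj_sum (P Q : subobj) :
  proj_obj P -> proj_obj Q -> proj_obj (SubObj (sub_sum (so_prop P) (so_prop Q))).
Proof.
move=> hP hQ X Y Z i p f ip; pose PQ := mor_sum P Q.
have L1 (M N : lmodType S) : linear (fun x : M => (x, 0) : M * N).
  by move=> a x y; apply/pair_equal_spec; rewrite /= scaler0 addr0.
have L2 (M N : lmodType S) : linear (fun y : N => (0, y) : M * N).
  by move=> a x y; apply/pair_equal_spec; rewrite /= scaler0 addr0.
have sP x : lin (L1 _ _) (mmap P x) = mmap (mor_sum P Q) (lin (L1 _ _) x).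
  by apply/pair_equal_spec; rewrite /= linear0.
have sQ x : lin (L2 _ _) (mmap Q x) = mmap (mor_sum P Q) (lin (L2 _ _) x).
  by apply/pair_equal_spec; rewrite /= linear0.
have [g [g1 g0]] := hP _ _ _ i p (mor_comp f (@MorHom P PQ _ _ sP)) ip.
have [h [h1 h0]] := hQ _ _ _ i p (mor_comp f (@MorHom Q PQ _ _ sQ)) ip.
have L (M N K : lmodType S) (u : {linear M -> K}) (v : {linear N -> K}) :
    linear (fun z : M * N => u z.1 + v z.2).
  by move=> a x y; rewrite /= !linearP scalerDr addrACA.
have sq x : lin (L _ _ _ (mor0 g) (mor0 h)) (mmap (mor_sum P Q) x) =
            mmap Y (lin (L _ _ _ (mor1 g) (mor1 h)) x).
  by rewrite !linE /= !mor_sq linearD.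
exists (@MorHom PQ Y _ _ sq); split=> -[x y].
- have E : mor1 p (mor1 g x) = mor1 f (x, 0) := g1 x.
  have E' : mor1 p (mor1 h y) = mor1 f (0, y) := h1 y.
  change (mor1 p (mor1 g x + mor1 h y) = mor1 f (x, y)).
  rewrite linearD E E' -linearD; congr (mor1 f _).
  by apply/pair_equal_spec; rewrite /= addr0 add0r.
- have E : mor0 p (mor0 g x) = mor0 f (x, 0) := g0 x.
  have E' : mor0 p (mor0 h y) = mor0 f (0, y) := h0 y.
  change (mor0 p (mor0 g x + mor0 h y) = mor0 f (x, y)).
  rewrite linearD E E' -linearD; congr (mor0 f _).
  by apply/pair_equal_spec; rewrite /= addr0 add0r.
Qed.

Lemma stable_eq_sym (X Y : subobj) (f g : morhom X Y) :
  stable_eq f g -> stable_eq g f.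
Proof.
case=> Q [a [b [hQ e1 e0]]].
have L (M N : lmodType S) (u : {linear M -> N}) : linear (fun x => - u x).
  by move=> c x y; rewrite linearP opprD scalerN.
have sq x : lin (L _ _ (mor0 b)) (mmap Q x) = mmap Y (lin (L _ _ (mor1 b)) x).
  by rewrite /lin /= mor_sq linearN.
exists Q, a, (MorHom sq); split=> // x; rewrite /lin /=.
  by rewrite -e1 opprB.
by rewrite -e0 opprB.
Qed.

Lemma stable_eq_trans (X Y : subobj) (f g h : morhom X Y) :
  stable_eq f g -> stable_eq g h -> stable_eq f h.
Proof.
case=> P [a [b [hP e1 e0]]] [Q [c [d [hQ e1' e0']]]].
pose PQ := mor_sum P Q.
have L (M N K : lmodType S) (u : {linear K -> M}) (v : {linear K -> N}) :
    linear (fun z : K => (u z, v z) : M * N).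
  by move=> k x y; apply/pair_equal_spec; rewrite /= !linearP.
have L' (M N K : lmodType S) (u : {linear M -> K}) (v : {linear N -> K}) :
    linear (fun z : M * N => u z.1 + v z.2).
  by move=> k x y; rewrite /= !linearP scalerDr addrACA.
have sq x : lin (L _ _ _ (mor0 a) (mor0 c)) (mmap X x) =
            mmap (mor_sum P Q) (lin (L _ _ _ (mor1 a) (mor1 c)) x).
  by apply/pair_equal_spec; rewrite /= !mor_sq.
have sq' x : lin (L' _ _ _ (mor0 b) (mor0 d)) (mmap (mor_sum P Q) x) =
            mmap Y (lin (L' _ _ _ (mor1 b) (mor1 d)) x).
  by rewrite /lin /= !mor_sq linearD.
exists (SubObj (sub_sum (so_prop P) (so_prop Q))).
exists (@MorHom X PQ _ _ sq), (@MorHom PQ Y _ _ sq').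
split=> [|x|x]; first exact: proj_obj_sum.
- by rewrite /lin /= -e1 -e1' addrA subrK.
- by rewrite /lin /= -e0 -e0' addrA subrK.
Qed.

Lemma stable_eq_comp (X Y Z : subobj) (g g' : morhom Y Z) (f f' : morhom X Y) :
  stable_eq g g' -> stable_eq f f' -> stable_eq (mor_comp g f) (mor_comp g' f').
Proof.
move=> [P [a [b [hP e1 e0]]]] [Q [c [d [hQ e1' e0']]]].
apply: (@stable_eq_trans _ _ _ (mor_comp g f')).
  exists Q, c, (mor_comp g d); split=> // x; rewrite /lin /=.
    by rewrite -linearB e1'.
  by rewrite -linearB e0'.
exists P, (mor_comp a f'), b; split=> // x; rewrite /lin /=.
  by rewrite e1.
by rewrite e0.
Qed.

Definition stable_category : category.
Proof.
refine (@Category subobj morhom stable_eq mor_id mor_comp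
  _ stable_eq_sym stable_eq_trans stable_eq_comp _ _ _) => [X Y f|X Y Z W h g f||];
  by move=> *; apply: mor_eq_stable; split.
Defined.

(* A choice of Happel's shift functor: for every object X a conflation
   X -> I(X) -> Sh X with I(X) injective, the morphism Sh f being induced by an
   extension I(X) -> I(Y) of f. *)
Record suspension := Suspension {
  susp : subobj -> subobj;
  hull : subobj -> subobj;
  hull_in : forall X : subobj, morhom X (hull X);
  hull_pr : forall X : subobj, morhom (hull X) (susp X);
  hull_conflation : forall X, conflation (hull_in X) (hull_pr X);
  hull_inj : forall X, inj_obj (hull X);
  susp1 : forall X Y : subobj, morhom X Y -> morhom (susp X) (susp Y);
  susp1P : forall (X Y : subobj) (f : morhom X Y),
    exists h : morhom (hull X) (hull Y),
      mor_eq (mor_comp h (hull_in X)) (mor_comp (hull_in Y) f) /\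
      mor_eq (mor_comp (hull_pr Y) h) (mor_comp (susp1 f) (hull_pr X));
  susp_functor : @is_functor stable_category stable_category susp susp1 }.

Section StableTricat.
Variable sh : suspension.

(* The triangles X -u-> Y -v-> Z -w-> Sh X obtained from the pushout
     X    ->  I(X)  -> Sh X
     |u        |h       ||
     Y -v->    Z   -w-> Sh X
   of the chosen conflation along u. *)
Definition pushout_triangle (X Y Z : stable_category)
    (u : Mor X Y) (v : Mor Y Z) (w : Mor Z (susp sh X : stable_category)) : Prop :=
  @conflation Y Z (susp sh X) v w /\
  exists h : morhom (hull sh X) Z,
    mor_eq (mor_comp h (hull_in sh X)) (mor_comp v u) /\
    mor_eq (mor_comp w h) (hull_pr sh X).

Definition stable_tricat : tricat :=
  @Tricat stable_category (susp sh) (susp1 sh) (susp_functor sh)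
    (@iso_closure stable_category (susp sh) (susp1 sh) pushout_triangle).

End StableTricat.
End ExactSub.
End MorphismCategory.

(** * The categories of monomorphisms *)

Section Mon.
Variables (S : comNzRingType) (w : S).

(* [w] annihilates Coker f. *)
Definition kills_coker (X : morobj S) : Prop :=
  forall y : mtgt X, exists x : msrc X, mmap X x = w *: y.

Definition in_monG (X : morobj S) : Prop :=
  [/\ injective (mmap X), gorenstein_projective (msrc X),
      projective_module (mtgt X) & kills_coker X].

Definition in_monP (X : morobj S) : Prop :=
  [/\ injective (mmap X), projective_module (msrc X),
      projective_module (mtgt X) & kills_coker X].

Lemma in_monP_monG X : in_monP X -> in_monG X.
Proof. by case=> *; split=> //; apply: projective_gorenstein. Qed.

Lemma in_monP_zero : in_monP (mor_zero S).
Proof.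
split; [|exact: projective_zero|exact: projective_zero|].
- by move=> x y _; rewrite (fgmod0_eq0 x) (fgmod0_eq0 y).
- by move=> y; exists y; rewrite !(fgmod0_eq0 y) scaler0.
Qed.

Lemma injective_sum X Y : injective (mmap X) -> injective (mmap Y) ->
  injective (mmap (@mor_sum S X Y)).
Proof. by move=> iX iY [x x'] [y y'] [/iX <- /iY <-]. Qed.

Lemma kills_coker_sum X Y : kills_coker X -> kills_coker Y ->
  kills_coker (mor_sum X Y).
Proof.
move=> hX hY [y y']; have [x E] := hX y; have [x' E'] := hY y'.
by exists (x, x'); apply/pair_equal_spec.
Qed.

Lemma in_monP_sum X Y : in_monP X -> in_monP Y -> in_monP (mor_sum X Y).
Proof.
move=> [? ? ? ?] [? ? ? ?]; split; [exact: injective_sum|exact: projective_sum..|].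
exact: kills_coker_sum.
Qed.

Lemma in_monG_sum X Y : in_monG X -> in_monG Y -> in_monG (mor_sum X Y).
Proof.
move=> [? ? ? ?] [? ? ? ?]; split; [exact: injective_sum|exact: gorenstein_sum|
  exact: projective_sum|exact: kills_coker_sum].
Qed.

Definition MonG : addsub S := AddSub (in_monP_monG in_monP_zero) in_monG_sum.
Definition MonP : addsub S := AddSub in_monP_zero in_monP_sum.

(* The inclusion; on morphisms it is the identity. *)
Definition incl0 (X : subobj MonP) : subobj MonG :=
  @SubObj S MonG X (in_monP_monG (so_prop X)).

Definition incl1 (X Y : subobj MonP) (f : morhom X Y) :
  morhom (incl0 X) (incl0 Y) := f.

End Mon.

(** * The functor T *)

(* [pi] presents [R] as S/(w). *)
Definition is_quotient_by (S R : comNzRingType) (pi : {rmorphism S -> R}) (w : S) :=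
  (forall r, exists s, pi s = r) /\
  (forall s, pi s = 0 <-> exists t, s = t * w).

Section Coker.
Variables (S R : comNzRingType) (pi : {rmorphism S -> R}) (w : S).
Hypothesis piP : is_quotient_by pi w.

Definition pi_lift (r : R) : S := projT1 (cid (piP.1 r)).

Lemma pi_liftK r : pi (pi_lift r) = r.
Proof. exact: projT2 (cid (piP.1 r)). Qed.

Section CokerObj.
Variables (M N : fgmod S) (f : {linear M -> N}).
Hypothesis fw : forall y : N, exists x : M, f x = w *: y.

Definition coker_rel (y y' : N) : bool :=
  `[< exists x, f x = y - y' >].

Lemma coker_rel_refl : reflexive coker_rel.
Proof. by move=> y; apply/asboolP; exists 0; rewrite linear0 subrr. Qed.

Lemma coker_rel_sym : symmetric coker_rel.
Proof.
have s y y' : coker_rel y y' -> coker_rel y' y.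
  by move/asboolP=> [x E]; apply/asboolP; exists (- x); rewrite linearN E opprB.
by move=> y y'; apply/idP/idP; apply: s.
Qed.

Lemma coker_rel_trans : transitive coker_rel.
Proof.
move=> y x z /asboolP[u E] /asboolP[v F]; apply/asboolP; exists (u + v).
by rewrite linearD E F addrA subrK.
Qed.

Canonical coker_equiv := EquivRel coker_rel coker_rel_refl coker_rel_sym coker_rel_trans.

Definition coker_type := {eq_quot coker_rel}.

Definition coker_class (y : N) : coker_type := \pi y.

Lemma coker_classP y y' :
  coker_class y = coker_class y' <-> exists x, f x = y - y'.
Proof.
split; first by move/eqmodP/asboolP.
by move=> h; apply/eqmodP/asboolP.
Qed.

Lemma coker_class_surj (c : coker_type) : exists y, coker_class y = c.
Proof. by exists (repr c); apply: reprK. Qed.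

Definition coker_zero : coker_type := coker_class 0.
Definition coker_opp (c : coker_type) : coker_type := coker_class (- repr c).
Definition coker_add (c d : coker_type) : coker_type :=
  coker_class (repr c + repr d).
Definition coker_scale (r : R) (c : coker_type) : coker_type :=
  coker_class (pi_lift r *: repr c).

Lemma repr_class y : exists x, f x = repr (coker_class y) - y.
Proof. by apply/coker_classP; apply: reprK. Qed.

Lemma coker_oppE y : coker_opp (coker_class y) = coker_class (- y).
Proof.
apply/coker_classP; have [x E] := repr_class y; exists (- x).
by rewrite linearN E opprB opprK addrC.
Qed.

Lemma coker_addE y y' :
  coker_add (coker_class y) (coker_class y') = coker_class (y + y').
Proof.
apply/coker_classP; have [x E] := repr_class y; have [x' E'] := repr_class y'.
by exists (x + x'); rewrite linearD E E' opprD addrACA.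
Qed.

(* The class of [y] is scaled by [pi s] through [s]. *)
Lemma coker_scaleE s y :
  coker_scale (pi s) (coker_class y) = coker_class (s *: y).
Proof.
apply/coker_classP; have [x E] := repr_class y.
have [t tE] : exists t, pi_lift (pi s) - s = t * w.
  by apply/piP.2; rewrite rmorphB /= pi_liftK subrr.
have [x' E'] := fw (repr (coker_class y)).
exists (t *: x' + s *: x); rewrite linearD !linearZ /= E E' scalerA -tE.
by rewrite scalerBl scalerBr scalerN addrA subrK.
Qed.

HB.instance Definition _ := Choice.on coker_type.

Lemma coker_addA : associative coker_add.
Proof.
move=> a b c; have [[x <-] [y <-]] := (coker_class_surj a, coker_class_surj b).
by have [z <-] := coker_class_surj c; rewrite !coker_addE addrA.
Qed.

Lemma coker_addC : commutative coker_add.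
Proof.
move=> a b; have [[x <-] [y <-]] := (coker_class_surj a, coker_class_surj b).
by rewrite !coker_addE addrC.
Qed.

Lemma coker_add0 : left_id coker_zero coker_add.
Proof. by move=> a; have [x <-] := coker_class_surj a; rewrite coker_addE add0r. Qed.

Lemma coker_addN : left_inverse coker_zero coker_opp coker_add.
Proof.
by move=> a; have [x <-] := coker_class_surj a; rewrite coker_oppE coker_addE addNr.
Qed.

HB.instance Definition _ :=
  GRing.isZmodule.Build coker_type coker_addA coker_addC coker_add0 coker_addN.

Lemma coker_classD y y' :
  coker_class (y + y') = coker_class y + coker_class y'.
Proof. by rewrite -coker_addE. Qed.

Lemma coker_scalerA a b (c : coker_type) :
  coker_scale a (coker_scale b c) = coker_scale (a * b) c.
Proof.
have [x <-] := coker_class_surj c; rewrite -(pi_liftK a) -(pi_liftK b).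
by rewrite -rmorphM !coker_scaleE scalerA.
Qed.

Lemma coker_scale1 : left_id 1 coker_scale.
Proof.
move=> c; have [x <-] := coker_class_surj c.
by rewrite -(rmorph1 pi) coker_scaleE scale1r.
Qed.

Lemma coker_scalerDr : right_distributive coker_scale +%R.
Proof.
move=> a b c; have [[x <-] [y <-]] := (coker_class_surj b, coker_class_surj c).
by rewrite -coker_classD -(pi_liftK a) !coker_scaleE scalerDr coker_classD.
Qed.

Lemma coker_scalerDl c : {morph coker_scale^~ c : a b / a + b}.
Proof.
move=> a b; have [x <-] := coker_class_surj c.
rewrite -(pi_liftK a) -(pi_liftK b) -rmorphD !coker_scaleE.
by rewrite scalerDl coker_classD.
Qed.

HB.instance Definition _ := GRing.Zmodule_isLmodule.Build R coker_type
  coker_scalerA coker_scale1 coker_scalerDr coker_scalerDl.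

Lemma coker_classZ s y : coker_class (s *: y) = pi s *: coker_class y.
Proof. by rewrite -coker_scaleE. Qed.

Lemma coker_fg : finitely_generated (coker_type : lmodType R).
Proof.
have [n [e eP]] := fg_prop (N).
exists n, (fun i => coker_class (e i)) => c; have [x <-] := coker_class_surj c.
have [k ->] := eP x; exists (fun i => pi (k i)).
rewrite (big_morph _ coker_classD (erefl : coker_class 0 = 0)).
by apply: eq_bigr => i _; rewrite coker_classZ.
Qed.

Definition coker_mod : fgmod R := FgMod coker_fg.

Definition coker_pr (y : N) : coker_mod := coker_class y.

Lemma coker_pr_surj (c : coker_mod) : exists y, coker_pr y = c.
Proof. exact: coker_class_surj. Qed.

Lemma coker_prP s y y' : coker_pr (s *: y + y') = pi s *: coker_pr y + coker_pr y'.
Proof. by rewrite /coker_pr coker_classD coker_classZ. Qed.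

Lemma coker_pr_eq y y' : coker_pr y = coker_pr y' <-> exists x, f x = y - y'.
Proof. exact: coker_classP. Qed.

End CokerObj.

Lemma so_kills (X : subobj (MonG w)) : kills_coker w X.
Proof. by case: (so_prop X). Qed.

(* Coker f, as an R-module. *)
Definition coker (X : subobj (MonG w)) : fgmod R := coker_mod (@so_kills X).

Section CokerMap.
Variables (X Y : subobj (MonG w)) (f : morhom X Y).

Definition coker_fun (c : coker X) : coker Y :=
  coker_pr (@so_kills Y) (mor0 f (projT1 (cid (coker_pr_surj c)))).

Lemma coker_funE y :
  coker_fun (coker_pr (@so_kills X) y) = coker_pr (@so_kills Y) (mor0 f y).
Proof.
rewrite /coker_fun; case: cid => y' /= /coker_pr_eq[x E]; apply/coker_pr_eq.
by exists (mor1 f x); rewrite -mor_sq E linearB.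
Qed.

Lemma coker_fun_linear : linear coker_fun.
Proof.
move=> a c d; have [[x <-] [y <-]] := (coker_pr_surj c, coker_pr_surj d).
by rewrite -(pi_liftK a) -coker_prP !coker_funE linearP coker_prP.
Qed.

Definition coker_map : {linear coker X -> coker Y} := lin coker_fun_linear.

End CokerMap.

Definition T0 (X : subobj (MonG w)) : Dsg R := stalk (coker X).

Definition T1 (X Y : subobj (MonG w)) (f : morhom X Y) : Mor (T0 X) (T0 Y) :=
  @Arr (Db R) (@cone_in (Db R) (@perfect R)) _ _
    (@Arr (cpx_category R) (@quasi_iso R) _ _ (stalk_map (coker_map f))).

End Coker.

(** * Rings *)

Section Rings.
Variable S : comNzRingType.

Definition maximal_ideal (I : {pred S}) : Prop :=
  idealr_closed I /\
  forall J : {pred S}, idealr_closed J -> {subset I <= J} -> J =i I.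

Definition prime_ideal (I : {pred S}) : Prop :=
  idealr_closed I /\ prime_idealr_closed I.

(* [idealr_closed] only covers proper ideals; the unit ideal is generated by 1. *)
Definition generated_by (n : nat) (e : 'I_n -> S) (I : {pred S}) : Prop :=
  forall x, x \in I <-> exists c : 'I_n -> S, x = \sum_i c i * e i.

Definition noetherian : Prop :=
  forall I : {pred S}, idealr_closed I ->
    exists (n : nat) (e : 'I_n -> S), generated_by e I.

Definition local_ring (m : {pred S}) : Prop :=
  maximal_ideal m /\ forall I : {pred S}, maximal_ideal I -> I =i m.

Definition prime_chain (d : nat) : Prop :=
  exists p : nat -> {pred S},
    (forall i, (i <= d)%N -> prime_ideal (p i)) /\
    (forall i, (i < d)%N -> {subset p i <= p i.+1} /\ ~ {subset p i.+1 <= p i}).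

Definition krull_dim (d : nat) : Prop :=
  prime_chain d /\ forall e, prime_chain e -> (e <= d)%N.

Definition min_generators (I : {pred S}) (d : nat) : Prop :=
  (exists e : 'I_d -> S, generated_by e I) /\
  forall n (e : 'I_n -> S), generated_by e I -> (d <= n)%N.

(* For a noetherian local ring with maximal ideal [m]: the minimal number of
   generators of [m] is the Krull dimension. *)
Definition regular_local (m : {pred S}) : Prop :=
  exists d, krull_dim d /\ min_generators m d.

(* Finite injective dimension over itself. *)
Definition gorenstein_ring : Prop :=
  exists (n : nat) (E : nat -> lmodType S) (eps : {linear S^o -> E 0%N})
         (d : forall i, {linear E i -> E i.+1}),
    [/\ forall i, injective_module (E i),
        injective eps /\ exact_at eps (d 0%N),
        forall i, exact_at (d i) (d i.+1)
      & forall i, (n < i)%N -> forall x : E i, x = 0].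

End Rings.

(* Main.v *)
(** If f : G -> P is an object of Mon(w, G), then w P lies in f(G), so there is
    c : P -> G with f c = w and c f = w.  The objects (P = P) + (Q -w-> Q) are
    exactly the projective-injective ones, and their cokernels Q / w Q are
    projective over R.  Pushing along a hull and pulling back along a cover shows
    that the cokernels of objects of Mon(w, G) are closed under syzygies and
    cosyzygies and satisfy Ext^1_R(-, projective) = 0.  Hence every Coker f has a
    totally acyclic complete resolution P over R.

    For M with complete resolution P, homotopy classes of chain maps [P, X]
    form a functor of X which inverts quasi-isomorphisms and maps with perfect
    cone, so it is defined on D_sg(R).  The truncations of P to degrees -n, ..., 0
    are isomorphic to M in D_sg(R), and letting n grow Yoneda's argument gives
    Hom_Dsg(M, X) = [P, X].  So T is full and faithful: [P, N] is Hom(M, N) modulo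
    the maps factoring through projectives, and morphisms of R-modules between
    cokernels, as well as such factorizations, lift to Mon(w, G).

    If R is Gorenstein, every complex is, up to isomorphism in D_sg(R) and a
    shift, a high syzygy module, and such modules are cokernels of objects of
    Mon(w, G), by the change of rings Ext_R^i(M, R) = Ext_S^(i+1)(M, S).
    Conversely, for an injective resolution J of R the germs at infinity of
    maps into the shifts of J are a functor on D_sg(R) which detects whether
    Ext^i(-, R) vanishes for large i; it vanishes on cokernels, so density gives
    Ext^i(k, R) = 0 for large i and R is Gorenstein.

    The same detection with syzygies of the residue field as coefficients shows
    that density of the restriction to Mon(w, P) forces the residue field to
    have finite projective dimension over S.  Regularity and finite global
    dimension are compared through rings obtained from a field by successively
    adjoining a regular element x of the maximal ideal, passing from S / x to S:
    Krull's principal ideal theorem yields such a tower for a regular ring, and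
    a regular element outside n^2 yields it when the global dimension is finite. *)

Require Import Defs.
From HB Require Import structures.
From mathcomp Require Import all_boot all_order all_algebra.
From mathcomp Require Import generic_quotient ring_quotient.
From mathcomp Require Import boolp.
From mathcomp Require classical_sets.
From mathcomp Require Import zify ring.

Set Implicit Arguments.
Unset Strict Implicit.
Unset Printing Implicit Defensive.

Import GRing.Theory Num.Theory Order.TTheory.

Local Open Scope ring_scope.

(** * Submodules and quotients *)

(** Three things that the argument speaks of are never built. Ext groups: [ext1] asserts only that
    maps out of kernels extend, and a higher degree is reached by passing to a cosyzygy of the
    coefficients ([injres]) or a syzygy of the module. Two resolutions are then compared through
    syzygies, without a comparison map. Localized modules: [extU] allows a denominator from a
    multiplicative set, so that Nakayama's lemma is applied to Hom(K, N) over the original ring.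
    Fractions: D^b and D_sg are categories of formal words, whose morphisms have no normal form. A
    statement about all morphisms is proved either by a functor to setoids that inverts the right
    arrows, or by induction on words, where a formal inverse is handled through existence and
    uniqueness ([Theta]). Families indexed by the integers cause a further difficulty: T (i - 1 + 1)
    and T i are different types, so homotopies and bi-infinite complexes are built by recursion on
    total spaces. The two stable categories use unrelated hulls; their triangles are compared after
    applying T, which is fully faithful. *)

Definition surj (A B : Type) (f : A -> B) : Prop := forall y, exists x, f x = y.

Lemma dchoice (A : Type) (B : A -> Type) (P : forall a, B a -> Prop) :
  (forall a, exists b, P a b) -> {f : forall a, B a & forall a, P a (f a)}.
Proof. by move=> h; exists (fun a => projT1 (cid (h a))) => a; case: cid. Qed.

Section Basics.
Variable R : comNzRingType.
Implicit Types M N K L Q : lmodType R.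

Definition submod M (U : M -> Prop) : Prop :=
  U 0 /\ forall a x y, U x -> U y -> U (a *: x + y).

Section SubmodTheory.
Variables (M : lmodType R) (U : M -> Prop) (hU : submod U).
Lemma submod0 : U 0. Proof. exact: hU.1. Qed.
Lemma submodZ a x : U x -> U (a *: x).
Proof. by move=> ux; rewrite -[_ *: _]addr0; apply: hU.2 => //; apply: hU.1. Qed.
Lemma submodD x y : U x -> U y -> U (x + y).
Proof. by move=> ux uy; rewrite -[x]scale1r; apply: hU.2. Qed.
Lemma submodN x : U x -> U (- x).
Proof. by move=> ux; rewrite -scaleN1r; apply: submodZ. Qed.
Lemma submodB x y : U x -> U y -> U (x - y).
Proof. by move=> ux uy; apply/submodD/submodN. Qed.
Lemma submod_sum (I : Type) (r : seq I) (P : pred I) (F : I -> M) :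
  (forall i, P i -> U (F i)) -> U (\sum_(i <- r | P i) F i).
Proof. by apply: (big_ind U); [exact: submod0|exact: submodD]. Qed.
End SubmodTheory.

Section SubType.
Variables (M : lmodType R) (U : M -> Prop) (hU : submod U).
(** The vacuous [let] makes the predicate depend on the closure proof, so that the submodule
    instance can be attached to it. [qrel], [desc_type] and [iq_pred] use the same device. *)
Definition sub_pred : {pred M} := let _ := hU in fun x => `[< U x >].
Fact sub_pred_closed : submod_closed sub_pred.
Proof.
split; first by apply/asboolP; apply: (submod0 hU).
by move=> a x y /asboolP ux /asboolP uy; apply/asboolP; apply: hU.2.
Qed.
HB.instance Definition _ := GRing.isSubmodClosed.Build R M sub_pred sub_pred_closed.
Record sub_type := SubTypeOf { sub_val :> M; _ : sub_val \in sub_pred }.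
HB.instance Definition _ := [isSub for sub_val].
HB.instance Definition _ := [Choice of sub_type by <:].
HB.instance Definition _ := [SubChoice_isSubLmodule of sub_type by <:].
End SubType.

Lemma sub_ex M (U : M -> Prop) : submod U ->
  exists (K : lmodType R) (i : {linear K -> M}),
    injective i /\ forall x, U x <-> exists k, i k = x.
Proof.
move=> hU; have L : linear (fun x : sub_type hU => val x) by [].
exists (sub_type hU), (lin L); split; first exact: val_inj.
move=> x; split=> [ux|[[k kP] <-]]; last exact/asboolP.
by exists (Sub x (introT (asboolP _) ux)); rewrite linE SubK.
Qed.

Section QuotType.
Local Open Scope quotient_scope.
Variables (M : lmodType R) (U : M -> Prop) (hU : submod U).
Definition qrel (x y : M) : bool := let _ := hU in `[< U (x - y) >].
Fact qrel_refl : reflexive qrel.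
Proof. by move=> x; apply/asboolP; rewrite subrr; apply: submod0. Qed.
Fact qrel_sym : symmetric qrel.
Proof.
have s x y : qrel x y -> qrel y x.
  by move/asboolP/(submodN hU); rewrite opprB => ?; apply/asboolP.
by move=> x y; apply/idP/idP; apply: s.
Qed.
Fact qrel_trans : transitive qrel.
Proof.
move=> y x z /asboolP u /asboolP v; apply/asboolP.
by rewrite -(subrK y x) -addrA; apply: submodD.
Qed.
Canonical qrel_equiv := EquivRel qrel qrel_refl qrel_sym qrel_trans.
Definition quot_type := {eq_quot qrel}.
HB.instance Definition _ := Choice.on quot_type.
Definition qcl (x : M) : quot_type := \pi x.
Fact qclP x y : qcl x = qcl y <-> U (x - y).
Proof.
by split=> [/eqmodP/asboolP|u] //; apply/eqmodP/asboolP.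
Qed.
Fact qcl_surj (c : quot_type) : exists x, qcl x = c.
Proof. by exists (repr c); apply: reprK. Qed.
Fact qcl_repr x : U (repr (qcl x) - x).
Proof. by apply/qclP; apply: reprK. Qed.
Definition qadd (c d : quot_type) := qcl (repr c + repr d).
Definition qopp (c : quot_type) := qcl (- repr c).
Definition qscale a (c : quot_type) := qcl (a *: repr c).
Fact qaddE x y : qadd (qcl x) (qcl y) = qcl (x + y).
Proof. by apply/qclP; rewrite opprD addrACA; apply: submodD => //; apply: qcl_repr. Qed.
Fact qoppE x : qopp (qcl x) = qcl (- x).
Proof. by apply/qclP; rewrite -opprD; apply: submodN => //; apply: qcl_repr. Qed.
Fact qscaleE a x : qscale a (qcl x) = qcl (a *: x).
Proof. by apply/qclP; rewrite -scalerBr; apply: submodZ => //; apply: qcl_repr. Qed.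
Fact qaddA : associative qadd.
Proof.
move=> a b c; case: (qcl_surj a) (qcl_surj b) (qcl_surj c) => x <- [y <-] [z <-].
by rewrite !qaddE addrA.
Qed.
Fact qaddC : commutative qadd.
Proof. by move=> a b; case: (qcl_surj a) (qcl_surj b) => x <- [y <-]; rewrite !qaddE addrC. Qed.
Fact qadd0 : left_id (qcl 0) qadd.
Proof. by move=> a; case: (qcl_surj a) => x <-; rewrite qaddE add0r. Qed.
Fact qaddN : left_inverse (qcl 0) qopp qadd.
Proof. by move=> a; case: (qcl_surj a) => x <-; rewrite qoppE qaddE addNr. Qed.
HB.instance Definition _ := GRing.isZmodule.Build quot_type qaddA qaddC qadd0 qaddN.
Fact qscaleA a b c : qscale a (qscale b c) = qscale (a * b) c.
Proof. by case: (qcl_surj c) => x <-; rewrite !qscaleE scalerA. Qed.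
Fact qscale1 : left_id 1 qscale.
Proof. by move=> c; case: (qcl_surj c) => x <-; rewrite qscaleE scale1r. Qed.
Fact qscaleDr : right_distributive qscale +%R.
Proof.
move=> a b c; case: (qcl_surj b) (qcl_surj c) => x <- [y <-].
by rewrite -[_ + qcl y]/(qadd _ _) qaddE !qscaleE scalerDr -qaddE.
Qed.
Fact qscaleDl c : {morph qscale^~ c : a b / a + b}.
Proof.
by move=> a b; case: (qcl_surj c) => x <-; rewrite !qscaleE scalerDl -qaddE.
Qed.
HB.instance Definition _ := GRing.Zmodule_isLmodule.Build R quot_type
  qscaleA qscale1 qscaleDr qscaleDl.
Fact qcl_linear : linear (qcl : M -> quot_type).
Proof. by move=> a x y; rewrite -qaddE -qscaleE. Qed.
End QuotType.

Lemma quot_ex M (U : M -> Prop) : submod U ->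
  exists (Q : lmodType R) (p : {linear M -> Q}),
    surj p /\ forall x, p x = 0 <-> U x.
Proof.
move=> hU; exists (quot_type hU), (lin (qcl_linear hU)); split=> [y|x].
  exact: qcl_surj.
by rewrite linE -(linear0 (lin (qcl_linear hU))) linE qclP subr0.
Qed.

Lemma fac_surj M Q N (p : {linear M -> Q}) (f : {linear M -> N}) :
  surj p -> (forall x, p x = 0 -> f x = 0) ->
  exists g : {linear Q -> N}, forall x, g (p x) = f x.
Proof.
move=> sp pf; have [s sE] := choice sp.
have e x : f (s (p x)) = f x.
  by apply/eqP; rewrite -subr_eq0 -linearB pf // linearB sE subrr.
have L : linear (fun q => f (s q)).
  move=> a x y; rewrite -linearP -(e (a *: s x + s y)); congr (f (s _)).
  by rewrite linearP !sE.
by exists (lin L) => x; rewrite linE e.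
Qed.

Lemma fac_inj K M L (i : {linear K -> M}) (f : {linear L -> M}) :
  injective i -> (forall x, exists k, i k = f x) ->
  exists g : {linear L -> K}, forall x, i (g x) = f x.
Proof.
move=> ii ex; have [g gE] := choice ex.
have Lg : linear g by move=> a x y; apply: ii; rewrite linearP !gE linearP.
by exists (lin Lg) => x; rewrite linE gE.
Qed.

Lemma lin_inv M N (f : {linear M -> N}) : injective f -> surj f ->
  exists g : {linear N -> M}, cancel f g /\ cancel g f.
Proof.
move=> fi fs; have [g gE] := fac_inj (f := lin (@id_linear R N)) fi fs.
by exists g; split=> x; [apply: fi; rewrite gE linE|rewrite gE linE].
Qed.

Lemma submod_ker M N (f : {linear M -> N}) : submod (fun x => f x = 0).
Proof. by split=> [|a x y ex ey]; rewrite ?linear0 // linearP ex ey scaler0 addr0. Qed.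

Lemma submod_im M N (f : {linear M -> N}) : submod (fun y => exists x, f x = y).
Proof.
split=> [|a x y [u <-] [v <-]]; first by exists 0; rewrite linear0.
by exists (a *: u + v); rewrite linearP.
Qed.

Lemma ker_ex M N (f : {linear M -> N}) :
  exists (K : lmodType R) (i : {linear K -> M}), injective i /\ exact_at i f.
Proof. by have [K [i [ii iE]]] := sub_ex (submod_ker f); exists K, i. Qed.

Lemma coker_ex M N (f : {linear M -> N}) :
  exists (Q : lmodType R) (p : {linear N -> Q}), surj p /\ exact_at f p.
Proof. by have [K [i [ii iE]]] := quot_ex (submod_im f); exists K, i. Qed.

Lemma inj0 M N (f : {linear M -> N}) : (forall x, f x = 0 -> x = 0) -> injective f.
Proof.
by move=> f0 x y e; apply/eqP; rewrite -subr_eq0; apply/eqP/f0; rewrite linearB e subrr.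
Qed.

Lemma ses_comp0 K L M (i : {linear K -> L}) (p : {linear L -> M}) k :
  exact_at i p -> p (i k) = 0.
Proof. by move=> e; apply/e; exists k. Qed.

Definition rowlin M n (e : 'I_n -> M) (x : 'rV[R]_n) : M := \sum_i x 0 i *: e i.
Lemma rowlin_linear M n (e : 'I_n -> M) : linear (rowlin e).
Proof.
move=> a x y; rewrite /rowlin scaler_sumr -big_split; apply: eq_bigr => i _.
by rewrite !mxE scalerDl scalerA.
Qed.

Lemma rowlin_delta M n (e : 'I_n -> M) i : rowlin e (delta_mx 0 i) = e i.
Proof.
rewrite /rowlin (bigD1 i) //= mxE !eqxx scale1r big1 ?addr0 // => j ji.
by rewrite mxE (negbTE ji) andbF scale0r.
Qed.

Lemma row_ext M n (f g : {linear 'rV[R]_n -> M}) :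
  (forall i, f (delta_mx 0 i) = g (delta_mx 0 i)) -> f =1 g.
Proof.
move=> fg x; rewrite [x]row_sum_delta !linear_sum; apply: eq_bigr => i _.
by rewrite !linearZ fg.
Qed.

Lemma proj_row n : projective_module 'rV[R]_n.
Proof.
move=> M N p f ps; have [e eE] := choice (fun i => ps (f (delta_mx 0 i))).
exists (lin (rowlin_linear e)) => x.
have L : linear (fun x => p (lin (rowlin_linear e) x)) by move=> a u v; rewrite !linearP.
by apply: (@row_ext _ _ (lin L) f) => i; rewrite !linE rowlin_delta eE.
Qed.

Lemma fg_row n : finitely_generated 'rV[R]_n.
Proof. by exists n, (fun i => delta_mx 0 i) => x; exists (x 0); rewrite -row_sum_delta. Qed.

Definition rowmod n : fgmod R := FgMod (fg_row n).

Lemma fg_cover M : finitely_generated M ->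
  exists n (p : {linear 'rV[R]_n -> M}), surj p.
Proof.
move=> [n [e eP]]; exists n, (lin (rowlin_linear e)) => x; have [c ->] := eP x.
exists (\row_i c i); rewrite linE /rowlin; apply: eq_bigr => i _; by rewrite mxE.
Qed.

Lemma fg_row_surj M n (p : {linear 'rV[R]_n -> M}) : surj p -> finitely_generated M.
Proof. by move=> ps; apply: fg_surj ps (fg_row n). Qed.

Lemma proj_retract (P Q : lmodType R) (i : {linear P -> Q}) (r : {linear Q -> P}) :
  (forall x, r (i x) = x) -> projective_module Q -> projective_module P.
Proof.
move=> ri hQ M N p f ps.
have [g gE] := hQ _ _ p (lin (comp_linear f r)) ps.
by exists (lin (comp_linear g i)) => x; rewrite linE gE linE ri.
Qed.

Lemma proj_section (P M : lmodType R) (p : {linear M -> P}) :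
  projective_module P -> surj p -> exists s : {linear P -> M}, forall x, p (s x) = x.
Proof.
move=> hP ps; have [s sE] := hP _ _ p (lin (@id_linear R P)) ps.
by exists s => x; rewrite sE linE.
Qed.

Lemma add_linear M N (f g : {linear M -> N}) : linear (fun x => f x + g x).
Proof. by move=> a x y; rewrite !linearP scalerDr addrACA. Qed.
Lemma sub_linear M N (f g : {linear M -> N}) : linear (fun x => f x - g x).
Proof. by move=> a x y; rewrite (linearP f) (linearP g) scalerBr opprD addrACA. Qed.
Lemma opp_linear M N (f : {linear M -> N}) : linear (fun x => - f x).
Proof. by move=> a x y; rewrite (linearP f) opprD scalerN. Qed.
Lemma scale_linear M N (c : R) (f : {linear M -> N}) : linear (fun x => c *: f x).
Proof. by move=> a x y; rewrite (linearP f) scalerDr !scalerA mulrC. Qed.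
Lemma pair_linear M N K (f : {linear M -> N}) (g : {linear M -> K}) :
  linear (fun x => (f x, g x) : N * K).
Proof. by move=> a x y; rewrite !linearP. Qed.
Lemma copair_linear M N K (f : {linear M -> K}) (g : {linear N -> K}) :
  linear (fun z : M * N => f z.1 + g z.2).
Proof. by move=> a x y; rewrite /= !linearP scalerDr addrACA. Qed.
Lemma fst_linear M N : linear (fun z : M * N => z.1).
Proof. by []. Qed.
Lemma snd_linear M N : linear (fun z : M * N => z.2).
Proof. by []. Qed.
Lemma inl_linear M N : linear (fun x : M => (x, 0) : M * N).
Proof. by move=> a x y; apply/pair_equal_spec; rewrite /= scaler0 addr0. Qed.
Lemma inr_linear M N : linear (fun x : N => (0, x) : M * N).
Proof. by move=> a x y; apply/pair_equal_spec; rewrite /= scaler0 addr0. Qed.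

Definition ladd M N (f g : {linear M -> N}) := lin (add_linear f g).
Definition lsub M N (f g : {linear M -> N}) := lin (sub_linear f g).
Definition lopp M N (f : {linear M -> N}) := lin (opp_linear f).
Definition lscale M N c (f : {linear M -> N}) := lin (scale_linear c f).
Definition lpair M N K (f : {linear M -> N}) (g : {linear M -> K}) := lin (pair_linear f g).
Definition lcopair M N K (f : {linear M -> K}) (g : {linear N -> K}) :=
  lin (copair_linear f g).
Definition lcomp L M N (g : {linear M -> N}) (f : {linear L -> M}) :=
  lin (comp_linear g f).
Definition lid M := lin (@id_linear R M).
Definition lzero M N := lin (@zero_linear R M N).
Definition lfst M N := lin (@fst_linear M N).
Definition lsnd M N := lin (@snd_linear M N).
Definition linl M N := lin (@inl_linear M N).
Definition linr M N := lin (@inr_linear M N).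

End Basics.

Arguments lid {R} M.
Arguments lzero {R} M N.
Arguments lfst {R} M N.
Arguments lsnd {R} M N.
Arguments linl {R} M N.
Arguments linr {R} M N.
Arguments ladd : simpl never.
Arguments lsub : simpl never.
Arguments lopp : simpl never.
Arguments lscale : simpl never.
Arguments lpair : simpl never.
Arguments lcopair : simpl never.
Arguments lcomp : simpl never.
Arguments lid : simpl never.
Arguments lzero : simpl never.
Arguments lfst : simpl never.
Arguments lsnd : simpl never.
Arguments linl : simpl never.
Arguments linr : simpl never.

Section OpsE.
Variables (R : comNzRingType) (K L M N : lmodType R).
Lemma laddE (f g : {linear M -> N}) x : ladd f g x = f x + g x. Proof. by []. Qed.
Lemma lsubE (f g : {linear M -> N}) x : lsub f g x = f x - g x. Proof. by []. Qed.
Lemma loppE (f : {linear M -> N}) x : lopp f x = - f x. Proof. by []. Qed.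
Lemma lscaleE c (f : {linear M -> N}) x : lscale c f x = c *: f x. Proof. by []. Qed.
Lemma lpairE (f : {linear M -> N}) (g : {linear M -> K}) x : lpair f g x = (f x, g x).
Proof. by []. Qed.
Lemma lcopairE (f : {linear M -> K}) (g : {linear N -> K}) x :
  lcopair f g x = f x.1 + g x.2. Proof. by []. Qed.
Lemma lcompE (g : {linear M -> N}) (f : {linear L -> M}) x : lcomp g f x = g (f x).
Proof. by []. Qed.
Lemma lidE (x : M) : lid M x = x. Proof. by []. Qed.
Lemma lzeroE (x : M) : lzero M N x = 0. Proof. by []. Qed.
Lemma lfstE (x : M * N) : lfst M N x = x.1. Proof. by []. Qed.
Lemma lsndE (x : M * N) : lsnd M N x = x.2. Proof. by []. Qed.
Lemma linlE (x : M) : linl M N x = (x, 0). Proof. by []. Qed.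
Lemma linrE (x : N) : linr M N x = (0, x). Proof. by []. Qed.
End OpsE.
Lemma linZ (R : comNzRingType) (M N : lmodType R) (f : {linear M -> N}) a x : f (a *: x) = a *: f x.
Proof. exact: linearZ. Qed.

Definition lE := (laddE, lsubE, loppE, lscaleE, lpairE, lcopairE, lcompE, lidE, lzeroE,
  lfstE, lsndE, linlE, linrE).

(** * Noetherian modules *)

Section Noetherian.
Variable R : comNzRingType.
Implicit Types M N K L : lmodType R.

Definition fgsub M (U : M -> Prop) : Prop :=
  exists (K : lmodType R) (f : {linear K -> M}),
    finitely_generated K /\ forall x, U x <-> exists k, f k = x.

Definition noeth_mod M : Prop := forall U : M -> Prop, submod U -> fgsub U.

Lemma fgsub_row M (U : M -> Prop) : fgsub U ->
  exists n (f : {linear 'rV[R]_n -> M}), forall x, U x <-> exists k, f k = x.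
Proof.
move=> [K [f [fgK fE]]]; have [n [p ps]] := fg_cover fgK.
exists n, (lcomp f p) => x; rewrite fE; split=> -[k <-]; last by exists (p k).
by have [v <-] := ps k; exists v.
Qed.

Lemma noeth_surj M N (p : {linear M -> N}) : surj p -> noeth_mod M -> noeth_mod N.
Proof.
move=> ps hM U hU.
have [|K [f [fgK fE]]] := hM (fun x => U (p x)).
  split=> [|a x y]; first by rewrite linear0; apply: submod0 hU.
  by rewrite linearP; apply: hU.2.
exists K, (lcomp p f); split=> // x; split=> [|[k <-]].
  by have [y <-] := ps x; rewrite fE => -[k <-]; exists k.
by apply/fE; exists k.
Qed.

(** Generators of the trace of U on K, together with lifts to U of generators of the image of U in
    N, generate U. *)
Lemma noeth_ext K M N (i : {linear K -> M}) (p : {linear M -> N}) :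
  exact_at i p -> noeth_mod K -> noeth_mod N -> noeth_mod M.
Proof.
move=> ex hK hN U hU.
have [|K1 [f1 [fg1 f1E]]] := hK (fun k => U (i k)).
  split=> [|a x y]; first by rewrite linear0; apply: submod0 hU.
  by rewrite linearP; apply: hU.2.
have [|n [f2 f2E]] := @fgsub_row N (fun z => exists2 y, U y & p y = z).
  apply: hN; split=> [|a x y [u uu <-] [v vv <-]].
    by exists 0; [apply: submod0 hU|rewrite linear0].
  by exists (a *: u + v); [apply: hU.2|rewrite linearP].
have /choice[e eE] j : exists y, U y /\ p y = f2 (delta_mx 0 j).
  have [y yU yE] := (f2E (f2 (delta_mx 0 j))).2 (ex_intro _ _ erefl).
  by exists y.
pose g := lin (rowlin_linear e).
have gU v : U (g v).
  by rewrite linE; apply: submod_sum => // j _; apply: submodZ => //; case: (eE j).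
have pg v : p (g v) = f2 v.
  by apply: (@row_ext _ _ _ (lcomp p g) f2) => j; rewrite linE linE rowlin_delta; case: (eE j).
exists (K1 * 'rV[R]_n)%type, (lcopair (lcomp i f1) g); split.
  exact: fg_pair fg1 (fg_row R n).
move=> x; split=> [ux|[[k v] <-]]; last first.
  by rewrite !lE; apply: (submodD hU _ (gU v)); apply/f1E; exists k.
have [|v vE] := (f2E (p x)).1; first by exists x.
have [|k kE] := (ex (x - g v)).1; first by rewrite linearB pg vE subrr.
have [|k1 k1E] := (f1E k).1; first by rewrite kE; apply: submodB.
by exists (k1, v); rewrite !lE /= k1E kE subrK.
Qed.

Hypothesis noethR : noetherian R.

Lemma noeth_regular : noeth_mod R^o.
Proof.
(* [noetherian] speaks of proper ideals, so the unit ideal is treated apart. *)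
move=> U hU; have [u1|nu1] := pselect (U 1).
  exists R^o, (lid _); split=> [|x].
    by exists 1%N, (fun=> 1) => x; exists (fun=> x); rewrite big_ord1 /GRing.scale /= mulr1.
  split=> [_|_]; first by exists x.
  by rewrite -[x]mulr1; apply: (submodZ hU).
pose I : {pred R} := fun x => `[< U x >].
have IE x : (x \in I) = `[< U x >] by [].
have [|n [e eP]] := noethR (I := I).
  split=> [||a x y]; rewrite ?IE; first exact/asboolP/(submod0 hU).
    by apply/negP=> /asboolP.
  by move=> /asboolP ux /asboolP uy; apply/asboolP/hU.2.
exists 'rV[R]_n, (lin (@rowlin_linear R R^o n e)); split; first exact: (fg_row R).
move=> x; split=> [ux|[v <-]].
  have /eP[c ->] : x \in I by apply/asboolP.
  by exists (\row_i c i); rewrite linE; apply: eq_bigr => i _; rewrite mxE.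
by apply/asboolP; rewrite -IE; apply/eP; exists (v 0).
Qed.

Lemma noeth_row n : noeth_mod 'rV[R]_n.
Proof.
elim: n => [|n IH].
  move=> U hU; exists 'rV[R]_0, (lid _); split=> [|x]; first exact: (fg_row R).
  split=> [_|_]; first by exists x.
  by rewrite [x]thinmx0; apply: submod0 hU.
have Li : linear (fun x : 'rV[R]_n => row_mx 0 x : 'rV[R]_(1 + n)).
  by move=> a x y; rewrite scale_row_mx add_row_mx scaler0 addr0.
have Lp : linear (fun x : 'rV[R]_(1 + n) => (lsubmx x) 0 0 : R^o).
  by move=> a x y; rewrite !mxE.
apply: (noeth_ext (i := lin Li) (p := lin Lp)) IH noeth_regular => x.
rewrite linE; split=> [e|[k <-]]; last by rewrite linE row_mxKl mxE.
exists (rsubmx x); rewrite linE -[RHS]hsubmxK; congr row_mx.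
by apply/matrixP=> a b; rewrite !ord1 e mxE.
Qed.

Lemma noeth_fg M : finitely_generated M -> noeth_mod M.
Proof. move=> /fg_cover[n [p ps]]; have H := @noeth_row n; exact: (noeth_surj ps H). Qed.

Lemma fg_inj K M (i : {linear K -> M}) :
  injective i -> finitely_generated M -> finitely_generated K.
Proof.
move=> ii fgM; have [L [f [fgL fE]]] := noeth_fg fgM (submod_im i).
have [g gE] := fac_inj (f := f) ii (fun x => (fE (f x)).2 (ex_intro _ x erefl)).
apply: (fg_surj (p := g)) fgL => k.
have [|l lE] := (fE (i k)).1; first by exists k.
by exists l; apply: ii; rewrite gE.
Qed.

Lemma noeth_chain M (U : nat -> M -> Prop) : finitely_generated M ->
  (forall n, submod (U n)) -> (forall n x, U n x -> U n.+1 x) ->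
  exists N : nat, forall n x, U n x -> U N x.
Proof.
move=> fgM hU mono.
have le m n x : (m <= n)%N -> U m x -> U n x.
  by move=> /subnK <-; elim: (n - m)%N => // k IH /IH; apply: mono.
have [|n [f fE]] := fgsub_row (noeth_fg fgM (U := fun x => exists n, U n x) _).
  split=> [|a x y [n un] [m um]]; first by exists 0%N; apply: submod0 (hU _).
  exists (maxn n m); apply: (hU _).2.
    by apply: le un; apply: leq_maxl.
  by apply: le um; apply: leq_maxr.
have /choice[k kE] i : exists m, U m (f (delta_mx 0 i)) by apply/fE; exists (delta_mx 0 i).
exists (\max_i k i)%N => m x um.
have [|v <-] := (fE x).1; first by exists m.
rewrite [v]row_sum_delta linear_sum; apply: submod_sum => // i _.
rewrite linearZ; apply: submodZ => //; apply: le (kE i); exact: leq_bigmax.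
Qed.

(** Noetherian induction from larger to smaller submodules: one that violates P would start an
    infinite strictly increasing chain of violators, against [noeth_chain]. *)
Lemma noeth_ind M (P : (M -> Prop) -> Prop) : finitely_generated M ->
  (forall U, submod U ->
     (forall V, submod V -> (forall x, U x -> V x) -> (exists x, V x /\ ~ U x) -> P V) ->
     P U) ->
  forall U, submod U -> P U.
Proof.
move=> fgM ind U0 hU0; apply: contrapT => nP0.
pose T := {U : M -> Prop | submod U /\ ~ P U}.
have /choice[next nextE] (U : T) : exists V : T,
    (forall x, sval U x -> sval V x) /\ exists x, sval V x /\ ~ sval U x.
  case: U => U [hU nP] /=; apply: contrapT => nV; apply: nP; apply: ind => // V hV UV UV'.
  apply: contrapT => nPV; apply: nV.
  by exists (exist _ V (conj hV nPV)).
pose s n := iter n next (exist _ U0 (conj hU0 nP0) : T).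
have [||N NE] := @noeth_chain M (fun n => sval (s n)) fgM.
- by move=> n; case: (s n) => ? [].
- by move=> n x; apply: (nextE _).1.
by have [x [h nh]] := (nextE (s N)).2; apply/nh/(NE N.+1).
Qed.

Lemma noeth_max M (P : (M -> Prop) -> Prop) (U : M -> Prop) :
  finitely_generated M -> submod U -> P U ->
  exists V : M -> Prop, [/\ submod V, P V & forall W : M -> Prop, submod W -> P W ->
    (forall x, V x -> W x) -> forall x, W x -> V x].
Proof.
move=> fgM hU PU; apply: contrapT => nV; move: PU.
apply: (noeth_ind (P := fun U => ~ P U)) hU => // V hV IH PV; apply: nV.
exists V; split=> // W hW PW VW x wx; apply: contrapT => nvx.
by apply: (IH W) => //; exists x.
Qed.

End Noetherian.

(** * Ideals, primes and Nakayama's lemma *)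

Section Nakayama.
Variable R : comNzRingType.

Definition ideal (q : R -> Prop) : Prop := @submod R R^o q.

Definition prime (q : R -> Prop) : Prop :=
  [/\ ideal q, ~ q 1 & forall a b, q (a * b) -> q a \/ q b].

Section IdealTheory.
Variables (q : R -> Prop) (hq : ideal q).
Lemma ideal0 : q 0. Proof. exact: submod0 hq. Qed.
Lemma idealD a b : q a -> q b -> q (a + b). Proof. exact: (submodD hq). Qed.
Lemma idealB a b : q a -> q b -> q (a - b). Proof. exact: (submodB hq). Qed.
Lemma idealN a : q a -> q (- a). Proof. exact: (submodN hq). Qed.
Lemma idealM a b : q b -> q (a * b). Proof. exact: (submodZ hq). Qed.
Lemma idealMr a b : q a -> q (a * b). Proof. by rewrite mulrC; apply: idealM. Qed.
Lemma idealBD a b : q (a - b) -> q b -> q a.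
Proof. by move=> h hb; rewrite -(subrK b a); apply: idealD. Qed.
Lemma ideal_sum (I : Type) (r : seq I) (P : pred I) (F : I -> R) :
  (forall i, P i -> q (F i)) -> q (\sum_(i <- r | P i) F i).
Proof. exact: (@submod_sum _ R^o). Qed.
End IdealTheory.

Lemma det_cong q n (A B : 'M[R]_n) : ideal q ->
  (forall i j, q (A i j - B i j)) -> q (\det A - \det B).
Proof.
move=> hq AB; rewrite /determinant -sumrB; apply: ideal_sum => // s _.
rewrite -mulrBr; apply: idealM => //.
apply: (big_ind2 (fun a b => q (a - b))) => [|a b c d h1 h2|i _]; last exact: AB.
  by rewrite subrr; apply: ideal0.
have -> : a * c - b * d = c * (a - b) + b * (c - d) by ring.
by apply: idealD => //; apply: idealM.
Qed.

(* The determinant trick. *)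
Lemma nakayama (H : lmodType R) (V : H -> Prop) (q : R -> Prop) (s : R) n (e : 'I_n -> H) :
  submod V -> ideal q ->
  (forall i, exists2 c : 'I_n -> R, forall j, q (c j) & V (s *: e i - \sum_j c j *: e j)) ->
  exists t, q (t - s ^+ n) /\ forall i, V (t *: e i).
Proof.
move=> hV hq h.
have /choice[C CE] i : exists c : 'I_n -> R, (forall j, q (c j)) /\
    V (s *: e i - \sum_j c j *: e j) by have [c ? ?] := h i; exists c.
pose A : 'M[R]_n := s%:M - \matrix_(i, j) C i j.
exists (\det A); split.
  rewrite -det_scalar; apply: det_cong => // i j; rewrite /A !mxE addrAC subrr add0r.
  by apply: idealN => //; case: (CE i).
move=> i.
have VA k : V (\sum_j A k j *: e j).
  have -> : \sum_j A k j *: e j = s *: e k - \sum_j C k j *: e j; last by case: (CE k).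
  under eq_bigr => j _ do rewrite /A !mxE scalerBl.
  rewrite sumrB; congr (_ - _); rewrite (bigD1 k) //= eqxx mulr1n big1 ?addr0 // => j jk.
  by rewrite eq_sym (negbTE jk) mulr0n scale0r.
(* Cramer's rule: A applied to the family e lies in V, and the adjugate turns this into a statement
   about det A times each e i. *)
have -> : \det A *: e i = \sum_k \adj A i k *: \sum_j A k j *: e j.
  have := mul_adj_mx A => /matrixP AE.
  transitivity (\sum_j (\adj A *m A) i j *: e j).
    rewrite (bigD1 i) //= AE !mxE eqxx mulr1n big1 ?addr0 // => j ji.
    by rewrite AE !mxE eq_sym (negbTE ji) mulr0n scale0r.
  under eq_bigr => j _ do rewrite mxE scaler_suml.
  rewrite exchange_big; apply: eq_bigr => k _; rewrite scaler_sumr.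
  by apply: eq_bigr => j _; rewrite scalerA.
by apply: submod_sum => // k _; apply: submodZ.
Qed.

End Nakayama.

(** * Injective modules and resolutions *)

Section Baer.
Variable R : comNzRingType.

(** The map is a function on all of R that is linear on I only; this spares the ideal a module of
    its own. *)
Definition baer (E : lmodType R) : Prop :=
  forall (I : R -> Prop) (f : R -> E), ideal I ->
    (forall a x y, I x -> I y -> f (a * x + y) = a *: f x + f y) ->
    exists e, forall x, I x -> f x = x *: e.

(* Zorn's lemma on the linear relations on [N * E] which contain the graph of
   [f] and are single valued. *)
Lemma baer_injective (E : lmodType R) : baer E -> injective_module E.
Proof.
move=> bE M N i f ii; pose NE := (N * E)%type : lmodType R.
pose ok (G : NE -> Prop) := [/\ submod G, forall e, G (0, e) -> e = 0 &
  forall x, G (i x, f x)].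
pose T := {G : NE -> Prop | ok G}.
pose le (G H : T) : bool := `[< forall z, sval G z -> sval H z >].
have ok0 : ok (fun z => exists x, (i x, f x) = z).
  split=> [|e [x [ix <-]]|x]; last by exists x.
    exact: (submod_im (lpair i f)).
  by rewrite (ii x 0) ?linear0.
have [||A Atot|[G Gok] /= Gmax] :=
    @classical_sets.ZL_preorder T (exist _ _ ok0) le.
- by move=> G; apply/asboolP.
- by move=> G H K /asboolP GH /asboolP HK; apply/asboolP=> z /GH/HK.
- have [[G0 AG0]|nA] := pselect (exists G, A G); last first.
    by exists (exist _ _ ok0) => G AG; case: nA; exists G.
  have okU : ok (fun z => exists2 G, A G & sval G z).
    split.
    + split=> [|a x y [G AG Gx] [H AH Hy]].
        by exists G0 => //; case: (svalP G0) => h _ _; apply: submod0 h.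
      have [/asboolP GH|/asboolP HG] := Atot _ _ AG AH.
        by exists H => //; case: (svalP H) => h _ _; apply: h.2 => //; apply: GH.
      by exists G => //; case: (svalP G) => h _ _; apply: h.2 => //; apply: HG.
    + by move=> e [G _]; case: (svalP G) => _ h _; apply: h.
    + by move=> x; exists G0 => //; case: (svalP G0).
  by exists (exist _ _ okU) => G AG; apply/asboolP=> z Gz; exists G.
have [hG G0 Gf] := Gok.
have Guniq y e e' : G (y, e) -> G (y, e') -> e = e'.
  move=> Ge Ge'; apply/eqP; rewrite -subr_eq0; apply/eqP/G0.
  by have : G (y - y, e - e') := submodB hG Ge Ge'; rewrite subrr.
have Gtot y : exists e, G (y, e).
  apply: contrapT => ny.
  pose I a := exists e, G (a *: y, e).
  have hI : ideal I.
    split=> [|a b c [e be] [e' ce']]; first by exists 0; rewrite scale0r; apply: submod0 hG.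
    exists (a *: e + e').
    by have := hG.2 a _ _ be ce'; rewrite scalerDl -scalerA.
  have /choice[h hP] a : exists e, I a -> G (a *: y, e).
    by have [[e ae]|na] := pselect (I a); [exists e|exists 0 => /na].
  have [|e0 e0P] := bE I h hI.
    move=> a b c /[dup] Ib /hP hb /[dup] Ic /hP hc.
    apply: (Guniq ((a * b + c) *: y)); first by apply: hP; apply: hI.2.
    by have := hG.2 a _ _ hb hc; rewrite scalerDl -scalerA.
  (* The relation enlarged by the pair (y, e0). Baer's condition, applied to the ideal of scalars
     that carry y into the domain of G, keeps it single valued. *)
  pose G' (z : NE) := exists2 a, G (z.1 - a *: y, z.2 - a *: e0) & True.
  have GG' z : G z -> G' z by case: z => u v Gz; exists 0; rewrite //= !scale0r !subr0.
  have okG' : ok G'.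
    split=> [||x]; last exact/GG'/Gf.
      split=> [|a [u v] [u' v'] [b hb _] [c hc _]]; first exact/GG'/(submod0 hG).
      exists (a * b + c) => //; have := hG.2 a _ _ hb hc; congr G; congr pair => /=.
        by rewrite scalerBr scalerDl scalerA opprD addrACA.
      by rewrite scalerBr scalerDl scalerA opprD addrACA.
    move=> e [a]; rewrite /= sub0r => ha _.
    have Ia : G (a *: y, a *: e0 - e).
      have : G (- - (a *: y), - (e - a *: e0)) := submodN hG ha.
      by rewrite opprK opprB.
    have hIa : I a by exists (a *: e0 - e).
    have := Guniq _ _ _ Ia (hP a hIa); rewrite e0P // => /eqP.
    by rewrite -subr_eq0 addrAC subrr add0r oppr_eq0 => /eqP.
  have /asboolP G'G := Gmax (exist _ _ okG') (introT (asboolP _) GG').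
  apply: ny; exists e0; apply: G'G; exists 1 => //=.
  by rewrite !scale1r !subrr; apply: submod0 hG.
have [g gE] := choice Gtot.
have Lg : linear g.
  move=> a x y; apply: (Guniq (a *: x + y)) => //.
  by have := hG.2 a _ _ (gE x) (gE y).
by exists (lin Lg) => x; rewrite linE; apply: (Guniq (i x)).
Qed.

End Baer.

Lemma int_ideal_principal (I : int -> Prop) : ideal I ->
  exists d : int, I d /\ forall x, I x -> exists k, x = k * d.
Proof.
move=> hI; have [[x [Ix x0]]|nI] := pselect (exists x, I x /\ x != 0); last first.
  exists 0; split=> [|x Ix]; first exact: ideal0 hI.
  exists 0; rewrite mul0r; apply/eqP; apply/negPn/negP => x0; apply: nI; by exists x.
have ex : exists n : nat, `[< I (n%:Z) >] && (0 < n)%N.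
  exists `|x|%N; rewrite absz_gt0 x0 andbT; apply/asboolP.
  by rewrite abszEsg; apply: idealM.
have [n /andP[/asboolP In n0] nmin] := find_ex_minn ex.
exists n; split=> // y Iy; exists (y %/ n)%Z.
have Im : I (y %% n)%Z by rewrite /modz; apply: idealB => //; apply: idealM.
rewrite [LHS](divz_eq y n) -[RHS]addr0; congr (_ + _).
have m0 : 0 <= (y %% n)%Z by apply: modz_ge0; lia.
have mn : (y %% n)%Z < n by apply: ltz_pmod; lia.
apply/eqP; rewrite -absz_eq0; apply/negPn/negP => mz.
have := nmin `|(y %% n)%Z|%N; rewrite absz_gt0 -absz_eq0 mz andbT.
rewrite gez0_abs // => /(_ (introT (asboolP _) Im)); lia.
Qed.

(** Q is the group of rationals modulo 1. Divisibility gives Baer's condition. For x of finite order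
    d a character of the group generated by x sends x to 1/d, for x of infinite order to 1/2, and
    injectivity extends it to M. *)
Lemma QZ_ex : exists (Q : lmodType int), injective_module Q /\
  forall (M : lmodType int) (x : M), x != 0 -> exists f : {linear M -> Q}, f x != 0.
Proof.
pose V := zmodule rat : lmodType int.
have hU : @submod int V (fun x => (x : rat) \is a Num.int).
  split; first exact: rpred0.
  move=> a x y xi yi; apply: rpredD => //; rewrite [_ *: _]/(x *~ a).
  exact: rpredMz.
have [Q [p [ps pE]]] := quot_ex hU.
have QI : injective_module Q.
  apply: baer_injective => I f hI fL.
  have [d [Id dP]] := int_ideal_principal hI.
  have [r rE] := ps (f d).
  have f0 : f 0 = 0.
    by have := fL (-1) 0 0 (ideal0 hI) (ideal0 hI); rewrite mulr0 add0r scaleN1r addNr.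
  have fk k : f (k * d) = k *: f d.
    by rewrite -[k * d]addr0 fL // ?f0 ?addr0 //; apply: ideal0.
  exists (p ((r : rat) / d%:~R : rat) : Q) => x Ix; have [k ->] := dP _ Ix; rewrite fk -scalerA.
  congr (_ *: _); have [->|d0] := eqVneq d 0; first by rewrite f0 scale0r.
  have d0' : (d%:~R : rat) != 0 by rewrite intr_eq0.
  rewrite -rE -linearZ; congr (p _).
  by change ((r : rat) = (r : rat) / d%:~R *~ d); rewrite -mulrzr divfK.
exists Q; split=> // M x x0.
have Lg : linear (fun n : int^o => (n : int) *: x) by move=> a b c; rewrite scalerDl scalerA.
pose g := lin Lg.
have hker : ideal (fun n : int => g n = 0) by apply: (submod_ker g).
have [d [gd dP]] := int_ideal_principal hker.
have [r rnint rd] : exists2 r : rat, r \isn't a Num.int & (r * d%:~R) \is a Num.int.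
  have [d0|d0] := eqVneq d 0.
    exists (1 / 2%:R); last by rewrite d0 mulr0 rpred0.
    apply/negP=> /intrP[m /(congr1 (fun r => r * 2%:R))].
    rewrite divfK // => /eqP; rewrite -[2%:R]/((2 : int)%:~R) -rmorphM /= -[1]/((1 : int)%:~R).
    by rewrite eqr_int => /eqP; lia.
  have d0' : (d%:~R : rat) != 0 by rewrite intr_eq0.
  exists (d%:~R^-1); last by rewrite mulVf.
  apply/negP=> /intrP[m /(congr1 (fun r => r * d%:~R))]; rewrite mulVf // => /eqP.
  rewrite -rmorphM /= -[1]/((1 : int)%:~R) eqr_int => /eqP md.
  move: x0; rewrite -[x]scale1r md -scalerA.
  by move: gd; rewrite linE => ->; rewrite scaler0 eqxx.
have [K [i [ii iE]]] := sub_ex (submod_im g).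
have [g' g'E] := fac_inj (f := g) ii (fun n => (iE _).1 (ex_intro _ n erefl)).
have g's : surj g'.
  by move=> k; have [n nE] := (iE (i k)).2 (ex_intro _ k erefl); exists n; apply: ii; rewrite g'E.
have Lh : linear (fun n : int^o => (n : int) *: p (r : V)).
  by move=> a b c; rewrite scalerDl scalerA.
have [|k kE] := fac_surj (f := lin Lh) g's.
  move=> n g'n; have [m ->] : exists m, n = m * d by apply: dP; rewrite -g'E g'n linear0.
  rewrite linE -linearZ; apply/pE.
  have e : r *~ (m * d) = (r * d%:~R) * m%:~R by rewrite -mulrzr rmorphM /=; ring.
  by change ((r *~ (m * d)) \is a Num.int); rewrite e; apply: rpredM => //; apply: rpred_int.
have [f fE] := QI _ _ i k ii; exists f.
have -> : f x = p (r : V).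
  by rewrite -[x in LHS]scale1r -[1 *: x]/(g 1) -g'E fE kE linE scale1r.
by apply/eqP => /pE; apply/negP.
Qed.

(** * Coinduced modules and enough injectives *)

Section Coinduced.
Variables (R : comNzRingType) (Q : lmodType int) (X : Type).

(** The product over X of copies of Hom_Z(R, Q), on which R acts through the argument. *)
Record coind := Coind { coind_fun :> X -> R -> Q;
  coindD : forall c a b, coind_fun c (a + b) = coind_fun c a + coind_fun c b }.

Lemma coind_ext (f g : coind) : (forall c a, f c a = g c a) -> f = g.
Proof.
case: f g => f fD [g gD] /= e; have {}e : f = g by apply/funext=> c; apply/funext=> a.
by case: _ / e gD => gD; congr Coind; apply: Prop_irrelevance.
Qed.

HB.instance Definition _ := gen_eqMixin coind.
HB.instance Definition _ := gen_choiceMixin coind.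

Program Definition coind_zero := @Coind (fun _ _ => 0) _.
Next Obligation. by rewrite addr0. Qed.
Program Definition coind_opp (f : coind) := @Coind (fun c a => - f c a) _.
Next Obligation. by rewrite coindD opprD. Qed.
Program Definition coind_add (f g : coind) := @Coind (fun c a => f c a + g c a) _.
Next Obligation. by rewrite !coindD addrACA. Qed.
Program Definition coind_scale (b : R) (f : coind) := @Coind (fun c a => f c (a * b)) _.
Next Obligation. by rewrite mulrDl coindD. Qed.

Fact coind_addA : associative coind_add.
Proof. by move=> f g h; apply: coind_ext => c a; rewrite /= addrA. Qed.
Fact coind_addC : commutative coind_add.
Proof. by move=> f g; apply: coind_ext => c a; rewrite /= addrC. Qed.
Fact coind_add0 : left_id coind_zero coind_add.
Proof. by move=> f; apply: coind_ext => c a; rewrite /= add0r. Qed.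
Fact coind_addN : left_inverse coind_zero coind_opp coind_add.
Proof. by move=> f; apply: coind_ext => c a; rewrite /= addNr. Qed.
HB.instance Definition _ :=
  GRing.isZmodule.Build coind coind_addA coind_addC coind_add0 coind_addN.
Fact coind_scaleA a b f : coind_scale a (coind_scale b f) = coind_scale (a * b) f.
Proof. by apply: coind_ext => c x; rewrite /= mulrA. Qed.
Fact coind_scale1 : left_id 1 coind_scale.
Proof. by move=> f; apply: coind_ext => c x; rewrite /= mulr1. Qed.
Fact coind_scaleDr : right_distributive coind_scale +%R.
Proof. by move=> a f g; apply: coind_ext. Qed.
Fact coind_scaleDl f : {morph coind_scale^~ f : a b / a + b}.
Proof. by move=> a b; apply: coind_ext => c x; rewrite /= mulrDr coindD. Qed.
HB.instance Definition _ := GRing.Zmodule_isLmodule.Build R coind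
  coind_scaleA coind_scale1 coind_scaleDr coind_scaleDl.

Lemma zlinear (M : zmodType) (N : lmodType int) (f : M -> N) :
  (forall x y, f (x + y) = f x + f y) -> linear (f : zmodule M -> N).
Proof.
move=> fD a x y; rewrite fD; congr (_ + _).
have f0 : f 0 = 0 by apply: (addrI (f 0)); rewrite -fD !addr0.
have fN z : f (- z) = - f z by apply: (addrI (f z)); rewrite -fD !subrr.
have fn n z : f (z *+ n) = f z *+ n.
  by elim: n => [|n IH]; rewrite ?mulr0n // !mulrS fD IH.
rewrite scalezrE; case: a => n; first by rewrite -pmulrn fn -scaler_nat natz.
by rewrite NegzE mulrNz fN -pmulrn fn scaleNr -scaler_nat natz.
Qed.

(** Coinduction is right adjoint to restriction to Z: evaluation at 1 identifies R-linear maps into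
    [coind] with X-indexed families of additive maps into Q, and these extend. *)
Lemma coind_injective : injective_module Q -> injective_module (coind : lmodType R).
Proof.
move=> QI M N i f ii.
have ex c : exists g : {linear zmodule N -> Q}, forall x : M, g (i x) = f x c 1.
  have L1 : linear (i : zmodule M -> zmodule N) by apply: (zlinear (N := zmodule N)) => x y; rewrite linearD.
  have L2 : linear ((fun x : M => f x c 1) : zmodule M -> Q).
    by apply: (zlinear (M := M)) => x y; rewrite linearD.
  have [g gE] := QI _ _ (lin L1) (lin L2) ii.
  by exists g => x; have := gE x.
have {ex}/choice[g gE] := ex.
have hD y c a b : g c ((a + b) *: y : N) = g c (a *: y : N) + g c (b *: y : N).
  by rewrite scalerDl -(linearD (g c)).
have L : linear (fun y : N => Coind (hD y)).
  move=> a x y; apply: coind_ext => c b /=.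
  by rewrite scalerDr scalerA -(linearD (g c)).
exists (lin L) => x; apply: coind_ext => c a; rewrite linE /= -linearZ gE linearZ /=.
by rewrite mul1r.
Qed.

End Coinduced.

Section Injectives.
Variable R : comNzRingType.
Implicit Types M N : lmodType R.

Lemma enough_inj M : exists (E : lmodType R) (i : {linear M -> E}),
  injective_module E /\ injective i.
Proof.
have [Q [QI Qcog]] := QZ_ex; pose X := {linear zmodule M -> Q}.
exists (@coind R Q X : lmodType R).
have D (x : M) (c : X) a b : c ((a + b) *: x) = c (a *: x) + c (b *: x).
  by rewrite scalerDl -(linearD c).
have L : linear (fun x : M => Coind (D x)).
  move=> a x y; apply: coind_ext => c b /=.
  by rewrite scalerDr scalerA -(linearD c).
exists (lin L); split; first exact: coind_injective.
apply: inj0 => x; rewrite linE => e; apply/eqP; apply/negPn/negP => x0.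
have [f /eqP[]] := Qcog (zmodule M) x x0.
by have := congr1 (fun h : coind R Q X => h f 1) e; rewrite /= scale1r.
Qed.

Definition cosyz M N : Prop := exists (E : lmodType R) (i : {linear M -> E})
  (p : {linear E -> N}), injective_module E /\ short_exact i p.

(** For injective M the identity is taken as the embedding, so that a resolution which reaches an
    injective cosyzygy stops there. [gorenstein_ext] turns this into finite injective dimension. *)
Lemma cosyz_ex M : exists N, cosyz M N /\
  (injective_module M -> forall x : N, x = 0).
Proof.
have [MI|nMI] := pselect (injective_module M).
  exists (fgmod0 : lmodType R); split=> [|_]; last exact: fgmod0_eq0.
  exists M, (lid _), (lzero _ _); split=> //; split=> // [y|z].
    by rewrite !lE; split=> // _; exists y.
  by exists 0; rewrite lE (fgmod0_eq0 z).
have [E [i [EI ii]]] := enough_inj M; have [N [p [ps ip]]] := coker_ex i.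
by exists N; split=> //; exists E, i, p.
Qed.

(** The cosyzygies of an injective resolution of C 0. By dimension shifting, Ext^1 with values in C
    j is Ext^(j+1) with values in C 0; this is how higher Ext is expressed throughout. *)
Definition injres (C : nat -> lmodType R) : Prop := forall n, cosyz (C n) (C n.+1).

Lemma injres_ex N : exists C, [/\ C 0%N = N, injres C &
  forall n, injective_module (C n) -> forall x : C n.+1, x = 0].
Proof.
have [f fE] := choice cosyz_ex.
by exists (fun n => iter n f N); split=> [|n|n] //; case: (fE (iter n f N)).
Qed.

Lemma injective0 M : (forall x : M, x = 0) -> injective_module M.
Proof.
by move=> M0 A B i f _; exists (lzero _ _) => x; rewrite lE (M0 (f x)).
Qed.

(* The Baer test against one proper ideal [I] only involves [R / I]. *)
Lemma baer_ext (E : lmodType R) :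
  (forall (I : R -> Prop) (K : lmodType R) (i : {linear K -> R^o}), ideal I ->
     injective i -> (forall x, I x <-> exists k, i k = x) ->
     forall f : {linear K -> E}, exists g : {linear R^o -> E}, forall k, g (i k) = f k) ->
  injective_module E.
Proof.
move=> h; apply: baer_injective => I f hI fL.
have [K [i [ii iE]]] := sub_ex (hI : @submod R R^o I).
have L : linear (fun k => f (i k)).
  by move=> a x y; rewrite linearP fL //; apply/iE; [exists x|exists y].
have [g gE] := h I K i hI ii iE (lin L).
exists (g 1) => x /iE[k kE]; rewrite -linearZ /= -kE -[f _]/(lin L k) -gE.
by congr (g _); rewrite /GRing.scale /= mulr1.
Qed.

End Injectives.

(** * Localized Ext *)

Definition mulset (R : comNzRingType) (U : R -> Prop) : Prop :=
  U 1 /\ forall a b, U a -> U b -> U (a * b).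

Definition one_set {R : comNzRingType} : R -> Prop := fun s => s = 1.

Lemma mulset1 (R : comNzRingType) : @mulset R one_set.
Proof. by split=> // a b -> ->; rewrite mulr1. Qed.

Lemma prime_mulset (R : comNzRingType) (q : R -> Prop) : prime q -> mulset (fun s => ~ q s).
Proof. by case=> _ q1 qM; split=> // a b na nb /qM[]. Qed.

(* Every element of Ext^1(M, C) is killed by an element of [U]. *)
Definition extU (R : comNzRingType) (U : R -> Prop) (M C : lmodType R) : Prop :=
  forall (K L : lmodType R) (i : {linear K -> L}) (p : {linear L -> M}), short_exact i p ->
  forall f : {linear K -> C}, exists2 s, U s &
    exists g : {linear L -> C}, forall k, g (i k) = s *: f k.

Notation ext1 := (extU one_set).

Section Ext.
Variable R : comNzRingType.
Implicit Types A B M N K L F C E : lmodType R.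

Lemma extU_sub (U U' : R -> Prop) M C :
  (forall s, U s -> U' s) -> extU U M C -> extU U' M C.
Proof. by move=> UU' h K L i p s f; have [a /UU' ua ?] := h _ _ _ _ s f; exists a. Qed.

Lemma extU_ext1 (U : R -> Prop) M C : (forall s, U s -> exists t, t * s = 1) ->
  extU U M C -> ext1 M C.
Proof.
move=> Uu h K L i p s f; have [a /Uu[t ta] [g gE]] := h _ _ _ _ s f.
by exists 1 => //; exists (lscale t g) => k; rewrite lE gE scalerA ta.
Qed.

Section MulSet.
Variables (U : R -> Prop) (hU : mulset U).

Lemma extU1 M C : ext1 M C -> extU U M C.
Proof. by apply: extU_sub => s ->; case: hU. Qed.

(** Ext^1(M, C) is the cokernel of Hom(M, E) -> Hom(M, C'). *)
Lemma extU_lift M C E C' (c : {linear C -> E}) (p : {linear E -> C'}) :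
  injective_module E -> short_exact c p ->
  extU U M C <-> forall f : {linear M -> C'}, exists2 s, U s &
    exists l : {linear M -> E}, forall x, p (l x) = s *: f x.
Proof.
move=> EI [ci cp ps]; split=> [h f|h K L i q [ii iq qs] f].
  (* L is the pullback of f and p, an extension of M by C. A map on L that restricts to s on C
     corrects the projection to E so that it descends to a lift of s f. *)
  have [L [j [ji jE]]] := ker_ex (lsub (lcomp f (lfst M E)) (lcomp p (lsnd M E))).
  have LE m e : (exists l, j l = (m, e)) <-> f m = p e.
    rewrite -jE !lE /=; split=> [/eqP|->]; last by rewrite subrr.
    by rewrite subr_eq0 => /eqP.
  have [|i iE] := fac_inj (f := linr M E \o c) ji.
    by move=> x; apply/LE; rewrite linear0 (ses_comp0 _ cp).
  have q_s : surj (lcomp (lfst M E) j).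
    move=> m; have [e eE] := ps (f m); have [l jl] := (LE m e).2 (esym eE).
    by exists l; rewrite !lE jl.
  have ex : short_exact i (lcomp (lfst M E) j).
    split=> //.
      move=> x y xy; apply: ci; have := congr1 (snd \o j) xy.
      by rewrite /= !iE.
    move=> l; rewrite !lE; case jl : (j l) => [m e] /=; split=> [m0|[x xl]].
      have /LE := ex_intro (fun l => j l = (m, e)) l jl; rewrite m0 linear0 => /esym/cp[x xe].
      by exists x; apply: ji; rewrite iE jl /= m0 xe.
    by move: jl; rewrite -xl iE => -[<-].
  have [s Us [g gE]] := h _ _ _ _ ex (lid C).
  have [|l lE'] := fac_surj (f := lsub (lscale s (lcomp (lsnd M E) j)) (lcomp c g)) q_s.
    case: ex => _ ex _ x /ex[y <-].
    by rewrite !lE gE iE lE linZ subrr.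
  exists s => //; exists l => m; have [x <-] := q_s m.
  rewrite lE' !lE linearB linZ (ses_comp0 _ cp) subr0; congr (_ *: _).
  by apply/esym/LE; exists x; case: (j x).
have [g gE] := EI _ _ i (lcomp c f) ii.
have [|f' f'E] := fac_surj (f := lcomp p g) qs.
  by move=> x /iq[k <-]; rewrite lE gE lE (ses_comp0 _ cp).
have [s Us [l lE']] := h f'.
have [|u uE] := fac_inj (f := lsub (lscale s g) (lcomp l q)) ci.
  by move=> x; apply/cp; rewrite !lE linearB linZ lE' f'E lE subrr.
exists s => //; exists u => k; apply: ci.
by rewrite uE !lE gE lE (ses_comp0 _ iq) linear0 subr0 linZ.
Qed.

(** One presentation with projective F tests all extensions of M, because each of them receives a
    map from it and is a pushout of it. *)
Lemma extU_pres K F M C (i : {linear K -> F}) (p : {linear F -> M}) :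
  projective_module F -> short_exact i p ->
  extU U M C <-> forall f : {linear K -> C}, exists2 s, U s &
    exists g : {linear F -> C}, forall k, g (i k) = s *: f k.
Proof.
move=> FP [ii ip ps]; split=> [h f|h K' L j q [ji jq qs] f].
  by apply: h; split; eauto.
have [t tE] := FP _ _ q p qs.
have [|u uE] := fac_inj (f := lcomp t i) ji.
  by move=> x; apply/jq; rewrite lE tE (ses_comp0 _ ip).
have [s Us [g gE]] := h (lcomp f u).
have sT : surj (lcopair j t).
  move=> l; have [x xE] := ps (q l).
  have [|k kE] := (jq (l - t x)).1; first by rewrite linearB tE xE subrr.
  by exists (k, x); rewrite lE /= kE subrK.
have [|v vE] := fac_surj (f := lcopair (lscale s f) g) sT.
  move=> [k x]; rewrite !lE /= => e.
  have [|y yE] := (ip x).1.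
    by rewrite -tE -[t x](addKr (j k)) e addr0 linearN (ses_comp0 _ jq) oppr0.
  have -> : k = - u y.
    apply: ji; rewrite linearN uE lE yE; apply/eqP; rewrite -subr_eq0 opprK; exact/eqP.
  by rewrite -yE gE lE linearN scalerN addNr.
exists s => //; exists v => k.
by have := vE (k, 0); rewrite !lE /= !linear0 !addr0.
Qed.

(** Both sides are Ext^2(M, C). They concern the same maps K -> C', one modulo those that lift to E,
    the other modulo those that extend to F; injectivity of E and projectivity of F make the two
    conditions agree. *)
Lemma extU_shift K F M C E C' (i : {linear K -> F}) (p : {linear F -> M})
    (c : {linear C -> E}) (r : {linear E -> C'}) :
  projective_module F -> short_exact i p -> injective_module E -> short_exact c r ->
  extU U K C <-> extU U M C'.
Proof.
move=> FP ip EI cr; rewrite (extU_lift K EI cr) (extU_pres C' FP ip).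
case: ip cr => ii ip ps [ci cr rs]; split=> h f.
  have [s Us [l lE']] := h f; have [g gE] := EI _ _ i l ii.
  by exists s => //; exists (lcomp r g) => k; rewrite lE gE lE'.
have [s Us [g gE]] := h f; have [l lE'] := FP _ _ r g rs.
by exists s => //; exists (lcomp l i) => k; rewrite lE lE' gE.
Qed.

Lemma extU_proj M C : projective_module M -> extU U M C.
Proof.
move=> MP; have [N [[E [c [p [EI cp]]]] _]] := cosyz_ex C.
apply/(extU_lift M EI cp) => f; have [_ _ ps] := cp; have [l lE'] := MP _ _ p f ps.
by exists 1; [case: hU|exists l => x; rewrite lE' scale1r].
Qed.

Lemma extU_inj M C : injective_module C -> extU U M C.
Proof.
move=> CI K L i p [ii _ _] f; have [g gE] := CI _ _ i f ii.
by exists 1; [case: hU|exists g => x; rewrite gE scale1r].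
Qed.

Lemma extU_kill M C s : U s -> (forall x : M, s *: x = 0) -> extU U M C.
Proof.
move=> Us s0; have [N [[E [c [p [EI cp]]]] _]] := cosyz_ex C.
apply/(extU_lift M EI cp) => f; exists s => //; exists (lzero _ _) => x.
by rewrite lE linear0 -linZ s0 linear0.
Qed.

Lemma extU_retract (A B : lmodType R) C (i : {linear A -> B}) (r : {linear B -> A}) :
  (forall x, r (i x) = x) -> extU U B C -> extU U A C.
Proof.
move=> ri; have [N [[E [c [p [EI cp]]]] _]] := cosyz_ex C.
move/(extU_lift B EI cp) => h; apply/(extU_lift A EI cp) => f.
have [s Us [l lE']] := h (lcomp f r).
by exists s => //; exists (lcomp l i) => x; rewrite lE lE' lE ri.
Qed.

Lemma extU_iso (A B : lmodType R) C (i : {linear A -> B}) :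
  injective i -> surj i -> extU U A C -> extU U B C.
Proof. by move=> ii si; have [r [ir ri]] := lin_inv ii si; apply: extU_retract ri. Qed.

Section LongExact.
Variables (A B D : lmodType R) (a : {linear A -> B}) (b : {linear B -> D}).
Hypothesis ab : short_exact a b.

Lemma extU_mid C : extU U A C -> extU U D C -> extU U B C.
Proof.
case: ab => ai ab' bs; have [N [[E [c [p [EI cp]]]] _]] := cosyz_ex C.
move/(extU_lift A EI cp) => hA /(extU_lift D EI cp) => hD.
apply/(extU_lift B EI cp) => f.
have [s Us [l lE']] := hA (lcomp f a); have [l' l'E] := EI _ _ a l ai.
have [|g gE] := fac_surj (f := lsub (lscale s f) (lcomp p l')) bs.
  by move=> x /ab'[y <-]; rewrite !lE l'E lE' lE subrr.
have [t Ut [m mE]] := hD g.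
exists (t * s); first by apply: hU.2.
exists (ladd (lscale t l') (lcomp m b)) => x.
by rewrite !lE linearD linZ /= mE gE !lE scalerBr scalerA addrC subrK.
Qed.

(** Exactness of Ext^1(B, C) -> Ext^1(A, C) -> Ext^2(D, C), the last group being read as Ext^1(D,
    C'). *)
Lemma extU_left C C' : cosyz C C' -> extU U B C -> extU U D C' -> extU U A C.
Proof.
move=> [E [c [p [EI cp]]]] /(extU_lift B EI cp) hB hD.
apply/(extU_lift A EI cp) => f.
have [s Us [g gE]] := hD _ _ _ _ ab f; have [t Ut [l lE']] := hB g.
exists (t * s); first by apply: hU.2.
by exists (lcomp l a) => x; rewrite lE lE' gE scalerA.
Qed.

(** Exactness of Ext^1(A, C) -> Ext^2(D, C) -> Ext^2(B, C), with C' absorbing one degree. *)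
Lemma extU_right C C' : cosyz C C' -> extU U A C -> extU U B C' -> extU U D C'.
Proof.
move=> [E [c [p [EI cp]]]] /(extU_lift A EI cp) hA.
have [N [[E' [c' [p' [E'I cp']]]] _]] := cosyz_ex C'.
move/(extU_lift B E'I cp') => hB; apply/(extU_lift D E'I cp') => f.
case: ab => ai ab' bs; have [s Us [l lE']] := hB (lcomp f b).
have [ci' cp'E _] := cp'.
have [|m mE] := fac_inj (f := lcomp l a) ci'.
  by move=> x; apply/cp'E; rewrite lE lE' lE (ses_comp0 _ ab') linear0 scaler0.
have [t Ut [l1 l1E]] := hA m; have [l2 l2E] := EI _ _ a l1 ai.
have [|g gE] := fac_surj (f := lsub (lscale t l) (lcomp c' (lcomp p l2))) bs.
  by move=> x /ab'[y <-]; rewrite !lE l2E l1E linZ mE lE subrr.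
exists (t * s); first by apply: hU.2.
exists g => x; have [y <-] := bs x.
by rewrite gE !lE linearB linZ lE' lE (ses_comp0 _ cp'E) subr0 scalerA.
Qed.

End LongExact.
End MulSet.
End Ext.

Section Syzygy.
Variable R : comNzRingType.
Implicit Types A B M N K L F C E : lmodType R.

Definition syz K M : Prop :=
  exists n (i : {linear K -> 'rV[R]_n}) (p : {linear 'rV[R]_n -> M}), short_exact i p.

Lemma syz_ex M : finitely_generated M -> exists K, syz K M.
Proof.
move=> /fg_cover[n [p ps]]; have [K [i [ii ip]]] := ker_ex p.
by exists K, n, i, p.
Qed.

Lemma syz_fg K M : noetherian R -> syz K M -> finitely_generated K.
Proof. by move=> hR [n [i [p [ii _ _]]]]; apply: (fg_inj hR ii); apply: fg_row. Qed.

Lemma syz_shift (U : R -> Prop) K M C C' : syz K M -> cosyz C C' ->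
  extU U K C <-> extU U M C'.
Proof.
move=> [n [i [p ip]]] [E [c [r [EI cr]]]].
exact: (extU_shift U (@proj_row R n) ip EI cr).
Qed.

Lemma short_exact_scale M x :
  (forall m : M, x *: m = 0 -> m = 0) -> exists (X : lmodType R) (r : {linear M -> X}),
  short_exact (lscale x (lid M)) r.
Proof.
move=> xi; have [X [r [rs ex]]] := coker_ex (lscale x (lid M)).
exists X, r; split=> //; apply: inj0 => m; rewrite !lE; exact: xi.
Qed.

End Syzygy.

(** * Localized Ext of finitely generated modules, and chains of primes *)

Section ExtNoetherian.
Variable R : comNzRingType.
Hypothesis noethR : noetherian R.
Implicit Types A B M N K L F C E : lmodType R.

Lemma prod_notin (q : R -> Prop) n (s : 'I_n -> R) : prime q ->
  (forall i, ~ q (s i)) -> ~ q (\prod_i s i).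
Proof.
move=> hq hs; have [u1 uM] := prime_mulset hq.
by apply: (big_ind (fun a => ~ q a)) => //; apply: uM.
Qed.

Lemma ffun_fg m N : finitely_generated N -> finitely_generated {ffun 'I_m -> N}.
Proof.
move=> [r [e eE]].
have L : linear (fun v : 'rV[R]_(m * r) =>
   [ffun i => \sum_j (vec_mx v : 'M_(m, r)) i j *: e j] : {ffun 'I_m -> N}).
  move=> a x y; apply/ffunP=> i; rewrite !ffunE scaler_sumr -big_split.
  by apply: eq_bigr => j _; rewrite linearP !mxE scalerDl scalerA.
apply: (fg_row_surj (p := lin L)) => h.
have [c cE] := choice (fun i => eE (h i)).
exists (mxvec (\matrix_(i, j) c i j)); apply/ffunP=> i; rewrite linE ffunE [RHS]cE mxvecK.
by apply: eq_bigr => j _; rewrite mxE.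
Qed.

(* Nakayama's lemma for the finitely generated module Hom(K, N) localized at [q]. *)
Lemma nakayama_hom (q : R -> Prop) (x : R) K N (W : {linear K -> N} -> Prop) :
  prime q -> q x -> finitely_generated K -> finitely_generated N ->
  (forall f g h : {linear K -> N}, forall a, W f -> W g ->
     (forall k, h k = a *: f k + g k) -> W h) ->
  (exists f, W f) ->
  (forall f : {linear K -> N}, exists2 s, ~ q s & exists f' w : {linear K -> N},
     W w /\ forall k, s *: f k = x *: f' k + w k) ->
  forall f : {linear K -> N}, exists2 t, ~ q t & W (lscale t f).
Proof.
move=> hq qx fgK fgN Wlin [w0 Ww0] h f.
have W0 (z : {linear K -> N}) : (forall k, z k = 0) -> W z.
  by move=> z0; apply: (Wlin w0 w0 z (-1)) => // k; rewrite z0 scaleN1r addNr.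
have [m [g gE]] := fgK.
(* Values on m generators embed Hom(K, N) in the finitely generated module N^m, which is
   noetherian. *)
pose ev (u : {linear K -> N}) : {ffun 'I_m -> N} := [ffun i => u (g i)].
have ev_ext (u v : {linear K -> N}) : ev u = ev v -> u =1 v.
  move=> e k; have [c ->] := gE k; rewrite !linear_sum; apply: eq_bigr => i _.
  by rewrite !linZ; congr (_ *: _); have := congr1 (fun h : {ffun 'I_m -> N} => h i) e; rewrite /= !ffunE.
have hA : submod (fun y => exists u, ev u = y).
  split=> [|a y z [u <-] [v <-]].
    by exists (lzero _ _); apply/ffunP=> i; rewrite !ffunE lE.
  by exists (ladd (lscale a u) v); apply/ffunP=> i; rewrite !ffunE !lE.
have hV : submod (fun y => exists2 u, W u & ev u = y).
  split=> [|a y z [u Wu <-] [v Wv <-]].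
    exists (lzero _ _); first exact: W0.
    by apply/ffunP=> i; rewrite !ffunE lE.
  exists (ladd (lscale a u) v); first by apply: (Wlin u v _ a).
  by apply/ffunP=> i; rewrite !ffunE !lE.
have [n [p pE]] := fgsub_row (noeth_fg noethR (ffun_fg m fgN) hA).
have /choice[u uE] j : exists u, ev u = p (delta_mx 0 j) by apply/pE; exists (delta_mx 0 j).
have /choice[s sE] j : exists s, ~ q s /\ exists f' w : {linear K -> N},
     W w /\ forall k, s *: u j k = x *: f' k + w k.
  by have [s ? ?] := h (u j); exists s.
have hq' := hq; case: hq' => hI _ _.
have [|t [tq tV]] := @nakayama _ _ _ q (\prod_i s i) n (fun j => p (delta_mx 0 j)) hV hI.
  move=> j; have [_ [f' [w [Ww fw]]]] := sE j.
  (* r brings the relation for the j-th generator to the common denominator. *)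
  pose r := \prod_(i | i != j) s i.
  have sr : \prod_i s i = r * s j by rewrite (bigD1 j) //= mulrC.
  have [v vE] := (pE (ev f')).1 (ex_intro _ f' erefl).
  exists (fun k => r * x * v 0 k) => [k|]; first by rewrite -mulrA mulrC -mulrA; apply: idealMr.
  exists (lscale r w); first by apply: (Wlin w (lzero _ _) _ r) => // [|k]; [apply: W0|rewrite !lE addr0].
  have -> : \sum_k (r * x * v 0 k) *: p (delta_mx 0 k) = (r * x) *: ev f'.
    rewrite -vE [v in p v]row_sum_delta linear_sum scaler_sumr; apply: eq_bigr => k _.
    by rewrite linZ scalerA.
  rewrite -uE sr; apply/ffunP=> i; rewrite !ffunE !lE -!scalerA fw scalerDr.
  by rewrite addrAC subrr add0r.
exists t.
  move=> qt; apply: (@prod_notin q n s hq (fun i => (sE i).1)).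
  set b := \prod_i s i in tq *.
  have : q (b ^+ n) by rewrite -(subKr t (b ^+ n)); apply: idealB.
  case: hq => _ q1 qM; elim: (n in b ^+ n) => [|k IH]; first by rewrite expr0.
  by rewrite exprS => /qM[].
have [v vE] := (pE (ev f)).1 (ex_intro _ f erefl).
have [w Ww wE] : exists2 w, W w & ev w = ev (lscale t f).
  have -> : ev (lscale t f) = \sum_j v 0 j *: (t *: p (delta_mx 0 j)).
    transitivity (t *: ev f); first by apply/ffunP=> i; rewrite !ffunE lE.
    rewrite -vE [v in p v]row_sum_delta linear_sum scaler_sumr; apply: eq_bigr => k _.
    by rewrite linZ !scalerA mulrC.
  by apply: (submod_sum hV) => j _; apply: (submodZ hV).
apply: (Wlin w (lzero _ _) _ 1) => // [|k]; first exact: W0.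
by rewrite lzeroE addr0 scale1r; apply/esym/ev_ext.
Qed.

Section KeyLemma.
Variables (q : R -> Prop) (hq : prime q) (C : nat -> lmodType R).
Hypotheses (hC : injres C) (fgC : finitely_generated (C 0%N)).
Let U := fun s => ~ q s.
Let hU : mulset U := prime_mulset hq.


(* Ext^(j+1)(M, C 0) = x Ext^(j+1)(M, C 0) after localization. *)
Let divisible (x : R) M j := forall E (c : {linear C j -> E}) (p : {linear E -> C j.+1}),
  injective_module E -> short_exact c p ->
  forall f : {linear M -> C j.+1}, exists2 s, U s &
    exists f' : {linear M -> C j.+1}, exists l : {linear M -> E},
    forall m, s *: f m = x *: f' m + p (l m).

(** The dimension shift of [divisible]: Ext^(j+1)(M, C 0), a quotient of Hom(M, C j.+1), is
    rewritten as a quotient of Hom(K, C j). *)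
Lemma divisible_down x M K n j (i : {linear K -> 'rV[R]_n}) (pi : {linear 'rV[R]_n -> M}) :
  short_exact i pi -> divisible x M j ->
  forall f : {linear K -> C j}, exists2 s, U s & exists f' : {linear K -> C j},
   exists g : {linear 'rV[R]_n -> C j}, forall k, s *: f k = x *: f' k + g (i k).
Proof.
move=> [ii ip ps] h f; have [E [c [p [EI cp]]]] := hC j.
have [ci cpE pps] := cp; have [g gE] := EI _ _ i (lcomp c f) ii.
have [|f1 f1E] := fac_surj (f := lcomp p g) ps.
  by move=> y /ip[k <-]; rewrite lE gE lE (ses_comp0 _ cpE).
have [s Us [f2 [l lE']]] := h E c p EI cp f1.
have [g' g'E] := @proj_row R n _ _ p (lcomp f2 pi) pps.
have [|g2 g2E] := fac_inj (f := lsub (lsub (lscale s g) (lscale x g')) (lcomp l pi)) ci.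
  move=> y; apply/cpE; rewrite !lE !linearB !linZ g'E lE.
  have := f1E y; rewrite lE => <-; rewrite /= lE'.
  by rewrite scalerN addrAC addrK subrr.
have [|f' f'E] := fac_inj (f := lcomp g' i) ci.
  by move=> y; apply/cpE; rewrite lE g'E lE (ses_comp0 _ ip) linear0.
exists s => //; exists f', g2 => k; apply: ci.
rewrite linearD !linZ f'E g2E !lE gE (ses_comp0 _ ip) linear0 subr0 lE.
by rewrite addrC subrK.
Qed.

(** Of the terms of C only C 0 is known to be finitely generated. Passing to syzygies of M lowers j
    to 0, where Nakayama's lemma applies to Hom(K, C 0) modulo the maps that extend to the free
    cover. *)
Lemma ext_divisible x M j : q x -> finitely_generated M -> divisible x M j ->
  extU U M (C j).
Proof.
move=> qx; elim: j M => [|j IH] M fgM h.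
all: have [K KM] := syz_ex fgM; have fgK := syz_fg noethR KM.
all: have [n [i [pi ipi]]] := KM.
all: have D := divisible_down ipi h.
  apply/(extU_pres U _ (@proj_row R n) ipi) => f.
  pose W (f : {linear K -> C 0%N}) :=
    exists g : {linear 'rV[R]_n -> C 0%N}, forall k, g (i k) = f k.
  have [|||t Ut [g gE]] := @nakayama_hom q x K (C 0%N) W hq qx fgK fgC _ _ _ f.
  - move=> f1 f2 f3 a [g1 g1E] [g2 g2E] f3E; exists (ladd (lscale a g1) g2) => k.
    by rewrite !lE g1E g2E f3E.
  - by exists (lzero _ _), (lzero _ _) => k; rewrite !lE.
  - move=> f1; have [s Us [f' [g gE]]] := D f1; exists s => //.
    by exists f', (lcomp g i); split; [exists g|].
  by exists t => //; exists g => k; rewrite gE lE.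
apply/(syz_shift U KM (hC j)); apply: IH => // E c p EI [ci cpE ps] f.
have [s Us [f' [g gE]]] := D f; have [l lE'] := @proj_row R n _ _ p g ps.
by exists s => //; exists f', (lcomp l i) => k; rewrite lE lE'.
Qed.

(** By the long exact sequence of x on M, vanishing of the next Ext of M / x M makes x surjective on
    the Ext of M; as x is in q, Nakayama's lemma applies. *)
Lemma ext_nakayama x M (X : lmodType R) (r : {linear M -> X}) j : q x -> finitely_generated M ->
  short_exact (lscale x (lid M)) r -> extU U X (C j.+1) -> extU U M (C j).
Proof.
move=> qx fgM ex h; apply: (ext_divisible qx fgM) => E c p _ _ f.
have [s Us [g gE]] := h _ _ _ _ ex f; exists s => //.
by exists g, (lzero _ _) => m; rewrite -gE !lE linZ linear0 addr0.
Qed.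

Lemma hom_nakayama x M (X : lmodType R) (r : {linear M -> X}) : q x -> finitely_generated M ->
  short_exact (lscale x (lid M)) r -> extU U X (C 0%N) ->
  forall f : {linear M -> C 0%N}, exists2 s, U s & forall m, s *: f m = 0.
Proof.
move=> qx fgM ex h f.
have [|||t Ut h0] :=
    @nakayama_hom q x M (C 0%N) (fun g => forall m, g m = 0) hq qx fgM fgC _ _ _ f.
- by move=> f1 f2 f3 a h1 h2 e m; rewrite e h1 h2 scaler0 addr0.
- by exists (lzero _ _) => m; rewrite lE.
- move=> f1; have [s Us [g gE]] := h _ _ _ _ ex f1; exists s => //.
  exists g, (lzero _ _); split=> m; first by rewrite lE.
  by rewrite -gE !lE linZ addr0.
by exists t => // m; rewrite -[RHS](h0 m) lE.
Qed.

(** R / q tests the vanishing of localized Ext. The proof is noetherian induction on the kernel W of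
    M0 -> Q, so that every proper quotient of Q is already settled; Q is then cut into proper
    quotients, modules killed by a denominator, and copies of R / q. *)
Lemma ext_key (k : lmodType R) (pk : {linear R^o -> k}) j0 :
  surj pk -> (forall x, pk x = 0 <-> q x) ->
  (forall j, (j0 <= j)%N -> extU U k (C j)) ->
  forall M, finitely_generated M -> forall j, (j0 <= j)%N -> extU U M (C j).
Proof.
move=> pks pkE hk M0 fg0.
pose P (W : M0 -> Prop) := forall (Q : lmodType R) (p : {linear M0 -> Q}), surj p ->
  (forall x, p x = 0 <-> W x) -> forall j, (j0 <= j)%N -> extU U Q (C j).
suff [h0 hP] : submod (fun x : M0 => x = 0) /\ forall W, submod W -> P W.
  apply: (hP _ (conj h0 hP).1 M0 (lid M0)) => [y|x]; last by rewrite lE.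
  by exists y; rewrite lE.
split; first exact: (submod_ker (lid M0)).
apply: (noeth_ind noethR fg0) => W hW IH Q p ps pE.
have fgQ : finitely_generated Q := fg_surj ps fg0.
have {}IH (X : lmodType R) (r : {linear Q -> X}) y : surj r -> r y = 0 -> y <> 0 ->
    forall j, (j0 <= j)%N -> extU U X (C j).
  move=> rs ry y0; apply: (IH (fun x => r (p x) = 0) _ _ _ X (lcomp r p)).
  - exact: (submod_ker (lcomp r p)).
  - by move=> x /pE ->; rewrite linear0.
  - have [x xE] := ps y; exists x; rewrite xE; split=> //.
    by move/pE; rewrite xE.
  - by move=> z; have [y' <-] := rs z; have [x <-] := ps y'; exists x; rewrite lE.
  - by move=> x; rewrite lE.
(* A is x Q, at once a submodule and a quotient of Q; X is Q / x Q. *)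
have im_ses (x : R) : exists (A X : lmodType R) (a : {linear A -> Q}) (a' : {linear Q -> A}) (r : {linear Q -> X}),
    [/\ short_exact a r, surj a' & forall y, a (a' y) = x *: y].
  have [A [a [ai aE]]] := sub_ex (submod_im (lscale x (lid Q))).
  have [|a' a'E] := fac_inj (f := lscale x (lid Q)) ai.
    by move=> y; apply/aE; exists y.
  have [X [r [rs re]]] := coker_ex a.
  exists A, X, a, a', r; split=> // z.
  by have [y yE] := (aE (a z)).2 (ex_intro _ z erefl); exists y; apply: ai; rewrite a'E.
have [nil|nnil] := pselect (forall x y, q x -> x *: (y : Q) = 0); last first.
  have [x [qx [y xy]]] : exists x, q x /\ exists y : Q, x *: y <> 0.
    apply: contrapT => n; apply: nnil => x y qx; apply: contrapT => xy.
    by apply: n; exists x; split=> //; exists y.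
  (* Some x in q acts on Q neither as zero nor injectively: then x Q and Q / x Q are both proper
     quotients. If x is injective on Q, Nakayama's lemma reduces Q to Q / x Q one degree higher. *)
  have [xi|nxi] := pselect (forall m : Q, x *: m = 0 -> m = 0); last first.
    have [z [xz z0]] : exists z : Q, x *: z = 0 /\ z <> 0.
      apply: contrapT => n; apply: nxi => m xm; apply: contrapT => m0.
      by apply: n; exists m.
    have [A [X [a [a' [r [ar a's aE]]]]]] := im_ses x; have [ai are rs] := ar.
    move=> j hj; apply: (extU_mid hU ar).
      by apply: (IH A a' z) => //; apply: ai; rewrite aE linear0.
    by apply: (IH X r (x *: y)) => //; rewrite -aE; apply: ses_comp0.
  have [X [r xr]] := short_exact_scale xi; have [_ xre rs] := xr.
  move=> j hj; apply: (ext_nakayama qx fgQ xr).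
  apply: (IH X r (x *: y)) => //; last exact: leqW.
  by apply/xre; exists y; rewrite !lE.
(* Now q kills Q. If s outside q has torsion, Q is an extension of the proper quotient s Q by a
   module killed by the denominator s. *)
have [[s [qs [z [sz z0]]]]|nt] :=
    pselect (exists s, ~ q s /\ exists z : Q, s *: z = 0 /\ z <> 0).
  have [A [X [a [a' [r [ar a's aE]]]]]] := im_ses s; have [ai _ _] := ar.
  have [K [i [ii ia]]] := ker_ex a'.
  move=> j hj; apply: (extU_mid hU (And3 ii ia a's)).
    apply: (extU_kill _ (s := s)) => // x; apply: ii; rewrite linZ linear0.
    by rewrite -aE (ses_comp0 _ ia) linear0.
  by apply: (IH A a' z) => //; apply: ai; rewrite aE linear0.
have [Q0|nQ0] := pselect (forall z : Q, z = 0).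
  move=> j hj; apply: (extU_kill _ (s := 1)); first by case: hU.
  by move=> x; rewrite (Q0 x) scaler0.
have [y y0] : exists y : Q, y <> 0.
  by apply: contrapT => n; apply: nQ0 => z; apply: contrapT => z0; apply: n; exists z.
(* Elements outside q act injectively and q acts as zero, so any nonzero y spans a copy of R / q;
   the cokernel is a proper quotient. *)
have L : linear (fun x : R^o => (x : R) *: y).
  by move=> a b c; rewrite scalerDl scalerA.
have [Y [i [ii iE]]] := sub_ex (submod_im (lin L)).
have [|g gE] := fac_inj (f := lin L) ii; first by move=> x; apply/iE; exists x.
have gs : surj g.
  by move=> z; have [x xE] := (iE (i z)).2 (ex_intro _ z erefl); exists x; apply: ii; rewrite gE.
have gker x : g x = 0 <-> q x.
  split=> [g0|qx]; last by apply: ii; rewrite gE linear0 linE nil.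
  apply: contrapT => nqx; apply: nt; exists x; split=> //; exists y; split=> //.
  by have := gE x; rewrite g0 linear0 linE.
have [|h hE] := fac_surj (f := g) pks; first by move=> x /pkE/gker.
have hi : injective h.
  by apply: inj0 => z; have [x <-] := pks z; rewrite hE => /gker/pkE.
have hs : surj h by move=> z; have [x <-] := gs z; exists (pk x); rewrite hE.
have [X [r [rs re]]] := coker_ex i.
move=> j hj; apply: (extU_mid hU (And3 ii re rs)).
  by apply: (extU_iso hi hs); apply: hk.
apply: (IH X r y) => //; apply/re; exists (g 1).
by rewrite gE linE scale1r.
Qed.

End KeyLemma.

(* Localized at [p], Ext^0(M, N) is Hom(M, N) and Ext^(j+1)(M, N) is computed by
   the j-th cosyzygy of [N]. *)
Definition ext_zero (q : R -> Prop) (C : nat -> lmodType R) M (i : nat) : Prop :=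
  if i is j.+1 then extU (fun s => ~ q s) M (C j) else
  forall f : {linear M -> C 0%N}, exists2 s, ~ q s & forall m, s *: f m = 0.

Lemma cyclic_quot (I : R -> Prop) : ideal I ->
  exists (k : lmodType R) (pk : {linear R^o -> k}), surj pk /\ forall x, pk x = 0 <-> I x.
Proof. by move=> hI; apply: (quot_ex (hI : @submod R R^o I)). Qed.

Lemma fg_regular : finitely_generated R^o.
Proof.
by exists 1%N, (fun=> 1) => x; exists (fun=> x); rewrite big_ord1 /GRing.scale /= mulr1.
Qed.

(** An argument of Bass, in contrapositive form: x in q outside p is regular on R / p, [ext_key]
    kills the higher Ext of (R / p) / x at q, and Nakayama's lemma kills Ext^i(R / p) at q, hence at
    p. Since q may have height above one over p, all degrees beyond i are assumed to vanish, not
    just the next. *)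
Lemma ext_zero_chain (p q : R -> Prop) (C : nat -> lmodType R)
    (Mp Mq : lmodType R) (rp : {linear R^o -> Mp}) (rq : {linear R^o -> Mq}) i :
  prime p -> prime q -> (forall x, p x -> q x) -> (exists x, q x /\ ~ p x) ->
  injres C -> finitely_generated (C 0%N) ->
  surj rp -> (forall x, rp x = 0 <-> p x) -> surj rq -> (forall x, rq x = 0 <-> q x) ->
  (forall j, (i < j)%N -> ext_zero q C Mq j) -> ext_zero p C Mp i.
Proof.
move=> hp hq pq [x [qx px]] hC fgC rps rpE rqs rqE h.
have fgMp := fg_surj rps fg_regular.
have [X [r xr]] : exists (X : lmodType R) (r : {linear Mp -> X}), short_exact (lscale x (lid Mp)) r.
  apply: short_exact_scale => m; have [a <-] := rps m.
  by rewrite -linZ => /rpE; case: hp => _ _ hM /hM[|/rpE].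
have fgX : finitely_generated X by case: xr => _ _ rs; apply: fg_surj rs fgMp.
have hX j : (i <= j)%N -> extU (fun s => ~ q s) X (C j).
  by apply: (ext_key hq hC fgC rqs rqE) => // {}j hj; apply: (h j.+1).
have sub s : ~ q s -> ~ p s by move=> nq /pq.
case: i h hX => [|i] h hX.
  move=> f; have [s qs s0] := hom_nakayama hq fgC qx fgMp xr (hX 0%N isT) f.
  by exists s => //; apply: sub.
by apply: (extU_sub sub); apply: (ext_nakayama hq hC fgC qx fgMp xr); apply: hX.
Qed.

(* Along a chain of primes the non-vanishing of Ext moves up, so the length of
   the chain is bounded by the degrees in which Ext does not vanish. *)
Lemma prime_chain_bound (e D : nat) (p : nat -> R -> Prop) :
  (forall i, (i <= e)%N -> prime (p i)) ->
  (forall i, (i < e)%N -> (forall x, p i x -> p i.+1 x) /\ exists x, p i.+1 x /\ ~ p i x) ->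
  (forall C : nat -> lmodType R, injres C -> finitely_generated (C 0%N) ->
     forall M, finitely_generated M -> forall j, (D <= j)%N -> ext1 M (C j)) ->
  (e <= D)%N.
Proof.
move=> hp pp hD.
(* With coefficients R / p 0 the identity gives a nonzero Ext^0 at the bottom of the chain; each
   strict inclusion then raises the degree by at least one. *)
have [N [rN [rNs rNE]]] := cyclic_quot (let: And3 h _ _ := hp 0%N isT in h).
have [C [C0 hC _]] := injres_ex N.
have fgN := fg_surj rNs fg_regular.
have fgC : finitely_generated (C 0%N) by rewrite C0.
suff : forall i, (i <= e)%N -> exists2 j, (i <= j)%N & exists (M : lmodType R)
    (r : {linear R^o -> M}), [/\ surj r, forall x, r x = 0 <-> p i x & ~ ext_zero (p i) C M j].
  move=> /(_ e (leqnn e))[[|j] ij [M [r [rs _ nz]]]]; first by rewrite (leq_trans ij).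
  apply: contrapT => /negP; rewrite -ltnNge => De; apply: nz.
  apply: (extU1 (prime_mulset (hp e (leqnn e)))); apply: hD => //.
    exact: fg_surj rs fg_regular.
  by rewrite -ltnS (leq_trans De).
elim=> [|i IH] ie.
  exists 0%N => //; exists N, rN; split=> //= h; move: (rN) rNs rNE.
  case: _ / C0 h => h r rs rE; have [s ns s0] := h (lid _).
  by apply/ns/rE; rewrite -[s]mulr1 -[s * 1]/(s *: (1 : R^o)) linZ -[r 1]lidE s0.
have [j ij [M [r [rs rE nz]]]] := IH (ltnW ie).
have [k [pk [pks pkE]]] := cyclic_quot (let: And3 h _ _ := hp i.+1 ie in h).
apply: contrapT => n; apply: nz.
have [h1 h2] := pp i ie.
apply: (@ext_zero_chain _ (p i.+1) C M k r pk j (hp _ (ltnW ie)) (hp _ ie)) => // j' jj'.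
apply: contrapT => nz; apply: n; exists j'; first exact: leq_ltn_trans jj'.
by exists k, pk.
Qed.

End ExtNoetherian.

(** * Local rings and change of rings *)

Section LocalRing.
Variables (S : comNzRingType) (n : {pred S}).
Hypotheses (noethS : noetherian S) (locS : local_ring n).

Lemma idealr_submod (I : {pred S}) : idealr_closed I -> ideal (fun x => x \in I).
Proof. by case=> I0 _ h; split=> // a x y; apply: h. Qed.

Lemma submod_idealr (I : S -> Prop) : ideal I -> ~ I 1 ->
  idealr_closed (fun x => `[< I x >] : bool).
Proof.
move=> hI n1; split=> [||a x y]; rewrite ?unfold_in; first exact/asboolP/(ideal0 hI).
  by apply/negP=> /asboolP.
by move=> /asboolP ux /asboolP uy; apply/asboolP/hI.2.
Qed.

Lemma local_ideal : ideal (fun x => x \in n).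
Proof. by case: locS => -[h _] _; apply: idealr_submod. Qed.

Lemma local_not1 : 1 \notin n.
Proof. by case: locS => -[[]]. Qed.

Lemma ideal_add (I : S -> Prop) a : ideal I ->
  ideal (fun x => exists b c, I b /\ x = b + c * a).
Proof.
move=> hI; split=> [|d x y [b [c [Ib ->]]] [b' [c' [Ib' ->]]]].
  by exists 0, 0; rewrite mul0r addr0; split=> //; apply: ideal0.
exists (d * b + b'), (d * c + c'); split; first exact: hI.2.
by change (d * (b + c * a) + (b' + c' * a) = d * b + b' + (d * c + c') * a); ring.
Qed.

Lemma local_prime : prime (fun x => x \in n).
Proof.
split; [exact: local_ideal|exact/negP/local_not1|move=> a b abn].
have [an|/negP nan] := boolP (a \in n); [by left|right].
have hJ := ideal_add a local_ideal.
have [[b' [c [b'n e]]]|nJ] := pselect (exists b' c, b' \in n /\ 1 = b' + c * a).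
  rewrite -[b]mul1r e mulrDl -mulrA; apply: (idealD local_ideal).
    exact: (idealMr local_ideal).
  exact: (idealM local_ideal).
case: locS => -[_ /(_ _ (submod_idealr hJ nJ)) nmax] _; case: nan.
rewrite -nmax => [|x xn]; rewrite unfold_in.
  apply/asboolP; exists 0, 1; rewrite mul1r add0r; split=> //; exact: (ideal0 local_ideal).
by apply/asboolP; exists x, 0; rewrite mul0r addr0.
Qed.

(** A nonunit lies in an ideal maximal among the proper ones, found by the ascending chain
    condition, and this ideal can only be n. *)
Lemma local_unit x : x \notin n -> exists y, y * x = 1.
Proof.
move=> xn; apply: contrapT => nx.
have hX : ideal (fun y => exists c, y = c * x).
  split=> [|a y z [c ->] [d ->]]; first by exists 0; rewrite mul0r.
  by exists (a * c + d); change (a * (c * x) + d * x = (a * c + d) * x); ring.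
have [|V [hV [nV1 xV] Vmax]] := noeth_max (M := S^o) (P := fun V : S -> Prop => ~ V 1 /\ V x)
    noethS (fg_regular S) hX.
  by split; [case=> c e; apply: nx; exists c|exists 1; rewrite mul1r].
have hV' := submod_idealr hV nV1.
have VM : maximal_ideal (fun x => `[< V x >] : bool).
  split=> // J hJ VJ y; apply/idP/idP => [yJ|]; last exact: VJ.
  rewrite unfold_in; apply/asboolP; apply: (Vmax _ (idealr_submod hJ)) yJ.
    split; first by case: hJ => _ /negP.
    by apply: VJ; rewrite unfold_in; apply/asboolP.
  by move=> z Vz; apply: VJ; rewrite unfold_in; apply/asboolP.
by move: xn; rewrite -(locS.2 _ VM) unfold_in => /asboolP.
Qed.

Lemma local_ext1 (M C : lmodType S) : extU (fun s => ~ (s \in n)) M C -> ext1 M C.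
Proof. by apply: extU_ext1 => s /negP/local_unit. Qed.

Lemma ext_local (C : nat -> lmodType S) (k : lmodType S) (pk : {linear S^o -> k}) j0 :
  injres C -> finitely_generated (C 0%N) ->
  surj pk -> (forall x, pk x = 0 <-> x \in n) ->
  (forall j, (j0 <= j)%N -> ext1 k (C j)) ->
  forall M, finitely_generated M -> forall j, (j0 <= j)%N -> ext1 M (C j).
Proof.
move=> hC fgC pks pkE hk M fgM j hj; apply: local_ext1.
apply: (ext_key noethS local_prime hC fgC pks pkE _ fgM hj) => {}j {}hj.
exact: (extU1 (prime_mulset local_prime) (hk j hj)).
Qed.

End LocalRing.

(** * Dimension shifting and finite injective dimension *)

Section Resolutions.
Variable R : comNzRingType.
Implicit Types M N K L : lmodType R.

Lemma extU_isoN (U : R -> Prop) M (C C' : lmodType R) (f : {linear C -> C'}) (g : {linear C' -> C}) :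
  cancel g f -> extU U M C -> extU U M C'.
Proof.
move=> gf h K L i p s u; have [a ua [v vE]] := h _ _ _ _ s (lcomp g u).
by exists a => //; exists (lcomp f v) => k; rewrite lE vE linZ lE gf.
Qed.

Fixpoint syzn (n : nat) K M : Prop :=
  if n is m.+1 then exists2 L, syz L M & syzn m K L else K = M.

Hypothesis noethR : noetherian R.

Lemma syzn_ex n M : finitely_generated M -> exists2 K, syzn n K M & finitely_generated K.
Proof.
elim: n M => [|n IH] M fgM; first by exists M.
have [L LM] := syz_ex fgM; have [K KL fgK] := IH L (syz_fg noethR LM).
by exists K => //; exists L.
Qed.

Lemma syzn_shift (U : R -> Prop) C n j K M : injres C -> syzn n K M ->
  extU U K (C j) <-> extU U M (C (j + n)%N).
Proof.
move=> hC; elim: n j M => [|n IH] j M /=; first by move=> ->; rewrite addn0.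
by case=> L LM KL; rewrite (IH j L KL) (syz_shift U LM (hC _)) addnS.
Qed.

Lemma syzn_ext1 (C : nat -> lmodType R) n K M : injres C -> syzn n K M ->
  ext1 K (C 0%N) <-> ext1 M (C n).
Proof. by move=> hC KM; rewrite (syzn_shift one_set 0 hC KM) add0n. Qed.

(** Both sides are read as Ext^1 of the j-th syzygy of M with coefficients in the term of index
    0. *)
Lemma injres_indep (U : R -> Prop) (C C' : nat -> lmodType R)
    (f : {linear C 0%N -> C' 0%N}) (g : {linear C' 0%N -> C 0%N}) M j :
  cancel f g -> cancel g f -> injres C -> injres C' -> finitely_generated M ->
  extU U M (C j) <-> extU U M (C' j).
Proof.
move=> fg gf hC hC' fgM; have [K KM _] := syzn_ex j fgM.
have := syzn_shift U 0 hC KM; have := syzn_shift U 0 hC' KM; rewrite !add0n => <- <-.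
by split; apply: extU_isoN; eassumption.
Qed.

Lemma injres_eq (U : R -> Prop) (C C' : nat -> lmodType R) M j :
  C 0%N = C' 0%N -> injres C -> injres C' -> finitely_generated M ->
  extU U M (C j) <-> extU U M (C' j).
Proof.
move=> e hC hC' fgM.
have [f [g [fg gf]]] : exists (f : {linear C 0%N -> C' 0%N}) (g : {linear C' 0%N -> C 0%N}),
    cancel f g /\ cancel g f by rewrite e; exists (lid _), (lid _).
exact: injres_indep fg gf hC hC' fgM.
Qed.

(** Finite injective dimension amounts to the vanishing of Ext(-, R) from some degree on. *)
Lemma gorenstein_ext (C : nat -> lmodType R) : C 0%N = R^o -> injres C ->
  gorenstein_ring R <->
  exists n, forall M, finitely_generated M -> forall j, (n <= j)%N -> ext1 M (C j).
Proof.
move=> C0 hC; split=> [[n [E [eps [d [EI [ei eE] dE En]]]]]|[n hn]].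
  (* The cocycles Z i of the given finite resolution form another [injres], zero far out, whose
     first term is R up to isomorphism. *)
  have /choice[Z /dchoice[z zE]] i : exists Z : lmodType R, exists z : {linear Z -> E i},
      injective z /\ exact_at z (d i) by apply: ker_ex.
  have hZ : injres Z.
    move=> i; have [zi ze] := zE i; have [zi' ze'] := zE i.+1.
    have [|p pE] := fac_inj (f := d i) zi'.
      by move=> x; apply/ze'/(dE i); exists x.
    exists (E i), (z i), p; split=> //; split=> // [y|y].
      rewrite -ze; split=> [e|e]; first by rewrite -pE e linear0.
      by apply: zi'; rewrite pE e linear0.
    have [x xE] := (dE i (z i.+1 y)).1 (ses_comp0 _ ze').
    by exists x; apply: zi'; rewrite pE.
  exists n.+1 => M fgM j nj; have [K KM _] := syzn_ex j fgM.
  rewrite -(syzn_ext1 hC KM) C0.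
  have [z0i z0e] := zE 0%N.
  have [|f fE] := fac_inj (f := z 0%N) ei.
    by move=> x; apply/eE; apply: ses_comp0 z0e.
  have [|g gE] := fac_inj (f := eps) z0i.
    by move=> x; apply/z0e/eE; exists x.
  apply: (@extU_isoN one_set K (Z 0%N) R^o f g).
    by move=> x; apply: ei; rewrite fE gE.
  apply/(syzn_ext1 hZ KM).
  apply: (extU_inj (mulset1 R)); apply: injective0 => x.
  by have [zi _] := zE j; apply: zi; rewrite linear0; apply: (En j).
have [D [D0 hD Dz]] := injres_ex R^o.
have {}hn M : finitely_generated M -> forall j, (n <= j)%N -> ext1 M (D j).
  move=> fgM j nj; apply/(@injres_eq one_set C D M j) => //; first by rewrite C0.
  exact: hn.
(* Baer's test involves the cyclic modules R / I, whose Ext^1 with values in D n vanishes. By the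
   choice made in [cosyz_ex] all later cosyzygies are zero. *)
have DI : injective_module (D n).
  apply: baer_ext => I K i hI ii iE f; have [Q [p [ps ip]]] := coker_ex i.
  have [s -> [g gE]] := hn Q (fg_surj ps (fg_regular R)) n (leqnn n) K R^o i p (And3 ii ip ps) f.
  by exists g => k; rewrite gE scale1r.
have D_0 j : (n < j)%N -> forall x : D j, x = 0.
  elim: j => // j IH; rewrite ltnS leq_eqVlt => /orP[/eqP <-|nj]; apply: Dz => //.
  exact/injective0/IH.
have /choice[E /dchoice[c /dchoice[p cpE]]] i : exists E : lmodType R,
    exists c : {linear D i -> E}, exists p : {linear E -> D i.+1},
    injective_module E /\ short_exact c p by apply: hD.
have [e0 [f0 [e0K f0K]]] : exists (e : {linear R^o -> D 0%N}) (f : {linear D 0%N -> R^o}),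
    cancel e f /\ cancel f e by rewrite D0; exists (lid _), (lid _).
exists n, E, (lcomp (c 0%N) e0), (fun i => lcomp (c i.+1) (p i)).
have ker i x : c i.+1 (p i x) = 0 <-> exists y, c i y = x.
  have [_ [_ cp _]] := cpE i; have [_ [ci _ _]] := cpE i.+1.
  by rewrite -cp; split=> [e|->]; [apply: ci; rewrite linear0|rewrite linear0].
split.
- by move=> i; case: (cpE i).
- have [_ [ci _ _]] := cpE 0%N; split=> [x y|x]; first by rewrite !lE => /ci/(can_inj e0K).
  rewrite lE ker; split=> -[y <-]; last by exists (e0 y); rewrite lE.
  by exists (f0 y); rewrite lE f0K.
- move=> i x; rewrite lE ker; have [_ [_ _ ps]] := cpE i.
  split=> -[y <-]; last by exists (p i y); rewrite lE.
  by have [z zE] := ps y; exists z; rewrite lE zE.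
- move=> i ni x; have [_ [_ cp _]] := cpE i.
  have [y <-] := (cp x).1 (D_0 _ (leqW ni) _).
  by rewrite (D_0 _ ni y) linear0.
Qed.

End Resolutions.

(** * Change of rings along S -> S / (w) *)

Section Restriction.
Variables (S R : comNzRingType).

Definition restr_type (f : {rmorphism S -> R}) (M : lmodType R) : Type := M.

Variable pi : {rmorphism S -> R}.

HB.instance Definition _ (M : lmodType R) := GRing.Zmodule.on (restr_type pi M).
Section RestrLmod.
Variable M : lmodType R.
Definition restr_scale (s : S) (x : restr_type pi M) : restr_type pi M := pi s *: (x : M).
Fact restr_scaleA a b x : restr_scale a (restr_scale b x) = restr_scale (a * b) x.
Proof. by rewrite /restr_scale scalerA rmorphM. Qed.
Fact restr_scale1 : left_id 1 restr_scale.
Proof. by move=> x; rewrite /restr_scale rmorph1 scale1r. Qed.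
Fact restr_scaleDr : right_distributive restr_scale +%R.
Proof. by move=> a x y; rewrite /restr_scale scalerDr. Qed.
Fact restr_scaleDl x : {morph restr_scale^~ x : a b / a + b}.
Proof. by move=> a b; rewrite /restr_scale rmorphD scalerDl. Qed.
HB.instance Definition _ := GRing.Zmodule_isLmodule.Build S (restr_type pi M)
  restr_scaleA restr_scale1 restr_scaleDr restr_scaleDl.
Definition restr : lmodType S := restr_type pi M.
Lemma restrE s (x : M) : s *: (x : restr) = pi s *: x. Proof. by []. Qed.
End RestrLmod.

Lemma restr_linear (M N : lmodType R) (f : {linear M -> N}) :
  linear (f : restr M -> restr N).
Proof. by move=> a x y; rewrite !restrE -linearP. Qed.

Definition rlin (M N : lmodType R) (f : {linear M -> N}) : {linear restr M -> restr N} :=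
  lin (restr_linear f).

Variable w : S.
Hypothesis piP : is_quotient_by pi w.

Lemma piw : pi w = 0.
Proof. by apply/piP.2; exists 1; rewrite mul1r. Qed.

Lemma unrestr_linear (M N : lmodType R) (f : {linear restr M -> restr N}) :
  linear (f : M -> N).
Proof. by move=> a x y; have [s <-] := piP.1 a; rewrite -!restrE -linearP. Qed.

Definition ulin (M N : lmodType R) (f : {linear restr M -> restr N}) : {linear M -> N} :=
  lin (unrestr_linear f).

Lemma restr_kill (M : lmodType R) (x : restr M) : w *: x = 0.
Proof. by rewrite restrE piw scale0r. Qed.

Lemma restr_fg (M : lmodType R) : finitely_generated M -> finitely_generated (restr M).
Proof.
move=> [m [e eE]]; exists m, e => x; have [c ->] := eE x.
have [b bE] := choice (fun i => piP.1 (c i)); exists b.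
by apply: eq_bigr => i _; rewrite restrE bE.
Qed.

Section Descent.
Variables (N : lmodType S) (killed : forall x : N, w *: x = 0).
Definition desc_type : Type := let _ := killed in N.
HB.instance Definition _ := GRing.Zmodule.copy desc_type N.
Definition desc_scale (r : R) (x : desc_type) : desc_type := pi_lift piP r *: (x : N).
Lemma desc_scaleE s x : desc_scale (pi s) x = s *: (x : N).
Proof.
have [t tE] : exists t, pi_lift piP (pi s) - s = t * w.
  by apply/piP.2; rewrite rmorphB /= pi_liftK subrr.
by apply/eqP; rewrite -subr_eq0 /desc_scale -scalerBl tE -scalerA killed scaler0.
Qed.
Fact desc_scaleA a b x : desc_scale a (desc_scale b x) = desc_scale (a * b) x.
Proof.
by rewrite -(pi_liftK piP a) -(pi_liftK piP b) -rmorphM !desc_scaleE scalerA.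
Qed.
Fact desc_scale1 : left_id 1 desc_scale.
Proof. by move=> x; rewrite -(rmorph1 pi) desc_scaleE scale1r. Qed.
Fact desc_scaleDr : right_distributive desc_scale +%R.
Proof. by move=> a x y; rewrite /desc_scale scalerDr. Qed.
Fact desc_scaleDl x : {morph desc_scale^~ x : a b / a + b}.
Proof.
move=> a b; rewrite -(pi_liftK piP a) -(pi_liftK piP b) -rmorphD !desc_scaleE.
by rewrite scalerDl.
Qed.
HB.instance Definition _ := GRing.Zmodule_isLmodule.Build R desc_type
  desc_scaleA desc_scale1 desc_scaleDr desc_scaleDl.
End Descent.

Lemma desc_ex (N : lmodType S) : (forall x : N, w *: x = 0) ->
  exists (N' : lmodType R) (i : {linear restr N' -> N}), injective i /\ surj i.
Proof.
move=> k; exists (desc_type k : lmodType R).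
have L : linear ((fun x => x) : restr (desc_type k : lmodType R) -> N).
  by move=> a x y; rewrite restrE [pi a *: x]desc_scaleE.
by exists (lin L); split=> [x y //|y]; exists y.
Qed.

(** T is Hom_S(R, N), the value of the right adjoint of restriction, realized as the w-torsion of N;
    hence it preserves injectives. *)
Lemma tors_ex (N : lmodType S) : exists (T : lmodType R) (i : {linear restr T -> N}),
  injective i /\ forall x, w *: x = 0 <-> exists t, i t = x.
Proof.
have [K [i [ii iE]]] := sub_ex (submod_ker (lscale w (lid N))).
have [|T [j [ji js]]] := desc_ex (N := K).
  by move=> x; apply: ii; rewrite linZ linear0; apply/iE; exists x.
exists T, (lcomp i j); split=> [x y|x]; first by rewrite !lE => /ii/ji.
rewrite -[_ *: x]/(lscale w (lid N) x) iE; split=> [[k <-]|[t <-]]; last by exists (j t).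
by have [t <-] := js k; exists t.
Qed.

Lemma fac_tors (N : lmodType S) (T M : lmodType R) (i : {linear restr T -> N})
    (f : {linear restr M -> N}) :
  injective i -> (forall x, w *: x = 0 <-> exists t, i t = x) ->
  exists g : {linear M -> T}, forall x, i (g x) = f x.
Proof.
move=> ii iE; have [|g gE] := fac_inj (f := f) ii.
  by move=> x; apply/iE; rewrite -linZ restr_kill linear0.
by exists (ulin g) => x; rewrite -gE.
Qed.

Lemma tors_injective (E : lmodType S) (T : lmodType R) (i : {linear restr T -> E}) :
  injective i -> (forall x, w *: x = 0 <-> exists t, i t = x) ->
  injective_module E -> injective_module T.
Proof.
move=> ii iE EI M N j f ji.
have [|g gE] := EI _ _ (rlin j) (lcomp i (rlin f)); first by move=> x y /ji.
have [g' g'E] := fac_tors g ii iE; exists g' => x; apply: ii.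
by rewrite g'E -[j x]/(rlin j x) gE.
Qed.

Hypothesis w_regular : GRing.lreg w.

Lemma injective_div (E : lmodType S) : injective_module E ->
  forall x : E, exists y, w *: y = x.
Proof.
move=> EI x; have L : linear (fun a : S^o => w * a : S^o).
  by move=> a b c; rewrite mulrDr mulrCA.
have L' : linear (fun a : S^o => (a : S) *: x).
  by move=> a b c; rewrite scalerDl scalerA.
have [|g gE] := EI _ _ (lin L) (lin L'); first by move=> a b /w_regular.
exists (g 1); rewrite -linZ; have := gE 1.
by rewrite !linE scale1r.
Qed.

Section Rees.
Variables (C : nat -> lmodType S) (hC : injres C).

Lemma injres_div j (x : C j.+1) : exists y, w *: y = x.
Proof.
have [E [c [p [EI [_ _ ps]]]]] := hC j.
have [e <-] := ps x; have [y <-] := injective_div EI e.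
by exists (p y); rewrite -linZ.
Qed.

Variables (T : nat -> lmodType R) (t : forall j, {linear restr (T j) -> C j}).
Hypotheses (ti : forall j, injective (t j))
  (tE : forall j x, w *: x = 0 <-> exists y, t j y = x).

(** Taking w-torsion stays exact from index 1 on because C j.+1, a quotient of an injective module
    over a ring where w is regular, is w-divisible. *)
Lemma tors_ses j (E : lmodType S) (c : {linear C j.+1 -> E}) (p : {linear E -> C j.+2}) :
  injective_module E -> short_exact c p ->
  exists (E' : lmodType R) (e : {linear restr E' -> E})
    (c' : {linear T j.+1 -> E'}) (p' : {linear E' -> T j.+2}),
  [/\ injective_module E', short_exact c' p', injective e,
     forall x, w *: x = 0 <-> exists y, e y = x &
     (forall x, e (c' x) = c (t _ x)) /\ forall x, t _ (p' x) = p (e x)].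
Proof.
move=> EI [ci cp ps]; have [E' [e [ei eE]]] := tors_ex E.
have [c' c'E] := fac_tors (lcomp c (t j.+1)) ei eE.
have [p' p'E] := fac_tors (lcomp p e) (ti (j := j.+2)) (tE (j := j.+2)).
exists E', e, c', p'; split=> //; first exact: tors_injective ei eE EI.
split.
- move=> x y xy; apply/ti/ci; have := congr1 e xy.
  by rewrite !c'E.
- move=> y; split=> [y0|[x <-]].
    have [x xE] : exists x, c x = e y.
      by apply/cp; rewrite -[RHS](linear0 (t j.+2)) -y0 p'E.
    have [x' x'E] : exists x', t j.+1 x' = x.
      apply/tE/ci; rewrite linZ xE linear0; apply/eE; by exists y.
    by exists x'; apply: ei; rewrite c'E lE x'E.
  by apply/(ti (j := j.+2)); rewrite p'E lE c'E lE (ses_comp0 _ cp) linear0.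
- move=> z; have [u uE] := ps (t j.+2 z).
  have [v vE] : exists v, c v = w *: u.
    by apply/cp; rewrite linZ uE; apply/tE; exists z.
  have [v' v'E] := injres_div v.
  have [y yE] : exists y, e y = u - c v'.
    by apply/eE; rewrite scalerBr -linZ v'E vE subrr.
  exists y; apply: (ti (j := j.+2)).
  by rewrite p'E lE yE linearB (ses_comp0 _ cp) subr0.
Qed.

Lemma tors_injres : injres (fun j => T j.+1).
Proof.
move=> j; have [E [c [p [EI cp]]]] := hC j.+1.
have [E' [e [c' [p' [E'I cp' _ _ _]]]]] := tors_ses EI cp.
by exists E', c', p'.
Qed.

Lemma tors_ext (M : lmodType R) j :
  ext1 M (T j.+1) <-> ext1 (restr M) (C j.+1).
Proof.
have [E [c [p [EI cp]]]] := hC j.+1.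
have [E' [e [c' [p' [E'I cp' ei eE [_ p'E]]]]]] := tors_ses EI cp.
rewrite (extU_lift one_set M E'I cp').
rewrite (extU_lift one_set (restr M) EI cp).
split=> h f.
  have [g gE] := fac_tors f (ti (j := j.+2)) (tE (j := j.+2)).
  have [s -> [l lE']] := h g; exists 1 => //; exists (lcomp e (rlin l)) => x.
  rewrite lE -p'E scale1r -gE; congr (t _ _).
  by rewrite [rlin l x]/(l x) lE' scale1r.
have [s -> [l lE']] := h (lcomp (t j.+2) (rlin f)).
have [g gE] := fac_tors l ei eE; exists 1 => //; exists g => x.
by apply: (ti (j := j.+2)); rewrite p'E gE lE' !scale1r lE.
Qed.

End Rees.

(* Ext_R^(i+1)(M, R) = Ext_S^(i+2)(M, S): the torsion of an injective resolution
   of S resolves R + E_0[w] after the first step. *)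
Lemma rees (C : nat -> lmodType S) (D : nat -> lmodType R) (M : lmodType R) j :
  noetherian R -> injres C -> C 0%N = S^o -> injres D -> D 0%N = R^o -> finitely_generated M ->
  ext1 M (D j) <-> ext1 (restr M) (C j.+1).
Proof.
move=> noethR hC C0 hD D0 fgM.
have [T /dchoice[t tP]] := choice (fun j => tors_ex (C j)).
have ti i : injective (t i) by case: (tP i).
have tE i x : w *: x = 0 <-> exists y, t i y = x by case: (tP i).
rewrite -(tors_ext hC ti tE) => {tP}.
have [K KM _] := syzn_ex noethR j fgM.
rewrite -(syzn_ext1 hD KM) -(syzn_ext1 (tors_injres hC ti tE) KM) D0.
have [E [c [p [EI [ci cp ps]]]]] := hC 0%N.
have wC (x : C 0%N) : w *: x = 0 -> x = 0.
  move: x; rewrite C0 => x /= e; apply: w_regular; rewrite mulr0; exact: e.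
have [sg [gs [sgK gsK]]] : exists (f : {linear S^o -> C 0%N}) (g : {linear C 0%N -> S^o}),
    cancel f g /\ cancel g f by rewrite C0; exists (lid _), (lid _).
have [E' [e [ei eE]]] := tors_ex E.
have E'I := tors_injective ei eE EI.
have [p' p'E] := fac_tors (lcomp p e) (ti 1%N) (tE 1%N).
(* The kernel of p is C 0 = S, on which w is regular, so it contains no torsion of E. *)
have p'i : injective p'.
  apply: inj0 => x px; apply: ei; rewrite linear0.
  have [a aE] : exists a, c a = e x by apply/cp; rewrite -[RHS](linear0 (t 1%N)) -px p'E.
  rewrite -aE; suff -> : a = 0 by rewrite linear0.
  by apply: wC; apply: ci; rewrite linear0 linZ aE; apply/eE; exists x.
have [r rE] := E'I _ _ p' (lid _) p'i.
(* delta (p e) = pi a where w e = c a *)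
have ex (x : T 1%N) : exists y : R, exists (u : E) (a : S),
    [/\ p u = t 1%N x, w *: u = c (sg a) & y = pi a].
  have [u uE] := ps (t 1%N x).
  have [a aE] : exists a, c a = w *: u by apply/cp; rewrite linZ uE; apply/tE; exists x.
  by exists (pi (gs a)), u, (gs a); rewrite gsK.
have [dl dlE] := choice ex.
have uniq (x : T 1%N) (u : E) (a : S) : p u = t 1%N x -> w *: u = c (sg a) -> dl x = pi a.
  move=> pu wu; have [u' [a' [pu' wu' ->]]] := dlE x.
  have [b bE] : exists b, c b = u' - u by apply/cp; rewrite linearB pu pu' subrr.
  apply/eqP; rewrite -subr_eq0 -rmorphB; apply/eqP; apply/piP.2; exists (gs b).
  rewrite mulrC; apply: (can_inj sgK); apply: ci.
  rewrite linearB linearB -wu -wu' -scalerBr -bE -linZ.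
  by congr (c _); rewrite -[w * _]/(w *: (gs b : S^o)) linZ gsK.
have dL : linear (dl : T 1%N -> R^o).
  move=> a x y; have [s <-] := piP.1 a.
  have [u [b [pu wu ->]]] := dlE x; have [u' [b' [pu' wu' ->]]] := dlE y.
  rewrite -[RHS]/(pi s * pi b + pi b') -rmorphM -rmorphD; apply: (uniq _ (s *: u + u')).
    by rewrite linearP pu pu' -[pi s *: x]/(s *: (x : restr (T 1%N))) linearP.
  rewrite scalerDr scalerA [w * s]mulrC -scalerA wu wu'.
  by rewrite -[s * b]/(s *: (b : S^o)) linearP linearP.
have ds : surj (lin dL).
  move=> y; have [a <-] := piP.1 y.
  have [u uE] := injective_div EI (c (sg a)).
  have [x xE] : exists x, t 1%N x = p u.
    by apply/tE; rewrite -linZ uE (ses_comp0 _ cp).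
  by exists x; rewrite linE; apply: (uniq _ u).
have R1P : projective_module (R^o : lmodType R).
  move=> A B q f qs; have [a aE] := qs (f 1).
  have L : linear (fun x : R^o => (x : R) *: a) by move=> b x y; rewrite scalerDl scalerA.
  exists (lin L) => x; rewrite linE linZ aE -linZ; congr (f _).
  by rewrite /GRing.scale /= mulr1.
(* [dl] is the snake map from the torsion of C 1 onto S / w S = R, with kernel the image of p'. As R
   is projective and E' injective, T 1 is the sum of R and E', and E' contributes nothing to Ext. *)
have [s sE] := proj_section R1P ds.
have dp x : lin dL (p' x) = 0.
  rewrite linE -[RHS](rmorph0 pi); apply: (uniq _ (e x)); first exact/esym/p'E.
  by rewrite linear0 linear0; apply/eE; exists x.
have kerd x : lin dL x = 0 -> exists y, p' y = x.
  rewrite linE; have [u [a [pu wu ->]]] := dlE x => /piP.2[b bE].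
  have [y yE] : exists y, e y = u - c (sg b).
    apply/eE; rewrite scalerBr wu bE mulrC -linZ -linZ.
    by rewrite -[w * b]/(w *: (b : S^o)) subrr.
  exists y; apply: (ti 1%N); rewrite p'E lE yE linearB (ses_comp0 _ cp) subr0 pu //.
split=> h.
  move=> K' L i q iq f.
  have [a -> [g gE]] := h _ _ _ _ iq (lcomp (lin dL) f).
  have [ii _ _] := iq.
  have [g' g'E] := E'I _ _ i (lcomp r (lsub f (lcomp s (lcomp (lin dL) f)))) ii.
  exists 1 => //.
  exists (ladd (lcomp s g) (lcomp p' g')) => k.
  rewrite !lE gE !scale1r g'E !lE.
  have [|y yE] := kerd (f k - s (lin dL (f k))); first by rewrite linearB sE subrr.
  by rewrite -yE rE lE yE addrC subrK.
move=> K' L i q iq f.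
have [a -> [g gE]] := h _ _ _ _ iq (lcomp s f).
exists 1 => //; exists (lcomp (lin dL) g) => k.
by rewrite lE gE !scale1r lE sE.
Qed.

End Restriction.

(** * Gorenstein projective modules *)

Lemma int_pred (i : int) : exists j : int, i = j + 1.
Proof. by exists (i - 1); rewrite subrK. Qed.

Section IntSequence.
Variables (T : Type) (rel : T -> T -> Prop).

Lemma int_seq (x0 x1 : T) : rel x0 x1 ->
  (forall x, exists y, rel x y) -> (forall y, exists x, rel x y) ->
  exists s : int -> T, [/\ s 0 = x0, s 1 = x1 & forall i, rel (s i) (s (i + 1))].
Proof.
move=> x01 /choice[next nextE] /choice[prev prevE].
exists (fun i => match i with Posz 0 => x0 | Posz n.+1 => iter n next x1
                 | Negz n => iter n.+1 prev x0 end); split=> // -[[|n]|[|n]] //.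
- by have -> : Posz n.+1 + 1 = Posz n.+2 by lia.
- have -> : Negz n.+1 + 1 = Negz n by lia.
  exact: prevE.
Qed.

End IntSequence.

Section GorensteinClass.
Variable R : comNzRingType.

(* [M] is a syzygy of a totally acyclic complex, presented as a quotient. *)
Definition complete_res (M : lmodType R) (P : int -> fgmod R)
    (d : forall i, {linear P i -> P (i + 1)}) (p : {linear P 0 -> M}) : Prop :=
  [/\ forall i, projective_module (P i),
      forall i, exact_at (d i) (d (i + 1)),
      forall (Q : fgmod R) (i : int) (phi : {linear P (i + 1) -> Q}),
        projective_module Q -> (forall x, phi (d i x) = 0) ->
        exists psi : {linear P (i + 1 + 1) -> Q},
          forall x, psi (d (i + 1) x) = phi x
    & surj p /\ forall x, p x = 0 <-> d 0 x = 0].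

Definition ses_proj (M N : fgmod R) : Prop := exists (P : fgmod R)
  (i : {linear M -> P}) (p : {linear P -> N}), projective_module P /\ short_exact i p.

(** Closure conditions which force the members to be Gorenstein projective. They are verified below
    for Gorenstein projectives, for projectives, for modules orthogonal to a Gorenstein ring, and
    for the cokernels in question. *)
Definition gclass (G : fgmod R -> Prop) : Prop :=
  [/\ forall M, G M -> exists2 N, G N & ses_proj M N,
      forall M, G M -> exists2 N, G N & ses_proj N M
    & forall M (Q : fgmod R), G M -> projective_module Q -> ext1 M Q].

(** Splicing the short exact sequences in both directions gives an exact complex of projectives;
    Ext^1(G, Q) = 0 keeps it exact under Hom(-, Q). M is placed at index 0 to be a submodule of P 0,
    and at index 1 to be a quotient of it. *)
Lemma gclass_gorenstein (G : fgmod R -> Prop) (M : fgmod R) : gclass G -> G M ->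
  gorenstein_projective M /\
  exists P d p, @complete_res M P d p.
Proof.
case=> hn hp he GM; pose T := {M | G M}.
pose rel (x y : T) := ses_proj (sval x) (sval y).
have next (x : T) : exists y : T, rel x y.
  by case: x => x Gx; have [y Gy xy] := hn x Gx; exists (exist _ y Gy).
have prev (y : T) : exists x : T, rel x y.
  by case: y => y Gy; have [x Gx xy] := hp y Gy; exists (exist _ x Gx).
have main (s : int -> T) : (forall i, rel (s i) (s (i + 1))) ->
    exists (P : int -> fgmod R) (d : forall i, {linear P i -> P (i + 1)}),
    [/\ forall i, projective_module (P i), forall i, exact_at (d i) (d (i + 1)),
      forall (Q : fgmod R) (i : int) (phi : {linear P (i + 1) -> Q}),
        projective_module Q -> (forall x, phi (d i x) = 0) ->
        exists psi : {linear P (i + 1 + 1) -> Q}, forall x, psi (d (i + 1) x) = phi x,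
      exists e : {linear sval (s 0) -> P 0}, injective e /\ exact_at e (d 0)
    & exists p : {linear P 0 -> sval (s 1)}, surj p /\ forall x, p x = 0 <-> d 0 x = 0].
  move=> /choice[P /dchoice[c /dchoice[p cpP]]].
  have ci i : injective (c i) by case: (cpP i) => _ [].
  have cp i : exact_at (c i) (p i) by case: (cpP i) => _ [].
  have ps i : surj (p i) by case: (cpP i) => _ [].
  have d0 i x : c (i + 1) (p i x) = 0 <-> p i x = 0.
    by split=> [e|->]; [apply: ci; rewrite linear0|rewrite linear0].
  exists P, (fun i => lcomp (c (i + 1)) (p i)); split.
  - by move=> i; case: (cpP i).
  - move=> i y; rewrite lE d0 cp; split=> -[x <-]; last by exists (p i x); rewrite lE.
    by have [z <-] := ps i x; exists z; rewrite lE.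
  - move=> Q i phi hQ phi0.
    have [|f fE] := fac_surj (f := phi) (ps (i + 1)).
      move=> x /cp[m <-]; have [z <-] := ps i m.
      by rewrite -(phi0 z) lE.
    have [_ ses] := cpP (i + 1 + 1).
    have [a -> [g gE]] := he _ Q (svalP (s (i + 1 + 1 + 1))) hQ _ _ _ _ ses f.
    by exists g => x; rewrite lE gE scale1r fE.
  - exists (c 0); split=> // y; rewrite lE d0; exact: cp.
  - by exists (p 0); split=> [|x]; [apply: ps|rewrite lE d0].
pose x0 : T := exist _ M GM.
split.
  have [x1 x01] := next x0; have [s [s0 _ srel]] := int_seq x01 next prev.
  by have [P [d [h1 h2 h3 h4 _]]] := main s srel; rewrite s0 in h4; exists P, d.
have [x1 x10] := prev x0; have [s [_ s1 srel]] := int_seq x10 next prev.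
have [P [d [h1 h2 h3 _ [p hp']]]] := main s srel.
move: p hp'; rewrite s1 => p hp'.
by exists P, d, p; split.
Qed.

(** Syzygies in an arbitrary degree i. Shifting a complex so that i becomes 0 would need transports;
    the round trip through [gclass_gorenstein] rebuilds the complex with the right index. *)
Definition gsyz (M : fgmod R) : Prop :=
  exists (P : int -> fgmod R) (d : forall i, {linear P i -> P (i + 1)}) (i : int),
    [/\ forall i, projective_module (P i),
        forall i, exact_at (d i) (d (i + 1)),
        forall (Q : fgmod R) (i : int) (phi : {linear P (i + 1) -> Q}),
          projective_module Q -> (forall x, phi (d i x) = 0) ->
          exists psi : {linear P (i + 1 + 1) -> Q},
            forall x, psi (d (i + 1) x) = phi x
      & exists e : {linear M -> P i}, injective e /\ exact_at e (d i)].

Lemma gsyz_gclass : gclass gsyz.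
Proof.
have cyc (P : int -> fgmod R) (d : forall i, {linear P i -> P (i + 1)}) i :
    exact_at (d i) (d (i + 1)) -> exists (N : fgmod R) (e : {linear N -> P (i + 1)})
    (p : {linear P i -> N}), [/\ injective e, exact_at e (d (i + 1)), surj p
       & forall x, e (p x) = d i x].
  move=> dE; have [N [e [ei eE]]] := ker_ex (d (i + 1)).
  have [|p pE] := fac_inj (f := d i) ei.
    by move=> x; apply/eE/dE; exists x.
  have ps : surj p.
    move=> y; have [x xE] := (dE (e y)).1 (ses_comp0 _ eE).
    by exists x; apply: ei; rewrite pE.
  by exists (FgMod (fg_surj ps (fg_prop (P i)))), e, p.
split.
- move=> M [P [d [i [hP dE dQ [e [ei eE]]]]]].
  have [N [e' [p [e'i e'E ps pE]]]] := cyc P d i (dE i).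
  exists N; first by exists P, d, (i + 1); split=> //; exists e'.
  exists (P i), e, p; split=> //; split=> // y; rewrite -eE -pE.
  by split=> [->|h]; [rewrite linear0|apply: e'i; rewrite h linear0].
- move=> M [P [d [i [hP dE dQ [e [ei eE]]]]]].
  have [j ij] := int_pred i; have [k jk] := int_pred j; subst i; subst j.
  have [N [e' [p [e'i e'E ps pE]]]] := cyc P d k (dE k).
  exists N; first by exists P, d, (k + 1); split=> //; exists e'.
  have [|q qE] := fac_inj (f := d (k + 1)) ei.
    by move=> x; apply/eE/dE; exists x.
  exists (P (k + 1)), e', q; split=> //; split=> // [y|y].
    rewrite -e'E -qE.
    by split=> [->|h]; [rewrite linear0|apply: ei; rewrite h linear0].
  have [x xE] := (dE _ (e y)).1 (ses_comp0 _ eE).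
  by exists x; apply: ei; rewrite qE.
move=> M Q [P [d [i [hP dE dQ [e [ei eE]]]]]] hQ.
have [j ij] := int_pred i; have [k jk] := int_pred j; have [l kl] := int_pred k.
subst i; subst j; subst k.
have [N [e' [p [e'i e'E ps pE]]]] := cyc P d (l + 1) (dE (l + 1)).
have [|q qE] := fac_inj (f := d (l + 1 + 1)) ei.
  by move=> x; apply/eE/dE; exists x.
have ses : short_exact e' q.
  split=> // [y|y].
    rewrite -e'E -qE.
    by split=> [->|h]; [rewrite linear0|apply: ei; rewrite h linear0].
  have [x xE] := (dE _ (e y)).1 (ses_comp0 _ eE).
  by exists x; apply: ei; rewrite qE.
apply/(extU_pres one_set Q (hP _) ses) => f; exists 1 => //.
have [|g gE] := dQ Q l (lcomp f p) hQ.
  move=> x; rewrite lE; suff -> : p (d l x) = 0 by rewrite linear0.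
  by apply: e'i; rewrite pE linear0; apply/dE; exists x.
exists g => x; have [y <-] := ps x.
by rewrite pE gE lE scale1r.
Qed.

Lemma gorenstein_gclass : gclass (fun M : fgmod R => gorenstein_projective M).
Proof.
have [h1 h2 h3] := gsyz_gclass.
have to (M : fgmod R) : gorenstein_projective M -> gsyz M.
  by case=> P [d [? ? ? ?]]; exists P, d, 0; split.
have from (M : fgmod R) : gsyz M -> gorenstein_projective M.
  by move=> GM; have [] := gclass_gorenstein gsyz_gclass GM.
split=> [M /to/h1[N GN ?]|M /to/h2[N GN ?]|M Q /to]; last exact: h3.
  by exists N => //; apply: from.
by exists N => //; apply: from.
Qed.

End GorensteinClass.

(** * Modules with vanishing Ext(-, R) over a Gorenstein ring *)

Section Orthogonal.
Variable R : comNzRingType.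
Hypothesis noethR : noetherian R.

Lemma proj_regular : projective_module R^o.
Proof.
move=> A B q f qs; have [a aE] := qs (f 1).
have L : linear (fun x : R^o => (x : R) *: a) by move=> b x y; rewrite scalerDl scalerA.
exists (lin L) => x; rewrite linE linZ aE -linZ; congr (f _).
by rewrite /GRing.scale /= mulr1.
Qed.

Lemma trmx_linear m n : linear (@trmx R m n).
Proof. by move=> a x y; rewrite linearP. Qed.

Lemma proj_col n : projective_module 'cV[R]_n.
Proof.
apply: (proj_retract (i := lin (@trmx_linear n 1)) (r := lin (@trmx_linear 1 n))).
  by move=> x; rewrite !linE trmxK.
exact: proj_row.
Qed.

Lemma fg_col n : finitely_generated 'cV[R]_n.
Proof.
apply: (fg_row_surj (p := lin (@trmx_linear 1 n))) => y.
by exists y^T; rewrite linE trmxK.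
Qed.

Lemma row_form n (f : {linear 'rV[R]_n -> R^o}) :
  exists y : 'cV[R]_n, forall x, f x = (x *m y) 0 0.
Proof.
exists (\col_i f (delta_mx 0 i)) => x; rewrite mxE {1}[x]row_sum_delta linear_sum.
by apply: eq_bigr => i _; rewrite linZ mxE.
Qed.

Lemma col_form n (f : {linear 'cV[R]_n -> R^o}) :
  exists x : 'rV[R]_n, forall y, f y = (x *m y) 0 0.
Proof.
have [y yE] := row_form (lcomp f (lin (@trmx_linear 1 n))).
exists y^T => x; have := yE x^T; rewrite lE linE trmxK => ->.
by rewrite -[in RHS](trmxK x) -trmx_mul [RHS]mxE.
Qed.

Lemma form_linear n (y : 'cV[R]_n) : linear (fun x : 'rV[R]_n => (x *m y) 0 0 : R^o).
Proof. by move=> a u v; rewrite mulmxDl -scalemxAl !mxE. Qed.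

Lemma coform_linear n (x : 'rV[R]_n) : linear (fun y : 'cV[R]_n => (x *m y) 0 0 : R^o).
Proof. by move=> a u v; rewrite mulmxDr -scalemxAr !mxE. Qed.

Lemma mulr_linear m n (A : 'M[R]_(m, n)) : linear (fun x : 'rV[R]_m => x *m A).
Proof. by move=> a x y; rewrite mulmxDl -scalemxAl. Qed.

Lemma mull_linear m n (A : 'M[R]_(m, n)) : linear (fun y : 'cV[R]_n => A *m y).
Proof. by move=> a x y; rewrite mulmxDr -scalemxAr. Qed.

Definition rmul m n (A : 'M[R]_(m, n)) := lin (mulr_linear A).
Definition lmul m n (A : 'M[R]_(m, n)) := lin (mull_linear A).

Lemma row_mx_of m n (f : {linear 'rV[R]_m -> 'rV[R]_n}) :
  exists A : 'M[R]_(m, n), forall x, f x = x *m A.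
Proof.
exists (\matrix_i f (delta_mx 0 i)).
apply: (@row_ext _ _ _ f (rmul _)) => i.
by rewrite linE -rowE rowK.
Qed.

Lemma presentation (M : lmodType R) : finitely_generated M ->
  exists m n (A : 'M[R]_(m, n)) (p : {linear 'rV[R]_n -> M}),
    surj p /\ exact_at (rmul A) p.
Proof.
move=> /fg_cover[n [p ps]]; have [m [f fE]] := fgsub_row (noeth_row noethR (submod_ker p)).
have [A AE] := row_mx_of f; exists m, n, A, p; split=> // x.
by rewrite fE; split=> -[y <-]; exists y; rewrite linE AE.
Qed.

Variable D : nat -> lmodType R.
Hypotheses (D0 : D 0%N = R^o) (hD : injres D).

Definition orth (M : lmodType R) : Prop := forall j, ext1 M (D j).

Lemma orth_regular (M : lmodType R) : orth M -> ext1 M R^o.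
Proof. by move=> h; rewrite -D0; apply: h. Qed.

Lemma proj_orth (P : lmodType R) : projective_module P -> orth P.
Proof. by move=> hP j; apply: (extU_proj (mulset1 R)). Qed.

Lemma syz_orth (K F M : lmodType R) (i : {linear K -> F}) (p : {linear F -> M}) :
  projective_module F -> short_exact i p -> orth M -> orth K.
Proof.
move=> FP ip hM j.
exact (extU_left (mulset1 R) ip (hD j) (@proj_orth _ FP j) (hM j.+1)).
Qed.

Lemma ext1_row (M : lmodType R) n : ext1 M R^o -> ext1 M 'rV[R]_n.
Proof.
move=> h K L i p ip f; exists 1 => //.
have L1 j : linear (fun x : K => (f x) 0 j : R^o).
  by move=> a x y; rewrite linearP !mxE.
have /dchoice[g gE] j : exists g : {linear L -> R^o}, forall k, g (i k) = f k 0 j.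
  have [a -> [g gE]] := h _ _ _ _ ip (lin (L1 j)).
  by exists g => k; rewrite gE scale1r.
have L2 : linear (fun y : L => \row_j g j y).
  by move=> a x y; apply/rowP=> j; rewrite !mxE linearP.
by exists (lin L2) => k; apply/rowP=> j; rewrite linE scale1r mxE gE.
Qed.

Lemma ext1_proj (M : lmodType R) (Q : fgmod R) : projective_module Q ->
  ext1 M R^o -> ext1 M Q.
Proof.
move=> hQ h; have [n [p ps]] := fg_cover (fg_prop Q).
have [s sE] := proj_section hQ ps.
exact (extU_isoN (f := p) (g := s) sE (@ext1_row _ n h)).
Qed.

Section Torsionless.
Variable n0 : nat.
Hypothesis gor : forall M : lmodType R, finitely_generated M ->
  forall j, (n0 <= j)%N -> ext1 M (D j).

(* The transpose of M, the cokernel of the dual of a presentation of M, is an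
   arbitrarily high syzygy. *)
Lemma transpose_ext j m n (A : 'M[R]_(m, n)) (M T : lmodType R)
    (p : {linear 'rV[R]_n -> M}) (t : {linear 'cV[R]_m -> T}) :
  surj p -> exact_at (rmul A) p -> surj t -> exact_at (lmul A) t -> orth M ->
  ext1 T (D j).
Proof.
(* Descending induction on j: the transpose of the syzygy N of M is needed one degree higher, and
   from n0 on [gor] applies. *)
have [k] := ubnP (n0 - j); elim: k j m n A M T p t => // k IH j m n A M T p t.
rewrite ltnS => jk ps pA ts tA hM.
have fgT := fg_surj ts (fg_col m).
have [nj|jn] := leqP n0 j; first exact: gor.
have [N [i [ii ip]]] := ker_ex p.
have [|a aE] := fac_inj (f := rmul A) ii.
  by move=> x; apply/ip/pA; exists x.
have as_ : surj a.
  move=> y; have [x xE] := (pA (i y)).1 (ses_comp0 _ ip).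
  by exists x; apply: ii; rewrite aE.
have [m2 [f fE]] := fgsub_row (noeth_row noethR (submod_ker a)).
have [A2 A2E] := row_mx_of f.
have a2 : exact_at (rmul A2) a.
  by move=> x; rewrite fE; split=> -[y <-]; exists y; rewrite linE A2E.
have A2A : A2 *m A = 0.
  apply/row_matrixP=> l; rewrite row0 rowE mulmxA -[_ *m A]/(rmul A _) -aE.
  suff -> : a (delta_mx 0 l *m A2) = 0 by rewrite linear0.
  by apply/a2; exists (delta_mx 0 l); rewrite linE.
have hN := syz_orth (@proj_row R n) (And3 ii ip ps) hM.
have [T2 [t2 [t2s t2E]]] := coker_ex (lmul A2).
have hT2 : ext1 T2 (D j.+1).
  by apply: (IH j.+1 m2 m A2 N T2 a t2) => //; lia.
(* The dual of the presentation stays exact: a column y killed by A2 is a form on N, and Ext^1(M, R)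
   = 0 extends it to the free cover of M. *)
have exA (y : 'cV[R]_m) : A2 *m y = 0 -> exists z, A *m z = y.
  move=> A2y.
  have [|u uE] := fac_surj (f := lin (form_linear y)) as_.
    move=> x /a2[z <-]; rewrite !linE -mulmxA A2y mulmx0; by rewrite mxE.
  have [s -> [g gE]] := orth_regular hM (And3 ii ip ps) u.
  have [z zE] := row_form g; exists z; apply/row_matrixP=> l.
  have := zE (rmul A (delta_mx 0 l)); rewrite -aE gE scale1r uE aE !linE.
  by rewrite !rowE !mulmxA => e; apply/matrixP=> b c; rewrite !ord1 -e.
have [|h hE] := fac_surj (f := lmul A2) ts.
  by move=> y /tA[z <-]; rewrite !linE mulmxA A2A mul0mx.
(* Hence T embeds in a free module with cokernel T2, the transpose of N. *)
have hi : injective h.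
  apply: inj0 => x; have [y <-] := ts x; rewrite hE linE => /exA[z zy].
  by apply/tA; exists z; rewrite linE.
have ht2 : exact_at h t2.
  move=> y; rewrite t2E; split=> -[z <-]; first by exists (t z); rewrite hE.
  by have [x <-] := ts z; exists x; rewrite hE.
exact (extU_left (mulset1 R) (And3 hi ht2 t2s) (hD j) (@proj_orth _ (@proj_col m2) j) hT2).
Qed.

(** Auslander: the kernel of M -> double dual is Ext^1 of the transpose T. If no form detects a = p
    x, then pairing with x is a well-defined form on the image of A; Ext^1(T, R) = 0 extends it to
    all columns, which writes x as y A, so a = 0. *)
Lemma torsionless (M : lmodType R) (a : M) : finitely_generated M -> orth M ->
  (forall f : {linear M -> R^o}, f a = 0) -> a = 0.
Proof.
move=> fgM hM fa; have [m [n [A [p [ps pA]]]]] := presentation fgM.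
have [T [t [ts tE]]] := coker_ex (lmul A).
have hT : ext1 T R^o by rewrite -D0; apply: transpose_ext ps pA ts tE hM.
have [x xE] := ps a.
have [I [i [ii it]]] := ker_ex t.
have [|b bE] := fac_inj (f := lmul A) ii.
  by move=> z; apply/it/tE; exists z.
have bs : surj b.
  move=> y; have [z zE] := (tE (i y)).1 (ses_comp0 _ it).
  by exists z; apply: ii; rewrite bE.
have [|u uE] := fac_surj (f := lin (coform_linear x)) bs.
  move=> z bz; rewrite linE.
  have Az : A *m z = 0 by rewrite -[A *m z]/(lmul A z) -bE bz linear0.
  have [|f fE] := fac_surj (f := lin (form_linear z)) ps.
    by move=> y /pA[v <-]; rewrite !linE -mulmxA Az mulmx0 mxE.
  by have := fa f; rewrite -xE fE linE.
have [s -> [g gE]] := hT _ _ _ _ (And3 ii it ts) u.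
have [y yE] := col_form g.
rewrite -xE; apply/pA; exists y; rewrite linE.
apply/rowP=> l; have := gE (b (delta_mx l 0)).
by rewrite scale1r uE bE yE !linE mulmxA -!colE ![col _ _ _ _]mxE.
Qed.

(** Finitely many generators of the dual of M give h : M -> R^m, injective because M is torsionless.
    Every form on M extends along h, so Ext^1(N, R) = 0 for the cokernel N, and the higher Ext
    follow from those of M. *)
Lemma orth_gclass : gclass (fun M : fgmod R => orth M).
Proof.
split=> [M hM|M hM|M Q hM hQ]; last exact (ext1_proj hQ (orth_regular hM)).
- have [k [q qs]] := fg_cover (fg_prop M).
  pose ev (f : {linear M -> R^o}) : 'rV[R]_k := \row_j f (q (delta_mx 0 j)).
  have evE (f : {linear M -> R^o}) x : f (q x) = (x *m (ev f)^T) 0 0.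
    rewrite mxE {1}[x]row_sum_delta !linear_sum; apply: eq_bigr => j _.
    by rewrite !linZ !mxE.
  have hU : submod (fun v => exists f, ev f = v).
    split=> [|a u v [f <-] [g <-]].
      by exists (lzero _ _); apply/rowP=> j; rewrite !mxE lE.
    by exists (ladd (lscale a f) g); apply/rowP=> j; rewrite !mxE !lE.
  have [m [u uE]] := fgsub_row (noeth_row noethR hU).
  have /choice[f fE] j : exists f, ev f = u (delta_mx 0 j).
    by apply/uE; exists (delta_mx 0 j).
  have Lh : linear (fun x : M => \row_j f j x).
    by move=> a x y; apply/rowP=> j; rewrite !mxE linearP.
  pose h := lin Lh.
  have ext (g : {linear M -> R^o}) : exists y : {linear 'rV[R]_m -> R^o}, forall x, y (h x) = g x.
    have [v vE] := (uE (ev g)).1 (ex_intro _ g erefl).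
    exists (lin (form_linear v^T)) => x; have [z <-] := qs x.
    pose G := lcomp (lin (form_linear v^T)) h.
    have e : ev g = ev G by
      rewrite -vE [v in LHS]row_sum_delta linear_sum; apply/rowP=> l;
      rewrite summxE mxE lE linE mxE; apply: eq_bigr => j _;
      rewrite linZ -fE !mxE mulrC.
    by rewrite evE e -evE lE.
  have hi : injective h.
    apply: inj0 => x hx; apply: torsionless (fg_prop M) hM _ => g.
    by have [y <-] := ext g; rewrite hx linear0.
  have [N [p [ps hp]]] := coker_ex h.
  exists (FgMod (fg_surj ps (@fg_row R m))); last first.
    by exists (rowmod R m), h, p; split; [apply: proj_row|].
  move=> -[|j]; last first.
    apply: (extU_right (mulset1 R) (And3 hi hp ps) (hD j) (hM j)).
    exact (@proj_orth _ (@proj_row R m) j.+1).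
  rewrite D0; apply/(extU_pres one_set _ (@proj_row R m) (And3 hi hp ps)) => g.
  by exists 1 => //; have [y yE] := ext g; exists y => k'; rewrite yE scale1r.
- have [N NM] := syz_ex (fg_prop M); have fgN := syz_fg noethR NM.
  have [k [i [p ip]]] := NM; exists (FgMod fgN); last first.
    by exists (rowmod R k), i, p; split; [apply: proj_row|].
  exact: syz_orth (@proj_row R k) ip hM.
Qed.

End Torsionless.

Lemma orth_gorenstein (M : fgmod R) : gorenstein_ring R -> orth M ->
  gorenstein_projective M.
Proof.
move=> /(gorenstein_ext noethR D0 hD)[n0 gor] hM.
by have [] := gclass_gorenstein (orth_gclass gor) hM.
Qed.

End Orthogonal.

(** * The quotient of a local ring by a regular element *)

Section QuotientRing.
Variables (S R : comNzRingType) (pi : {rmorphism S -> R}) (w : S) (n : {pred S}).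
Hypotheses (piP : is_quotient_by pi w) (noethS : noetherian S).

Lemma quot_noetherian : noetherian R.
Proof.
move=> I hI; have hJ : ideal (fun s => pi s \in I).
  have hI' := idealr_submod hI; split=> [|a x y hx hy]; first by rewrite rmorph0; apply: (ideal0 hI').
  rewrite rmorphD; apply: (idealD hI') => //; rewrite rmorphM; exact: (idealM hI').
have [m [f fE]] := fgsub_row (noeth_regular noethS hJ).
exists m, (fun i => pi (f (delta_mx 0 i))) => x; have [s <-] := piP.1 x.
have Hf (v : 'rV_m) : pi (f v) = \sum_i pi (v 0 i) * pi (f (delta_mx 0 i)).
  rewrite [v in LHS]row_sum_delta linear_sum rmorph_sum; apply: eq_bigr => i _.
  by rewrite linZ rmorphM.
split=> [/fE[v <-]|[c ->]]; first by exists (fun i => pi (v 0 i)).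
have hI' := idealr_submod hI; apply: (ideal_sum hI') => i _; apply: (idealM hI').
by apply/fE; exists (delta_mx 0 i).
Qed.

Hypotheses (locS : local_ring n) (wn : w \in n).

Definition quot_max : {pred R} := fun r => `[< exists2 s, s \in n & pi s = r >].

Lemma quot_maxP s : (pi s \in quot_max) = (s \in n).
Proof.
have hn := local_ideal locS.
apply/asboolP/idP => [[s' s'n e]|sn]; last by exists s.
have [|t tE] := (piP.2 (s - s')).1; first by rewrite rmorphB e subrr.
by apply: (idealBD hn _ s'n); rewrite tE; apply: (idealM hn).
Qed.

Lemma quot_local : local_ring quot_max.
Proof.
have hn := local_ideal locS.
have closed : idealr_closed quot_max.
  split; first by rewrite -(rmorph0 pi) quot_maxP; apply: (ideal0 hn).
    by rewrite -(rmorph1 pi) quot_maxP local_not1.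
  move=> a u v; have [[a' <-] [u' <-]] := (piP.1 a, piP.1 u); have [v' <-] := piP.1 v.
  by rewrite -rmorphM -rmorphD !quot_maxP => un vn; apply: hn.2.
have pre (J : {pred R}) : idealr_closed J -> idealr_closed (fun s => pi s \in J : bool).
  move=> hJ; have hJ' := idealr_submod hJ; case: hJ => h0 h1 h2.
  split=> [||a u v]; rewrite ?unfold_in ?rmorph0 ?rmorph1 //= => hu hv.
  by rewrite rmorphD rmorphM; apply: h2.
have inn (J : {pred R}) : idealr_closed J -> {subset J <= quot_max}.
  move=> hJ r rJ; apply: contrapT => /negP; have [s sE] := piP.1 r; rewrite -sE quot_maxP.
  move=> /(local_unit noethS locS)[t ts]; case: (hJ) => _ /negP[]; rewrite -(rmorph1 pi) -ts rmorphM.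
  by rewrite sE; apply: (idealM (idealr_submod hJ)).
split.
  split=> // J hJ nJ x; apply/idP/idP; [exact: inn|exact: nJ].
by move=> I [hI Imax] x; rewrite -(Imax quot_max) //; apply: inn.
Qed.

Hypothesis w_regular : GRing.lreg w.

(** [rees] shifts degrees by one but only sees restricted R-modules. The residue field is one of
    them, and it tests all finitely generated S-modules. *)
Lemma gorenstein_quot : gorenstein_ring R <-> gorenstein_ring S.
Proof.
have noethR := quot_noetherian.
have [C [C0 hC _]] := injres_ex (S^o : lmodType S).
have [D [D0 hD _]] := injres_ex (R^o : lmodType R).
rewrite (gorenstein_ext noethR D0 hD) (gorenstein_ext noethS C0 hC).
have [hnR _] := quot_local.
split=> -[n0 h].
  have [k [pk [pks pkE]]] := cyclic_quot (local_ideal quot_local).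
  have fgk := fg_surj pks (fg_regular R).
  have L : linear (fun s : S^o => pk (pi s) : restr pi k).
    by move=> a x y; rewrite restrE -linearP rmorphD rmorphM.
  exists n0.+1; apply: (ext_local noethS locS (k := restr pi k) (pk := lin L) hC).
  - by rewrite C0; apply: fg_regular.
  - by move=> y; have [r <-] := pks y; have [s <-] := piP.1 r; exists s.
  - by move=> x; rewrite linE; split=> [/pkE|xn]; [rewrite quot_maxP|apply/pkE; rewrite quot_maxP].
  - by move=> [//|j] jn; exact ((rees piP w_regular j noethR hC C0 hD D0 fgk).1 (h _ fgk j jn)).
exists n0 => M fgM j jn; apply (rees piP w_regular j noethR hC C0 hD D0 fgM).
by apply: h; [apply: (restr_fg piP) fgM|apply: leqW].
Qed.

End QuotientRing.

(** * Localization of categories *)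

Section CategoryTheory.
Implicit Types C D : category.

Lemma is_iso_comp C (X Y Z : C) (g : Mor Y Z) (f : Mor X Y) :
  is_iso g -> is_iso f -> is_iso (g ∘ f).
Proof.
move=> [g' [g'g gg']] [f' [f'f ff']]; exists (f' ∘ g'); split.
  apply: heq_trans (Defs.compA _ _ _) _; apply: (heq_trans _ f'f).
  apply: comp_heq (heq_refl _); apply: heq_trans (heq_sym (Defs.compA _ _ _)) _.
  by apply: heq_trans (compm1 _); apply: comp_heq (heq_refl _) _.
apply: heq_trans (Defs.compA _ _ _) _; apply: (heq_trans _ gg').
apply: comp_heq (heq_refl _); apply: heq_trans (heq_sym (Defs.compA _ _ _)) _.
by apply: heq_trans (compm1 _); apply: comp_heq (heq_refl _) _.
Qed.

Lemma is_iso_heq C (X Y : C) (f g : Mor X Y) : f ≡ g -> is_iso f -> is_iso g.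
Proof.
move=> fg [h [hf fh]]; exists h; split.
  by apply: heq_trans hf; apply: comp_heq (heq_refl _) (heq_sym fg).
by apply: heq_trans fh; apply: comp_heq (heq_sym fg) (heq_refl _).
Qed.

Lemma is_iso_id C (X : C) : is_iso (idm X).
Proof. by exists (idm X); split; apply: comp1m. Qed.

Lemma compAA C (X Y Z W : C) (h : Mor Z W) (g : Mor Y Z) (f : Mor X Y) (k : Mor X Z) :
  g ∘ f ≡ k -> (h ∘ g) ∘ f ≡ h ∘ k.
Proof. by move=> e; apply: heq_trans (heq_sym (Defs.compA _ _ _)) _; apply: comp_heq (heq_refl _) e. Qed.

Lemma compAl C (X Y Z W : C) (h : Mor Z W) (g : Mor Y Z) (f : Mor X Y) (k : Mor Y W) :
  h ∘ g ≡ k -> h ∘ (g ∘ f) ≡ k ∘ f.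
Proof. by move=> e; apply: heq_trans (Defs.compA _ _ _) _; apply: comp_heq e (heq_refl _). Qed.

Lemma iso_cancel_r C (X Y Z : C) (f : Mor X Y) (g h : Mor Y Z) :
  is_iso f -> g ∘ f ≡ h ∘ f -> g ≡ h.
Proof.
move=> [k [_ fk]] e; apply: heq_trans (heq_sym (compm1 g)) _; apply: (heq_trans _ (compm1 h)).
apply: heq_trans (comp_heq (heq_refl _) (heq_sym fk)) _.
apply: heq_trans (Defs.compA _ _ _) _; apply: heq_trans (comp_heq e (heq_refl k)) _.
exact: compAA fk.
Qed.

Lemma iso_cancel_l C (X Y Z : C) (f : Mor Y Z) (g h : Mor X Y) :
  is_iso f -> f ∘ g ≡ f ∘ h -> g ≡ h.
Proof.
move=> [k [kf _]] e; apply: heq_trans (heq_sym (comp1m g)) _; apply: (heq_trans _ (comp1m h)).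
apply: heq_trans (comp_heq (heq_sym kf) (heq_refl _)) _.
apply: heq_trans (heq_sym (Defs.compA _ _ _)) _; apply: heq_trans (comp_heq (heq_refl k) e) _.
exact: compAl kf.
Qed.

Lemma iso_cancel2 C (X Y Z : C) (g : Mor Y Z) (f : Mor X Y) :
  is_iso g -> is_iso (g ∘ f) -> is_iso f.
Proof.
move=> gI gfI; have [g' [g'g gg']] := gI.
apply: (@is_iso_heq _ _ _ (g' ∘ (g ∘ f))).
  by apply: heq_trans (compAl _ g'g) _; apply: comp1m.
by apply: is_iso_comp => //; exists g.
Qed.

Lemma iso_cancel2r C (X Y Z : C) (g : Mor Y Z) (f : Mor X Y) :
  is_iso f -> is_iso (g ∘ f) -> is_iso g.
Proof.
move=> fI gfI; have [f' [f'f ff']] := fI.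
apply: (@is_iso_heq _ _ _ ((g ∘ f) ∘ f')).
  by apply: heq_trans (compAA _ ff') _; apply: compm1.
by apply: is_iso_comp => //; exists f.
Qed.

Section LocFunctor.
Variables (C D : category) (W : forall X Y : C, Mor X Y -> Prop).
Variables (F0 : C -> D) (F1 : forall X Y : C, Mor X Y -> Mor (F0 X) (F0 Y)).
Hypothesis FF : is_functor F1.
Hypothesis FW : forall X Y (s : Mor X Y), W s -> is_iso (F1 s).

Fixpoint loc_map (X Y : C) (f : word W X Y) {struct f} : Mor (F0 X) (F0 Y) :=
  match f in word _ X Y return Mor (F0 X) (F0 Y) with
  | Arr _ _ f => F1 f
  | Inv _ _ _ Ws => projT1 (cid (FW Ws))
  | Seq _ _ _ v u => loc_map v ∘ loc_map u
  end.

Lemma loc_map_functor : @is_functor (localization W) D F0 (fun X Y => @loc_map X Y).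
Proof.
have [Fe Fi Fc] := FF; split=> /= [X Y f g|X|X Y Z g f]; last 2 first.
- exact: Fi.
- exact: heq_refl.
elim=> {X Y f g} /=.
- by move=> *; apply: heq_refl.
- by move=> *; apply: heq_sym.
- by move=> X Y f g h _ + _; apply: heq_trans.
- by move=> *; apply: comp_heq.
- by move=> *; apply: Defs.compA.
- by move=> X Y f; apply: heq_trans (comp1m _); apply: comp_heq (heq_refl _).
- by move=> X Y f; apply: heq_trans (compm1 _); apply: comp_heq (heq_refl _) _.
- by move=> *; apply: Fe.
- by move=> *; apply: Fc.
- move=> X Y s Ws; case: cid => /= t [ts _].
  by apply: heq_trans ts _; apply: heq_sym.
- move=> X Y s Ws; case: cid => /= t [_ st].
  by apply: heq_trans st _; apply: heq_sym.
Qed.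
End LocFunctor.

Lemma arr_iso C (W : forall X Y : C, Mor X Y -> Prop) (X Y : C) (s : Mor X Y) :
  W _ _ s -> @is_iso (localization W) X Y (Arr W s).
Proof. by move=> Ws; exists (Inv Ws); split; [apply: weq_invl|apply: weq_invr]. Qed.

Lemma arr_functor C (W : forall X Y : C, Mor X Y -> Prop) :
  @is_functor C (localization W) (fun X => X) (@Arr C W).
Proof.
by split=> [X Y f g|X|X Y Z g f]; [apply: weq_arr|apply: weq_refl|apply: weq_arr_comp].
Qed.

(* Setoids, and sequences of pointed setoids with germs of maps at infinity,
   the latter with the arrows reversed. *)
Record setoid := Setoid { car :> Type; seq_ : car -> car -> Prop;
  srefl : forall x, seq_ x x; ssym : forall x y, seq_ x y -> seq_ y x;
  strans : forall x y z, seq_ x y -> seq_ y z -> seq_ x z }.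

Record setmap (A B : setoid) := Setmap { smap :> A -> B;
  smapP : forall x y, seq_ x y -> seq_ (smap x) (smap y) }.

Definition setmap_id (A : setoid) : setmap A A := @Setmap A A (fun x => x) (fun _ _ h => h).
Definition setmap_comp (A B E : setoid) (g : setmap B E) (f : setmap A B) : setmap A E :=
  @Setmap A E (fun x => g (f x)) (fun x y h => smapP g (smapP f h)).

Definition SET : category.
Proof.
refine (@Category setoid setmap (fun A B f g => forall x, seq_ (f x) (g x))
  setmap_id setmap_comp _ _ _ _ _ _ _) => //.
- by move=> X Y f x; apply: srefl.
- by move=> X Y f g h x; apply/ssym/h.
- by move=> X Y f g h fg gh x; apply: strans (fg x) (gh x).
- move=> X Y Z g g' f f' gg ff x; apply: strans (gg _) _.
  by apply: smapP; apply: ff.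
- by move=> *; apply: srefl.
- by move=> *; apply: srefl.
- by move=> *; apply: srefl.
Defined.

Lemma set_iso (A B : setoid) (f : setmap A B) :
  (forall x y, seq_ (f x) (f y) -> seq_ x y) ->
  (forall y, exists x, seq_ (f x) y) -> @is_iso SET A B f.
Proof.
move=> fi /choice[g gE].
have gP x y : seq_ x y -> seq_ (g x) (g y).
  by move=> xy; apply: fi; apply: strans (gE x) _; apply: strans xy (ssym (gE y)).
by exists (Setmap gP); split=> x; [apply: fi; apply: gE|apply: gE].
Qed.

Definition GERM : category.
Proof.
refine (@Category (nat -> setoid) (fun A B => forall k, setmap (B k) (A k))
  (fun A B f g => exists n, forall k, (n <= k)%N -> forall x, seq_ (f k x) (g k x))
  (fun A k => setmap_id (A k)) (fun A B E g f k => setmap_comp (f k) (g k)) _ _ _ _ _ _ _).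
- by move=> X Y f; exists 0%N => k _ x; apply: srefl.
- by move=> X Y f g [n h]; exists n => k nk x; apply/ssym/h.
- move=> X Y f g h [n fg] [m gh]; exists (maxn n m) => k; rewrite geq_max => /andP[nk mk] x.
  by apply: strans (fg k nk x) (gh k mk x).
- move=> X Y Z g g' f f' [n gg] [m ff]; exists (maxn n m) => k.
  rewrite geq_max => /andP[nk mk] x.
  by apply: strans (ff k mk _) _; apply: smapP; apply: gg.
- by move=> *; exists 0%N => *; apply: srefl.
- by move=> *; exists 0%N => *; apply: srefl.
- by move=> *; exists 0%N => *; apply: srefl.
Defined.

(** Below n the inverse is a constant map, for which every B k must be inhabited. *)
Lemma germ_iso (A B : nat -> setoid) (f : forall k, setmap (B k) (A k)) n :
  (forall k, exists b : B k, True) ->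
  (forall k, (n <= k)%N -> (forall x y, seq_ (f k x) (f k y) -> seq_ x y) /\
    (forall y, exists x, seq_ (f k x) y)) -> @is_iso GERM A B f.
Proof.
move=> B0 h.
have /dchoice[g gE] k : exists g : setmap (A k) (B k), (n <= k)%N ->
    (forall x, seq_ (g (f k x)) x) /\ forall y, seq_ (f k (g y)) y.
  have [nk|kn] := leqP n k; last first.
    by have [b _] := B0 k; exists (@Setmap (A k) (B k) (fun=> b) (fun _ _ _ => srefl b)).
  have [fi fs] := h k nk; have [g [gf fg]] := set_iso fi fs.
  by exists g.
by exists g; split; exists n => k nk x; case: (gE k nk) => h1 h2; [apply: h2|apply: h1].
Qed.

End CategoryTheory.

(** * Recursion over the integers *)

Section IntRecursion.
Variable T : int -> Type.

Lemma existT_inj (i : int) (x y : T i) : existT T i x = existT T i y -> x = y.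
Proof. by apply: Eqdep_dec.inj_pair2_eq_dec => a b; apply: decP (a =P b). Qed.

(** Every integer is some j + 1; choosing values in the total space avoids transports along this
    equation. *)
Lemma int_reindex (h : forall i, T (i + 1)) : exists g : forall i, T i, forall i, g (i + 1) = h i.
Proof.
have /dchoice[g gE] i : exists t : T i, exists j, existT T i t = existT T (j + 1) (h j).
  by have [j ij] := int_pred i; subst i; exists (h j), j.
exists g => i; have [j jE] := gE (i + 1).
have ij : i = j by have := congr1 (@projT1 _ _) jE => /= /addIr.
by subst j; apply: existT_inj.
Qed.

(** Recursion from degree a in the direction e, on the total space; the default h0 fills the other
    side of a. *)
Lemma int_rec_gen (N : {i & T i} -> {i & T i} -> Prop) (e : int) (good : forall i, T i -> Prop)
    (a : int) (h0 : forall i, T i) :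
  e = 1 \/ e = -1 ->
  good a (h0 a) ->
  (forall i t, good i t -> exists t', good (i + e) t' /\ N (existT T i t) (existT T (i + e) t')) ->
  exists h : forall i, T i, (forall i, e * i <= e * a -> h i = h0 i) /\
    forall i, e * a <= e * i -> N (existT T i (h i)) (existT T (i + e) (h (i + e))).
Proof.
move=> he ga step; have ee : e * e = 1 by case: he => ->.
pose G := {x : {i & T i} | good (projT1 x) (projT2 x)}.
have /choice[next nextE] (x : G) : exists y : G,
    projT1 (sval y) = projT1 (sval x) + e /\ N (sval x) (sval y).
  case: x => -[i t] /= gt; have [t' [gt' Nt]] := step i t gt.
  by exists (exist _ (existT T (i + e) t') gt').
pose s n := iter n next (exist _ (existT T a (h0 a)) ga : G).
have s1 n : projT1 (sval (s n)) = a + e *+ n.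
  elim: n => [|n IH]; first by rewrite /= addr0.
  by rewrite (_ : s n.+1 = next (s n)) // (nextE _).1 IH mulrSr addrA.
have sE i : e * a <= e * i -> exists n t, sval (s n) = existT T i t.
  move=> ai; exists `|i - a|%N.
  have : projT1 (sval (s `|i - a|%N)) = i.
    rewrite s1; case: he => he; subst e; rewrite ?mulNrn -?mulrnA; lia.
  by case: (sval (s _)) => j t /= <-; exists t.
have /dchoice[h hE] i : exists t : T i, (e * i <= e * a -> t = h0 i) /\
    (e * a <= e * i -> exists n, sval (s n) = existT T i t).
  have [->|ia] := eqVneq i a; first by exists (h0 a); split=> // _; exists 0%N.
  have [lia_|lai] := leP (e * i) (e * a).
    exists (h0 i); split=> // ai; case/eqP: ia.
    by case: he => he; rewrite he in lia_ ai; lia.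
  have [n [t st]] := sE i (ltW lai); exists t; split=> [|_]; last by exists n.
  by rewrite ltNge in lai; move=> h; case/negP: lai.
exists h; split=> i hi; first by case: (hE i) => + _; apply.
have hi' : e * a <= e * (i + e) by rewrite mulrDr ee; lia.
have [n sn] := (hE i).2 hi; have [m sm] := (hE (i + e)).2 hi'.
have e1 : e * i = e * a + n%:Z.
  by have := s1 n; rewrite sn /= => ->; rewrite mulrDr mulrnAr ee natz.
have e2 : e * i + 1 = e * a + m%:Z.
  have := s1 m; rewrite sm /= => /(congr1 (fun x => e * x)).
  by rewrite !mulrDr ee mulrnAr ee natz.
have mn : m = n.+1.
  by move: e1 e2; move: (e * i) (e * a) => x y -> /eqP; rewrite -addrA (inj_eq (addrI _)) => /eqP; lia.
by rewrite -sn -sm mn; apply: (nextE (s n)).2.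
Qed.
End IntRecursion.

(** * Complexes and homotopies *)

Section IntRecursionUpDown.
Variables (T : int -> Type) (Q : forall i, T i -> T (i + 1) -> Prop).
Variables (good : forall i, T i -> Prop) (a : int) (h0 : forall i, T i).

Inductive up_rel : {i & T i} -> {i & T i} -> Prop :=
| UpRel i t t' of @Q i t t' : up_rel (existT T i t) (existT T (i + 1) t').

Inductive down_rel : {i & T i} -> {i & T i} -> Prop :=
| DownRel i t t' of @Q i t' t : down_rel (existT T (i + 1) t) (existT T i t').

Lemma up_relE i t t' : up_rel (existT T i t) (existT T (i + 1) t') -> @Q i t t'.
Proof.
move E1 : (existT T i t) => x; move E2 : (existT T (i + 1) t') => y h.
case: h E1 E2 => {x y} j u u' Qu E1; have ij := congr1 (@projT1 _ _) E1; rewrite /= in ij.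
by subst j => E2; rewrite (@existT_inj T _ _ _ E1) (@existT_inj T _ _ _ E2).
Qed.

Lemma down_relE i t t' : down_rel (existT T (i + 1) t) (existT T i t') -> @Q i t' t.
Proof.
move E1 : (existT T (i + 1) t) => x; move E2 : (existT T i t') => y h.
case: h E1 E2 => {x y} j u u' Qu E1 E2; have ij := congr1 (@projT1 _ _) E2; rewrite /= in ij.
by subst j; rewrite (@existT_inj T _ _ _ E1) (@existT_inj T _ _ _ E2).
Qed.

Lemma int_rec_up : good (h0 a) -> (forall i, i < a -> Q (h0 i) (h0 (i + 1))) ->
  (forall i (t : T i), good t -> exists t' : T (i + 1), good t' /\ Q t t') ->
  exists h : forall i, T i, forall i, Q (h i) (h (i + 1)).
Proof.
move=> ga lo step.
have [|h [hlo hhi]] := @int_rec_gen T up_rel 1 good a h0 (or_introl erefl) ga.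
  by move=> i t /step[t' [gt' Qt]]; exists t'.
exists h => i; have [ia|ai] := ltP i a.
  by rewrite !hlo ?mul1r; [apply: lo|lia|lia].
by apply: up_relE; apply: hhi; rewrite !mul1r.
Qed.

Lemma int_rec_down : good (h0 a) -> (forall i, a <= i -> Q (h0 i) (h0 (i + 1))) ->
  (forall i (t : T (i + 1)), good t -> exists t' : T i, good t' /\ Q t' t) ->
  exists h : forall i, T i, forall i, Q (h i) (h (i + 1)).
Proof.
move=> ga hi step.
have [|h [hlo hhi]] := @int_rec_gen T down_rel (-1) good a h0 (or_intror erefl) ga.
  move=> i t gt; have [j ij] := int_pred i; subst i.
  by rewrite addrK; have [t' [gt' Qt]] := step j t gt; exists t'.
exists h => i; have [ia|ai] := ltP i a; last first.
  by rewrite !hlo ?mulN1r; [apply: hi|lia|lia].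
apply: down_relE; have := hhi (i + 1); rewrite addrK; apply; rewrite !mulN1r; lia.
Qed.

End IntRecursionUpDown.

Section ZmodIdentities.
Variable V : zmodType.
Implicit Types a b c e : V.
Lemma addN_eq a b : - a + b = 0 -> a = b.
Proof. by move/eqP; rewrite addrC subr_eq0 => /eqP. Qed.
Lemma add3K a b c : a + b + c - a = b + c.
Proof. by rewrite addrC !addrA addNr add0r. Qed.
Lemma addBK a b : a + b - a = b.
Proof. by rewrite addrC addrA addNr add0r. Qed.
Lemma cyl_sum a b c e (e' : V) : a + (e + e') = - b + (c + (a + b) + e + (- c + e')).
Proof. by rewrite [c + (a + b)]addrC -!addrA [c + (e + _)]addrCA addNKr [a + (b + _)]addrCA addKr. Qed.
End ZmodIdentities.

Section Homotopy.
Variable R : comNzRingType.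

(* Unbounded complexes of modules which need not be finitely generated. *)
Record ucx := Ucx { uo :> int -> lmodType R; ud : forall i, {linear uo i -> uo (i + 1)};
  udd : forall i x, ud (i + 1) (ud i x) = 0 }.

Definition ucx_of (X : cpx R) : ucx := @Ucx (fun i => X i) (cd X) (@cdd R X).

Record umap (X Y : ucx) := Umap { um :> forall i, {linear X i -> Y i};
  umP : forall i x, ud Y i (um i x) = um (i + 1) (ud X i x) }.

Definition umap_of (X Y : cpx R) (f : cmap X Y) : umap (ucx_of X) (ucx_of Y) :=
  @Umap (ucx_of X) (ucx_of Y) (cm f) (@cmP R X Y f).

Definition ucomp (X Y Z : ucx) (g : umap Y Z) (f : umap X Y) : umap X Z.
Proof.
exists (fun i => lcomp (g i) (f i)) => i x.
by rewrite !lE umP umP.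
Defined.

Definition uzero (X Y : ucx) : umap X Y.
Proof. by exists (fun i => lzero _ _) => i x; rewrite !lE linear0. Defined.

Definition hty (X Y : ucx) (f g : umap X Y) : Prop :=
  exists h : forall i, {linear X (i + 1) -> Y i}, forall i x,
    f (i + 1) x - g (i + 1) x = ud Y i (h i x) + h (i + 1) (ud X (i + 1) x).

Lemma hty_refl X Y (f : umap X Y) : hty f f.
Proof. by exists (fun i => lzero _ _) => i x; rewrite subrr !lE linear0 addr0. Qed.

Lemma hty_sym X Y (f g : umap X Y) : hty f g -> hty g f.
Proof.
by case=> h hE; exists (fun i => lopp (h i)) => i x; rewrite -opprB hE !lE linearN opprD.
Qed.

Lemma hty_trans X Y (f g k : umap X Y) : hty f g -> hty g k -> hty f k.
Proof.
case=> h hE [l lE']; exists (fun i => ladd (h i) (l i)) => i x.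
rewrite !lE linearD -(subrK (g (i + 1) x) (f (i + 1) x)) -addrA hE lE'.
by rewrite addrACA.
Qed.

Lemma hty_eq X Y (f g : umap X Y) : (forall i x, f i x = g i x) -> hty f g.
Proof. by move=> e; exists (fun i => lzero _ _) => i x; rewrite e subrr !lE linear0 addr0. Qed.

Lemma hty_compl X Y Z (k : umap Y Z) (f g : umap X Y) : hty f g -> hty (ucomp k f) (ucomp k g).
Proof.
case=> h hE; exists (fun i => lcomp (k i) (h i)) => i x.
by rewrite !lE -linearB hE linearD umP.
Qed.

Lemma hty_compr X Y Z (k : umap X Y) (f g : umap Y Z) : hty f g -> hty (ucomp f k) (ucomp g k).
Proof.
case=> h hE; exists (fun i => lcomp (h i) (k (i + 1))) => i x.
by rewrite !lE hE umP.
Qed.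

(* Homotopies are built from the region where the map vanishes, upwards if maps
   extend along the differential of the source. *)
Lemma null_up (X Y : ucx) (f : umap X Y) (a : int) :
  (forall i, i < a -> forall x, f (i + 1) x = 0) ->
  (forall i (u : {linear X (i + 1) -> Y (i + 1)}), (forall x, u (ud X i x) = 0) ->
     exists v : {linear X (i + 1 + 1) -> Y (i + 1)}, forall x, v (ud X (i + 1) x) = u x) ->
  hty f (uzero X Y).
Proof.
move=> fa ext.
pose good i (h : {linear X (i + 1) -> Y i}) :=
  forall x, f (i + 1) (ud X i x) = ud Y i (h (ud X i x)).
pose Q i (h : {linear X (i + 1) -> Y i}) (h' : {linear X (i + 1 + 1) -> Y (i + 1)}) :=
  forall x, f (i + 1) x = ud Y i (h x) + h' (ud X (i + 1) x).
have [|i ia|i t gt|h hE] := @int_rec_up _ Q good (a - 1) (fun i => lzero _ _).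
- by move=> x; rewrite fa ?lE ?linear0 //; lia.
- by move=> x; rewrite fa ?lE ?linear0 ?addr0 //; lia.
- have [|v vE] := ext i (lsub (f (i + 1)) (lcomp (ud Y i) t)).
    by move=> x; rewrite !lE gt subrr.
  exists v; split=> x; last by rewrite vE !lE [RHS]addrC subrK.
  by rewrite vE !lE linearB udd subr0 umP.
by exists h => i x; rewrite lE subr0 hE.
Qed.

Lemma null_down (X Y : ucx) (f : umap X Y) (b : int) :
  (forall i, b <= i -> forall x, f (i + 1) x = 0) ->
  (forall i (u : {linear X (i + 1) -> Y (i + 1)}), (forall x, ud Y (i + 1) (u x) = 0) ->
     exists v : {linear X (i + 1) -> Y i}, forall x, ud Y i (v x) = u x) ->
  hty f (uzero X Y).
Proof.
move=> fb lift.
pose good i (h : {linear X (i + 1) -> Y i}) :=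
  forall x, ud Y i (f i x - h (ud X i x)) = 0.
pose Q i (h : {linear X (i + 1) -> Y i}) (h' : {linear X (i + 1 + 1) -> Y (i + 1)}) :=
  forall x, f (i + 1) x = ud Y i (h x) + h' (ud X (i + 1) x).
have [|i ia|i t gt|h hE] := @int_rec_down _ Q good b (fun i => lzero _ _).
- by move=> x; rewrite lE subr0 umP fb.
- by move=> x; rewrite fb ?lE ?linear0 ?addr0.
- have [|v vE] := lift i (lsub (f (i + 1)) (lcomp t (ud X (i + 1)))).
    by move=> x; rewrite !lE gt.
  exists v; split=> x; last by rewrite vE !lE subrK.
  by rewrite linearB vE !lE udd linear0 subr0 umP subrr.
by exists h => i x; rewrite lE subr0 hE.
Qed.

Definition all_null (X Y : ucx) : Prop := forall f : umap X Y, hty f (uzero X Y).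

Lemma all_null_hty X Y (f g : umap X Y) : all_null X Y -> hty f g.
Proof. by move=> h; apply: hty_trans (h f) (hty_sym (h g)). Qed.

Definition ushift (X : ucx) : ucx.
Proof.
exists (fun i => X (i + 1)) (fun i => lopp (ud X (i + 1))) => i x.
by rewrite !lE linearN opprK udd.
Defined.

Lemma ushift_dE (X : ucx) i (x : X (i + 1)) : ud (ushift X) i x = - ud X (i + 1) x.
Proof. by []. Qed.

Lemma cone_dE (X Y : cpx R) (f : cmap X Y) i (z : cone f i) :
  cd (cone f) i z = (- cd X (i + 1) z.1, f (i + 1) z.1 + cd Y i z.2).
Proof. by []. Qed.

Section ConeBijection.
Variables (P : ucx) (X Y : cpx R) (f : cmap X Y).
Let C := ucx_of (cone f).

(** A null homotopy of P -> Y -> cone f has two components: a chain map P -> X, and a homotopy from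
    its composite with f to phi. *)
Lemma cone_hom_surj : all_null P C -> forall phi : umap P (ucx_of Y),
  exists psi : umap P (ucx_of X), hty (ucomp (umap_of f) psi) phi.
Proof.
move=> nul phi.
have [h hE] := nul (ucomp (umap_of (cone_inl f)) phi).
have {}hE i x : ((0, phi (i + 1) x) : cone f (i + 1)) =
    cd (cone f) i (h i x) + h (i + 1) (ud P (i + 1) x) by rewrite -(hE i x) lE subr0.
have h1 i x : cd X (i + 1) (h i x).1 = (h (i + 1) (ud P (i + 1) x)).1.
  by have := congr1 fst (hE i x); rewrite cone_dE /= => /esym/addN_eq.
have h2 i x : phi (i + 1) x =
    f (i + 1) (h i x).1 + cd Y i (h i x).2 + (h (i + 1) (ud P (i + 1) x)).2.
  exact: (congr1 snd (hE i x)).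
have [g gE] := int_reindex (T := fun i => {linear P i -> X i})
  (fun i => lcomp (lfst (X (i + 1)) (Y i)) (h i)).
have gP i x : cd X i (g i x) = g (i + 1) (ud P i x).
  by have [j ij] := int_pred i; subst i; rewrite !gE !lE h1.
exists (@Umap P (ucx_of X) g gP); apply: hty_sym.
exists (fun i => lcomp (lsnd (X (i + 1)) (Y i)) (h i)) => i x.
by rewrite !lE /= gE !lE h2; apply: add3K.
Qed.

(** phi and a null homotopy of f phi form a chain map P[1] -> cone f; the first component of a null
    homotopy of that map contracts phi. *)
Lemma cone_hom_inj : all_null (ushift P) C -> forall phi : umap P (ucx_of X),
  hty (ucomp (umap_of f) phi) (uzero P (ucx_of Y)) -> hty phi (uzero P (ucx_of X)).
Proof.
move=> nul phi [h hE].
have {}hE i x : f (i + 1) (phi (i + 1) x) = cd Y i (h i x) + h (i + 1) (ud P (i + 1) x).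
  by rewrite -(hE i x) lE subr0.
have PP i x : cd (cone f) i (lpair (phi (i + 1)) (lopp (h i)) x) =
    lpair (phi (i + 1 + 1)) (lopp (h (i + 1))) (ud (ushift P) i x).
  rewrite cone_dE ushift_dE !lE /= !linearN opprK hE; congr (_, _).
    by congr (- _); exact (umP phi x).
  by apply: addBK.
have [k kE] := nul (@Umap (ushift P) C (fun i => lpair (phi (i + 1)) (lopp (h i))) PP).
have {}kE i (y : P (i + 1 + 1)) : phi (i + 1 + 1) y =
    - cd X (i + 1) (k i y).1 - (k (i + 1) (ud P (i + 1 + 1) y)).1.
  have := congr1 fst (kE i y); rewrite !lE /= subr0 => ->.
  by rewrite (linearN (k (i + 1))).
have [g gE] := int_reindex (T := fun i => {linear P (i + 1) -> X i})
  (fun i => lopp (lcomp (lfst (X (i + 1)) (Y i)) (k i))).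
exists g => i x; have [j ij] := int_pred i; subst i.
by rewrite lE subr0 !gE !lE linearN kE.
Qed.

Variable J : ucx.

(** Dually, phi composed with cone f -> X[1] is a map to J[1]; restricting a null homotopy of it to
    Y gives psi, and restricting it to X[1] gives the homotopy. *)
Lemma cone_cohom_surj : all_null C (ushift J) -> forall phi : umap (ucx_of X) J,
  exists psi : umap (ucx_of Y) J, hty (ucomp psi (umap_of f)) phi.
Proof.
move=> nul phi.
have PP i (z : cone f i) : ud (ushift J) i (lcomp (phi (i + 1)) (lfst (X (i + 1)) (Y i)) z) =
    lcomp (phi (i + 1 + 1)) (lfst (X (i + 1 + 1)) (Y (i + 1))) (cd (cone f) i z).
  rewrite cone_dE !lE /= linearN; congr (- _); exact (umP phi z.1).
have [k kE] := nul (@Umap C (ushift J) (fun i => lcomp (phi (i + 1)) (lfst _ _)) PP).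
have {}kE i (z : cone f (i + 1)) : phi (i + 1 + 1) z.1 =
    - ud J (i + 1) (k i z) + k (i + 1) (cd (cone f) (i + 1) z).
  by have := kE i z; rewrite !lE subr0.
have [g gE] := int_reindex (T := fun i => {linear Y i -> J i})
  (fun i => lcomp (k i) (linr (X (i + 1 + 1)) (Y (i + 1)))).
have gP i x : ud J i (g i x) = g (i + 1) (cd Y i x).
  have [j ij] := int_pred i; subst i; rewrite !gE !lE.
  by have := kE j (0, x); rewrite cone_dE /= !linear0 ?oppr0 !add0r => /esym/addN_eq.
exists (@Umap (ucx_of Y) J g gP); apply: hty_sym.
have [l lE'] := int_reindex (T := fun i => {linear X (i + 1) -> J i})
  (fun i => lopp (lcomp (k i) (linl (X (i + 1 + 1)) (Y (i + 1))))).
exists l => i x; have [j ij] := int_pred i; subst i; rewrite !lE' !lE /= !gE !lE.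
have := kE j (x, 0); rewrite cone_dE /= linear0 addr0 => ->.
rewrite linearN.
have -> : ((- cd X (j + 1 + 1) x, f (j + 1 + 1) x) : cone f (j + 1 + 1)) =
    - (cd X (j + 1 + 1) x, 0) + (0, f (j + 1 + 1) x).
  by apply/pair_equal_spec; rewrite /= addr0 oppr0 add0r.
by rewrite (linearD (k (j + 1))) linearN addrA addrK.
Qed.

Lemma cone_cohom_inj : all_null C J -> forall phi : umap (ucx_of Y) J,
  hty (ucomp phi (umap_of f)) (uzero (ucx_of X) J) -> hty phi (uzero (ucx_of Y) J).
Proof.
move=> nul phi [h hE].
have {}hE i x : phi (i + 1) (f (i + 1) x) = ud J i (h i x) + h (i + 1) (cd X (i + 1) x).
  by rewrite -(hE i x) lE subr0.
have PP i (z : cone f i) : ud J i (lcopair (h i) (phi i) z) =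
    lcopair (h (i + 1)) (phi (i + 1)) (cd (cone f) i z).
  rewrite cone_dE !lE /= linearN !linearD hE addrA [- _ + _]addrC addrK.
  by congr (_ + _); exact (umP phi z.2).
have [k kE] := nul (@Umap C J (fun i => lcopair (h i) (phi i)) PP).
exists (fun i => lcomp (k i) (linr _ _)) => i x.
have := kE i (0, x); rewrite !lE /= linear0 add0r => ->.
by rewrite (linear0 (cd X _)) (linear0 (f _)) oppr0 add0r.
Qed.

End ConeBijection.

Definition acyclic (X : cpx R) : Prop := forall i, exact_at (cd X i) (cd X (i + 1)).

Lemma quasi_iso_acyclic (X Y : cpx R) (f : cmap X Y) : quasi_iso f -> acyclic (cone f).
Proof.
move=> qf i z; split=> [|[u <-]]; last exact: cdd.
rewrite cone_dE; case: z => x y /= [/eqP]; rewrite oppr_eq0 => /eqP dx e.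
have [x' xE] : exists x', cd X (i + 1) x' = x.
  apply: (qf (i + 1)).1 => //.
  by exists (- y); rewrite linearN; apply/esym/eqP; rewrite -addr_eq0 e.
have [|x'' [y'' [dx'' yE]]] := (qf i).2 (y + f _ x').
  by rewrite linearD cmP xE [LHS]addrC.
exists (x'' - x', y''); rewrite ?cone_dE /= linearB dx'' sub0r opprK xE.
by congr (_, _); rewrite linearB [LHS]addrAC -yE addrK.
Qed.

Lemma null_proj_acyclic (P : ucx) (A : cpx R) :
  (forall i, projective_module (P i)) -> acyclic A -> all_null P (ucx_of A).
Proof.
move=> hP hA f; have [a [b ab]] := cbdd A.
apply: (@null_down _ _ f b) => [i bi x|i u du].
  by apply: ab; apply/orP; right; lia.
have [K [k [ki kA]]] := ker_ex (cd A (i + 1)).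
have [|u' u'E] := fac_inj (f := u) ki; first by move=> x; apply/kA; apply: du.
have [|p pE] := fac_inj (f := cd A i) ki; first by move=> x; apply/kA; apply: cdd.
have ps : surj p.
  move=> y; have [x xE] := (hA i (k y)).1 (ses_comp0 _ kA).
  by exists x; apply: ki; rewrite pE.
have [v vE] := hP _ _ _ p u' ps.
by exists v => x; rewrite -u'E -vE pE.
Qed.

Definition tot_acyclic (P : ucx) : Prop :=
  (forall i, projective_module (P i)) /\
  forall (Q : fgmod R) (i : int) (phi : {linear P (i + 1) -> Q}),
    projective_module Q -> (forall x, phi (ud P i x) = 0) ->
    exists psi : {linear P (i + 1 + 1) -> Q}, forall x, psi (ud P (i + 1) x) = phi x.

Lemma tot_acyclic_shift P : tot_acyclic P -> tot_acyclic (ushift P).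
Proof.
move=> [hP ext]; split=> [i|Q i phi hQ phi0]; first exact: hP.
have [|psi psiE] := ext Q (i + 1) phi hQ.
  by move=> x; have := phi0 x; rewrite lE linearN => /eqP; rewrite oppr_eq0 => /eqP.
by exists (lopp psi) => x; rewrite !lE linearN opprK psiE.
Qed.

Lemma null_tot_perfect (P : ucx) (Q : cpx R) :
  tot_acyclic P -> (forall i, projective_module (Q i)) -> all_null P (ucx_of Q).
Proof.
move=> [_ ext] hQ f; have [a [b ab]] := cbdd Q.
apply: (@null_up _ _ f (a - 1)) => [i ai x|i u u0].
  by apply: ab; apply/orP; left; lia.
by apply: (ext (Q (i + 1)) i u (hQ _)).
Qed.

Lemma null_acyclic_inj (A : cpx R) (J : ucx) :
  (forall i, injective_module (J i)) -> acyclic A -> all_null (ucx_of A) J.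
Proof.
move=> hJ hA f; have [a [b ab]] := cbdd A.
apply: (@null_up _ _ f (a - 1)) => [i ai x|i u u0].
  by rewrite (ab (i + 1) _ x) ?linear0 //; apply/orP; left; lia.
have [K [k [ki kA]]] := ker_ex (cd A (i + 1 + 1)).
have [|p pE] := fac_inj (f := cd A (i + 1)) ki; first by move=> x; apply/kA; apply: cdd.
have ps : surj p.
  move=> y; have [x xE] := (hA (i + 1) (k y)).1 (ses_comp0 _ kA).
  by exists x; apply: ki; rewrite pE.
have [|u' u'E] := fac_surj (f := u) ps.
  move=> x px; have : cd A (i + 1) x = 0 by rewrite -pE px linear0.
  by move/hA => [y <-]; apply: u0.
have [v vE] := hJ _ _ _ k u' ki.
by exists v => x; rewrite -[ud _ _ _]pE vE u'E.
Qed.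

Lemma null_perfect_inj (Q : cpx R) (J : ucx) (a b : int) :
  (forall i, (i < a) || (b < i) -> forall x : Q i, x = 0) ->
  (forall i, projective_module (Q i)) ->
  (forall i, a <= i + 1 -> exact_at (ud J i) (ud J (i + 1))) -> all_null (ucx_of Q) J.
Proof.
move=> ab hQ hJ f.
apply: (@null_down _ _ f b) => [i bi x|i u du].
  by rewrite (ab (i + 1) _ x) ?linear0 //; apply/orP; right; lia.
have [ia|ai] := ltP (i + 1) a.
  by exists (lzero _ _) => x; rewrite (ab (i + 1) _ x) ?linear0 ?ia.
have [K [k [ki kJ]]] := ker_ex (ud J (i + 1)).
have [|u' u'E] := fac_inj (f := u) ki; first by move=> x; apply/kJ; apply: du.
have [|p pE] := fac_inj (f := ud J i) ki; first by move=> x; apply/kJ; apply: udd.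
have ps : surj p.
  move=> y; have [x xE] := (hJ i ai (k y)).1 (ses_comp0 _ kJ).
  by exists x; apply: ki; rewrite pE.
have [v vE] := hQ _ _ _ p u' ps.
by exists v => x; rewrite -u'E -vE pE.
Qed.

End Homotopy.

(** * Functors on the singularity category *)

Section DsgFunctors.
Variable R : comNzRingType.

Lemma iso_closure_std (C : category) (s0 : C -> C)
    (s1 : forall X Y : C, Mor X Y -> Mor (s0 X) (s0 Y)) std (X Y Z : C)
    (u : Mor X Y) (v : Mor Y Z) (w : Mor Z (s0 X)) :
  is_functor s1 -> std X Y Z u v w -> iso_closure s1 std u v w.
Proof.
move=> [_ s1i _] h; exists X, Y, Z, u, v, w, (idm _), (idm _), (idm _); split.
  by split=> //; apply: is_iso_id.
split; [| |].
- by apply: heq_trans (comp1m _) _; apply/heq_sym/compm1.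
- by apply: heq_trans (comp1m _) _; apply/heq_sym/compm1.
- apply: heq_trans (comp_heq (s1i _) (heq_refl _)) _.
  by apply: heq_trans (comp1m _) _; apply/heq_sym/compm1.
Qed.

Definition bD (X Y : cpx R) (f : cmap X Y) : @Mor (Db R) X Y :=
  @Arr (cpx_category R) (@quasi_iso R) X Y f.

Definition qD (X Y : cpx R) (f : cmap X Y) : @Mor (Dsg R) X Y :=
  @Arr (Db R) (@cone_in (Db R) (@perfect R)) X Y (bD f).

Lemma dist_cone (X Y : cpx R) (f : cmap X Y) :
  @dist (Db R) X Y (cone f) (bD f) (bD (cone_inl f)) (bD (cone_pr f)).
Proof.
apply: iso_closure_std; first exact: word_map_functor (@shift_functor R).
exact: (@LocStd (cpx_tricat R)).
Qed.

Lemma bD_functor : @is_functor (cpx_category R) (Db R) (fun X => X) bD.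
Proof. exact: arr_functor. Qed.

Lemma qD_functor : @is_functor (cpx_category R) (Dsg R) (fun X => X) qD.
Proof.
have [h1 h2 h3] := bD_functor.
have [k1 k2 k3] := @arr_functor (Db R) (@cone_in (Db R) (@perfect R)).
split=> [X Y f g fg|X|X Y Z g f]; first exact/k1/h1.
  by apply: heq_trans (k2 X); apply: k1.
by apply: heq_trans (k3 _ _ _ _ _); apply: k1.
Qed.

Lemma bD_qi (X Y : cpx R) (f : cmap X Y) : quasi_iso f -> is_iso (bD f).
Proof. by move=> qf; apply: (@arr_iso (cpx_category R) (@quasi_iso R)). Qed.

Lemma qD_qi (X Y : cpx R) (f : cmap X Y) : quasi_iso f -> is_iso (qD f).
Proof. by move=> /bD_qi; apply: functor_iso; apply: arr_functor. Qed.

Lemma qD_perfect (X Y : cpx R) (f : cmap X Y) (Q : cpx R) :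
  (forall i, projective_module (Q i)) -> isom (cone f : Db R) (Q : Db R) -> is_iso (qD f).
Proof.
move=> hQ fQ; apply: (@arr_iso (Db R)).
exists (cone f), (bD (cone_inl f)), (bD (cone_pr f)); split; first exact: dist_cone.
by exists Q.
Qed.

Section Extend.
Variables (D : category) (F0 : cpx_category R -> D)
  (F1 : forall X Y : cpx_category R, Mor X Y -> Mor (F0 X) (F0 Y)).
Hypothesis FF : is_functor F1.
Hypothesis Fq : forall (X Y : cpx_category R) (s : Mor X Y), quasi_iso s -> is_iso (F1 s).

Lemma db_functor : exists G1 : forall X Y : Db R, Mor X Y -> Mor (F0 X) (F0 Y),
  is_functor G1 /\ forall (X Y : cpx R) (f : cmap X Y),
    G1 X Y (bD f) ≡ F1 (f : @Mor (cpx_category R) X Y).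
Proof.
by exists (fun X Y => @loc_map _ _ _ F0 F1 Fq X Y); split=> [|X Y f];
  [apply: loc_map_functor|apply: heq_refl].
Qed.

Hypothesis Fp : forall (X Y Q : cpx R) (u : cmap X Y), (forall i, projective_module (Q i)) ->
  isom (cone u : Db R) (Q : Db R) -> is_iso (F1 (u : @Mor (cpx_category R) X Y)).

Lemma dsg_functor : exists G1 : forall X Y : Dsg R, Mor X Y -> Mor (F0 X) (F0 Y),
  is_functor G1 /\ forall (X Y : cpx R) (f : cmap X Y),
    G1 X Y (qD f) ≡ F1 (f : @Mor (cpx_category R) X Y).
Proof.
have [G1 [GF GE]] := db_functor.
have GW (X Y : Db R) (s : Mor X Y) : cone_in (@perfect R) s -> is_iso (G1 X Y s).
  case=> Z [v [w [[X' [Y' [Z' [u' [v' [w' [a [b [c [[std aI bI cI] [e1 _ _]]]]]]]]]]] pZ]]].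
  destruct std as [X' Y' Z' u' v' w' std]; destruct std as [X' Y' u'].
  have [Q [hQ ZQ]] := pZ.
  have uQ : isom (cone u' : Db R) (Q : Db R).
    by apply: isom_trans ZQ; apply: isom_sym; exists c.
  have uI : is_iso (G1 _ _ (bD u')).
    by apply: is_iso_heq (Fp hQ uQ); apply: heq_sym; apply: GE.
  have [h1 _ h3] := GF.
  have sq : G1 _ _ b ∘ G1 _ _ s ≡ G1 _ _ (bD u') ∘ G1 _ _ a.
    apply: heq_trans (heq_sym (h3 _ _ _ _ _)) _; apply: heq_trans (h3 _ _ _ _ _).
    exact: h1.
  apply: (iso_cancel2 (functor_iso GF bI)); apply: (is_iso_heq (heq_sym sq)).
  by apply: is_iso_comp => //; apply: functor_iso GF aI.
exists (fun X Y => @loc_map (Db R) D (@cone_in (Db R) (@perfect R)) F0 G1 GW X Y).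
split=> [|X Y f].
  exact: loc_map_functor.
exact: GE.
Qed.

End Extend.

Definition usub (X Y : ucx R) (f g : umap X Y) : umap X Y.
Proof.
exists (fun i => lsub (f i) (g i)) => i x.
by rewrite !lE linearB !umP.
Defined.

Lemma usub_hty (X Y : ucx R) (f g : umap X Y) : hty (usub f g) (uzero X Y) <-> hty f g.
Proof.
by split=> -[h hE]; exists h => i x; have := hE i x; rewrite !lE subr0.
Qed.

Definition hset (X Y : ucx R) : setoid :=
  @Setoid (umap X Y) (@hty R X Y) (@hty_refl R X Y) (@hty_sym R X Y) (@hty_trans R X Y).

Section Hom.
Variable P : ucx R.

Definition homF0 (X : cpx_category R) : SET := hset P (ucx_of X).
Definition homF1 (X Y : cpx_category R) (f : Mor X Y) : Mor (homF0 X) (homF0 Y) :=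
  @Setmap (hset P (ucx_of X)) (hset P (ucx_of Y)) (fun phi => ucomp (umap_of (f : cmap X Y)) phi)
    (fun _ _ h => hty_compl _ h).

Lemma hom_functor : is_functor homF1.
Proof.
split=> [X Y f g fg phi|X phi|X Y Z g f phi]; apply: hty_eq => i x //.
exact: fg.
Qed.

Lemma hom_cone_iso (X Y : cpx R) (f : cmap X Y) :
  all_null P (ucx_of (cone f)) -> all_null (ushift P) (ucx_of (cone f)) ->
  is_iso (homF1 (f : @Mor (cpx_category R) X Y)).
Proof.
move=> n1 n2; apply: set_iso => [phi psi h|phi].
  apply/usub_hty; apply: (cone_hom_inj n2); move/usub_hty: h; apply: hty_trans.
  by apply: hty_eq => i x /=; rewrite ?lE /= ?lE linearB.
exact: (cone_hom_surj n1).
Qed.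

Hypothesis hP : forall i, projective_module (P i).

Lemma hom_qi (X Y : cpx_category R) (s : Mor X Y) : quasi_iso s -> is_iso (homF1 s).
Proof.
move=> /quasi_iso_acyclic ac; apply: hom_cone_iso.
  exact: null_proj_acyclic.
by apply: null_proj_acyclic => // i; apply: hP.
Qed.

Lemma hom_db_null (X Y : cpx R) : isom (X : Db R) (Y : Db R) ->
  all_null P (ucx_of Y) -> all_null P (ucx_of X).
Proof.
have [G1 [GF _]] := db_functor hom_functor hom_qi.
move=> [f fI] nul phi; have [g [gf _]] := functor_iso GF fI.
apply: hty_trans (hty_sym (gf phi)) _; apply: hty_trans _ (gf (uzero _ _)).
by apply: (smapP g); apply: all_null_hty.
Qed.
End Hom.

Lemma hom_dsg_functor (P : ucx R) : tot_acyclic P ->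
  exists G1 : forall X Y : Dsg R, Mor X Y -> setmap (hset P (ucx_of X)) (hset P (ucx_of Y)),
  @is_functor (Dsg R) SET (homF0 P) G1 /\
  forall (X Y : cpx R) (f : cmap X Y) (phi : umap P (ucx_of X)),
    hty (G1 X Y (qD f) phi) (ucomp (umap_of f) phi).
Proof.
move=> hP; have [G1 [GF GE]] := dsg_functor (hom_functor P) (hom_qi hP.1) (fun X Y Q u hQ uQ =>
  hom_cone_iso (hom_db_null hP.1 uQ (null_tot_perfect hP hQ))
   (hom_db_null (tot_acyclic_shift hP).1 uQ (null_tot_perfect (tot_acyclic_shift hP) hQ))).
by exists G1; split.
Qed.

Section Cohom.
Variable J : nat -> ucx R.

Definition cohF0 (X : cpx_category R) : GERM := fun k => hset (ucx_of X) (J k).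
Definition cohF1 (X Y : cpx_category R) (f : Mor X Y) : Mor (cohF0 X) (cohF0 Y) :=
  fun k => @Setmap (hset (ucx_of Y) (J k)) (hset (ucx_of X) (J k))
    (fun phi => ucomp phi (umap_of (f : cmap X Y))) (fun _ _ h => hty_compr _ h).

Lemma coh_functor : is_functor cohF1.
Proof.
split=> [X Y f g fg|X|X Y Z g f]; exists 0%N => k _ phi; apply: hty_eq => i x //.
by rewrite /= (fg i x).
Qed.

Lemma coh_cone_iso (X Y : cpx R) (f : cmap X Y) n :
  (forall k, (n <= k)%N -> all_null (ucx_of (cone f)) (J k) /\
     all_null (ucx_of (cone f)) (ushift (J k))) ->
  is_iso (cohF1 (f : @Mor (cpx_category R) X Y)).
Proof.
move=> h; apply: (germ_iso (n := n)) => [k|k nk]; first by exists (uzero _ _).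
have [n1 n2] := h k nk; split=> [phi psi e|phi].
  apply/usub_hty; apply: (cone_cohom_inj n1); move/usub_hty: e; apply: hty_trans.
  by apply: hty_eq => i x /=; rewrite ?lE.
exact: (cone_cohom_surj n2).
Qed.

Hypothesis hJ : forall k i, injective_module (J k i).

Lemma coh_qi (X Y : cpx_category R) (s : Mor X Y) : quasi_iso s -> is_iso (cohF1 s).
Proof.
move=> /quasi_iso_acyclic ac; apply: (coh_cone_iso (n := 0%N)) => k _.
by split; apply: null_acyclic_inj => // i; apply: hJ.
Qed.

Lemma coh_db_null (X Y : cpx R) n : isom (X : Db R) (Y : Db R) ->
  (forall k, (n <= k)%N -> all_null (ucx_of Y) (J k)) ->
  exists m, forall k, (m <= k)%N -> all_null (ucx_of X) (J k).
Proof.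
have [G1 [GF _]] := db_functor coh_functor coh_qi.
move=> [f fI] nul; have [g [[m gf] _]] := functor_iso GF fI.
exists (maxn n m) => k; rewrite geq_max => /andP[nk mk] phi.
apply: hty_trans (hty_sym (gf k mk phi)) _; apply: hty_trans _ (gf k mk (uzero _ _)).
by apply: (smapP (G1 X Y f k)); apply: all_null_hty; apply: nul.
Qed.
End Cohom.

(** A perfect complex in degrees >= a has only null-homotopic maps into a complex exact from a on.
    As a varies with the perfect complex, no single J k serves, but germs for large k do. *)
Definition eventually_exact (J : nat -> ucx R) : Prop :=
  forall a : int, exists n, forall k, (n <= k)%N -> forall i, a <= i + 1 ->
    exact_at (ud (J k) i) (ud (J k) (i + 1)).

Lemma coh_dsg_null (J : nat -> ucx R) (X Y : cpx R) n :
  (forall k i, injective_module (J k i)) -> eventually_exact J ->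
  @isom (Dsg R) X Y ->
  (forall k, (n <= k)%N -> all_null (ucx_of Y) (J k)) ->
  exists m, forall k, (m <= k)%N -> all_null (ucx_of X) (J k).
Proof.
move=> hJ eJ [f fI] nul.
have hJ' k i : injective_module (ushift (J k) i) by apply: hJ.
have eJ' : eventually_exact (fun k => ushift (J k)).
  move=> a; have [m hm] := eJ a; exists m => k mk i ai y; rewrite !ushift_dE.
  have E := hm k mk (i + 1) _; split=> [/eqP|[x <-]].
    rewrite oppr_eq0 => /eqP/E; case=> [|x xE]; first by lia.
    by exists (- x); rewrite ushift_dE linearN opprK.
  by rewrite ushift_dE linearN udd !oppr0.
have perf (J' : nat -> ucx R) (C Q : cpx R) : (forall k i, injective_module (J' k i)) ->
    eventually_exact J' -> (forall i, projective_module (Q i)) ->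
    isom (C : Db R) (Q : Db R) ->
    exists m, forall k, (m <= k)%N -> all_null (ucx_of C) (J' k).
  move=> hJ1 eJ1 hQ CQ; have [a [b ab]] := cbdd Q; have [m hm] := eJ1 a.
  apply: (@coh_db_null J' hJ1 C Q m CQ) => k mk.
  exact: (null_perfect_inj ab hQ (hm k mk)).
have [G1 [GF _]] := dsg_functor (coh_functor J) (coh_qi hJ) (fun X Y Q u hQ uQ =>
  let: ex_intro m1 h1 := perf J _ _ hJ eJ hQ uQ in
  let: ex_intro m2 h2 := perf (fun k => ushift (J k)) _ _ hJ' eJ' hQ uQ in
  @coh_cone_iso J _ _ u (maxn m1 m2) (fun k mk => conj
    (h1 k (leq_trans (leq_maxl m1 m2) mk)) (h2 k (leq_trans (leq_maxr m1 m2) mk)))).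
have [g [[m gf] _]] := functor_iso GF fI.
exists (maxn n m) => k; rewrite geq_max => /andP[nk mk] phi.
apply: hty_trans (hty_sym (gf k mk phi)) _; apply: hty_trans _ (gf k mk (uzero _ _)).
by apply: (smapP (G1 X Y f k)); apply: all_null_hty; apply: nul.
Qed.

Section ExtDetection.
Variables (D : nat -> lmodType R) (hD : injres D).

Lemma stalk_zero (M : fgmod R) i : i != 0 -> forall x : stalk M i, x = 0.
Proof. by case: i => [[|n]|n] // _ x; apply: fgmod0_eq0. Qed.

Lemma stalk_d0 (M : fgmod R) i x : cd (stalk M) i x = 0.
Proof. by []. Qed.

Lemma stalk_ud0 (M : fgmod R) i x : ud (ucx_of (stalk M)) i x = 0.
Proof. by []. Qed.

Lemma uzeroE (X Y : ucx R) i x : uzero X Y i x = 0.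
Proof. by []. Qed.

(* The injective resolution of [D 0], moved [k] steps to the left. *)
Lemma res_cpx_ex k : exists J : ucx R, [/\ forall i, injective_module (J i),
  forall i, - k.+1%:Z <= i -> exact_at (ud J i) (ud J (i + 1)) &
  forall M : fgmod R, all_null (ucx_of (stalk M)) J <-> ext1 M (D k)].
Proof.
(* The cocycles in degree i are D (i + k + 1). Those of degree -1 are D k, so maps from a stalk in
   degree 0 up to homotopy form Ext^1(M, D k). *)
pose C (i : int) : lmodType R := if i + k.+1%:Z is Posz m then D m else (fgmod0 : lmodType R).
have ex i : exists E : lmodType R, exists c : {linear C i -> E},
    exists p : {linear E -> C (i + 1)}, [/\ injective_module E, injective c,
      forall x, p (c x) = 0 & - k.+1%:Z <= i -> short_exact c p].
  rewrite /C; have [ki|ik] := leP (- k.+1%:Z) i.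
    have [m [-> ->]] : exists m : nat, i + 1 + k.+1%:Z = m.+1%:Z /\ i + k.+1%:Z = m%:Z.
      by exists (absz (i + k.+1%:Z)); lia.
    have [E [c [p [EI cp]]]] := hD m.
    by have [ci cpe ps] := cp; exists E, c, p; split=> // x; apply: ses_comp0 cpe.
  have [m ->] : exists m : nat, i + k.+1%:Z = Negz m by exists (absz (i + k.+1%:Z)).-1; lia.
  exists (fgmod0 : lmodType R), (lid _), (lzero _ _); split=> //.
  by apply: injective0; apply: fgmod0_eq0.
have {ex}[J /dchoice[c /dchoice[p cpP]]] := choice ex.
have ci i : injective (c i) by case: (cpP i).
have d0 i (x : J i) : c (i + 1) (p i x) = 0 <-> p i x = 0.
  by split=> [e|->]; [apply: ci; rewrite linear0|rewrite linear0].
have dd i x : lcomp (c (i + 1 + 1)) (p (i + 1)) (lcomp (c (i + 1)) (p i) x) = 0.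
  by rewrite !lE; case: (cpP (i + 1)) => _ _ -> _; rewrite linear0.
pose JJ := @Ucx R J (fun i => lcomp (c (i + 1)) (p i)) dd.
have JI i : injective_module (J i) by case: (cpP i).
have ses i : - k.+1%:Z <= i -> short_exact (c i) (p i) by case: (cpP i).
exists JJ; split=> [||M]; first exact: JI.
  move=> i ki y; rewrite lE d0.
  have [|_ cp1 _] := ses (i + 1); first by lia.
  have [_ _ ps] := ses i ki; rewrite cp1.
  split=> -[x <-]; last by exists (p i x); rewrite lE.
  by have [z <-] := ps x; exists z; rewrite lE.
have -> : D k = C (Negz 0) by rewrite /C; have -> : Negz 0 + k.+1%:Z = k%:Z by lia.
have ses1 : short_exact (c (Negz 0)) (p (Negz 0)) by apply: ses; lia.
have [_ cp0 _] : short_exact (c 0) (p 0) by apply: ses; lia.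
rewrite (extU_lift one_set M (JI _) ses1); split=> h f.
  pose Phi i : {linear stalk M i -> J i} :=
    match i return {linear stalk_obj M i -> J i} with
    | Posz 0 => lcomp (c 0) f | Posz n.+1 => lzero _ _ | Negz n => lzero _ _ end.
  have PhiP i (x : stalk M i) : ud JJ i (Phi i x) = Phi (i + 1) (cd (stalk M) i x).
    rewrite stalk_d0 linear0; have [i0|i0] := eqVneq i 0; last first.
      by rewrite (stalk_zero i0 x) !linear0.
    by subst i; exact ((d0 0 (c 0 (f x))).2 (ses_comp0 _ cp0)).
  have [l lE'] := h (@Umap R (ucx_of (stalk M)) JJ Phi PhiP).
  exists 1 => //; exists (l (Negz 0)) => x; rewrite scale1r.
  have := lE' (Negz 0) x; rewrite stalk_ud0 uzeroE subr0 (linear0 (l _)) addr0 => e.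
  by apply: (ci 0); apply: esym; exact: e.
have f0 (x : M) : p 0 (f 0 x) = 0.
  apply/d0; have := umP f (x : stalk M 0); rewrite stalk_ud0 linear0; exact.
have [|g gE] := fac_inj (f := f 0) (ci 0); first by move=> x; apply/cp0/f0.
have [s -> [l lE']] := h g.
exists (fun i => match i return {linear stalk M (i + 1) -> J i} with
  | Negz 0 => l | Negz n.+1 => lzero _ _ | Posz n => lzero _ _ end) => i x.
rewrite stalk_ud0 uzeroE subr0.
have [i0|i0] := eqVneq i (Negz 0); last first.
  by rewrite (stalk_zero _ x) ?linear0 ?addr0 //; lia.
subst i; rewrite [X in _ = _ + X]linear0 addr0; change (f 0 x = c 0 (p (Negz 0) (l x))).
by rewrite lE' scale1r gE.
Qed.

End ExtDetection.

(** The resolved module D k 0 may change with k: density on Mon(w, P) is tested with a different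
    syzygy of the residue field in each degree. *)
Lemma stalk_isom_ext (D : nat -> nat -> lmodType R) (M N : fgmod R) :
  (forall k, injres (D k)) -> @isom (Dsg R) (stalk M) (stalk N) ->
  (exists n, forall k, (n <= k)%N -> ext1 N (D k k)) ->
  exists n, forall k, (n <= k)%N -> ext1 M (D k k).
Proof.
move=> hD MN [n hn]; have [J JP] := choice (fun k => res_cpx_ex (hD k) k).
have JI k i : injective_module (J k i) by case: (JP k).
have Jn k (L : fgmod R) : all_null (ucx_of (stalk L)) (J k) <-> ext1 L (D k k) by case: (JP k).
have Je : eventually_exact J.
  move=> a; exists `|a|%N.+1 => k ak i ai; case: (JP k) => _ + _; apply; lia.
have [k nk|m hm] := coh_dsg_null (n := n) JI Je MN; first by apply/Jn/hn.
by exists m => k mk; apply/Jn/hm.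
Qed.

End DsgFunctors.

(** * Homotopic maps and maps with perfect kernel or cokernel *)

Section DsgBasics.
Variable R : comNzRingType.

Section Cylinder.
Variable X : cpx R.
Let cobj_ i : fgmod R := fgmod_sum (X (i + 1)) (fgmod_sum (X i) (X i)).

Fact cyl_linear i : linear (fun z : cobj_ i =>
  (- cd X (i + 1) z.1, (z.1 + cd X i z.2.1, - z.1 + cd X i z.2.2)) : cobj_ (i + 1)).
Proof.
move=> a x y; apply/pair_equal_spec; split; rewrite /=.
  by rewrite (linearP (cd X _)) opprD scalerN.
apply/pair_equal_spec; split; rewrite /= (linearP (cd X _)).
  by rewrite scalerDr addrACA.
by rewrite opprD scalerDr scalerN addrACA.
Qed.

Fact cyl_cdd i (z : cobj_ i) : lin (@cyl_linear (i + 1)) (lin (@cyl_linear i) z) = 0.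
Proof.
rewrite !linE /=; apply/pair_equal_spec; split; first by rewrite linearN cdd !oppr0.
apply/pair_equal_spec; split; rewrite /= (linearD (cd X _)) cdd addr0; first by rewrite addNr.
by rewrite (linearN (cd X _)) opprK subrr.
Qed.

Fact cyl_cbdd : exists a b : int,
  forall i, (i < a) || (b < i) -> forall z : cobj_ i, z = 0.
Proof.
have [a [b ab]] := cbdd X; exists (a - 1), b => i iab [s [x x']].
apply/pair_equal_spec; split; last apply/pair_equal_spec; last split; apply: ab.
- by case/orP: iab => ?; apply/orP; [left|right]; lia.
- by case/orP: iab => ?; apply/orP; [left|right]; lia.
- by case/orP: iab => ?; apply/orP; [left|right]; lia.
Qed.

Definition cyl : cpx R := Cpx cyl_cdd cyl_cbdd.

Fact cyl_pr_linear i : linear (fun z : cyl i => z.2.1 + z.2.2 : X i).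
Proof. by move=> a x y; rewrite /= scalerDr addrACA. Qed.
Fact cyl_prP i x : cd X i (lin (@cyl_pr_linear i) x) = lin (@cyl_pr_linear (i + 1)) (cd cyl i x).
Proof. by rewrite !linE /= linearD addrACA addrN add0r. Qed.
Definition cyl_pr : cmap cyl X := Cmap cyl_prP.

Fact cyl_inP (e : bool) i x :
  cd cyl i (lcomp (linr (X (i + 1)) (fgmod_sum (X i) (X i))) (if e then linl _ _ else linr _ _) x) =
  lcomp (linr (X (i + 1 + 1)) (fgmod_sum (X (i + 1)) (X (i + 1))))
    (if e then linl _ _ else linr _ _) (cd X i x).
Proof.
case: e; apply/pair_equal_spec; (split; first by rewrite /= linear0 oppr0).
  by apply/pair_equal_spec; split; rewrite /= ?linear0 ?oppr0 ?add0r.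
by apply/pair_equal_spec; split; rewrite /= ?linear0 ?oppr0 ?add0r.
Qed.
Definition cyl_in e : cmap X cyl := Cmap (@cyl_inP e).

Lemma cyl_pr_qi : quasi_iso cyl_pr.
Proof.
move=> i; split=> [[s [x x']] /= [_ [e1 e2]] [y ye]|y dy]; last first.
  exists (0, (y, 0)), 0; split; last by rewrite linear0 /= !addr0.
  apply/pair_equal_spec; split; first by rewrite /= linear0 oppr0.
  by apply/pair_equal_spec; split; rewrite /= ?dy ?linear0 ?oppr0 ?addr0.
exists (x, (0, y)); apply/pair_equal_spec; split=> /=.
  by apply/eqP; rewrite eq_sym -subr_eq0 opprK e1.
apply/pair_equal_spec; split=> /=; first by rewrite linear0 addr0.
by rewrite ye addrA addNr add0r.
Qed.

End Cylinder.

(** A homotopy is a map out of the cylinder of X, whose two end inclusions are sections of the same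
    quasi-isomorphism and so coincide in D^b. *)
Lemma hty_bD (X Y : cpx R) (f g : cmap X Y) : hty (umap_of f) (umap_of g) -> bD f ≡ bD g.
Proof.
case=> h hE.
have {}hE i x : f (i + 1) x = g (i + 1) x + (cd Y i (h i x) + h (i + 1) (cd X (i + 1) x)).
  by rewrite -(hE i x) [RHS]addrC subrK.
have HP i (z : cyl X i) : cd Y i (lcopair (h i) (lcopair (f i) (g i)) z) =
    lcopair (h (i + 1)) (lcopair (f (i + 1)) (g (i + 1))) (cd (cyl X) i z).
  case: z => s [x x']; rewrite !lE /= !linearD !linearN !cmP (hE i s).
  exact: cyl_sum.
pose H := @Cmap _ (cyl X) Y (fun i => lcopair (h i) (lcopair (f i) (g i))) HP.
have [be _ bc] := bD_functor R.
have e0 : bD (cyl_in X true) ≡ bD (cyl_in X false).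
  apply: (iso_cancel_l (bD_qi (cyl_pr_qi X))).
  apply: heq_trans (heq_sym (bc _ _ _ _ _)) _; apply: heq_trans (bc _ _ _ _ _).
  by apply: be => i x; change (x + 0 = 0 + x); rewrite addr0 add0r.
have e1 : bD f ≡ bD H ∘ bD (cyl_in X true).
  apply: heq_trans (bc _ _ _ _ _); apply: be => i x.
  by change (f i x = h i 0 + (f i x + g i 0)); rewrite !linear0 add0r addr0.
have e2 : bD g ≡ bD H ∘ bD (cyl_in X false).
  apply: heq_trans (bc _ _ _ _ _); apply: be => i x.
  by change (g i x = h i 0 + (f i 0 + g i x)); rewrite !linear0 !add0r.
apply: heq_trans e1 _; apply: heq_trans (heq_sym e2).
exact: comp_heq (heq_refl _) e0.
Qed.

Lemma hty_qD (X Y : cpx R) (f g : cmap X Y) : hty (umap_of f) (umap_of g) -> qD f ≡ qD g.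
Proof. by move/hty_bD; apply: weq_arr. Qed.

Lemma ses_shift_cone (L A B : cpx R) (j : cmap L A) (u : cmap A B) :
  (forall i, short_exact (j i) (u i)) -> exists s : cmap (shift L) (cone u), quasi_iso s.
Proof.
move=> ju.
have ji i : injective (j i) by case: (ju i).
have je i : exact_at (j i) (u i) by case: (ju i).
have us i : surj (u i) by case: (ju i).
have sP i (x : shift L i) : cd (cone u) i (lcomp (linl _ _) (j (i + 1)) x) =
    lcomp (linl (A (i + 1 + 1)) (B (i + 1))) (j (i + 1 + 1)) (cd (shift L) i x).
  apply/pair_equal_spec; split; rewrite /=.
    by rewrite cmP [in RHS]linearN.
  by rewrite (ses_comp0 _ (je _)) linear0 addr0.
exists (@Cmap _ (shift L) (cone u) (fun i => lcomp (linl _ _) (j (i + 1))) sP) => i.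
split=> [l /= dl [[a b] /= [ea eb]]|[a b] /= [ea eb]].
  have [a'' a''E] := us i b.
  have [l' l'E] : exists l', j (i + 1) l' = a + cd A i a''.
    by apply/je; rewrite linearD -cmP a''E.
  exists (l' : shift L i); apply: (ji (i + 1 + 1)).
  by rewrite linearN -cmP l'E linearD cdd addr0 -ea.
have [a' a'E] := us (i + 1) b.
have [l lE'] : exists l, j (i + 1 + 1) l = a + cd A (i + 1) a'.
  by apply/je; rewrite linearD -cmP a'E.
exists (l : shift L (i + 1)), (a', 0); split.
  apply: (ji (i + 1 + 1 + 1)); rewrite linear0 linearN -cmP lE' linearD cdd addr0.
  exact: ea.
apply/pair_equal_spec; split; rewrite /=; first by rewrite lE' addrK.
by rewrite linear0 addr0 add0r.
Qed.

Lemma ses_perfect_l (L A B : cpx R) (j : cmap L A) (u : cmap A B) :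
  (forall i, short_exact (j i) (u i)) -> (forall i, projective_module (L i)) -> is_iso (qD u).
Proof.
move=> ju LP; have [s sq] := ses_shift_cone ju.
apply: (qD_perfect (Q := shift L)) => [i|]; first exact: LP.
by apply: isom_sym; exists (bD s); apply: bD_qi.
Qed.

Lemma ses_cone_qi (L A B : cpx R) (j : cmap L A) (u : cmap A B) :
  (forall i, short_exact (j i) (u i)) ->
  exists s : cmap (cone j) B, quasi_iso s /\ forall i z, s i z = u i z.2.
Proof.
move=> ju.
have ji i : injective (j i) by case: (ju i).
have je i : exact_at (j i) (u i) by case: (ju i).
have us i : surj (u i) by case: (ju i).
have sP i (z : cone j i) : cd B i (lcomp (u i) (lsnd (L (i + 1)) (A i)) z) =
    lcomp (u (i + 1)) (lsnd (L (i + 1 + 1)) (A (i + 1))) (cd (cone j) i z).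
  by rewrite !lE /= linearD (ses_comp0 _ (je _)) add0r cmP.
exists (@Cmap _ (cone j) B _ sP); split=> // i.
split=> [[l a] /= [e1 e2] [b be]|b db].
  have [a1 a1E] := us i b.
  have [l1 l1E] : exists l1, j (i + 1) l1 = a - cd A i a1.
    by apply/je; rewrite linearB -cmP a1E be subrr.
  exists (l1, a1); apply/pair_equal_spec; split=> /=; last by rewrite l1E subrK.
  apply: (ji (i + 1 + 1)); rewrite linearN -cmP l1E linearB cdd subr0.
  by apply/eqP; rewrite eq_sym -addr_eq0; apply/eqP.
have [a aE] := us (i + 1) b.
have [l lE'] : exists l, j (i + 1 + 1) l = cd A (i + 1) a.
  by apply/je; rewrite -cmP aE db.
exists (- l, a), 0; split; last by change (b = u (i + 1) a + cd B i 0); rewrite linear0 addr0 aE.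
apply/pair_equal_spec; split=> /=; last by rewrite linearN lE' addNr.
apply: (ji (i + 1 + 1 + 1)); rewrite linear0 linearN (linearN (cd L (i + 1 + 1))) (linearN (j _)) opprK.
by rewrite -cmP lE' cdd.
Qed.

Lemma ses_perfect_r (L A B : cpx R) (j : cmap L A) (u : cmap A B) :
  (forall i, short_exact (j i) (u i)) -> (forall i, projective_module (B i)) -> is_iso (qD j).
Proof.
move=> ju BP; have [s [sq _]] := ses_cone_qi ju.
by apply: (qD_perfect (Q := B)) => //; exists (bD s); apply: bD_qi.
Qed.

Lemma cone_ses (X Y : cpx R) (f : cmap X Y) i : short_exact (cone_inl f i) (cone_pr f i).
Proof.
split=> [x y [] //|[a b]|a]; last by exists (a, 0).
by split=> [/= e|[y [<-]] //]; exists b; congr (_, _); rewrite -e.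
Qed.

Lemma cone_inl_iso (X Y : cpx R) (f : cmap X Y) :
  (forall i, projective_module (X i)) -> is_iso (qD (cone_inl f)).
Proof. by move=> XP; apply: (ses_perfect_r (cone_ses f)) => i; apply: XP. Qed.

(** The kernel is a bounded complex of projectives: in each degree it is all of A i or zero. *)
Lemma surj_perfect (A B : cpx R) (u : cmap A B) : noetherian R ->
  (forall i, surj (u i)) ->
  (forall i, (projective_module (A i) /\ forall b : B i, b = 0) \/ injective (u i)) ->
  is_iso (qD u).
Proof.
move=> noethR us uA.
have /choice[L /dchoice[j jE]] i : exists L : fgmod R, exists j : {linear L -> A i},
    short_exact j (u i).
  have [L [j [ji je]]] := ker_ex (u i).
  exists (FgMod (fg_inj noethR ji (fg_prop (A i)))), j.
  by split; [exact: ji|exact: je|exact: us].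
have ji i : injective (j i) by case: (jE i).
have je i : exact_at (j i) (u i) by case: (jE i).
have LP i : projective_module (L i).
  case: (uA i) => [[AP B0]|ui].
    have [|r [rK _]] := lin_inv (ji i); first by move=> x; apply/je; apply: B0.
    exact: proj_retract rK AP.
  move=> M N q f _; exists (lzero _ _) => x.
  have -> : x = 0 by apply: (ji i); apply: ui; rewrite (ses_comp0 _ (je i)) !linear0.
  by rewrite !linear0.
have /dchoice[dL dLE] i : exists d : {linear L i -> L (i + 1)}, forall x,
    j (i + 1) (d x) = cd A i (j i x).
  have [|d dE] := fac_inj (f := lcomp (cd A i) (j i)) (ji (i + 1)).
    by move=> x; apply/je; rewrite lE -cmP (ses_comp0 _ (je i)) linear0.
  by exists d.
have dd i x : dL (i + 1) (dL i x) = 0.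
  by apply: ji; rewrite !dLE cdd linear0.
have bdd : exists a b : int, forall i, (i < a) || (b < i) -> forall x : L i, x = 0.
  have [a [b ab]] := cbdd A; exists a, b => i iab x.
  by apply: ji; rewrite linear0; apply: ab.
pose LL := Cpx dd bdd.
have jP i x : cd A i (j i x) = j (i + 1) (cd LL i x) by rewrite -dLE.
exact: (ses_perfect_l (j := @Cmap _ LL A j jP) jE LP).
Qed.

End DsgBasics.

(** * Morphisms between stalk complexes *)

Section StalkHom.
Variable R : comNzRingType.
Hypothesis noethR : noetherian R.

Section Truncation.
Variables (M : fgmod R) (P : int -> fgmod R) (d : forall i, {linear P i -> P (i + 1)})
  (p : {linear P 0 -> M}).
Hypothesis res : complete_res d p.

Let dd i x : d (i + 1) (d i x) = 0.
Proof. by have [_ ex _ _] := res; exact: ses_comp0 (ex i). Qed.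

Definition res_ucx : ucx R := @Ucx R (fun i => P i) d dd.
Notation PU := res_ucx.

Lemma res_tot_acyclic : tot_acyclic PU.
Proof. by have [hP _ ext _] := res; split. Qed.

Definition iota_at i : {linear P i -> stalk M i} :=
  match i return {linear P i -> stalk_obj M i} with
  | Posz 0 => p
  | Posz n.+1 => lzero _ _
  | Negz n => lzero _ _
  end.

Lemma iotaP i x : ud (ucx_of (stalk M)) i (iota_at i x) = iota_at (i + 1) (d i x).
Proof.
rewrite stalk_ud0; apply: esym; have [i0|i0] := eqVneq i (Negz 0).
  have [_ _ _ [_ pE]] := res.
  by subst i; exact ((pE (d (Negz 0) x)).2 (dd x)).
by apply: stalk_zero; lia.
Qed.

Definition iota : umap PU (ucx_of (stalk M)) := @Umap R PU (ucx_of (stalk M)) iota_at iotaP.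

(* The truncation P/B: degrees i with a < i <= b are kept, and in degree a the
   cocycles are divided out. *)
Definition trunc_rel (a b i : int) (x : P i) : Prop :=
  [\/ x = 0, i < a, b < i | i = a /\ d i x = 0].

Lemma trunc_submod a b i : submod (@trunc_rel a b i).
Proof.
split=> [|c x y]; first by constructor 1.
have [ia|ai] := ltP i a; first by constructor 2.
have [bi|ib] := ltP b i; first by constructor 3.
have h (z : P i) : trunc_rel a b z -> z = 0 \/ i = a /\ d i z = 0.
  by case; rewrite ?ltNge ?ai ?ib //; [left|right].
move=> /h[->|[ea dx]] /h[->|[ea' dy]].
- by constructor 1; rewrite scaler0 addr0.
- by constructor 4; rewrite scaler0 add0r.
- by constructor 4; rewrite addr0 linZ dx scaler0.
- by constructor 4; rewrite linearP dx dy scaler0 addr0.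
Qed.

Definition is_trunc (a b : int) (K : cpx R) (q : umap PU (ucx_of K)) : Prop :=
  forall i, surj (q i) /\ forall x, q i x = 0 <-> trunc_rel a b (x : P i).

Lemma trunc_ex a b : exists (K : cpx R) (q : umap PU (ucx_of K)), is_trunc a b q.
Proof.
have /choice[K /dchoice[q qE]] i : exists K : fgmod R, exists q : {linear P i -> K},
    surj q /\ forall x, q x = 0 <-> trunc_rel a b x.
  have [K [q [qs qE]]] := quot_ex (@trunc_submod a b i).
  by exists (FgMod (fg_surj qs (fg_prop (P i)))), q.
have /dchoice[dK dKE] i : exists e : {linear K i -> K (i + 1)}, forall x,
    e (q i x) = q (i + 1) (d i x).
  have [qs q0] := qE i; have [|e eE] := fac_surj (f := lcomp (q (i + 1)) (d i)) qs.
    move=> x /q0 h; rewrite lE; apply/(qE (i + 1)).2.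
    have [e|i0] := eqVneq (d i x) 0; first by constructor 1.
    case: h => [x0|ia|bi|[_ dx]].
    - by constructor 1; rewrite x0 linear0.
    - have [e|ne] := eqVneq (i + 1) a; first by constructor 4; split.
      by constructor 2; lia.
    - by constructor 3; lia.
    - by constructor 1.
  by exists e => x; rewrite eE lE.
have ddK i x : dK (i + 1) (dK i x) = 0.
  by have [qs _] := qE i; have [y <-] := qs x; rewrite !dKE dd linear0.
have bdd : exists a b : int, forall i, (i < a) || (b < i) -> forall x : K i, x = 0.
  exists a, b => i iab x; have [qs q0] := qE i; have [y <-] := qs x; apply/q0.
  by case/orP: iab => h; [constructor 2|constructor 3].
exists (Cpx ddK bdd), (@Umap R PU (ucx_of (Cpx ddK bdd)) q (fun i x => dKE i x)).
exact: qE.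
Qed.

Lemma trunc_desc a b K (q : umap PU (ucx_of K)) (X : cpx R) (phi : umap PU (ucx_of X)) :
  is_trunc a b q -> (forall i (x : P i), trunc_rel a b x -> phi i x = 0) ->
  exists f : cmap K X, forall i x, f i (q i x) = phi i x.
Proof.
move=> qE h; have /dchoice[f fE] i : exists f : {linear K i -> X i}, forall x, f (q i x) = phi i x.
  by have [qs q0] := qE i; apply: fac_surj qs _ => x /q0; apply: h.
have fP i x : cd X i (f i x) = f (i + 1) (cd K i x).
  have [qs _] := qE i; have [y <-] := qs x.
  by have := umP q y; rewrite /= => ->; rewrite !fE; exact (umP phi y).
by exists (Cmap fP).
Qed.

Lemma trunc_rel_in a b i (x : P i) : a < i -> i <= b -> trunc_rel a b x -> x = 0.
Proof. by move=> ai ib; case=> [//|||[]]; lia. Qed.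

Lemma trunc_rel_le a b a' b' i (x : P i) : a' <= a -> b <= b' ->
  trunc_rel a' b' x -> trunc_rel a b x.
Proof.
move=> aa bb; case=> [x0|ia|bi|[ia dx]].
- by constructor 1.
- by constructor 2; lia.
- by constructor 3; lia.
- by have [e|ne] := eqVneq a a'; [constructor 4; rewrite e|constructor 2; lia].
Qed.

Lemma trunc_map a b a' b' K K' (q : umap PU (ucx_of K)) (q' : umap PU (ucx_of K')) :
  is_trunc a b q -> is_trunc a' b' q' -> a' <= a -> b <= b' ->
  exists f : cmap K' K, forall i x, f i (q' i x) = q i x.
Proof.
move=> qE q'E aa bb; apply: (trunc_desc q'E) => i x /(trunc_rel_le aa bb).
by case: (qE i) => _ h /h.
Qed.

Lemma trunc_stalk a b K (q : umap PU (ucx_of K)) : is_trunc a b q -> a < 0 -> 0 <= b ->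
  exists s : cmap K (stalk M), forall i x, s i (q i x) = iota i x.
Proof.
move=> qE a0 b0; apply: (trunc_desc qE) => i x h.
have [i0|i0] := eqVneq i 0; last exact: stalk_zero.
by subst i; rewrite (trunc_rel_in a0 b0 h) linear0.
Qed.

(** In degree a the quotient by the cocycles is isomorphic to the boundaries of degree a + 1, so the
    truncation is exact below 0 and resolves M. *)
Lemma trunc_stalk0_qi a K (q : umap PU (ucx_of K)) (s : cmap K (stalk M)) :
  is_trunc a 0 q -> a < 0 -> (forall i x, s i (q i x) = iota i x) -> quasi_iso s.
Proof.
move=> qE a0 sE; have [_ ex _ [ps pE]] := res.
have qd i x : q (i + 1) (d i x) = cd K i (q i x) by rewrite -(umP q).
move=> i; split=> [x dx [y ye]|y _]; last first.
  have [qs q0] := qE (i + 1).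
  have [i0|i0] := eqVneq (i + 1) 0; last first.
    by exists 0, 0; rewrite !linear0 addr0; split=> //; apply: stalk_zero.
  have ie : i = Negz 0 by lia.
  subst i; have [z ze] := ps y; exists (q 0 z), 0; rewrite linear0 addr0; split.
    rewrite -[LHS]/(cd K 0 (q 0 z)) -qd; apply/(qE (0 + 1)).2; constructor 3; lia.
  by have := sE 0 z; rewrite /= ze => ->.
have [qs q0] := qE (i + 1); have [z zE] := qs x.
have [ia|ai] := leP (i + 1) a.
  have [lt|ge] := ltP (i + 1) a.
    by exists 0; rewrite linear0 -zE; apply/esym/q0; constructor 2.
  have ia' : i + 1 = a by lia.
  exists 0; rewrite linear0 -zE; apply/esym/q0; constructor 4; split=> //.
  have /(qE (i + 1 + 1)).2 h : q (i + 1 + 1) (d (i + 1) z) = 0 by rewrite qd zE.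
  by apply: trunc_rel_in h; lia.
have [bi|ib] := ltP 0 (i + 1).
  by exists 0; rewrite linear0 -zE; apply/esym/q0; constructor 3.
have dz : d (i + 1) z = 0.
  have [i0|i0] := eqVneq (i + 1) 0; last first.
    have /(qE (i + 1 + 1)).2 h : q (i + 1 + 1) (d (i + 1) z) = 0 by rewrite qd zE.
    by apply: trunc_rel_in h; lia.
  have ie : i = Negz 0 by lia.
  subst i; apply/pE; have := sE 0 z; rewrite /= => <-; rewrite zE -ye.
  exact (@stalk_d0 R M (Negz 0) y).
have [u uE] := (ex i z).1 dz.
by exists (q i u); rewrite -qd uE zE.
Qed.

(** The map factors through the truncation at 0; the kernel of that first step consists of the
    projectives in degrees 1, ..., b and is perfect. *)
Lemma trunc_stalk_iso a b K (q : umap PU (ucx_of K)) (s : cmap K (stalk M)) :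
  is_trunc a b q -> a < 0 -> 0 <= b -> (forall i x, s i (q i x) = iota i x) -> is_iso (qD s).
Proof.
move=> qE a0 b0 sE; have [K' [q' q'E]] := trunc_ex a 0.
have [f fE] := trunc_map q'E qE (lexx a) b0.
have [s' s'E] := trunc_stalk q'E a0 (lexx 0).
apply: (@is_iso_heq _ _ _ (qD s' ∘ qD f)).
  apply: heq_trans (heq_sym (functor_comp (qD_functor R) _ _)) _.
  apply: (functor_heq (qD_functor R)) => i x; have [qs _] := qE i; have [y <-] := qs x.
  by rewrite sE -s'E -fE.
apply: is_iso_comp; first exact/qD_qi/(trunc_stalk0_qi q'E a0 s'E).
apply: (surj_perfect noethR) => i.
  by move=> y; have [qs _] := q'E i; have [x <-] := qs y; exists (q i x); rewrite fE.
have [qs q0] := qE i; have [qs' q0'] := q'E i.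
have [i0|i0] := ltP 0 i.
  have K0 (x : K' i) : x = 0 by have [y <-] := qs' x; apply/q0'; constructor 3.
  have [bi|ib] := ltP b i.
    right; apply: inj0 => x _; have [y <-] := qs x; apply/q0; by constructor 3.
  left; split=> //.
  have qi : injective (q i).
    by apply: inj0 => x /q0; apply: trunc_rel_in => //; apply: lt_trans a0 i0.
  have [g [_ gK]] := lin_inv qi qs; have [hP _ _ _] := res.
  exact: proj_retract gK (hP i).
right; apply: inj0 => x; have [y <-] := qs x; rewrite fE => /q0' h; apply/q0.
case: h => [y0|ia|bi|[ia dy]]; first by constructor 1.
- by constructor 2.
- lia.
- by constructor 4.
Qed.

(** The Yoneda correspondence as a relation: phi is, up to homotopy, a map f from a truncation of P,
    and al is f composed with the inverse of s. It is shown to be total and single valued, which is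
    what formal inverses require. *)
Definition Theta (X : cpx R) (phi : umap PU (ucx_of X)) (al : @Mor (Dsg R) (stalk M) X) : Prop :=
  exists a b K (q : umap PU (ucx_of K)) (f : cmap K X) (s : cmap K (stalk M)),
    [/\ is_trunc a b q, a < 0 /\ 0 <= b, forall i x, s i (q i x) = iota i x,
        hty (ucomp (umap_of f) q) phi & al ∘ qD s ≡ qD f].

Lemma Theta_ex X (phi : umap PU (ucx_of X)) : exists al, Theta phi al.
Proof.
have [a [b ab]] := cbdd X.
pose a' := Num.min a 0 - 1; pose b' := Num.max b 0.
have [K [q qE]] := trunc_ex a' b'.
have [||s sE] := trunc_stalk qE; [rewrite /a'; lia|rewrite /b'; lia|].
have [|f fE] := trunc_desc (phi := phi) qE.
  move=> i x h; have [/andP[ai ib]|] := boolP ((a' < i) && (i <= b')).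
    by rewrite (trunc_rel_in ai ib h) linear0.
  move=> n; apply: ab; rewrite /a' /b' in n; lia.
have [||g [gs sg]] := trunc_stalk_iso qE _ _ sE; [rewrite /a'; lia|rewrite /b'; lia|].
exists (qD f ∘ g), a', b', K, q, f, s; split=> //.
- by rewrite /a' /b'; split; lia.
- by apply: hty_eq => i x; exact: fE.
- apply: heq_trans (compAA _ gs) _; exact: compm1.
Qed.

Lemma Theta_uniq X (phi : umap PU (ucx_of X)) al al' : Theta phi al -> Theta phi al' -> al ≡ al'.
Proof.
case=> a [b [K [q [f [s [qE [a0 b0] sE fE alE]]]]]].
case=> a' [b' [K' [q' [f' [s' [q'E [a0' b0'] sE' fE' alE']]]]]].
have [c [e ce]] := cbdd X.
(* The bounds reach past those of X, shifted by one upwards because k i starts in degree i + 1, so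
   that the homotopy vanishes wherever L has been cut. *)
pose a1 := Num.min (Num.min a a') c - 1; pose b1 := Num.max (Num.max b b') (e + 1).
have [L [r rE]] := trunc_ex a1 b1.
have [||g gE] := trunc_map qE rE; [rewrite /a1; lia|rewrite /b1; lia|].
have [||g' gE'] := trunc_map q'E rE; [rewrite /a1; lia|rewrite /b1; lia|].
have [h hE] := hty_trans fE (hty_sym fE').
have [k kE] : exists k : forall i, {linear L (i + 1) -> X i},
    forall i (x : P (i + 1)), k i (r (i + 1) x) = h i x.
  have /dchoice[k kE] i : exists k : {linear L (i + 1) -> X i},
      forall x : P (i + 1), k (r (i + 1) x) = h i x.
    have [rs r0] := rE (i + 1); apply: fac_surj rs _ => x /r0 t.
    have [/andP[ai ib]|n] := boolP ((a1 < i + 1) && (i + 1 <= b1)).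
      by rewrite (trunc_rel_in ai ib t) linear0.
    by apply: ce; rewrite /a1 /b1 in n; lia.
  by exists k.
have e1 : qD (cmap_comp f g) ≡ qD (cmap_comp f' g').
  apply: hty_qD; exists k => i x; have [rs _] := rE (i + 1); have [y <-] := rs x.
  change (f (i + 1) (g (i + 1) (r (i + 1) y)) - f' (i + 1) (g' (i + 1) (r (i + 1) y)) =
    cd X i (k i (r (i + 1) y)) + k (i + 1) (cd L (i + 1) (r (i + 1) y))).
  rewrite gE gE' kE; have := umP r y; rewrite /= => ->; rewrite kE; exact: hE.
have Fc := functor_comp (qD_functor R).
have sg : qD (cmap_comp s g) ≡ qD (cmap_comp s' g').
  apply: (functor_heq (qD_functor R)) => i x; have [rs _] := rE i; have [y <-] := rs x.
  by change (s i (g i (r i y)) = s' i (g' i (r i y))); rewrite gE gE' sE sE'.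
apply: (@iso_cancel_r _ _ _ _ (qD (cmap_comp s g))).
  apply: (trunc_stalk_iso rE); [rewrite /a1; lia|rewrite /b1; lia|].
  by move=> i x; change (s i (g i (r i x)) = iota i x); rewrite gE sE.
have step (A B : cpx R) (u : cmap B X) (v : cmap B (stalk M)) (w : cmap A B) be :
    be ∘ qD v ≡ qD u -> be ∘ qD (cmap_comp v w) ≡ qD (cmap_comp u w).
  move=> E; apply: heq_trans (comp_heq (heq_refl _) (Fc _ _ _ _ _)) _.
  apply: heq_trans (compAl _ E) _; exact: heq_sym (Fc _ _ _ _ _).
apply: heq_trans (step _ _ _ _ _ _ alE) _; apply: heq_trans e1 _.
apply: heq_sym; apply: heq_trans (comp_heq (heq_refl _) sg) _.
exact: step alE'.
Qed.

Lemma Theta_hty X (phi psi : umap PU (ucx_of X)) al be :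
  hty phi psi -> al ≡ be -> Theta phi al -> Theta psi be.
Proof.
move=> pp ab [a [b [K [q [f [s [qE ab0 sE fE alE]]]]]]].
exists a, b, K, q, f, s; split=> //; first exact: hty_trans fE pp.
by apply: heq_trans alE; apply: comp_heq (heq_sym ab) (heq_refl _).
Qed.

Lemma Theta_iota : Theta iota (idm _).
Proof.
have [K [q qE]] := trunc_ex (-1) 0.
have [//|//|s sE] := trunc_stalk qE; exists (-1), 0, K, q, s, s; split=> //.
  by apply: hty_eq => i x; exact: sE.
exact: comp1m.
Qed.

Lemma Theta_arr X Y (f : cmap X Y) (phi : umap PU (ucx_of X)) al :
  Theta phi al -> Theta (ucomp (umap_of f) phi) (qD f ∘ al).
Proof.
case=> a [b [K [q [g [s [qE ab0 sE fE alE]]]]]].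
exists a, b, K, q, (cmap_comp f g), s; split=> //.
  by apply: hty_trans (hty_compl (umap_of f) fE); apply: hty_eq.
apply: heq_trans (compAA _ alE) _.
exact: heq_sym (functor_comp (qD_functor R) _ _).
Qed.

(** Induction on words in two layers, first for D^b and then for D_sg. Chain maps and compositions
    are direct. *)
Lemma Theta_natural : exists G1 : forall X Y : Dsg R, Mor X Y ->
    setmap (hset PU (ucx_of X)) (hset PU (ucx_of Y)),
  [/\ forall X Y (v v' : @Mor (Dsg R) X Y) phi, v ≡ v' -> hty (G1 X Y v phi) (G1 X Y v' phi),
      forall (X Y : cpx R) (f : cmap X Y) phi, hty (G1 X Y (qD f) phi) (ucomp (umap_of f) phi) &
      forall X Y (v : @Mor (Dsg R) X Y) phi al, Theta phi al -> Theta (G1 X Y v phi) (v ∘ al)].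
Proof.
have [G1 [[Ge Gi Gc] GE]] := hom_dsg_functor res_tot_acyclic.
exists G1; split=> [X Y v v' phi vv|//|]; first exact: Ge vv phi.
pose N (X Y : Dsg R) (v : Mor X Y) := forall phi al, Theta phi al -> Theta (G1 X Y v phi) (v ∘ al).
(* For an inverse v', a partner of v' phi exists; applying v to it gives a partner of phi, which
   uniqueness identifies with al. *)
have Ninv (X Y : Dsg R) (v : Mor X Y) (v' : Mor Y X) :
    v' ∘ v ≡ idm X -> v ∘ v' ≡ idm Y -> N X Y v -> N Y X v'.
  move=> v'v vv' Nv phi al h; have [be hb] := Theta_ex (G1 Y X v' phi).
  have hb' := Nv _ _ hb; have e : hty (G1 X Y v (G1 Y X v' phi)) phi.
    apply: hty_trans (Gi Y phi); apply: hty_trans (Ge _ _ _ _ vv' phi).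
    exact: hty_sym (Gc _ _ _ v v' phi).
  have ab := Theta_uniq h (Theta_hty e (heq_refl _) hb').
  apply: Theta_hty (hty_refl _) _ hb.
  apply: heq_sym; apply: heq_trans (comp_heq (heq_refl _) ab) _.
  by apply: heq_trans (compAl _ v'v) _; apply: comp1m.
have Nc (X Y Z : Dsg R) (v : Mor Y Z) (u : Mor X Y) : N _ _ v -> N _ _ u -> N _ _ (v ∘ u).
  move=> Nv Nu phi al /Nu/Nv h; apply: Theta_hty h.
    exact: hty_sym (Gc _ _ _ v u phi).
  exact: Defs.compA.
have NqD (X Y : cpx R) (f : cmap X Y) : N X Y (qD f).
  move=> phi al h; apply: Theta_hty (Theta_arr f h); last exact: heq_refl.
  exact: hty_sym (GE _ _ f phi).
have Nw (X Y : Db R) (v : Mor X Y) : N X Y (Arr _ v).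
  have Nheq (A B : Dsg R) (u u' : Mor A B) : u ≡ u' -> N A B u -> N A B u'.
    move=> uu Nu phi al /Nu; apply: Theta_hty; first exact: Ge.
    exact: comp_heq uu (heq_refl _).
  have aF := @arr_functor (Db R) (@cone_in (Db R) (@perfect R)).
  elim: v => {X Y} [X Y f|X Y s Ws|X Y Z v Nv u Nu].
  - exact: NqD.
    have vs : (Inv Ws : @Mor (Db R) Y X) ∘ bD s ≡ idm _ by apply: weq_invl.
    have sv : bD s ∘ (Inv Ws : @Mor (Db R) Y X) ≡ idm _ by apply: weq_invr.
    apply: (Ninv _ _ (qD s)); last exact: NqD.
      exact: heq_trans (heq_sym (functor_comp aF _ _)) (functor_heq aF vs).
    exact: heq_trans (heq_sym (functor_comp aF _ _)) (functor_heq aF sv).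
  - by apply: (Nheq _ _ _ _ (heq_sym (functor_comp aF _ _))); apply: Nc.
move=> X Y v; elim: v => {X Y} [X Y f|X Y s Ws|X Y Z v Nv u Nu].
- exact: Nw.
- by apply: (Ninv _ _ (Arr _ s)); [apply: weq_invl|apply: weq_invr|apply: Nw].
- exact: Nc.
Qed.

(** [iota] corresponds to the identity of M. Its image under al is a chain map P -> N, whose
    component in degree 0 kills boundaries and so factors through M. *)
Lemma stalk_full (N : fgmod R) (al : @Mor (Dsg R) (stalk M) (stalk N)) :
  exists g : {linear M -> N}, qD (stalk_map g) ≡ al.
Proof.
have [G1 [Ge GE GT]] := Theta_natural; have [_ _ _ [ps pE]] := res.
pose phi : umap PU (ucx_of (stalk N)) := G1 _ _ al iota.
have [|g gE] := fac_surj (f := phi 0) ps.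
  move=> x /pE dx; have [_ ex _ _] := res.
  have [y <-] := (ex (Negz 0) x).1 dx.
  by have := umP phi (y : PU (Negz 0)); rewrite stalk_ud0 => <-.
exists g; apply: heq_trans (heq_sym (compm1 _)) _; apply: (heq_trans _ (compm1 al)).
apply: Theta_uniq (GT _ _ al _ _ Theta_iota).
apply: Theta_hty (Theta_arr (stalk_map g) Theta_iota); last exact: heq_refl.
apply: hty_eq => i x; have [i0|i0] := eqVneq i 0.
  by subst i; exact: gE.
by rewrite (stalk_zero i0 (phi i x)); apply: (stalk_zero i0).
Qed.

(** In degree 0 a homotopy between f iota and g iota has a single nonzero term, h 0 after d 0, and
    this one passes through P 1. *)
Lemma stalk_faithful (N : fgmod R) (f g : {linear M -> N}) :
  qD (stalk_map f) ≡ qD (stalk_map g) ->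
  exists (Q : fgmod R) (a : {linear M -> Q}) (b : {linear Q -> N}),
    projective_module Q /\ forall x, f x - g x = b (a x).
Proof.
move=> fg; have [G1 [Ge GE _]] := Theta_natural; have [hP ex _ [ps pE]] := res.
have := hty_trans (hty_sym (GE _ _ (stalk_map f) iota))
  (hty_trans (Ge _ _ _ _ iota fg) (GE _ _ (stalk_map g) iota)).
case=> h hE; have [|a aE] := fac_surj (f := d 0) ps; first by move=> x /pE.
exists (P 1), a, (h 0); split=> // x; have [y <-] := ps x; rewrite aE.
have := hE (Negz 0) y; rewrite stalk_ud0 add0r; exact.
Qed.

End Truncation.
End StalkHom.

(** * The connecting morphism *)

Section Delta.
Variable R : comNzRingType.

Section ConeMap.
Variables (X Y X' Y' : cpx R) (u : cmap X Y) (u' : cmap X' Y') (a : cmap X X') (b : cmap Y Y').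
Hypothesis sq : forall i x, b i (u i x) = u' i (a i x).

Fact cone_cmapP i (z : cone u i) :
  cd (cone u') i (lpair (lcomp (a (i + 1)) (lfst (X (i + 1)) (Y i))) (lcomp (b i) (lsnd (X (i + 1)) (Y i))) z) =
  lpair (lcomp (a (i + 1 + 1)) (lfst (X (i + 1 + 1)) (Y (i + 1))))
    (lcomp (b (i + 1)) (lsnd (X (i + 1 + 1)) (Y (i + 1)))) (cd (cone u) i z).
Proof.
rewrite !cone_dE; apply/pair_equal_spec; split; rewrite /= ?lE /=.
  by rewrite (linearN (a _)) cmP.
by rewrite (linearD (b _)) sq cmP.
Qed.

Definition cone_cmap : cmap (cone u) (cone u') := Cmap cone_cmapP.

Lemma cone_cmapE i z : cone_cmap i z = (a (i + 1) z.1, b i z.2).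
Proof. by []. Qed.

End ConeMap.

Fact cmap_oppP (X : cpx R) i x : cd X i (lopp (lid (X i)) x) = lopp (lid (X (i + 1))) (cd X i x).
Proof. by rewrite !lE linearN. Qed.
Definition cmap_opp (X : cpx R) : cmap X X := Cmap (@cmap_oppP X).

Definition ncone_pr (X Y : cpx R) (u : cmap X Y) : cmap (cone u) (shift X) :=
  cmap_comp (cmap_opp (shift X)) (cone_pr u).

Lemma ncone_prE X Y (u : cmap X Y) i z : ncone_pr u i z = - z.1.
Proof. by []. Qed.

Lemma stalk_eq (N : fgmod R) i (x y : stalk N i) : (i = 0 -> x = y) -> x = y.
Proof.
have [i0|i0 _] := eqVneq i 0; first by move/(_ i0).
by rewrite (stalk_zero i0 x) (stalk_zero i0 y).
Qed.

Lemma stalk_ses (L M N : fgmod R) (f : {linear L -> M}) (g : {linear M -> N}) :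
  short_exact f g -> forall i, short_exact (stalk_map f i) (stalk_map g i).
Proof.
move=> fg i; have [i0|i0] := eqVneq i 0; first by subst i.
split=> [x y _|y|z]; first by rewrite (stalk_zero i0 x) (stalk_zero i0 y).
  by split=> _; [exists 0; rewrite linear0; apply/esym/stalk_zero|apply: stalk_zero].
by exists 0; rewrite linear0; apply/esym/stalk_zero.
Qed.

Lemma stalk_proj (M : fgmod R) : projective_module M -> forall i, projective_module (stalk M i).
Proof. by move=> hM [[|n]|n] //=; apply: projective_zero. Qed.

Lemma stalk_map_id (M : fgmod R) i x : stalk_map (lid M) i x = x.
Proof. by case: i x => [[|n]|n] x. Qed.

Lemma stalk_map_comp (L M N : fgmod R) (g : {linear M -> N}) (f : {linear L -> M})
    (h : {linear L -> N}) : (forall x, h x = g (f x)) ->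
  forall i x, stalk_map h i x = stalk_map g i (stalk_map f i x).
Proof. by move=> e i x; apply: stalk_eq => i0; subst i; exact: e. Qed.

Lemma stalk_map_eq (M N : fgmod R) (f g : {linear M -> N}) :
  f =1 g -> forall i x, stalk_map f i x = stalk_map g i x.
Proof. by move=> e i x; apply: stalk_eq => i0; subst i; exact: e. Qed.

Lemma qD_stalk_comp (L M N : fgmod R) (g : {linear M -> N}) (f : {linear L -> M})
    (h : {linear L -> N}) : (forall x, h x = g (f x)) ->
  qD (stalk_map h) ≡ qD (stalk_map g) ∘ qD (stalk_map f).
Proof.
move=> /stalk_map_comp e; apply: heq_trans (functor_comp (qD_functor R) _ _).
exact: (functor_heq (qD_functor R)).
Qed.

Lemma qD_stalk_eq (M N : fgmod R) (f g : {linear M -> N}) :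
  f =1 g -> qD (stalk_map f) ≡ qD (stalk_map g).
Proof. by move=> /stalk_map_eq; apply: (functor_heq (qD_functor R)). Qed.

Lemma qD_stalk_id (M : fgmod R) (f : {linear M -> M}) :
  (forall x, f x = x) -> qD (stalk_map f) ≡ idm _.
Proof.
move=> e; apply: heq_trans (functor_id (qD_functor R) _).
by apply: (functor_heq (qD_functor R)) => i x; rewrite -[RHS](stalk_map_id (M := M)); apply: stalk_map_eq.
Qed.

(* [f] and [g] agree after adding [Q] to the target of (1, a), and the two
   sections (1, a) and (1, 0) of M + Q -> M have the same image in D_sg. *)
Lemma stalk_stable (M N Q : fgmod R) (f g : {linear M -> N}) (a : {linear M -> Q})
    (b : {linear Q -> N}) : projective_module Q -> (forall x, f x - g x = b (a x)) ->
  qD (stalk_map f) ≡ qD (stalk_map g).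
Proof.
move=> hQ e; pose MQ := fgmod_sum M Q.
pose pr : {linear MQ -> M} := lfst M Q; pose k : {linear MQ -> N} := lcopair g b.
have prI : is_iso (qD (stalk_map pr)).
  apply: (@ses_perfect_l _ _ _ _ (stalk_map (linr M Q : {linear Q -> MQ})) (stalk_map pr)).
    apply: stalk_ses; split=> [x y [] //|[x y]|x]; last by exists (x, 0).
    by split=> [/= ->|[z [<-]] //]; exists y.
  exact: stalk_proj.
have sec : qD (stalk_map (lpair (lid M) a : {linear M -> MQ})) ≡
           qD (stalk_map (lpair (lid M) (lzero M Q) : {linear M -> MQ})).
  apply: (iso_cancel_l prI).
  apply: heq_trans (heq_sym (qD_stalk_comp (h := lid M) _)) (qD_stalk_comp _) => x //.
have fE : qD (stalk_map f) ≡ qD (stalk_map k) ∘ qD (stalk_map (lpair (lid M) a : {linear M -> MQ})).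
  by apply: qD_stalk_comp => x; rewrite !lE /= -e [RHS]addrC subrK.
have gE : qD (stalk_map g) ≡
    qD (stalk_map k) ∘ qD (stalk_map (lpair (lid M) (lzero M Q) : {linear M -> MQ})).
  by apply: qD_stalk_comp => x; rewrite !lE /= linear0 addr0.
apply: heq_trans fE _; apply: heq_trans (heq_sym gE); exact: comp_heq (heq_refl _) sec.
Qed.

(* The connecting morphism C -> A[1] of a short exact sequence A -> I -> C; the
   sign makes the image of a pushout triangle distinguished. *)
Definition is_delta (A I C : fgmod R) (j : {linear A -> I}) (p : {linear I -> C})
    (del : @Mor (Dsg R) (stalk C) (shift (stalk A))) : Prop :=
  forall q : cmap (cone (stalk_map j)) (stalk C),
    (forall i z, q i z = stalk_map p i z.2) -> del ∘ qD q ≡ qD (ncone_pr (stalk_map j)).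

Section DeltaOf.
Variables (A I C : fgmod R) (j : {linear A -> I}) (p : {linear I -> C}).
Hypothesis jp : short_exact j p.

Lemma delta_ex : exists del, is_delta j p del.
Proof.
have [q [qq qE]] := ses_cone_qi (stalk_ses jp).
have [g [gq _]] := qD_qi qq.
exists (qD (ncone_pr (stalk_map j)) ∘ g) => q' q'E.
have e : qD q' ≡ qD q by apply: (functor_heq (qD_functor R)) => i z; rewrite qE q'E.
apply: heq_trans (comp_heq (heq_refl _) e) _.
by apply: heq_trans (compAA _ gq) _; apply: compm1.
Qed.

Lemma delta_iso del : is_delta j p del -> projective_module I -> is_iso del.
Proof.
move=> dE IP; have [q [qq qE]] := ses_cone_qi (stalk_ses jp).
apply: (iso_cancel2r (qD_qi qq)); apply: (is_iso_heq (heq_sym (dE _ qE))).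
apply: (@ses_perfect_l _ _ _ _ (cone_inl (stalk_map j)) (ncone_pr (stalk_map j))); last exact: stalk_proj.
move=> i; split=> [x y [] //|[x y]|x]; last by exists (- x, 0); rewrite ncone_prE /= opprK.
rewrite ncone_prE /=; split=> [/eqP|[z [<- _]]]; last by rewrite oppr0.
by rewrite oppr_eq0 => /eqP ->; exists y.
Qed.
End DeltaOf.

Lemma delta_nat (A I C A' I' C' : fgmod R) (j : {linear A -> I}) (p : {linear I -> C})
    (j' : {linear A' -> I'}) (p' : {linear I' -> C'}) del del'
    (f : {linear A -> A'}) (h : {linear I -> I'}) (k : {linear C -> C'}) :
  short_exact j p -> short_exact j' p' -> is_delta j p del -> is_delta j' p' del' ->
  (forall x, h (j x) = j' (f x)) -> (forall x, p' (h x) = k (p x)) ->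
  qD (shift_map (stalk_map f)) ∘ del ≡ del' ∘ qD (stalk_map k).
Proof.
move=> jp jp' dE dE' hj ph; have [q [qq qE]] := ses_cone_qi (stalk_ses jp).
have [q' [_ qE']] := ses_cone_qi (stalk_ses jp').
have sq i x : stalk_map h i (stalk_map j i x) = stalk_map j' i (stalk_map f i x).
  by rewrite -(stalk_map_comp (h := lcomp h j)) // -(stalk_map_comp (h := lcomp h j)) // => y; rewrite lE hj.
have Fc := functor_comp (qD_functor R); have Fe := functor_heq (qD_functor R).
apply: (iso_cancel_r (qD_qi qq)).
apply: heq_trans (compAA _ (dE _ qE)) _; apply: heq_trans (heq_sym (Fc _ _ _ _ _)) _.
have e1 : qD (stalk_map k) ∘ qD q ≡ qD q' ∘ qD (cone_cmap sq).
  apply: heq_trans (heq_sym (Fc _ _ _ _ _)) _; apply: heq_trans (Fc _ _ _ _ _).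
  apply: Fe => i z; change (stalk_map k i (q i z) = q' i (cone_cmap sq i z)).
  rewrite qE qE' cone_cmapE /=.
  by rewrite -(stalk_map_comp (h := lcomp k p)) // -(stalk_map_comp (h := lcomp k p)) // => y; rewrite lE ph.
apply: heq_sym; apply: heq_trans (compAA _ e1) _; apply: heq_trans (compAl _ (dE' _ qE')) _.
apply: heq_trans (heq_sym (Fc _ _ _ _ _)) _; apply: Fe => i z.
change (- stalk_map f (i + 1) z.1 = stalk_map f (i + 1) (- z.1)).
by rewrite linearN.
Qed.

(** Z is the pushout of I and B along A, so A -> I + B -> Z is exact and Z becomes the cone of (j,
    -u). Discarding the projective I turns this into the cone of u; the sign of u is absorbed by -1
    on A, which is also the sign in [ncone_pr]. *)
Lemma delta_cone (A I C B Z : fgmod R) (j : {linear A -> I}) (p : {linear I -> C}) del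
    (u : {linear A -> B}) (v : {linear B -> Z}) (t : {linear Z -> C}) (h : {linear I -> Z}) :
  short_exact j p -> is_delta j p del -> projective_module I -> short_exact v t ->
  (forall x, h (j x) = v (u x)) -> (forall x, t (h x) = p x) ->
  exists c : @Mor (Dsg R) (stalk Z) (cone (stalk_map u)), [/\ is_iso c,
    c ∘ qD (stalk_map v) ≡ qD (cone_inl (stalk_map u)) &
    del ∘ qD (stalk_map t) ≡ qD (cone_pr (stalk_map u)) ∘ c].
Proof.
move=> jp dE IP vt hj th; have [ji je ps] := jp; have [vi ve ts] := vt.
pose IB := fgmod_sum I B.
pose e : {linear A -> IB} := lpair j (lopp u); pose m : {linear IB -> Z} := lcopair h v.
have em : short_exact e m.
  split=> [x y [/ji] //|[x y]|z].
    rewrite /m !lE /=; split=> [s|[a [<- <-]]]; last by rewrite hj linearN subrr.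
    have [a aE] : exists a, j a = x.
      by apply/je; rewrite -th -[h x](addrK (v y)) s sub0r linearN (ses_comp0 _ ve) oppr0.
    exists a; rewrite aE; congr (_, _); apply: vi; rewrite linearN -hj aE.
    by apply/eqP; rewrite eq_sym -addr_eq0 addrC s.
  have [x xE] := ps (t z); have [y yE] : exists y, v y = z - h x.
    by apply/ve; rewrite linearB th xE subrr.
  by exists (x, y); rewrite /m !lE /= yE [LHS]addrC subrK.
have [q [qq qE]] := ses_cone_qi (stalk_ses em).
have [q0 [qq0 qE0]] := ses_cone_qi (stalk_ses jp).
have [g [gq qg]] := qD_qi qq.
have sq1 i x : stalk_map (lsnd I B : {linear IB -> B}) i (stalk_map e i x) =
    stalk_map u i (cmap_opp (stalk A) i x).
  rewrite -[cmap_opp _ i x]/(- x) linearN.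
  by apply: stalk_eq => i0; subst i.
have sq2 i x : stalk_map (lfst I B : {linear IB -> I}) i (stalk_map e i x) =
    stalk_map j i (cmap_id (stalk A) i x).
  by apply: stalk_eq => i0; subst i.
have Fc := functor_comp (qD_functor R); have Fe := functor_heq (qD_functor R).
pose m1 := cone_cmap sq1; pose m2 := cone_cmap sq2.
have linP i (x : stalk I i) : cd (cone (stalk_map e)) i (lcomp (linr _ _) (stalk_map (linl I B : {linear I -> IB}) i) x) =
    lcomp (linr (stalk A (i + 1 + 1)) (stalk IB (i + 1))) (stalk_map (linl I B : {linear I -> IB}) (i + 1)) (cd (stalk I) i x).
  rewrite cone_dE; apply/pair_equal_spec; split; first exact: oppr0.
  change (stalk_map e (i + 1) 0 + 0 = stalk_map (linl I B : {linear I -> IB}) (i + 1) 0).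
  by rewrite addr0 !linear0.
(* m1 is surjective with kernel the stalk of the projective I. *)
have m1I : is_iso (qD m1).
  apply: (@ses_perfect_l _ (stalk I) _ _ (Cmap linP) m1); last exact: stalk_proj.
  move=> i; split=> [x y /= [] |[x z]|[x y]].
  - have [i0|i0] := eqVneq i 0; last by rewrite (stalk_zero i0 x) (stalk_zero i0 y).
    by subst i => -[].
  - rewrite cone_cmapE -[cmap_opp _ _ _]/(- x); split=> [[/eqP]|[y [<- <-]]]; last first.
      rewrite oppr0; congr (_, _).
      by apply: stalk_eq => i0; subst i.
    rewrite oppr_eq0 => /eqP -> z0; exists (stalk_map (lfst I B : {linear IB -> I}) i z).
    congr (_, _); have [i0|i0] := eqVneq i 0; last by rewrite (stalk_zero i0 z) !linear0.
    by subst i; case: z z0 => z1 z2 /= ->.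
  - exists (- x, stalk_map (linr I B : {linear B -> IB}) i y).
    rewrite cone_cmapE; congr (_, _); first exact: opprK.
    by apply: stalk_eq => i0; subst i.
exists (qD m1 ∘ g); split.
- by apply: is_iso_comp => //; exists (qD q).
- pose v' := cmap_comp (cone_inl (stalk_map e)) (stalk_map (linr I B : {linear B -> IB})).
  have ev : qD (stalk_map v) ≡ qD q ∘ qD v'.
    apply: heq_trans (Fc _ _ _ _ _); apply: Fe => i y.
    change (stalk_map v i y = q i (v' i y)); rewrite qE.
    apply: stalk_eq => i0; subst i.
    by change (v y = h 0 + v y); rewrite linear0 add0r.
  apply: heq_trans (comp_heq (heq_refl _) ev) _.
  apply: heq_trans (heq_sym (Defs.compA _ _ _)) _.
  apply: heq_trans (comp_heq (heq_refl _) (compAl _ gq)) _.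
  apply: heq_trans (comp_heq (heq_refl _) (comp1m _)) _.
  apply: heq_trans (heq_sym (Fc _ _ _ _ _)) _; apply: Fe => i y.
  change (m1 i (v' i y) = (0, y)); rewrite cone_cmapE; congr (_, _); first exact: oppr0.
  by apply: stalk_eq => i0; subst i.
- apply: (iso_cancel_r (qD_qi qq)).
  have et : qD (stalk_map t) ∘ qD q ≡ qD q0 ∘ qD m2.
    apply: heq_trans (heq_sym (Fc _ _ _ _ _)) _; apply: heq_trans (Fc _ _ _ _ _).
    apply: Fe => i z; change (stalk_map t i (q i z) = q0 i (m2 i z)).
    rewrite qE qE0 cone_cmapE /=.
    apply: stalk_eq => i0; subst i; case: z => x0 [x y].
    by change (t (h x + v y) = p x); rewrite linearD th (ses_comp0 _ ve) addr0.
  apply: heq_trans (compAA _ et) _; apply: heq_trans (compAl _ (dE _ qE0)) _.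
  apply: heq_sym; apply: heq_trans (compAA _ (compAA _ gq)) _.
  apply: heq_trans (comp_heq (heq_refl _) (compm1 _)) _.
  apply: heq_trans (heq_sym (Fc _ _ _ _ _)) _; apply: heq_trans (Fc _ _ _ _ _).
  exact: Fe.
Qed.

End Delta.

(** * Objects of Mon(w, G) *)

Section MonObjects.
Variables (S : comNzRingType) (w : S).
Hypothesis wreg : GRing.lreg w.
(** The class G of admissible sources is abstract: it is instantiated with the Gorenstein
    projectives for Mon(w, G) and with the projectives for Mon(w, P). *)
Variables (A : addsub S) (G : fgmod S -> Prop).
Hypothesis hG : gclass G.
Hypothesis hGp : forall P : fgmod S, projective_module P -> G P.
Hypothesis hGs : forall P M : fgmod S, projective_module P -> G M -> G (fgmod_sum P M).
Hypothesis hA : forall X : morobj S, A X <->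
  [/\ injective (mmap X), G (msrc X), projective_module (mtgt X) & kills_coker w X].
Implicit Types (X Y Z : subobj A) (P Q : fgmod S).

Lemma proj_reg P : projective_module P -> injective (lscale w (lid P)).
Proof.
move=> hP; have [n [p ps]] := fg_cover (fg_prop P).
have [s sK] := proj_section hP ps.
apply: inj0 => x; rewrite !lE => e; rewrite -[x]sK -[RHS](linear0 p); congr (p _).
apply/rowP => i; rewrite !mxE; apply: wreg; rewrite mulr0.
have /rowP/(_ i) : w *: s x = 0 by rewrite -linZ e linear0.
by rewrite !mxE.
Qed.

Lemma class_reg (M : fgmod S) : G M -> injective (lscale w (lid M)).
Proof.
case: hG => hn _ _ /hn[N _ [P [i [p [hP [ii _ _]]]]]].
apply: inj0 => x; rewrite !lE => e; apply: ii; rewrite linear0; apply: (proj_reg hP).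
by rewrite linear0 !lE -linZ e linear0.
Qed.

Lemma mon_inj X : injective (mmap X). Proof. by case: ((hA X).1 (so_prop X)). Qed.
Lemma mon_src X : G (msrc X). Proof. by case: ((hA X).1 (so_prop X)). Qed.
Lemma mon_tgt X : projective_module (mtgt X). Proof. by case: ((hA X).1 (so_prop X)). Qed.

(* f and its companion form a matrix factorization of w. *)
Lemma mon_factor X : exists c : {linear mtgt X -> msrc X},
  (forall y, mmap X (c y) = w *: y) /\ forall x, c (mmap X x) = w *: x.
Proof.
have [_ _ _ kX] := (hA X).1 (so_prop X).
have [|c cE] := fac_inj (f := lscale w (lid (mtgt X))) (@mon_inj X).
  by move=> y; apply: kX.
exists c; split=> [y|x]; first by rewrite cE !lE.
by apply: (@mon_inj X); rewrite cE !lE linZ.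
Qed.

Definition mfac X : {linear mtgt X -> msrc X} := projT1 (cid (mon_factor X)).
Lemma mfacE X y : mmap X (mfac X y) = w *: y.
Proof. by rewrite /mfac; case: cid => c []. Qed.
Lemma mfacK X x : mfac X (mmap X x) = w *: x.
Proof. by rewrite /mfac; case: cid => c []. Qed.

Lemma mor_ext X Y (f g : morhom X Y) : mor0 f =1 mor0 g -> mor_eq f g.
Proof. by move=> fg; split=> // x; apply: (@mon_inj Y); rewrite -!mor_sq fg. Qed.

Definition jmap P Q : {linear fgmod_sum P Q -> fgmod_sum P Q} :=
  lpair (lfst P Q) (lscale w (lsnd P Q)).
Definition jobj P Q : morobj S := MorObj (jmap P Q).

Lemma jobj_in P Q : projective_module P -> projective_module Q -> A (jobj P Q).
Proof.
move=> hP hQ; apply/hA; split.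
- by move=> [x y] [x' y'] [-> /(proj_reg hQ) ->].
- exact/hGp/projective_sum.
- exact: projective_sum.
- by move=> [x y]; exists (w *: x, y).
Qed.

Definition jsub P Q (hP : projective_module P) (hQ : projective_module Q) : subobj A :=
  SubObj (jobj_in hP hQ).

(** A morphism to (P = P) + (Q -w-> Q) is a map of the target into P and a map of the source into Q;
    the partner [mfac X] in the matrix factorization supplies the other components. *)
Fact to_j_sq X P Q (a : {linear mtgt X -> P}) (b : {linear msrc X -> Q}) x :
  lpair a (lcomp b (mfac X)) (mmap X x) = mmap (jobj P Q) (lpair (lcomp a (mmap X)) b x).
Proof. by apply/pair_equal_spec; split=> //=; rewrite mfacK linZ. Qed.
Definition to_j X P Q a b : morhom X (jobj P Q) := @MorHom S X (jobj P Q) _ _ (@to_j_sq X P Q a b).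

Fact from_j_sq X P Q (a : {linear P -> msrc X}) (b : {linear Q -> mtgt X}) z :
  lcopair (lcomp (mmap X) a) b (mmap (jobj P Q) z) = mmap X (lcopair a (lcomp (mfac X) b) z).
Proof. by rewrite !lE linearD mfacE; congr (_ + _); exact: linZ. Qed.
Definition from_j X P Q a b : morhom (jobj P Q) X := @MorHom S (jobj P Q) X _ _ (@from_j_sq X P Q a b).

Section JObject.
Variables (P Q : fgmod S) (hP : projective_module P) (hQ : projective_module Q).

Lemma from_jP X (f : morhom (jsub hP hQ) X) :
  mor_eq f (from_j (lcomp (mor1 f) (linl P Q)) (lcomp (mor0 f) (linr P Q))).
Proof.
apply: (@mor_ext (jsub hP hQ) X) => -[x y].
change (mor0 f (x, y) = mmap X (mor1 f (x, 0)) + mor0 f (0, y)).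
rewrite -mor_sq -linearD; congr (mor0 f _).
by apply/pair_equal_spec; split; rewrite /= ?scaler0 ?addr0 ?add0r.
Qed.

Lemma jsub_proj : proj_obj (jsub hP hQ).
Proof.
move=> X Y Z i p f [[_ _ p1s] [_ _ p0s]]; have [f1 f0] := from_jP f.
have [a aE] := hP (lcomp (mor1 f) (linl P Q)) p1s.
have [b bE] := hQ (lcomp (mor0 f) (linr P Q)) p0s.
exists (from_j a b : morhom (jsub hP hQ) Y); apply: (@mor_ext (jsub hP hQ) Z) => z.
change (mor0 p (mmap Y (a z.1) + b z.2) = mor0 f z).
by rewrite linearD bE mor_sq aE f0.
Qed.

End JObject.

(** X embeds by the identity of its target P and an embedding e of its source in a projective Q with
    cosyzygy G'. Since Ext^1(G', P) = 0, [mmap X] extends to f' on Q, and f' identifies the source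
    of the quotient with P + G'. *)
Lemma hull_ex X : exists P Q (hP : projective_module P) (hQ : projective_module Q) X'
  (i : morhom X (jsub hP hQ)) (p : morhom (jsub hP hQ) X'), conflation i p.
Proof.
have [hn _ hext] := hG; have [G' GG' [Q [e [r [hQ er]]]]] := hn _ (mon_src X).
have [ei ee rs] := er; pose P := mtgt X; have hP : projective_module P := @mon_tgt X.
have [_ -> // [f' f'E]] := hext _ P GG' hP _ _ _ _ er (mmap X).
have {}f'E x : f' (e x) = mmap X x by rewrite f'E scale1r.
pose b := lcomp e (mfac X).
have [|k kE] := fac_surj (f := lsub (lscale w (lid Q)) (lcomp b f')) rs.
  by move=> q /ee[x <-]; rewrite !lE f'E mfacK linZ subrr.
pose h : {linear fgmod_sum P G' -> Q} := lcopair (lopp b) k.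
have hE x q : h (x, r q) = w *: q - b (x + f' q).
  by rewrite /h !lE /= kE !lE (linearD (mfac X)) (linearD e) opprD addrCA.
have hX : A (MorObj h).
  apply/hA; split=> //; [|exact: hGs|].
    change (injective h); apply: inj0 => -[x t]; have [q <-] := rs t; rewrite hE => /eqP.
    rewrite subr_eq0 => /eqP wq.
    have [g gE] : exists g, e g = q.
      apply/ee; apply: (class_reg GG'); rewrite linear0 !lE -linZ wq.
      exact: ses_comp0 ee.
    have : x + f' q = mmap X g.
      apply: (proj_reg hP); rewrite !lE -!mfacE; congr (mmap X _); apply: ei.
      by rewrite mfacK linZ gE wq.
    rewrite -gE f'E -[RHS]add0r => /addIr ->; congr (_, _); exact: ses_comp0 ee.
  by move=> q; exists (- f' q, r q); rewrite hE addNr linear0 subr0.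
pose p1 : {linear fgmod_sum P Q -> fgmod_sum P G'} :=
  lpair (lsub (lfst P Q) (lcomp f' (lsnd P Q))) (lcomp r (lsnd P Q)).
pose p0 : {linear fgmod_sum P Q -> Q} := lsub (lsnd P Q) (lcomp b (lfst P Q)).
have sq z : p0 (mmap (jobj P Q) z) = mmap (MorObj h) (p1 z).
  change (w *: z.2 - b z.1 = h (z.1 - f' z.2, r z.2)); by rewrite hE subrK.
exists P, Q, hP, hQ, (SubObj hX), (to_j (lid P) e), (@MorHom S (jobj P Q) (MorObj h) _ _ sq).
split; split.
- by move=> x y /= [_ /ei].
- move=> [x q]; change ((x - f' q, r q) = 0 <-> exists g, (mmap X g, e g) = (x, q)).
  split=> [[/eqP + /ee[g gE]]|[g [<- <-]]].
    by rewrite subr_eq0 => /eqP ->; exists g; rewrite -gE f'E.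
  by rewrite f'E subrr (ses_comp0 _ ee).
- move=> [x t]; have [q <-] := rs t; exists (x + f' q, q).
  by apply/pair_equal_spec; split=> //=; rewrite addrK.
- by move=> x y /= [].
- move=> [x q]; change (q - b x = 0 <-> exists y : P, (y, b y) = (x, q)).
  split=> [/eqP|[y [<- <-]]]; last by rewrite subrr.
  by rewrite subr_eq0 => /eqP ->; exists x.
- move=> q; exists (0, q); change (q - b 0 = q); by rewrite linear0 subr0.
Qed.

(** Dually, a projective Q covers the source of X with kernel G', and a lift c of [mfac X] to Q
    identifies the source of the kernel with P + G'. *)
Lemma cover_ex X : exists P Q (hP : projective_module P) (hQ : projective_module Q) X'
  (i : morhom X' (jsub hP hQ)) (p : morhom (jsub hP hQ) X), conflation i p.
Proof.
have [_ hp hext] := hG; have [G' GG' [Q [e [r [hQ er]]]]] := hp _ (mon_src X).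
have [ei ee rs] := er; pose P := mtgt X; have hP : projective_module P := @mon_tgt X.
have [c cE] := hP _ _ r (mfac X) rs.
pose h : {linear fgmod_sum P G' -> Q} := lsub (lcomp e (lsnd P G')) (lcomp c (lfst P G')).
have hE y g : h (y, g) = e g - c y by [].
have rh y g : r (h (y, g)) = - mfac X y by rewrite hE linearB cE (ses_comp0 _ ee) sub0r.
have hX : A (MorObj h).
  apply/hA; split=> //; [|exact: hGs|].
    change (injective h); apply: inj0 => -[y g] h0; have := rh y g; rewrite h0 linear0 => /eqP.
    rewrite eq_sym oppr_eq0 => /eqP y0.
    have {}y0 : y = 0.
      by apply: (proj_reg hP); rewrite linear0 !lE -mfacE y0 linear0.
    move: h0; rewrite hE y0 linear0 subr0 => g0; congr (_, _); apply: ei.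
    by rewrite linear0.
  move=> q; have [g gE] : exists g, e g = w *: q - c (mmap X (r q)).
    by apply/ee; rewrite linearB cE mfacK linZ subrr.
  exists (- mmap X (r q), g); by rewrite hE gE linearN opprK subrK.
pose i1 : {linear fgmod_sum P G' -> fgmod_sum Q P} := lpair h (lfst P G').
pose i0 : {linear Q -> fgmod_sum Q P} := lpair (lid Q) (lopp (lcomp (mmap X) r)).
have sq z : i0 (mmap (MorObj h) z) = mmap (jobj Q P) (i1 z).
  case: z => y g; apply/pair_equal_spec; split=> //.
  change (- mmap X (r (h (y, g))) = w *: y); by rewrite rh linearN opprK mfacE.
exists Q, P, hQ, hP, (SubObj hX), (@MorHom S (MorObj h) (jobj Q P) _ _ sq), (from_j r (lid P)).
split; split.
- move=> [y g] [y' g'] /= [+ yy]; rewrite -!hE yy !hE => /addIr/ei ->; done.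
- move=> [q y]; change (r q + mfac X y = 0 <-> exists z, (h z, z.1) = (q, y)).
  split=> [/eqP|[[y' g] [<- <-]]]; last by rewrite rh addNr.
  rewrite addr_eq0 => /eqP rq; have [g gE] : exists g, e g = q + c y.
    by apply/ee; rewrite linearD cE rq addNr.
  by exists (y, g); rewrite hE gE addrK.
- move=> x; have [q <-] := rs x; exists (q, 0).
  by change (r q + mfac X 0 = r q); rewrite linear0 addr0.
- by move=> x y /= [].
- move=> [q y]; change (mmap X (r q) + y = 0 <-> exists q', (q', - mmap X (r q')) = (q, y)).
  split=> [/eqP|[q' [<- <-]]]; last by rewrite subrr.
  by rewrite addrC addr_eq0 => /eqP ->; exists q.
- move=> y; exists (0, y); change (mmap X (r 0) + y = y); by rewrite !linear0 add0r.
Qed.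

Definition jretract X : Prop := exists P Q (hP : projective_module P) (hQ : projective_module Q)
  (i : morhom X (jsub hP hQ)) (r : morhom (jsub hP hQ) X), mor_eq (mor_comp r i) (mor_id X).

Lemma inj_retract X : inj_obj X -> jretract X.
Proof.
move=> hX; have [P [Q [hP [hQ [X' [i [p ip]]]]]]] := hull_ex X.
have [r ri] := hX _ _ _ i p (mor_id X) ip.
by exists P, Q, hP, hQ, i, r.
Qed.

Lemma proj_retract_obj X : proj_obj X -> jretract X.
Proof.
move=> hX; have [P [Q [hP [hQ [X' [i [p ip]]]]]]] := cover_ex X.
have [r ri] := hX _ _ _ i p (mor_id X) ip.
by exists P, Q, hP, hQ, r, p.
Qed.

Lemma jretract_proj X : jretract X -> proj_obj X.
Proof.
move=> [P [Q [hP [hQ [i [r [e1 e0]]]]]]] Y Z T j p f jp.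
have [g [g1 g0]] := jsub_proj (mor_comp f r) jp.
exists (mor_comp g i); apply: mor_ext => x.
exact (etrans (g0 (mor0 i x)) (congr1 (mor0 f) (e0 x))).
Qed.

(** The difference factors through (P = P) + (Q -w-> Q) with P the target of X: s uses the first
    summand, a1 and b the second. Regularity of w on Q gives a0 as a1 after [mfac X]. *)
Lemma stable_crit X Y Q (f g : morhom X Y) (a0 : {linear mtgt X -> Q})
    (a1 : {linear msrc X -> Q}) (b : {linear Q -> mtgt Y}) (s : {linear mtgt X -> msrc Y}) :
  projective_module Q -> (forall x, a0 (mmap X x) = w *: a1 x) ->
  (forall y, mor0 f y - mor0 g y = mmap Y (s y) + b (a0 y)) -> stable_eq f g.
Proof.
move=> hQ a01 fg.
pose al : morhom X (jsub (@mon_tgt X) hQ) := to_j (lid _) a1.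
pose be : morhom (jsub (@mon_tgt X) hQ) Y := from_j s b.
have e y : mor0 f y - mor0 g y = mor0 be (mor0 al y).
  rewrite fg; change (mmap Y (s y) + b (a0 y) = mmap Y (s y) + b (a1 (mfac X y))).
  congr (_ + b _); apply: (proj_reg hQ).
  by rewrite !lE -a01 mfacE linZ.
exists (jsub (@mon_tgt X) hQ), al, be; split=> [|x|//]; first exact: jsub_proj.
by apply: (@mon_inj Y); rewrite linearB -!mor_sq e.
Qed.

End MonObjects.

(** * The functor T *)

Section TriangleFunctors.

Lemma iso_closure_iso (C : category) (s0 : C -> C)
    (s1 : forall X Y : C, Mor X Y -> Mor (s0 X) (s0 Y)) std (X Y Z X' Y' Z' : C)
    (u : Mor X Y) (v : Mor Y Z) (t : Mor Z (s0 X))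
    (u' : Mor X' Y') (v' : Mor Y' Z') (t' : Mor Z' (s0 X')) a b c :
  is_functor s1 -> is_iso a -> is_iso b -> is_iso c ->
  b ∘ u ≡ u' ∘ a -> c ∘ v ≡ v' ∘ b -> s1 X X' a ∘ t ≡ t' ∘ c ->
  iso_closure s1 std u' v' t' -> iso_closure s1 std u v t.
Proof.
move=> [se si sc] aI bI cI e1 e2 e3 [X2 [Y2 [Z2 [u2 [v2 [t2 [a' [b' [c' [[st aI' bI' cI'] [h1 h2 h3]]]]]]]]]]].
exists X2, Y2, Z2, u2, v2, t2, (a' ∘ a), (b' ∘ b), (c' ∘ c).
have sq (A B A' B' A2 B2 : C) (f : Mor A B) (f' : Mor A' B') (f2 : Mor A2 B2)
    (x : Mor A A') (y : Mor B B') (x' : Mor A' A2) (y' : Mor B' B2) :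
    y ∘ f ≡ f' ∘ x -> y' ∘ f' ≡ f2 ∘ x' -> (y' ∘ y) ∘ f ≡ f2 ∘ (x' ∘ x).
  move=> k1 k2; apply: heq_trans (compAA _ k1) _; apply: heq_trans (compAl _ k2) _.
  exact: heq_sym (Defs.compA _ _ _).
split; split; try exact: is_iso_comp.
- exact: st.
- exact: sq e1 h1.
- exact: sq e2 h2.
- apply: heq_trans (comp_heq (sc _ _ _ _ _) (heq_refl _)) _.
  exact: sq e3 h3.
Qed.

Lemma fully_faithful_comp (C D E : category) (F0 : C -> D)
    (F1 : forall X Y : C, Mor X Y -> Mor (F0 X) (F0 Y)) (H0 : D -> E)
    (H1 : forall X Y : D, Mor X Y -> Mor (H0 X) (H0 Y)) :
  is_functor H1 -> fully_faithful F1 -> fully_faithful H1 ->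
  fully_faithful (fun X Y f => H1 _ _ (F1 X Y f)).
Proof.
move=> HF Ff Hf X Y; have [F2 F3] := Ff X Y; have [H2 H3] := Hf (F0 X) (F0 Y).
split=> [f g /H2/F2 //|h]; have [k kE] := H3 h; have [f fE] := F3 k.
by exists f; apply: heq_trans kE; apply: (functor_heq HF).
Qed.

Lemma is_functor_comp (C D E : category) (F0 : C -> D)
    (F1 : forall X Y : C, Mor X Y -> Mor (F0 X) (F0 Y)) (H0 : D -> E)
    (H1 : forall X Y : D, Mor X Y -> Mor (H0 X) (H0 Y)) :
  is_functor F1 -> is_functor H1 ->
  @is_functor C E (fun X => H0 (F0 X)) (fun X Y f => H1 _ _ (F1 X Y f)).
Proof.
move=> [Fe Fi Fc] [He Hi Hc]; split=> [X Y f g /Fe/He //|X|X Y Z g f].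
  exact: heq_trans (He _ _ _ _ (Fi X)) (Hi _).
exact: heq_trans (He _ _ _ _ (Fc _ _ _ _ _)) (Hc _ _ _ _ _).
Qed.

Lemma triangle_functor_comp (C D E : tricat) (F0 : C -> D)
    (F1 : forall X Y : C, Mor X Y -> Mor (F0 X) (F0 Y)) (H0 : D -> E)
    (H1 : forall X Y : D, Mor X Y -> Mor (H0 X) (H0 Y)) :
  (forall (X Y Z : E) (u : Mor X Y) (v : Mor Y Z) (t t' : Mor Z (sh0 X)),
    t ≡ t' -> dist u v t -> dist u v t') ->
  triangle_functor F1 -> triangle_functor H1 ->
  @triangle_functor C E (fun X => H0 (F0 X)) (fun X Y f => H1 _ _ (F1 X Y f)).
Proof.
move=> distE [FF [xi [xI xn xd]]] [HF [ze [zI zn zd]]].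
split; first exact: is_functor_comp.
exists (fun X => ze (F0 X) ∘ H1 _ _ (xi X)); split=> [X|X Y f|X Y Z u v t uvt].
- by apply: is_iso_comp => //; apply: functor_iso.
- apply: heq_trans (compAl _ (zn _ _ _)) _.
  apply: heq_trans (heq_sym (Defs.compA _ _ _)) _; apply: heq_trans (Defs.compA _ _ _).
  apply: comp_heq (heq_refl _) _.
  apply: heq_trans (heq_sym (functor_comp HF _ _)) _; apply: heq_trans (functor_comp HF _ _).
  by apply: (functor_heq HF); apply: xn.
- apply: distE (zd _ _ _ _ _ _ (xd _ _ _ _ _ _ uvt)).
  apply: heq_trans (comp_heq (heq_refl _) (functor_comp HF _ _)) _.
  exact: Defs.compA.
Qed.

Lemma dsg_dist_heq (R : comNzRingType) (X Y Z : Dsg R) (u : Mor X Y) (v : Mor Y Z)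
    (t t' : Mor Z (sh0 X)) : t ≡ t' -> dist u v t -> dist u v t'.
Proof.
move=> tt; apply: iso_closure_iso (is_iso_id X) (is_iso_id Y) (is_iso_id Z) _ _ _.
- exact: sh_functor.
- by apply: heq_trans (comp1m _) (heq_sym (compm1 _)).
- by apply: heq_trans (comp1m _) (heq_sym (compm1 _)).
- apply: heq_trans (comp_heq (functor_id (sh_functor (Dsg R)) X) (heq_refl _)) _.
  by apply: heq_trans (comp1m _) _; apply: heq_trans (heq_sym tt) (heq_sym (compm1 _)).
Qed.

End TriangleFunctors.

(** * Cokernels over R and the triangle functor T *)

Section CokerFunctor.
Variables (S R : comNzRingType) (pi : {rmorphism S -> R}) (w : S).
Hypotheses (piP : is_quotient_by pi w) (noethS : noetherian S) (wreg : GRing.lreg w).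
Notation gproj := (fun M : fgmod S => gorenstein_projective M).
Implicit Types (X Y Z : subobj (MonG w)).

Let hG : gclass gproj := gorenstein_gclass S.
Let hGp (P : fgmod S) : projective_module P -> gorenstein_projective P :=
  @projective_gorenstein S P.
Let hGs (P M : fgmod S) : projective_module P -> gorenstein_projective M ->
  gorenstein_projective (fgmod_sum P M).
Proof. by move=> hP; apply: gorenstein_sum; apply: projective_gorenstein. Qed.
Let hA (X : morobj S) : MonG w X <-> [/\ injective (mmap X), gorenstein_projective (msrc X),
  projective_module (mtgt X) & kills_coker w X].
Proof. by []. Qed.
Let inj := @mon_inj S w (MonG w) gproj hA.
Let tgt := @mon_tgt S w (MonG w) gproj hA.
Let J P Q hP hQ := @jsub S w wreg (MonG w) gproj hGp hA P Q hP hQ.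

Fact cpr_linear X : linear (fun y : mtgt X => coker_pr piP (@so_kills S w X) y : restr pi (coker piP X)).
Proof. by move=> s y y'; rewrite coker_prP. Qed.
Definition cpr X : {linear mtgt X -> restr pi (coker piP X)} := lin (@cpr_linear X).

Lemma cpr_surj X : surj (cpr X).
Proof. by move=> c; apply: coker_pr_surj. Qed.

Lemma cpr0 X : exact_at (mmap X) (cpr X).
Proof.
move=> y; split=> [e|[x xE]]; last first.
  by apply: etrans (linear0 (cpr X)); apply/coker_pr_eq; exists x; rewrite xE subr0.
have /coker_pr_eq[x xE] : coker_pr piP (@so_kills S w X) y = coker_pr piP (@so_kills S w X) 0.
  exact: etrans e (esym (linear0 (cpr X))).
by exists x; rewrite xE subr0.
Qed.

Lemma coker_mapE X Y (f : morhom X Y) y : coker_map piP f (cpr X y) = cpr Y (mor0 f y).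
Proof. exact: coker_funE. Qed.

Lemma coker_map_ses X Y Z (i : morhom X Y) (p : morhom Y Z) :
  conflation i p -> short_exact (coker_map piP i) (coker_map piP p).
Proof.
move=> [[i1 e1 p1] [i0 e0 p0]]; split.
- apply: inj0 => c; have [y <-] := cpr_surj c; rewrite coker_mapE => /cpr0[x xE].
  have /e1[x' x'E] : mor1 p x = 0.
    by apply: (@inj Z); rewrite linear0 -mor_sq xE (ses_comp0 _ e0).
  by apply/cpr0; exists x'; apply: i0; rewrite mor_sq x'E.
- move=> c; have [y <-] := cpr_surj c; rewrite coker_mapE; split=> [/cpr0[z zE]|[c' ]].
    have [x xE] := p1 z; have [y' y'E] : exists y', mor0 i y' = y - mmap Y x.
      by apply/e0; rewrite linearB mor_sq xE zE subrr.
    exists (cpr X y'); rewrite coker_mapE y'E linearB.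
    by rewrite (ses_comp0 _ (@cpr0 Y)) subr0.
  have [y' <-] := cpr_surj c'; rewrite coker_mapE => e.
  by rewrite -coker_mapE -e coker_mapE (ses_comp0 _ e0) linear0.
- move=> c; have [z <-] := cpr_surj c; have [y yE] := p0 z.
  by exists (cpr Y y); rewrite coker_mapE yE.
Qed.

Lemma coker_jsub P Q hP hQ : projective_module (coker piP (@J P Q hP hQ)).
Proof.
move=> M N p f ps.
have [g gE] := hQ _ _ (rlin pi p) (lcomp (rlin pi f) (lcomp (cpr (J hP hQ)) (linr P Q))) ps.
have [|h hE] := fac_surj (f := lcomp g (lsnd P Q)) (@cpr_surj (J hP hQ)).
  by move=> z /cpr0[[x y] <-]; rewrite !lE /= linZ (restr_kill piP).
exists (ulin piP h) => c; have [[x y] <-] := cpr_surj c.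
change (p (h (cpr (J hP hQ) (x, y))) = f (cpr (J hP hQ) (x, y))); rewrite hE.
have := gE y; rewrite !lE => e; apply: etrans e _; congr (f _).
apply: (subr0_eq (V := restr pi (coker piP (J hP hQ)))); rewrite -linearB; apply/cpr0; exists (- x, 0).
by apply/pair_equal_spec; split; rewrite /= ?sub0r ?scaler0 ?subrr.
Qed.

Lemma coker_jretract X : @jretract S w wreg (MonG w) gproj hGp hA X ->
  projective_module (coker piP X).
Proof.
move=> [P [Q [hP [hQ [i [r [_ e0]]]]]]].
apply: (@proj_retract R (coker piP X) (coker piP (J hP hQ)) (coker_map piP i) (coker_map piP r)).
  move=> c; have [y <-] := cpr_surj c; rewrite (coker_mapE i y) (coker_mapE r (mor0 i y)); exact (congr1 (cpr X) (e0 y)).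
exact: coker_jsub.
Qed.

Lemma coker_proj X : proj_obj X -> projective_module (coker piP X).
Proof. by move=> /(proj_retract_obj wreg hG hGp hGs hA)/coker_jretract. Qed.

Lemma coker_inj X : inj_obj X -> projective_module (coker piP X).
Proof. by move=> /(inj_retract wreg hG hGp hGs hA)/coker_jretract. Qed.

Lemma coker_lift X Y (g : {linear coker piP X -> coker piP Y}) :
  exists f : morhom X Y, coker_map piP f =1 g.
Proof.
have [f0 f0E] := @tgt X _ _ (cpr Y) (lcomp (rlin pi g) (cpr X)) (@cpr_surj Y).
have [|f1 f1E] := fac_inj (f := lcomp f0 (mmap X)) (@inj Y).
  by move=> x; apply/cpr0; rewrite lE f0E !lE (ses_comp0 _ (@cpr0 X)) linear0.
exists (@MorHom S X Y f1 f0 (fun x => esym (f1E x))) => c; have [y <-] := cpr_surj c.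
by rewrite coker_mapE f0E.
Qed.

(** Change of rings: Ext_R^1(Coker f, R) = Ext_S^2(Coker f, S) = Ext_S^1(G, S), which vanishes for
    Gorenstein projective G. *)
Lemma coker_ext X (Q : fgmod R) : projective_module Q -> ext1 (coker piP X) Q.
Proof.
move=> hQ; have noethR := quot_noetherian piP noethS.
have [C [C0 hC _]] := injres_ex (S^o : lmodType S).
have [D [D0 hD _]] := injres_ex (R^o : lmodType R).
refine (ext1_proj hQ _); rewrite -D0.
apply/(rees piP wreg _ noethR hC C0 hD D0 (fg_prop (coker piP X))).
have [E [c [p [EI cp]]]] := hC 0%N.
have ses : short_exact (mmap X) (cpr X).
  by split; [exact: inj|exact: cpr0|exact: cpr_surj].
have [_ _ hext] := hG; have [_ G1 _ _] := so_prop X.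
apply/(extU_shift one_set (@tgt X) ses EI cp); rewrite C0.
exact (hext _ (FgMod (fg_regular S)) G1 (@proj_regular S)).
Qed.

Definition is_coker (M : fgmod R) : Prop := exists X, coker piP X = M.

Lemma coker_gclass : gclass is_coker.
Proof.
split=> [M [X <-]|M [X <-]|M Q [X <-]]; last exact: coker_ext.
- have [P [Q [hP [hQ [X' [j [p jp]]]]]]] := hull_ex wreg hG hGp hGs hA X.
  exists (coker piP X'); first by exists X'.
  exists (coker piP (J hP hQ)), (coker_map piP j), (coker_map piP p).
  by split; [exact: coker_jsub|exact: coker_map_ses].
- have [P [Q [hP [hQ [X' [j [p jp]]]]]]] := cover_ex wreg hG hGp hGs hA X.
  exists (coker piP X'); first by exists X'.
  exists (coker piP (J hP hQ)), (coker_map piP j), (coker_map piP p).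
  by split; [exact: coker_jsub|exact: coker_map_ses].
Qed.

Lemma coker_res X : exists P d p, @complete_res R (coker piP X) P d p.
Proof. by have [] := gclass_gorenstein coker_gclass (ex_intro _ X erefl). Qed.

Fact red_row_linear n : linear (@map_mx S R pi 1 n : 'rV[S]_n -> restr pi 'rV[R]_n).
Proof. by move=> s x y; rewrite map_mxD map_mxZ. Qed.

(** Q is a retract of R^n. The maps a and b lift to a0 and b0 over S^n; a0 is divisible by w on the
    source of X because a only sees the cokernel, and the remaining difference falls into the image
    of [mmap Y]. *)
Lemma coker_stable X Y (f g : morhom X Y) (Q : fgmod R) (a : {linear coker piP X -> Q})
    (b : {linear Q -> coker piP Y}) : projective_module Q ->
  (forall c, coker_map piP f c - coker_map piP g c = b (a c)) ->
  exists n (a0 : {linear mtgt X -> 'rV[S]_n}) (a1 : {linear msrc X -> 'rV[S]_n})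
    (b0 : {linear 'rV[S]_n -> mtgt Y}) (s : {linear mtgt X -> msrc Y}),
    (forall x, a0 (mmap X x) = w *: a1 x) /\
    (forall y, mor0 f y - mor0 g y = mmap Y (s y) + b0 (a0 y)).
Proof.
move=> hQ e; have [n [ep eps]] := fg_cover (fg_prop Q); have [si siK] := proj_section hQ eps.
pose rho := lin (@red_row_linear n).
have rs : surj rho.
  move=> y; have [x xE] := choice (fun i => piP.1 (y 0 i)).
  exists (\row_i x i); apply/rowP => i; by rewrite !mxE xE.
have r0 x : rho x = 0 -> exists t, w *: t = x.
  move=> /rowP x0; have ex i : exists t, x 0 i = t * w.
    by apply/piP.2; have := x0 i; rewrite !mxE.
  have [t tE] := choice ex.
  by exists (\row_i t i); apply/rowP => i; rewrite !mxE tE mulrC.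
have [a0 a0E] := @tgt X _ _ rho (lcomp (lcomp (rlin pi si) (rlin pi a)) (cpr X)) rs.
have [|a1 a1E] := fac_inj (f := lcomp a0 (mmap X)) (@proj_reg S w wreg (rowmod S n) (@proj_row S n)).
  move=> x; have [|t tE] := r0 (a0 (mmap X x)); last by exists t; rewrite !lE.
  by rewrite a0E !lE (ses_comp0 _ (@cpr0 X)) !linear0.
have [b0 b0E] := @proj_row S n _ _ (cpr Y) (lcomp (lcomp (rlin pi b) (rlin pi ep)) rho) (@cpr_surj Y).
have [|s sE] := fac_inj (f := lsub (lsub (mor0 f) (mor0 g)) (lcomp b0 a0)) (@inj Y).
  move=> y; apply/cpr0; rewrite !lE !linearB b0E !lE a0E !lE.
  rewrite -!coker_mapE; apply/eqP; rewrite subr_eq0; apply/eqP; rewrite e.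
  by congr (b _); rewrite /rlin !linE siK.
exists n, a0, a1, b0, s; split=> [x|y]; first by have := a1E x; rewrite !lE.
by rewrite sE !lE subrK.
Qed.

Lemma stable_eq_coker X Y (f g : morhom X Y) : stable_eq f g ->
  exists (Q : fgmod R) (a : {linear coker piP X -> Q}) (b : {linear Q -> coker piP Y}),
    projective_module Q /\ forall c, coker_map piP f c - coker_map piP g c = b (a c).
Proof.
case=> Q [a [b [hQ _ e]]].
exists (coker piP Q), (coker_map piP a), (coker_map piP b); split; first exact: coker_proj.
move=> c; have [y <-] := cpr_surj c.
by rewrite (coker_mapE a y) (coker_mapE b _) (coker_mapE f) (coker_mapE g) -e linearB.
Qed.

Lemma coker_stable_eq X Y (f g : morhom X Y) (Q : fgmod R) (a : {linear coker piP X -> Q})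
    (b : {linear Q -> coker piP Y}) : projective_module Q ->
  (forall c, coker_map piP f c - coker_map piP g c = b (a c)) -> stable_eq f g.
Proof.
move=> hQ /(coker_stable hQ)[n [a0 [a1 [b0 [s [a01 e]]]]]].
by apply: (stable_crit wreg hGp hA (Q := rowmod S n) _ a01 e); apply: proj_row.
Qed.

Notation stMonG := (stable_category (MonG w)).
Notation T_1 := (fun X Y : stMonG => @T1 S R pi w piP X Y).

Lemma T_functor : @is_functor stMonG (Dsg R) (T0 piP) T_1.
Proof.
split=> [X Y f g /stable_eq_coker[Q [a [b [hQ e]]]]|X|X Y Z g f].
- exact: stalk_stable hQ e.
- apply: qD_stalk_id => c; have [y <-] := cpr_surj c.
  exact: (@coker_mapE X X (mor_id X) y).
- apply: qD_stalk_comp => c; have [y <-] := cpr_surj c.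
  by rewrite (coker_mapE f y) (coker_mapE g _); apply: (coker_mapE (mor_comp g f)).
Qed.

Lemma T_fully_faithful : @fully_faithful stMonG (Dsg R) (T0 piP) T_1.
Proof.
have noethR := quot_noetherian piP noethS.
move=> X Y; have [P [d [p res]]] := coker_res X; split=> [f g fg|h].
  have [Q [a [b [hQ e]]]] := stalk_faithful noethR res fg.
  exact: coker_stable_eq hQ e.
have [g gE] := stalk_full noethR res h; have [f fE] := coker_lift g.
by exists f; apply: heq_trans gE; apply: qD_stalk_eq.
Qed.

(** Any conflation whose middle term has projective cokernel is allowed, so that the hulls of Mon(w,
    G) and those of Mon(w, P) are both covered. *)
Lemma coker_cone (X I C Y Z : subobj (MonG w)) (j : morhom X I) (p : morhom I C) (u : morhom X Y)
    (v : morhom Y Z) (t : morhom Z C) (h : morhom I Z) del :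
  conflation j p -> projective_module (coker piP I) ->
  is_delta (coker_map piP j) (coker_map piP p) del -> conflation v t ->
  mor_eq (mor_comp h j) (mor_comp v u) -> mor_eq (mor_comp t h) p ->
  exists c : @Mor (Dsg R) (T0 piP Z) (cone (stalk_map (coker_map piP u))), [/\ is_iso c,
    c ∘ T_1 _ _ v ≡ qD (cone_inl (stalk_map (coker_map piP u))) &
    del ∘ T_1 _ _ t ≡ qD (cone_pr (stalk_map (coker_map piP u))) ∘ c].
Proof.
move=> jp IP dE vt [_ e1] [_ e2].
refine (@delta_cone R _ _ _ _ _ _ _ del (coker_map piP u) (coker_map piP v) (coker_map piP t)
  (coker_map piP h) (coker_map_ses jp) dE IP (coker_map_ses vt) _ _) => c;
  have [y <-] := cpr_surj c.
  rewrite (coker_mapE j y) (coker_mapE h) (coker_mapE u y) (coker_mapE v).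
  exact (congr1 (cpr Z) (e1 y)).
rewrite (coker_mapE h y) (coker_mapE t) (coker_mapE p y).
exact (congr1 (cpr _) (e2 y)).
Qed.

Section Triangle.
Variable sh : suspension (MonG w).

Definition T_delta X := @is_delta R (coker piP X) (coker piP (hull sh X)) (coker piP (susp sh X))
  (coker_map piP (hull_in sh X)) (coker_map piP (hull_pr sh X)).
Arguments T_delta : clear implicits.

Lemma hull_coker_ses X : short_exact (coker_map piP (hull_in sh X)) (coker_map piP (hull_pr sh X)).
Proof. exact/coker_map_ses/hull_conflation. Qed.

Lemma hull_coker_proj X : projective_module (coker piP (hull sh X)).
Proof. exact/coker_inj/hull_inj. Qed.

Lemma T_delta_cone (X Y Z : stMonG) (u : Mor X Y) (v : Mor Y Z) (t : Mor Z (susp sh X : stMonG)) del :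
  pushout_triangle (sh := sh) u v t -> T_delta X del ->
  exists c : @Mor (Dsg R) (T0 piP Z) (cone (stalk_map (coker_map piP u))), [/\ is_iso c,
    c ∘ T_1 _ _ v ≡ qD (cone_inl (stalk_map (coker_map piP u))) &
    del ∘ T_1 _ _ t ≡ qD (cone_pr (stalk_map (coker_map piP u))) ∘ c].
Proof.
move=> [vt [h [e1 e2]]] dE.
exact (coker_cone (@hull_conflation _ _ sh X) (@hull_coker_proj X) dE vt e1 e2).
Qed.

(** xi is the connecting morphism of the cokernels of the hull conflation, invertible because the
    hull has projective cokernel. That xi has this form is recorded for [incl_triangle]. *)
Lemma T_triangle_ex : exists xi : forall X, @Mor (Dsg R) (T0 piP (susp sh X)) (shift (T0 piP X)),
  (forall X, T_delta X (xi X)) /\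
  [/\ forall X, is_iso (xi X),
      forall (X Y : stable_tricat sh) (f : Mor X Y),
        @sh1 (Dsg R) _ _ (T_1 _ _ f) ∘ xi X ≡ xi Y ∘ T_1 _ _ (sh1 f)
    & forall (X Y Z : stable_tricat sh) (u : Mor X Y) (v : Mor Y Z) (t : Mor Z (sh0 X)),
        dist u v t -> @dist (Dsg R) _ _ _ (T_1 _ _ u) (T_1 _ _ v) (xi X ∘ T_1 _ _ t)].
Proof.
have [xi xiE] := dchoice (fun X => delta_ex (hull_coker_ses X)).
have nat (X Y : stable_tricat sh) (f : Mor X Y) :
    @sh1 (Dsg R) _ _ (T_1 _ _ f) ∘ xi X ≡ xi Y ∘ T_1 _ _ (sh1 f).
  have [h [[_ e1] [_ e2]]] := susp1P sh f.
  refine (@delta_nat R _ _ _ _ _ _ _ _ _ _ _ _ (@coker_map S R pi w piP X Y f)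
    (coker_map piP h) (coker_map piP (susp1 sh f)) (hull_coker_ses X) (hull_coker_ses Y) (xiE X) (xiE Y) _ _) => c;
    have [y <-] := cpr_surj c.
    rewrite (coker_mapE (hull_in sh X) y) (coker_mapE h) (coker_mapE f y) (coker_mapE (hull_in sh Y)).
    exact (congr1 (cpr _) (e1 y)).
  rewrite (coker_mapE h y) (coker_mapE (hull_pr sh Y)) (coker_mapE (hull_pr sh X) y).
  rewrite (coker_mapE (susp1 sh f)); exact (congr1 (cpr _) (e2 y)).
exists xi; split=> //; split=> [X|//|X Y Z u v t].
  exact (delta_iso (hull_coker_ses X) (xiE X) (@hull_coker_proj X)).
case=> X' [Y' [Z' [u' [v' [t' [a [b [c [[std aI bI cI] [e1 e2 e3]]]]]]]]]].
have [k [kI kv kt]] := T_delta_cone std (xiE X').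
have [Fe Fi Fc] := T_functor.
have sq (A B A' B' : stMonG) (f : Mor A B) (f' : Mor A' B') (x : Mor A A') (y : Mor B B') :
    y ∘ f ≡ f' ∘ x -> T_1 _ _ y ∘ T_1 _ _ f ≡ T_1 _ _ f' ∘ T_1 _ _ x.
  move=> e; apply: heq_trans (heq_sym (Fc _ _ _ _ _)) _; apply: heq_trans (Fc _ _ _ _ _).
  exact: Fe.
apply: (iso_closure_iso (sh_functor (Dsg R)) (functor_iso T_functor aI) (functor_iso T_functor bI)
  (is_iso_comp kI (functor_iso T_functor cI))).
- exact: sq e1.
- apply: heq_trans (compAA _ (sq _ _ _ _ _ _ _ _ e2)) _.
  by apply: heq_trans (compAl _ kv) _; apply: heq_refl.
- apply: heq_trans (compAl _ (nat _ _ a)) _.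
  apply: heq_trans (heq_sym (Defs.compA _ _ _)) _.
  apply: heq_trans (comp_heq (heq_refl _) (sq _ _ _ _ _ _ _ _ e3)) _.
  apply: heq_trans (compAl _ kt) _; exact: heq_sym (Defs.compA _ _ _).
- apply: iso_closure_std; first exact: sh_functor.
  exact (@LocStd (Db R) (@cone_in (Db R) (@perfect R)) _ _ _ _ _ _
    (dist_cone (stalk_map (coker_map piP u')))).
Qed.

Lemma T_triangle : @triangle_functor (stable_tricat sh) (Dsg R) (T0 piP) T_1.
Proof. by split; [exact: T_functor|have [xi [_ h]] := T_triangle_ex; exists xi]. Qed.

End Triangle.
End CokerFunctor.

(** * The inclusion of Mon(w, P) *)

Lemma ff_reflect_iso (C D : category) (F0 : C -> D)
    (F1 : forall X Y : C, Mor X Y -> Mor (F0 X) (F0 Y)) (X Y : C) (f : Mor X Y) :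
  is_functor F1 -> fully_faithful F1 -> is_iso (F1 _ _ f) -> is_iso f.
Proof.
move=> [Fe Fi Fc] ff [g [gf fg]]; have [_ /(_ g)[k kE]] := ff Y X.
exists k; split; [apply: (ff X X).1|apply: (ff Y Y).1].
  apply: heq_trans (Fc _ _ _ _ _) _; apply: heq_trans (comp_heq kE (heq_refl _)) _.
  exact: heq_trans gf (heq_sym (Fi _)).
apply: heq_trans (Fc _ _ _ _ _) _; apply: heq_trans (comp_heq (heq_refl _) kE) _.
exact: heq_trans fg (heq_sym (Fi _)).
Qed.

Lemma proj_gclass (S : comNzRingType) : gclass (fun P : fgmod S => projective_module P).
Proof.
split=> [M MP|M MP|M Q MP _]; last by apply: extU_proj MP; apply: mulset1.
  exists fgmod0; first exact: projective_zero.
  exists M, (lid M), (lzero M fgmod0); split=> //; split=> [//|x|x]; last first.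
    by exists 0; rewrite (fgmod0_eq0 x) linear0.
  by split=> // _; exists x.
exists fgmod0; first exact: projective_zero.
exists M, (lzero fgmod0 M), (lid M); split=> //; split=> [x y _|x|x]; last by exists x.
  by rewrite (fgmod0_eq0 x) (fgmod0_eq0 y).
by rewrite lE; split=> [->|[y <-]]; [exists 0|]; rewrite lE.
Qed.

Section Inclusion.
Variables (S R : comNzRingType) (pi : {rmorphism S -> R}) (w : S).
Hypotheses (piP : is_quotient_by pi w) (noethS : noetherian S) (wreg : GRing.lreg w).
Notation gproj := (fun M : fgmod S => gorenstein_projective M).
Notation proj := (fun M : fgmod S => projective_module M).

Let hG : gclass gproj := gorenstein_gclass S.
Let hGp (P : fgmod S) : projective_module P -> gorenstein_projective P :=
  @projective_gorenstein S P.
Let hGs (P M : fgmod S) : projective_module P -> gorenstein_projective M ->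
  gorenstein_projective (fgmod_sum P M).
Proof. by move=> hP; apply: gorenstein_sum; apply: projective_gorenstein. Qed.
Let hA (X : morobj S) : MonG w X <-> [/\ injective (mmap X), gorenstein_projective (msrc X),
  projective_module (mtgt X) & kills_coker w X].
Proof. by []. Qed.

Let kG : gclass proj := proj_gclass S.
Let kGp (P : fgmod S) : projective_module P -> projective_module P := id.
Let kGs (P M : fgmod S) : projective_module P -> projective_module M ->
  projective_module (fgmod_sum P M) := @projective_sum S P M.
Let kA (X : morobj S) : MonP w X <-> [/\ injective (mmap X), projective_module (msrc X),
  projective_module (mtgt X) & kills_coker w X].
Proof. by []. Qed.

Notation stMonG := (stable_category (MonG w)).
Notation stMonP := (stable_category (MonP w)).
Notation T_1 := (fun X Y : stMonG => @T1 S R pi w piP X Y).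
Notation i_1 := (fun X Y : stMonP => @incl1 S w X Y).
Notation i_0 := (@incl0 S w : stMonP -> stMonG).

Lemma incl_jretract (X : subobj (MonP w)) : @jretract S w wreg (MonP w) proj kGp kA X ->
  @jretract S w wreg (MonG w) gproj hGp hA (incl0 X).
Proof. by case=> P [Q [hP [hQ [i [r ri]]]]]; exists P, Q, hP, hQ, i, r. Qed.

(** A projective object of Mon(w, P) is a retract of some (P = P) + (Q -w-> Q), hence still
    projective in Mon(w, G). *)
Lemma incl_functor : @is_functor stMonP stMonG (@incl0 S w) i_1.
Proof.
split=> [X Y f g|X|X Y Z g f]; try exact: heq_refl.
case=> Q [a [b [hQ e1 e0]]]; exists (incl0 Q), a, b; split=> //.
have := incl_jretract (proj_retract_obj wreg kG kGp kGs kA hQ); exact: jretract_proj.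
Qed.

(** A stable factorization in Mon(w, G) is pushed down to a factorization through a projective
    R-module, then lifted again by [coker_stable] to one inside Mon(w, P). *)
Lemma incl_fully_faithful : @fully_faithful stMonP stMonG (@incl0 S w) i_1.
Proof.
move=> X Y; split=> [f g|h]; last by exists h; apply: heq_refl.
move=> /(stable_eq_coker piP wreg)[Q [a [b [hQ /(coker_stable wreg hQ)]]]].
case=> n [a0 [a1 [b0 [s [a01 e]]]]].
by apply: (@stable_crit S w wreg (MonP w) proj kGp kA X Y (rowmod S n) f g a0 a1 b0 s _ a01 e); apply: proj_row.
Qed.

(* The pushout of a morphism [u] along the hull of [X] in Mon(w, G); as the
   source of [X] is projective, the hull is componentwise split. *)
Lemma incl_pushout (sh : suspension (MonG w)) (X Y : subobj (MonP w)) (u : morhom X Y) :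
  exists (Z : stMonG) (v : @Mor stMonG (incl0 Y) Z) (t : @Mor stMonG Z (susp sh (incl0 X))),
    @pushout_triangle S (MonG w) sh (incl0 X) (incl0 Y) Z u v t.
Proof.
pose X' := incl0 X; pose I := hull sh X'; pose C := susp sh X'.
pose j : morhom X' I := hull_in sh X'; pose p : morhom I C := hull_pr sh X'.
have [[j1i j1e p1s] [j0i j0e p0s]] : conflation j p by exact: hull_conflation.
have [_ X1 X0 _] := so_prop X; have [_ Y1 Y0 _] := so_prop Y.
have [iC C1 C0 kC] := so_prop C; have [iY _ _ kY] := so_prop Y.
have [_ _ hext] := hG.
have ses1 : short_exact (mor1 j) (mor1 p) by split.
have ses0 : short_exact (mor0 j) (mor0 p) by split.
have [_ -> [r1 r1E]] := hext (msrc C) (msrc X) C1 X1 _ _ _ _ ses1 (lid _).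
have [_ -> [r0 r0E]] := extU_proj (mulset1 S) C0 ses0 (lid (mtgt X)).
have {}r1E x : r1 (mor1 j x) = x by rewrite r1E scale1r lE.
have {}r0E x : r0 (mor0 j x) = x by rewrite r0E scale1r lE.
have uX x : mor0 u (mmap X x) = mmap Y (mor1 u x) by exact: mor_sq.
have jX x : mor0 j (mmap X x) = mmap I (mor1 j x) by exact: (mor_sq j).
have pI x : mor0 p (mmap I x) = mmap C (mor1 p x) by exact: mor_sq.
(* With the retractions r1 and r0 the pushout is Y + C in each component; th is the off-diagonal
   part of its structure map. *)
have [|th thE] := fac_surj (p := mor1 p)
    (f := lcomp (mor0 u) (lsub (lcomp r0 (mmap I)) (lcomp (mmap X) r1))) p1s.
  by move=> i /j1e[x <-]; rewrite !lE -jX r0E r1E subrr linear0.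
have {}thE i : th (mor1 p i) = mor0 u (r0 (mmap I i)) - mmap Y (mor1 u (r1 i)).
  by rewrite thE !lE linearB uX.
pose zm : {linear fgmod_sum (msrc Y) (msrc C) -> fgmod_sum (mtgt Y) (mtgt C)} :=
  lpair (lcopair (mmap Y) th) (lcomp (mmap C) (lsnd _ _)).
have zmE y s : zm (y, s) = (mmap Y y + th s, mmap C s) by [].
have hZ : MonG w (MorObj zm).
  split; [|by apply: gorenstein_sum => //; apply: projective_gorenstein|exact: projective_sum|].
    apply: inj0 => -[y s]; change (zm (y, s) = 0 -> (y, s) = 0); rewrite zmE => -[+ s0].
    have -> : s = 0 by apply: iC; rewrite s0 linear0.
    by rewrite linear0 addr0 => y0; congr (_, _); apply: iY; rewrite y0 linear0.
  move=> [y s]; have [i iE] := p0s s; have [s' s'E] := kC s.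
  have [_ _ _ kI] := so_prop I; have [i' i'E] := kI i.
  have pi' : mor1 p i' = s' by apply: iC; rewrite -pI i'E linZ iE s'E.
  have [y' y'E] := kY (y - mor0 u (r0 i)).
  exists (y' + mor1 u (r1 i'), s'); change (zm (y' + mor1 u (r1 i'), s') = w *: (y, s)).
  rewrite zmE s'E -pi' thE linearD y'E i'E !linZ; congr (_, _).
  by rewrite scalerBr -addrA [X in _ + X]addrC subrK subrK.
pose Z : stMonG := SubObj hZ.
have vP x : linl (mtgt Y) (mtgt C) (mmap Y x) = zm (linl (msrc Y) (msrc C) x).
  by rewrite zmE !linear0 addr0.
have tP z : lsnd (mtgt Y) (mtgt C) (zm z) = mmap C (lsnd (msrc Y) (msrc C) z) by [].
pose h1 : {linear msrc I -> fgmod_sum (msrc Y) (msrc C)} := lpair (lcomp (mor1 u) r1) (mor1 p).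
pose h0 : {linear mtgt I -> fgmod_sum (mtgt Y) (mtgt C)} := lpair (lcomp (mor0 u) r0) (mor0 p).
have hP x : h0 (mmap I x) = zm (h1 x).
  change ((mor0 u (r0 (mmap I x)), mor0 p (mmap I x)) = zm (mor1 u (r1 x), mor1 p x)).
  by rewrite zmE thE addrC subrK pI.
exists Z, (@MorHom S (incl0 Y) (MorObj zm) _ _ vP), (@MorHom S (MorObj zm) C _ _ tP).
split; last first.
  exists (@MorHom S I (MorObj zm) _ _ hP); split; split=> x //.
    change ((mor1 u (r1 (mor1 j x)), mor1 p (mor1 j x)) = (mor1 u x, 0)).
    by rewrite r1E (ses_comp0 _ j1e).
  change ((mor0 u (r0 (mor0 j x)), mor0 p (mor0 j x)) = (mor0 u x, 0)).
  by rewrite r0E (ses_comp0 _ j0e).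
have sum_ses (A B : fgmod S) : short_exact (linl A B : {linear A -> fgmod_sum A B}) (lsnd A B).
  split=> [x y [] //|[x y]|y]; last by exists (0, y).
  by split=> [/= ->|[a [_ <-]] //]; exists x.
by split; apply: sum_ses.
Qed.

Section Triangle.
Variables (shG : suspension (MonG w)) (shP : suspension (MonP w)).

Lemma incl_hull_proj X : projective_module (coker piP (incl0 (hull shP X))).
Proof.
apply: (@coker_jretract S R pi w piP wreg); apply: incl_jretract.
exact (inj_retract wreg kG kGp kGs kA (@hull_inj _ _ shP X)).
Qed.

(** Every identity is checked after applying T, where hulls of either category produce connecting
    morphisms of the same kind. *)
Lemma incl_triangle : @triangle_functor (stable_tricat shP) (stable_tricat shG) (@incl0 S w) i_1.
Proof.
split; first exact: incl_functor.
have TF := T_functor piP wreg; have [Te Ti Tc] := TF.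
have Tff := T_fully_faithful piP noethS wreg.
have [ze [zeE [zeI zeN _]]] := T_triangle_ex piP wreg shG.
have ses X : short_exact (coker_map piP (hull_in shP X : morhom (incl0 X) (incl0 (hull shP X))))
    (coker_map piP (hull_pr shP X : morhom (incl0 (hull shP X)) (incl0 (susp shP X)))).
  exact/coker_map_ses/hull_conflation.
have [de deE] := dchoice (fun X => delta_ex (ses X)).
have deI X : is_iso (de X) by exact (delta_iso (ses X) (deE X) (@incl_hull_proj X)).
(* The comparison of shifts is the preimage under T of the inverse of ze after the connecting
   morphism of the Mon(w, P) hull. *)
have /dchoice[xi xiE] X : exists xi : @Mor stMonG (incl0 (susp shP X)) (susp shG (incl0 X)),
    ze (incl0 X) ∘ T_1 _ _ xi ≡ de X.
  have [k [kz zk]] := zeI (incl0 X).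
  have [_ /(_ (k ∘ de X))[f fE]] := Tff (incl0 (susp shP X)) (susp shG (incl0 X)).
  exists f; apply: heq_trans (comp_heq (heq_refl _) fE) _.
  by apply: heq_trans (compAl _ zk) _; apply: comp1m.
have xiI X : is_iso (xi X).
  apply: (ff_reflect_iso TF Tff); apply: (iso_cancel2 (zeI (incl0 X))).
  exact: is_iso_heq (heq_sym (xiE X)) (deI X).
have cE (A B : subobj (MonP w)) (g : morhom A B) y :
    coker_map piP (g : morhom (incl0 A) (incl0 B)) (cpr piP (incl0 A) y) =
    cpr piP (incl0 B) (mor0 g y) by exact: coker_mapE.
have nat (X Y : subobj (MonP w)) (f : morhom X Y) :
   (@sh1 (stable_tricat shG) (incl0 X) (incl0 Y) f : @Mor stMonG _ _) ∘ xi X ≡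
   xi Y ∘ (susp1 shP f : @Mor stMonG (incl0 (susp shP X)) (incl0 (susp shP Y))).
  apply: (Tff _ _).1; apply: (iso_cancel_l (zeI (incl0 Y))).
  apply: heq_trans (comp_heq (heq_refl _) (Tc _ _ _ _ _)) _.
  apply: heq_trans (compAl _ (heq_sym (zeN _ _ _))) _.
  apply: heq_trans (compAA _ (xiE X)) _.
  apply: heq_sym; apply: heq_trans (comp_heq (heq_refl _) (Tc _ _ _ _ _)) _.
  apply: heq_trans (compAl _ (xiE Y)) _; apply: heq_sym.
  have [h [[_ e1] [_ e2]]] := susp1P shP f.
  refine (@delta_nat R _ _ _ _ _ _ _ _ _ _ _ _ (@coker_map S R pi w piP (incl0 X) (incl0 Y) f)
    (@coker_map S R pi w piP (incl0 (hull shP X)) (incl0 (hull shP Y)) h)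
    (@coker_map S R pi w piP (incl0 (susp shP X)) (incl0 (susp shP Y)) (susp1 shP f))
    (ses X) (ses Y) (deE X) (deE Y) _ _) => c.
    have [y <-] := @cpr_surj S R pi w piP (incl0 X) c.
    rewrite (cE _ _ (hull_in shP X)) (cE _ _ h) (cE _ _ f) (cE _ _ (hull_in shP Y)).
    exact (congr1 (cpr piP (incl0 _)) (e1 y)).
  have [y <-] := @cpr_surj S R pi w piP (incl0 (hull shP X)) c.
  rewrite (cE _ _ h) (cE _ _ (hull_pr shP Y)) (cE _ _ (hull_pr shP X)) (cE _ _ (susp1 shP f)).
  exact (congr1 (cpr piP (incl0 _)) (e2 y)).
exists xi; split=> // X Y Z u v t.
case=> X' [Y' [Z' [u' [v' [t' [a [b [c [[std aI bI cI] [e1 e2 e3]]]]]]]]]].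
(* The triangle on u' built with the Mon(w, G) hull. T sends both third objects to the cone of the
   cokernel map of u', and l is the resulting isomorphism between them. *)
have [Z2 [v2 [t2 po]]] := incl_pushout shG u'.
have [vt [h [h1 h2]]] := std.
have [k [kI kv kt]] := @coker_cone S R pi w piP (incl0 X') (incl0 (hull shP X')) (incl0 (susp shP X'))
  (incl0 Y') (incl0 Z') (hull_in shP X') (hull_pr shP X') u' v' t' h (de X')
  (@hull_conflation _ _ shP X') (@incl_hull_proj X') (deE X') vt h1 h2.
have [k2 [k2I k2v k2t]] := T_delta_cone wreg po (zeE (incl0 X')).
have [k2' [k2'k k2k']] := k2I.
have [_ /(_ (k2' ∘ k))[l lE]] := Tff (incl0 Z') Z2.
have lI : is_iso l.
  apply: (ff_reflect_iso TF Tff); apply: is_iso_heq (heq_sym lE) _.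
  by apply: is_iso_comp kI; exists k2.
have lv : l ∘ (v' : @Mor stMonG (incl0 Y') (incl0 Z')) ≡ v2.
  apply: (Tff _ _).1; apply: (iso_cancel_l k2I).
  apply: heq_trans (comp_heq (heq_refl _) (Tc _ _ _ _ _)) _.
  apply: heq_trans (comp_heq (heq_refl _) (comp_heq lE (heq_refl _))) _.
  apply: heq_trans (comp_heq (heq_refl _) (compAA _ kv)) _.
  apply: heq_trans (compAl _ k2k') _; apply: heq_trans (comp1m _) _.
  exact: heq_sym k2v.
have lt : t2 ∘ l ≡ xi X' ∘ (t' : @Mor stMonG (incl0 Z') (incl0 (susp shP X'))).
  apply: (Tff _ _).1; apply: (iso_cancel_l (zeI (incl0 X'))).
  apply: heq_trans (comp_heq (heq_refl _) (Tc _ _ _ _ _)) _.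
  apply: heq_trans (compAl _ k2t) _.
  apply: heq_trans (comp_heq (heq_refl _) lE) _.
  apply: heq_trans (compAA _ (compAl _ k2k')) _.
  apply: heq_trans (comp_heq (heq_refl _) (comp1m _)) _.
  apply: heq_sym; apply: heq_trans (comp_heq (heq_refl _) (Tc _ _ _ _ _)) _.
  by apply: heq_trans (compAl _ (xiE X')) _.
have iF := incl_functor.
have sq (A B A' B' : stMonP) (f : Mor A B) (f' : Mor A' B') (x : Mor A A') (y : Mor B B') :
  y ∘ f ≡ f' ∘ x -> @heq stMonG _ _ (@Defs.comp stMonG (i_0 A) (i_0 B) (i_0 B') y f)
    (@Defs.comp stMonG (i_0 A) (i_0 A') (i_0 B') f' x).
  exact: (functor_heq iF).
refine (@iso_closure_iso stMonG _ _ (@pushout_triangle _ _ shG) (incl0 X) (incl0 Y) (incl0 Z)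
  (incl0 X') (incl0 Y') Z2 u v _ u' v2 t2 a b (l ∘ (c : @Mor stMonG (incl0 Z) (incl0 Z')))
  (sh_functor (stable_tricat shG)) (functor_iso iF aI) (functor_iso iF bI)
  (is_iso_comp lI (functor_iso iF cI)) _ _ _ _).
- exact: sq e1.
- apply: heq_trans (compAA _ (sq _ _ _ _ _ _ _ _ e2)) _.
  exact: compAl lv.
- apply: heq_trans (compAl _ (nat _ _ a)) _.
  apply: heq_trans (heq_sym (Defs.compA _ _ _)) _.
  apply: heq_trans (comp_heq (heq_refl _) (sq _ _ _ _ _ _ _ _ e3)) _.
  apply: heq_trans (compAl _ (heq_sym lt)) _; exact: heq_sym (Defs.compA _ _ _).
- exact (iso_closure_std (sh_functor (stable_tricat shG)) po).
Qed.

End Triangle.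
End Inclusion.

(** * Density *)

Section Concentration.
Variable R : comNzRingType.
Hypothesis noethR : noetherian R.

Definition conc (b : int) (Y : cpx R) : Prop := forall i, i != b -> forall x : Y i, x = 0.

(* The top term of [Y] is covered by a free module, and the cone of the
   resulting map from a perfect complex is truncated. *)
Lemma dsg_step (Y : cpx R) (a b : int) :
  (forall i, (i < a) || (b + 1 < i) -> forall x : Y i, x = 0) ->
  exists Y' : cpx R, [/\ @isom (Dsg R) Y Y',
    forall i, (i < Num.min a b) || (b < i) -> forall x : Y' i, x = 0 &
    a = b + 1 -> syz (Y' b) (Y (b + 1))].
Proof.
move=> Y0.
have /choice[m /dchoice[e eP]] i : exists m : nat, exists e : {linear 'rV[R]_m -> Y i},
    (i = b + 1 -> surj e) /\ (i != b + 1 -> forall x : 'rV[R]_m, x = 0).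
  have [ib|ib] := eqVneq i (b + 1).
    by have [m [e es]] := fg_cover (fg_prop (Y i)); exists m, e.
  by exists 0%N, (lzero _ _); split=> [e|_ x]; [rewrite e eqxx in ib|exact: (@fgmod0_eq0 R x)].
have e1 : surj (e (b + 1)) by case: (eP (b + 1)) => + _; apply.
have e0 i : i != b + 1 -> forall x : 'rV[R]_(m i), x = 0 by case: (eP i) => _.
have Ab : exists a b : int, forall i, (i < a) || (b < i) -> forall x : rowmod R (m i), x = 0.
  by exists (b + 1), (b + 1) => i h; apply: e0; apply/eqP => ib; rewrite ib ltxx in h.
pose A := @Cpx R (fun i => rowmod R (m i)) (fun i => lzero _ _) (fun _ _ => erefl) Ab.
have eC i (x : A i) : cd Y i (e i x) = e (i + 1) (cd A i x).
  rewrite [RHS]linear0; have [ib|/e0 x0] := eqVneq i (b + 1); last by rewrite (x0 x) !linear0.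
  by apply: Y0; apply/orP; right; lia.
pose C := cone (@Cmap R A Y e eC).
have dC i (z : C i) : cd C i z = (0, e (i + 1) z.1 + cd Y i z.2).
  by rewrite cone_dE; congr (_, _); apply: oppr0.
pose U i (z : C i) : Prop := [\/ z = 0, i < b | i = b /\ cd C i z = 0].
have Usub i : submod (@U i).
  split=> [|c x y]; first by constructor 1.
  have [ib|bi] := ltP i b; first by constructor 2.
  have h (z : C i) : U i z -> z = 0 \/ i = b /\ cd C i z = 0.
    by case; rewrite ?ltNge ?bi //; [left|right].
  move=> /h[->|[ib dx]] /h[->|[ib' dy]].
  - by constructor 1; rewrite scaler0 addr0.
  - by constructor 3; rewrite scaler0 add0r.
  - by constructor 3; rewrite addr0 linZ dx scaler0.
  - by constructor 3; rewrite linearP dx dy scaler0 addr0.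
have /choice[K /dchoice[j jE]] i : exists K : fgmod R, exists j : {linear K -> C i},
    injective j /\ forall x, U i x <-> exists k, j k = x.
  have [K [j [ji jU]]] := sub_ex (Usub i).
  by exists (FgMod (fg_inj noethR ji (fg_prop (C i)))), j.
have ji i : injective (j i) by case: (jE i).
have jU i x : U i x <-> exists k, j i k = x by case: (jE i).
have /dchoice[dK dKE] i : exists d : {linear K i -> K (i + 1)}, forall x,
    j (i + 1) (d x) = cd C i (j i x).
  have [|d dE] := fac_inj (f := lcomp (cd C i) (j i)) (ji (i + 1)); last by exists d.
  move=> x; apply/jU; rewrite lE; have [ib|bi] := ltP i b.
    have [lt|ge] := ltP (i + 1) b; first by constructor 2.
    by constructor 3; split; [lia|apply: cdd].
  have /jU[->|ib|[ib dx]] : exists k, j i k = j i x by exists x.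
  - by constructor 1; rewrite linear0.
  - lia.
  - by constructor 1.
have ddK i x : dK (i + 1) (dK i x) = 0 by apply: ji; rewrite !dKE cdd linear0.
have Kb : exists a b : int, forall i, (i < a) || (b < i) -> forall x : K i, x = 0.
  have [a' [b' h]] := cbdd C; exists a', b' => i /h C0 x.
  by apply: ji; rewrite linear0.
pose Y' := Cpx ddK Kb.
have jC i (x : Y' i) : cd C i (j i x) = j (i + 1) (cd Y' i x) by rewrite -dKE.
have Ktop i : b < i -> forall x : K i, x = 0.
  move=> bi x; apply: ji; rewrite linear0.
  have /jU[//|ib|[ib _]] : exists k, j i k = j i x by exists x.
  - lia.
  - lia.
exists Y'; split=> [|i h x|ab].
- apply: (@isom_trans (Dsg R) _ C).
    exists (qD (cone_inl (@Cmap R A Y e eC))); apply: cone_inl_iso => i; exact: proj_row.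
  apply: isom_sym; exists (qD (@Cmap R Y' C j jC)); apply: qD_qi => i.
  split=> [x dx [y ye]|y dy].
    have [ib|bi] := ltP i b; last by exists 0; rewrite linear0 (Ktop _ _ x) //; lia.
    have [k kE] : exists k, j i k = y by apply/jU; constructor 2.
    by exists k; apply: (ji (i + 1)); rewrite dKE kE.
  have [ib|bi] := leP (i + 1) b.
    have [k kE] : exists k, j (i + 1) k = y.
      apply/jU; have [lt|ge] := ltP (i + 1) b; first by constructor 2.
      by constructor 3; split=> //; lia.
    exists k, 0; rewrite linear0 addr0; split=> //.
    by apply: (ji (i + 1 + 1)); rewrite dKE kE dy linear0.
  have [ib|ib] := eqVneq i b; last first.
    exists 0, 0; rewrite !linear0 addr0; split=> //.
    case: (y) => y1 y2; apply/pair_equal_spec; split; first by apply: e0; lia.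
    by apply: Y0; apply/orP; right; lia.
  subst i; case: (y) => y1 y2; have [x xE] := e1 y2.
  exists 0, (x, 0); split; first by rewrite linear0.
  rewrite linear0 add0r dC; apply/pair_equal_spec; split; last by rewrite /= linear0 addr0 xE.
  by apply: e0; lia.
- have [bi|ib] := ltP b i; first exact: Ktop.
  apply: ji; rewrite linear0; case: (j i x) => y1 y2.
  by apply/pair_equal_spec; split; [apply: e0; lia|apply: Y0; lia].
- have Yb (y : Y b) : y = 0 by apply: Y0; apply/orP; left; lia.
  pose k : {linear Y' b -> 'rV[R]_(m (b + 1))} := lcomp (lfst (A (b + 1)) (Y b)) (j b).
  exists (m (b + 1)), k, (e (b + 1)); split=> //.
    move=> x y; rewrite /k !lE => xy; apply: ji.
    by case: (j b x) (j b y) xy => x1 x2 [y1 y2] /= ->; congr (_, _); rewrite (Yb x2) (Yb y2).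
  move=> x; split=> [ex|[z <-]].
    have [z zE] : exists z, j b z = (x, 0).
      by apply/jU; constructor 3; split=> //; rewrite dC /= ex linear0 addr0.
    by exists z; rewrite /k !lE zE.
  rewrite /k !lE; have /jU : exists k, j b k = j b z by exists z.
  case=> [->|bb|[_]]; [by rewrite linear0|by rewrite ltxx in bb|].
  by rewrite dC => /(congr1 snd) /=; rewrite (Yb (j b z).2) linear0 addr0.
Qed.

Lemma dsg_conc (Y : cpx R) : exists a Y', conc a Y' /\ @isom (Dsg R) Y Y'.
Proof.
have [a [b ab]] := cbdd Y; exists a.
have : forall i, (i < a) || (a + `|b - a|%N%:Z < i) -> forall x : Y i, x = 0.
  by move=> i h; apply: ab; lia.
elim: `|b - a|%N Y {ab} => [|r IH] Y Y0.
  exists Y; split; last by exists (idm _); apply: is_iso_id.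
  by move=> i ia; apply: Y0; lia.
have [|Y' [YY' Y'0 _]] := @dsg_step Y a (a + r%:Z); first by move=> i h; apply: Y0; lia.
have [|Z [Zc YZ]] := IH Y'; first by move=> i h; apply: Y'0; lia.
by exists Z; split=> //; apply: isom_trans YY' YZ.
Qed.

Lemma conc_syz r (a : int) (Y : cpx R) : conc a Y ->
  exists b Y', [/\ conc b Y', @isom (Dsg R) Y Y', b = a - r%:Z & syzn r (Y' b) (Y a)].
Proof.
elim: r a Y => [|r IH] a Y Yc.
  by exists a, Y; split=> //; [exists (idm _); apply: is_iso_id|lia].
have [b ab] := int_pred a; subst a.
have [|Y' [YY' Y'0 syzY]] := @dsg_step Y (b + 1) b; first by move=> i h; apply: Yc; lia.
have [|c [Z [Zc YZ cE ZY]]] := IH b Y'; first by move=> i h; apply: Y'0; lia.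
exists c, Z; split=> //; [exact: isom_trans YY' YZ|lia|].
by exists (Y' b) => //; apply: syzY.
Qed.

Lemma fgmod_eq_iso (M N : fgmod R) : M = N ->
  exists f : {linear M -> N}, exists g : {linear N -> M}, cancel f g /\ cancel g f.
Proof. by move=> <-; exists (lid M), (lid M). Qed.

Lemma conc_unshift (b : int) (Y : cpx R) : conc b Y ->
  exists Y', [/\ conc (b + 1) Y', @isom (Dsg R) (shift Y') Y & Y' (b + 1) = Y b].
Proof.
move=> Yc; have [A AE] := int_reindex (T := fun=> fgmod R) (fun i => Y i).
have Ac i : i != b + 1 -> forall x : A i, x = 0.
  have [j ij] := int_pred i; subst i => jb; rewrite AE; apply: Yc; lia.
have Ab : exists a b : int, forall i, (i < a) || (b < i) -> forall x : A i, x = 0.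
  by exists (b + 1), (b + 1) => i h; apply: Ac; lia.
pose Y' := @Cpx R A (fun i => lzero _ _) (fun _ _ => erefl) Ab.
have dY i (x : Y i) : cd Y i x = 0.
  have [ib|ib] := eqVneq i b; last by rewrite (Yc i ib x) linear0.
  by apply: Yc; lia.
have /dchoice[f /dchoice[g fg]] i := fgmod_eq_iso (AE i).
have fC i (x : shift Y' i) : cd Y i (f i x) = f (i + 1) (cd (shift Y') i x).
  by rewrite dY -[cd (shift Y') i x]/(- (0 : A (i + 1 + 1))) oppr0 linear0.
have gC i (x : Y i) : cd (shift Y') i (g i x) = g (i + 1) (cd Y i x).
  by rewrite dY linear0; apply: oppr0.
exists Y'; split=> //; exists (qD (@Cmap R (shift Y') Y f fC)).
apply: (functor_iso (qD_functor R)); exists (@Cmap R Y (shift Y') g gC).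
by split=> i x; case: (fg i) => h1 h2; [apply: h1|apply: h2].
Qed.

Lemma conc0_stalk (Y : cpx R) : conc 0 Y -> @isom (Dsg R) (stalk (Y 0)) Y.
Proof.
move=> Yc.
have dY i (x : Y i) : cd Y i x = 0.
  have [ib|ib] := eqVneq i 0; last by rewrite (Yc i ib x) linear0.
  by apply: Yc; lia.
pose f i : {linear stalk (Y 0) i -> Y i} :=
  match i return {linear stalk_obj (Y 0) i -> Y i} with
  | Posz 0 => lid _ | Posz n.+1 => lzero _ _ | Negz n => lzero _ _ end.
pose g i : {linear Y i -> stalk (Y 0) i} :=
  match i return {linear Y i -> stalk_obj (Y 0) i} with
  | Posz 0 => lid _ | Posz n.+1 => lzero _ _ | Negz n => lzero _ _ end.
have fC i x : cd Y i (f i x) = f (i + 1) (cd (stalk (Y 0)) i x).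
  by rewrite dY stalk_d0 linear0.
have gC i x : cd (stalk (Y 0)) i (g i x) = g (i + 1) (cd Y i x).
  by rewrite dY stalk_d0 linear0.
exists (qD (Cmap fC)); apply: (functor_iso (qD_functor R)); exists (Cmap gC).
split=> i x; first by apply: stalk_eq => i0; subst i.
have [i0|i0] := eqVneq i 0; first by subst i.
by rewrite [LHS](Yc i i0) [RHS](Yc i i0).
Qed.

End Concentration.

Lemma gclass_orth (R : comNzRingType) (D : nat -> lmodType R) (G : fgmod R -> Prop) (M : fgmod R) :
  injres D -> D 0%N = R^o -> gclass G -> G M -> orth D M.
Proof.
move=> hD D0 [_ hp hext] GM j; elim: j M GM => [|j IH] M GM.
  rewrite D0; exact (hext M (FgMod (fg_regular R)) GM (@proj_regular R)).
have [N GN [P [i [p [hP ip]]]]] := hp M GM; have [E [c [r [EI cr]]]] := hD j.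
by apply/(extU_shift one_set hP ip EI cr); apply: IH.
Qed.

Section Density.
Variables (S R : comNzRingType) (pi : {rmorphism S -> R}) (w : S) (n : {pred S}).
Hypotheses (piP : is_quotient_by pi w) (noethS : noetherian S) (wreg : GRing.lreg w).
Hypotheses (locS : local_ring n) (wn : w \in n).
Notation stMonG := (stable_category (MonG w)).

Lemma T_dense_gorenstein : @dense stMonG (Dsg R) (T0 piP) -> gorenstein_ring R.
Proof.
move=> dT; have noethR := quot_noetherian piP noethS.
have locR := quot_local piP noethS locS wn.
have [D [D0 hD _]] := injres_ex (R^o : lmodType R).
have [k [pk [pks pk0]]] := cyclic_quot (local_ideal locR).
have [X XK] := dT (stalk (FgMod (fg_surj pks (fg_regular R)))).
have [|j0 hj] := stalk_isom_ext (fun=> hD) (isom_sym XK).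
  exists 0%N => j _; exact (gclass_orth hD D0 (coker_gclass piP noethS wreg) (ex_intro _ X erefl) (j := j)).
apply/(gorenstein_ext noethR D0 hD); exists j0.
by apply: (ext_local noethR locR hD _ pks pk0 hj); rewrite D0; apply: fg_regular.
Qed.

Lemma coker_isom (X : subobj (MonG w)) (M : fgmod R) (f : {linear mtgt X -> restr pi M}) :
  surj f -> exact_at (mmap X) f -> @isom (Dsg R) (T0 piP X) (stalk M).
Proof.
move=> fs fe; have [|g gE] := fac_surj (f := f) (@cpr_surj S R pi w piP X).
  by move=> y /cpr0[x <-]; apply: ses_comp0 fe.
have gi : injective (ulin piP g : {linear coker piP X -> M}).
  apply: inj0 => c; have [y <-] := @cpr_surj S R pi w piP X c => e.
  by apply/cpr0; apply/fe; rewrite -gE.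
have gs : surj (ulin piP g : {linear coker piP X -> M}).
  by move=> m; have [y yE] := fs m; exists (cpr piP X y); apply: etrans (gE y) yE.
have [h [hg gh]] := lin_inv gi gs.
exists (qD (stalk_map (ulin piP g : {linear coker piP X -> M}))), (qD (stalk_map h)); split.
  apply: heq_trans (heq_sym (qD_stalk_comp (h := lid _) (fun x => esym (hg x)))) _.
  exact: qD_stalk_id.
apply: heq_trans (heq_sym (qD_stalk_comp (h := lid _) (fun x => esym (gh x)))) _.
exact: qD_stalk_id.
Qed.

(** The object is the kernel of a free S-cover of M. Orthogonality of M over R becomes, by [rees]
    and one syzygy, orthogonality of that kernel over S, hence Gorenstein projectivity. *)
Lemma orth_coker (D : nat -> lmodType R) (M : fgmod R) : injres D -> D 0%N = R^o ->
  gorenstein_ring S -> orth D M -> exists X : stMonG, @isom (Dsg R) (T0 piP X) (stalk M).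
Proof.
move=> hD D0 gS hM; have noethR := quot_noetherian piP noethS.
have [C [C0 hC _]] := injres_ex (S^o : lmodType S).
have [m [p ps]] := fg_cover (restr_fg piP (fg_prop M)).
have [K [i [ii ie]]] := ker_ex p.
have ip : short_exact i p by split.
pose G := FgMod (fg_inj noethS ii (fg_row S m)).
have hG : orth C G.
  move=> j; have [E [c [r [EI cr]]]] := hC j.
  apply/(extU_shift one_set (@proj_row S m) ip EI cr).
  by apply/(rees piP wreg _ noethR hC C0 hD D0 (fg_prop M)).
have hX : MonG w (@MorObj S G (rowmod S m) i).
  split=> //=; [exact (orth_gorenstein noethS C0 hC gS hG)|exact: proj_row|].
  by move=> y; apply/ie; rewrite linZ (restr_kill piP).
by exists (SubObj hX); apply: (coker_isom (X := SubObj hX) ps ie).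
Qed.

Lemma gorenstein_T_dense (sh : suspension (MonG w)) : gorenstein_ring R ->
  @dense stMonG (Dsg R) (T0 piP).
Proof.
move=> gR Y; have noethR := quot_noetherian piP noethS.
have gS : gorenstein_ring S := (gorenstein_quot piP noethS locS wn wreg).1 gR.
have [D [D0 hD _]] := injres_ex (R^o : lmodType R).
have [N hN] := (gorenstein_ext noethR D0 hD).1 gR.
have [a [Z [Zc YZ]]] := dsg_conc noethR Y.
(* At least N syzygies make the module orthogonal; the further |a| move it to a degree b <= 0. *)
have [b [Z' [Z'c ZZ' bE ZZs]]] := conc_syz noethR (N + `|a|%N) Zc.
have oZ : orth D (Z' b).
  move=> j; apply/(syzn_shift one_set j hD ZZs); apply: hN; first exact: fg_prop.
  by rewrite (leq_trans (leq_addr `|a|%N N)) // leq_addl.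
(* A complex in degree -r is an r-fold shift of a stalk, and T carries suspensions to shifts. *)
suff main (r : nat) (V : cpx R) c : c = - r%:Z -> conc c V -> orth D (V c) ->
    exists X : stMonG, @isom (Dsg R) (T0 piP X) V.
  have [X XZ] : exists X : stMonG, @isom (Dsg R) (T0 piP X) Z'.
    by apply: (main (`|b|%N) _ b) => //; lia.
  exists X; apply: isom_trans XZ _; apply: isom_sym; exact: isom_trans YZ ZZ'.
elim: r V c => [|r IH] V c cE Vc oV.
  have c0 : c = 0 by lia.
  subst c; have [X XV] := orth_coker hD D0 gS oV.
  by exists X; apply: isom_trans XV (conc0_stalk Vc).
have [V' [V'c VV' V'E]] := conc_unshift Vc.
have [||X [f fI]] := IH V' (c + 1) _ V'c; [lia|by rewrite V'E|].
have [_ [xi [xiI _ _]]] := T_triangle piP wreg sh.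
exists (susp sh X); apply: isom_trans (ex_intro _ _ (xiI X)) _.
by apply: isom_trans VV'; exists (@sh1 (Dsg R) _ _ f); apply: functor_iso (sh_functor (Dsg R)) fI.
Qed.

Lemma incl_dense : (forall G : fgmod S, gorenstein_projective G -> projective_module G) ->
  @dense stMonG (Dsg R) (T0 piP) ->
  @dense (stable_category (MonP w)) (Dsg R) (fun X => T0 piP (incl0 X)).
Proof.
move=> gp dT Y; have [[X hX] XY] := dT Y.
have hX' : MonP w X by case: (hX) => *; split=> //; apply: gp.
exists (SubObj hX'); rewrite (_ : incl0 (SubObj hX') = SubObj hX) //.
by congr SubObj; apply: Prop_irrelevance.
Qed.

End Density.

(** * Finite global dimension and regular rings *)

Section ProjDim.
Variable S : comNzRingType.
Implicit Types M N K P : lmodType S.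

(* Projective dimension at most [D]. *)
Definition epd (D : nat) M : Prop :=
  forall C, injres C -> forall j, (D <= j)%N -> ext1 M (C j).

Lemma proj_epd D P : projective_module P -> epd D P.
Proof. by move=> hP C _ j _; exact (extU_proj (mulset1 S) hP). Qed.

Lemma epd_syz D K P M (i : {linear K -> P}) (p : {linear P -> M}) :
  projective_module P -> short_exact i p -> epd D K <-> epd D.+1 M.
Proof.
move=> hP ip; split=> h C hC j jD; last first.
  have [E [c [r [EI cr]]]] := hC j.
  by apply/(extU_shift one_set hP ip EI cr); apply: h.
case: j jD => // j jD; have [E [c [r [EI cr]]]] := hC j.
by apply/(extU_shift one_set hP ip EI cr); apply: h.
Qed.

Lemma epd_retract D M N (i : {linear M -> N}) (r : {linear N -> M}) :
  (forall x, r (i x) = x) -> epd D N -> epd D M.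
Proof. by move=> ri h C hC j jD; exact (extU_retract ri (h C hC j jD)). Qed.

Lemma epd_syzn r D K M : syzn r K M -> epd D K -> epd (D + r) M.
Proof.
move=> KM hK C hC j jD; rewrite -(subnK (leq_trans (leq_addl D r) jD)).
apply/(syzn_shift one_set _ hC KM); apply: hK => //.
by rewrite leq_subRL ?(leq_trans (leq_addl D r) jD) // addnC.
Qed.

Lemma split_proj K P M (i : {linear K -> P}) (p : {linear P -> M}) :
  projective_module P -> short_exact i p -> ext1 M K -> projective_module M.
Proof.
move=> hP ip h; have [_ -> [r rE]] := h _ _ _ _ ip (lid K); have [_ ie ps] := ip.
have [|s sE] := fac_surj (f := lsub (lid P) (lcomp i r)) ps.
  by move=> x /ie[k <-]; rewrite !lE rE scale1r lE subrr.
apply: (proj_retract (i := s) (r := p)) hP => m; have [x <-] := ps m.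
by rewrite sE !lE linearB (ses_comp0 _ ie) subr0.
Qed.

Lemma epd0_proj M : finitely_generated M -> epd 0 M -> projective_module M.
Proof.
move=> /fg_cover[m [p ps]] h; have [K [i [ii ie]]] := ker_ex p.
have [C [C0 hC _]] := injres_ex K.
have := h C hC 0%N (leqnn 0); rewrite C0; apply: (split_proj (@proj_row S m)).
by split; [exact: ii|exact: ie|exact: ps].
Qed.

Hypothesis noethS : noetherian S.

Lemma ext_proj M : finitely_generated M ->
  (forall N, finitely_generated N -> ext1 M N) -> projective_module M.
Proof.
move=> /fg_cover[m [p ps]] h; have [K [i [ii ie]]] := ker_ex p.
apply: (split_proj (@proj_row S m) (i := i) (p := p)).
  by split; [exact: ii|exact: ie|exact: ps].
by apply: h; exact (fg_inj noethS ii (fg_row S m)).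
Qed.

Definition gldim (D : nat) : Prop := forall M, finitely_generated M -> epd D M.

Variable n : {pred S}.
Hypothesis locS : local_ring n.

(** Ext^1 of the D-th syzygy K of M is Ext^(D+1) of M, which the residue field controls; so K is
    projective. *)
Lemma gldim_local D (k : lmodType S) (pk : {linear S^o -> k}) :
  surj pk -> (forall x, pk x = 0 <-> x \in n) -> epd D k -> gldim D.
Proof.
move=> pks pk0 hk M fgM; have [K KM fgK] := syzn_ex noethS D fgM.
apply: (epd_syzn (D := 0) KM); apply: proj_epd; apply: (ext_proj fgK) => N fgN.
have [C [C0 hC _]] := injres_ex N; rewrite -C0.
apply/(syzn_ext1 hC KM).
by apply: (ext_local noethS locS hC _ pks pk0 (hk C hC)); rewrite ?C0.
Qed.

End ProjDim.

(** * Projective dimension modulo a regular element *)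

Section QuotientDim.
Variables (S R : comNzRingType) (pi : {rmorphism S -> R}) (x : S).
Hypotheses (piP : is_quotient_by pi x) (xreg : GRing.lreg x) (noethS : noetherian S).

(* [M'] is M / x M. *)
Definition red (M : lmodType S) (M' : lmodType R) (rho : {linear M -> restr pi M'}) : Prop :=
  surj rho /\ forall y, rho y = 0 <-> exists z, x *: z = y.

Lemma red_ex (M : lmodType S) : exists M' rho, @red M M' rho.
Proof.
have [Q [q [qs q0]]] := coker_ex (lscale x (lid M)).
have [|M' [j [ji js]]] := desc_ex piP (N := Q).
  by move=> c; have [y <-] := qs c; rewrite -linZ; apply/q0; exists y; rewrite !lE.
have [g [gj jg]] := lin_inv ji js.
exists M', (lcomp g q); split=> [c|y].
  by have [y yE] := qs (j c); exists y; rewrite lE yE gj.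
rewrite lE; split=> [e|[z zE]].
  have /q0[z zE] : q y = 0 by rewrite -[q y]jg e linear0.
  by exists z; rewrite !lE in zE.
by rewrite (_ : q y = 0) ?linear0 //; apply/q0; exists z; rewrite !lE.
Qed.

Lemma red_proj (M : lmodType S) (M' : lmodType R) (rho : {linear M -> restr pi M'}) :
  red rho -> projective_module M -> projective_module M'.
Proof.
move=> [rs r0] hM A B p f ps; have [g gE] := hM _ _ (rlin pi p) (lcomp (rlin pi f) rho) ps.
have [|h hE] := fac_surj (f := g) rs.
  by move=> _ /r0[z <-]; rewrite linZ (restr_kill piP).
exists (ulin piP h) => c; have [y <-] := rs c.
by change (p (h (rho y)) = f (rho y)); rewrite hE; exact: gE.
Qed.

Lemma red_map (M N : lmodType S) (M' N' : lmodType R) (rho : {linear M -> restr pi M'})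
    (sig : {linear N -> restr pi N'}) (f : {linear M -> N}) : red rho -> red sig ->
  exists f' : {linear M' -> N'}, forall y, f' (rho y) = sig (f y).
Proof.
move=> [rs r0] [ss s0]; have [|h hE] := fac_surj (f := lcomp sig f) rs.
  by move=> _ /r0[z <-]; rewrite lE linZ; apply/s0; exists (f z).
by exists (ulin piP h) => y; exact: hE.
Qed.

(** Left exactness after reduction modulo x is the vanishing of Tor_1(R, M), that is, regularity of
    x on M. *)
Lemma red_ses (K P M : lmodType S) (K' P' M' : lmodType R) (k : {linear K -> restr pi K'})
    (q : {linear P -> restr pi P'}) (m : {linear M -> restr pi M'})
    (i : {linear K -> P}) (p : {linear P -> M}) :
  injective (lscale x (lid M)) -> short_exact i p -> red k -> red q -> red m ->
  exists (i' : {linear K' -> P'}) (p' : {linear P' -> M'}), short_exact i' p'.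
Proof.
move=> xM [ii ie ps] hk hq hm; have [i' iE] := red_map i hk hq; have [p' pE] := red_map p hq hm.
have [ks k0] := hk; have [qs q0] := hq; have [ms m0] := hm.
exists i', p'; split.
- apply: inj0 => c; have [y <-] := ks c; rewrite iE => /q0[z zE].
  have /ie[y' y'E] : p z = 0.
    by apply: xM; rewrite !lE -linZ zE (ses_comp0 _ ie) linear0.
  by apply/k0; exists y'; apply: ii; rewrite linZ y'E.
- move=> c; have [y <-] := qs c; rewrite pE; split=> [/m0[z zE]|[c' ]].
    have [z' z'E] := ps z; have [y' y'E] : exists y', i y' = y - x *: z'.
      by apply/ie; rewrite linearB linZ z'E zE subrr.
    exists (k y'); rewrite iE y'E linearB.
    by rewrite ((q0 (x *: z')).2 _) ?subr0 //; exists z'.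
  have [y' <-] := ks c'; rewrite iE => e; rewrite -pE -e pE (ses_comp0 _ ie).
  exact: linear0.
- by move=> c; have [y <-] := ms c; have [z <-] := ps y; exists (q z); rewrite pE.
Qed.

Lemma red_epd D (M : lmodType S) (M' : lmodType R) (rho : {linear M -> restr pi M'}) :
  red rho -> injective (lscale x (lid M)) -> finitely_generated M -> epd D M -> epd D M'.
Proof.
elim: D M M' rho => [|D IH] M M' rho rM xM fgM hM.
  by apply: proj_epd; apply: red_proj rM (epd0_proj fgM hM).
have [m [p ps]] := fg_cover fgM; have [K [i [ii ie]]] := ker_ex p.
have ip : short_exact i p by split.
have [K' [k rK]] := red_ex K; have [P' [q rP]] := red_ex 'rV[S]_m.
have [i' [p' ip']] := red_ses xM ip rK rP rM.
apply/(epd_syz D (red_proj rP (@proj_row S m)) ip').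
apply: (IH K K' k rK); last first.
- exact/(epd_syz D (@proj_row S m) ip).
- exact (fg_inj noethS ii (fg_row S m)).
apply: inj0 => y; rewrite !lE => y0; apply: ii; rewrite linear0.
by apply: (@proj_reg S x xreg (rowmod S m) (@proj_row S m)); rewrite !lE -linZ y0 !linear0.
Qed.

End QuotientDim.

Section IdealQuotient.
Local Open Scope quotient_scope.
Variables (S : comNzRingType) (I : S -> Prop).
Hypotheses (hI : ideal I) (I1 : ~ I 1).
Definition iq_pred : {pred S} := let _ := (hI, I1) in fun x => `[< I x >] : bool.
Fact iq_closed : idealr_closed iq_pred.
Proof. exact: submod_idealr hI I1. Qed.
HB.instance Definition _ := isIdealr.Build S iq_pred iq_closed.
Definition iq_ring : comNzRingType := {ideal_quot (iq_pred : idealr S)}.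
Definition iq_pi (x : S) : iq_ring := \pi_{ideal_quot (iq_pred : idealr S)} x.
Fact iq_pi_add : zmod_morphism iq_pi.
Proof. by move=> x y; rewrite /iq_pi !piE. Qed.
Fact iq_pi_mul : monoid_morphism iq_pi.
Proof. by split=> [|x y]; rewrite /iq_pi !piE. Qed.
HB.instance Definition _ := GRing.isZmodMorphism.Build S iq_ring iq_pi iq_pi_add.
HB.instance Definition _ := GRing.isMonoidMorphism.Build S iq_ring iq_pi iq_pi_mul.

Lemma iq_pi_surj r : exists s, iq_pi s = r.
Proof. by exists (repr r); apply: reprK. Qed.

Lemma iq_pi0 s : iq_pi s = 0 <-> I s.
Proof.
have -> : (iq_pi s = 0) <-> (iq_pi s == iq_pi 0).
  by split=> [->|/eqP ->]; [rewrite -(rmorph0 iq_pi)|rewrite rmorph0].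
rewrite /iq_pi -(Quotient.idealrBE (iq_pred : idealr S)) subr0.
by split=> [/asboolP|?] //; apply/asboolP.
Qed.
End IdealQuotient.

Lemma quot_ring_ex (S : comNzRingType) (n : {pred S}) (x : S) : local_ring n -> x \in n ->
  exists (R : comNzRingType) (pi : {rmorphism S -> R}), is_quotient_by pi x.
Proof.
move=> locS xn; have hn := local_ideal locS.
have hI : ideal (fun s => exists t, s = t * x).
  split=> [|a y z [t ->] [t' ->]]; first by exists 0; rewrite mul0r.
  by exists (a * t + t'); rewrite mulrDl -mulrA.
have I1 : ~ exists t, 1 = t * x.
  by case=> t e; have := local_not1 locS; rewrite e (idealM hn).
exists (iq_ring hI I1), (iq_pi hI I1); split; first exact: iq_pi_surj.
by move=> s; rewrite iq_pi0.
Qed.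

(** * Divisibility by an element of n, and towers of regular elements *)

Section KrullIntersection.
Variables (S : comNzRingType) (n : {pred S}).
Hypotheses (noethS : noetherian S) (locS : local_ring n).

Lemma principal_ideal (a : S) : ideal (fun s => exists t, s = t * a).
Proof.
split=> [|b y z [t ->] [t' ->]]; first by exists 0; rewrite mul0r.
by exists (b * t + t'); rewrite mulrDl -mulrA.
Qed.

Lemma unit_sub1 (x t : S) : x \in n -> exists y, y * (1 - t * x) = 1.
Proof.
move=> xn; apply: (local_unit noethS locS); apply/negP => h; have hn := local_ideal locS.
have := local_not1 locS; rewrite -[1](subrK (t * x)) => /negP; apply.
by apply: (idealD hn) => //; apply: (idealM hn).
Qed.

(** Among the ideals (a') with a = x^i a' a maximal one exists. If a' = c x for it, then (c) = (a'),
    so c = t c x and c = 0 since 1 - t x is a unit. *)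
Lemma krull_factor (x a : S) : x \in n -> a != 0 ->
  exists i a', a = x ^+ i * a' /\ ~ exists c, a' = c * x.
Proof.
move=> xn a0; pose P (U : S^o -> Prop) := exists i a', a = x ^+ i * a' /\
  forall s : S, U s <-> exists t, s = t * a'.
have [|V [hV [i [a' [aE VE]]] Vmax]] := noeth_max noethS (P := P) (fg_regular S) (principal_ideal a).
  by exists 0%N, a; rewrite expr0 mul1r.
exists i, a'; split=> // -[c cE].
have [|s Vs||t ct] := (VE c).1 (Vmax (fun s => exists t, s = t * c) (principal_ideal c) _ _ c _).
- by exists i.+1, c; split=> //; rewrite aE cE exprSr -mulrA [c * x]mulrC.
- by have [t ->] := (VE s).1 Vs; exists (t * x); rewrite cE [c * x]mulrC mulrA.
- by exists 1; rewrite mul1r.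
have [y yE] := unit_sub1 t xn.
have c0 : c = 0.
  rewrite -[c]mul1r -yE -mulrA mulrBl mul1r -mulrA [x * c]mulrC -cE -ct subrr mulr0 //.
by move/eqP: a0; apply; rewrite aE cE c0 mul0r mulr0.
Qed.

End KrullIntersection.

Section QuotientExt.
Variables (S R : comNzRingType) (pi : {rmorphism S -> R}) (x : S) (n : {pred S}).
Hypotheses (piP : is_quotient_by pi x) (xreg : GRing.lreg x).

Lemma epd_restr D (M : lmodType R) : epd D M -> epd D.+1 (restr pi M).
Proof.
move=> h C hC [//|j] jD; have [T /dchoice[t tP]] := choice (fun j => tors_ex piP (C j)).
have ti i : injective (t i) by case: (tP i).
have tE i y : x *: y = 0 <-> exists z, t i z = y by case: (tP i).
apply/(tors_ext piP xreg hC ti tE); apply: (h (fun j => T j.+1)) => //.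
exact: (tors_injres piP xreg hC ti tE).
Qed.

Fact residue_linear (k' : lmodType R) (pk : {linear R^o -> k'}) :
  linear (fun s : S^o => pk (pi s) : restr pi k').
Proof. by move=> a s t; rewrite rmorphD rmorphM (linearP pk). Qed.

Lemma quot_prime (p : R -> Prop) : prime p -> prime (fun s => p (pi s)).
Proof.
move=> [hp p1 pM]; split=> [||a b]; last by rewrite rmorphM; apply: pM.
  split=> [|a s t hs ht]; first by rewrite rmorph0; apply: (ideal0 hp).
  by rewrite rmorphD rmorphM; apply: (idealD hp) => //; apply: (idealM hp).
by rewrite rmorph1.
Qed.

End QuotientExt.

Fixpoint regloc (d : nat) (S : comNzRingType) (n : {pred S}) : Prop :=
  if d is e.+1 then exists (x : S) (R : comNzRingType) (pi : {rmorphism S -> R}),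
    [/\ x \in n, GRing.lreg x, is_quotient_by pi x & regloc e (quot_max pi n)]
  else forall x, x \in n -> x = 0.

Lemma regloc_gldim d (S : comNzRingType) (n : {pred S}) :
  noetherian S -> local_ring n -> regloc d n -> gldim S d.
Proof.
elim: d S n => [|d IH] S n noethS locS /=.
  move=> n0; apply: (gldim_local noethS locS (pk := lid (S^o : lmodType S))).
  - by move=> y; exists y.
  - by move=> y; split=> [e|/n0 //]; rewrite (e : y = 0); apply: (ideal0 (local_ideal locS)).
  - exact/proj_epd/proj_regular.
case=> x [R [pi [xn xreg piP rR]]].
have noethR := quot_noetherian piP noethS; have locR := quot_local piP noethS locS xn.
have [k' [pk [pks pk0]]] := cyclic_quot (local_ideal locR).
apply: (gldim_local noethS locS (pk := lin (residue_linear pi pk))).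
- by move=> c; have [r <-] := pks c; have [s <-] := piP.1 r; exists s.
- by move=> s; rewrite -(quot_maxP piP locS xn) -pk0.
- by apply: (epd_restr piP xreg); apply: (IH R _ noethR locR rR); apply: fg_surj pks (fg_regular R).
Qed.

Lemma quot_gens (S R : comNzRingType) (pi : {rmorphism S -> R}) (x : S) (n : {pred S}) d
    (e : 'I_d -> R) : is_quotient_by pi x -> local_ring n -> x \in n ->
  generated_by e (quot_max pi n) -> exists e' : 'I_d.+1 -> S, generated_by e' n.
Proof.
move=> piP locS xn eE; have hn := local_ideal locS.
have [f fE] := choice (fun i => piP.1 (e i)).
exists (fun i => if unlift ord0 i is Some j then f j else x) => y; split=> [yn|[c ->]]; last first.
  apply: (ideal_sum hn) => i _; apply: (idealM hn); case: unliftP => [j _|_] //.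
  rewrite -(quot_maxP piP locS xn) fE; apply/eE.
  exists (fun k => if k == j then 1 else 0); rewrite (bigD1 j) //= eqxx mul1r big1 ?addr0 //.
  by move=> k /negbTE ->; rewrite mul0r.
have [c cE] : exists c : 'I_d -> R, pi y = \sum_i c i * e i.
  by apply/eE; rewrite (quot_maxP piP locS xn).
have [b bE] := choice (fun i => piP.1 (c i)).
have [t tE] : exists t, y - \sum_i b i * f i = t * x.
  apply/piP.2; rewrite rmorphB rmorph_sum /= cE; apply/eqP; rewrite subr_eq0; apply/eqP.
  by apply: eq_bigr => i _; rewrite rmorphM bE fE.
exists (fun i => if unlift ord0 i is Some j then b j else t).
rewrite big_ord_recl unlift_none -tE [X in _ + X](eq_bigr (fun i => b i * f i)) ?subrK // => i _.
by rewrite liftK.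
Qed.

(* A regular element x with S / x a domain makes S a domain: factor out powers of x. *)
Lemma domain_lift (S R : comNzRingType) (pi : {rmorphism S -> R}) (x : S) (n : {pred S}) :
  noetherian S -> local_ring n -> x \in n -> GRing.lreg x -> is_quotient_by pi x ->
  prime (fun r : R => r = 0) -> prime (fun s : S => s = 0).
Proof.
move=> noethS locS xn xreg piP [_ _ rM]; split=> [||a b ab].
- by split=> // a s t -> ->; rewrite scaler0 addr0.
- by apply/eqP; apply: oner_neq0.
have [->|a0] := eqVneq a 0; [by left|right]; apply/eqP; apply: contraT => b0.
have [i [a' [aE na]]] := krull_factor noethS locS xn a0.
have [j [b' [bE nb]]] := krull_factor noethS locS xn b0.
have xk k (c : S) : x ^+ k * c = 0 -> c = 0.
  by elim: k => [|k IH]; rewrite ?expr0 ?mul1r // exprS -mulrA => e; apply: IH; apply: xreg; rewrite mulr0.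
have ab' : a' * b' = 0.
  by apply: (xk (i + j)%N); rewrite exprD mulrACA -aE -bE.
have /rM[/piP.2[t tE]|/piP.2[t tE]] : pi a' * pi b' = 0 by rewrite -rmorphM ab' rmorph0.
  by case: na; exists t.
by case: nb; exists t.
Qed.

Lemma regloc_domain d (S : comNzRingType) (n : {pred S}) :
  noetherian S -> local_ring n -> regloc d n -> prime (fun s : S => s = 0).
Proof.
elim: d S n => [|d IH] S n noethS locS /=.
  move=> n0; split=> [||a b ab]; first by split=> // a s t -> ->; rewrite scaler0 addr0.
    by apply/eqP; apply: oner_neq0.
  have [/n0 ->|/(local_unit noethS locS)[c ca]] := boolP (a \in n); [by left|right].
  by rewrite -[b]mul1r -ca -mulrA ab mulr0.
case=> x [R [pi [xn xreg piP rR]]].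
have noethR := quot_noetherian piP noethS; have locR := quot_local piP noethS locS xn.
exact: domain_lift noethS locS xn xreg piP (IH R _ noethR locR rR).
Qed.

Definition chain (S : comNzRingType) (d : nat) (p : nat -> S -> Prop) : Prop :=
  (forall i, (i <= d)%N -> prime (p i)) /\
  (forall i, (i < d)%N -> (forall s, p i s -> p i.+1 s) /\ exists s, p i.+1 s /\ ~ p i s).

Lemma lreg_neq0 (S : comNzRingType) (x : S) : GRing.lreg x -> x <> 0.
Proof. by move=> xreg x0; have /eqP := oner_neq0 S; apply; apply: xreg; rewrite x0 !mul0r. Qed.

Lemma regloc_chain d (S : comNzRingType) (n : {pred S}) :
  noetherian S -> local_ring n -> regloc d n -> exists p, @chain S d p.
Proof.
elim: d S n => [|d IH] S n noethS locS hr.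
  exists (fun _ s => s = 0); split=> // -[] // _; exact: regloc_domain hr.
have h0 := regloc_domain noethS locS hr.
case: hr => x [R [pi [xn xreg piP rR]]].
have noethR := quot_noetherian piP noethS; have locR := quot_local piP noethS locS xn.
have [p [pp pc]] := IH R _ noethR locR rR.
exists (fun i s => if i is j.+1 then p j (pi s) else s = 0); split=> [[|i]//|[|i]] id.
- exact/quot_prime/pp.
- have [hp _ _] := pp 0%N isT; split=> [s ->|]; first by rewrite rmorph0; apply: (ideal0 hp).
  exists x; split; last exact: lreg_neq0.
  by rewrite (piw piP); apply: (ideal0 hp).
have [sub [r [pr nr]]] := pc i id; split=> [s|]; first exact: sub.
by have [s sE] := piP.1 r; exists s; rewrite sE.
Qed.

Lemma chain_prime_chain (S : comNzRingType) d p : @chain S d p -> prime_chain S d.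
Proof.
move=> [pp pc]; exists (fun i s => `[< p i s >] : bool); split=> i id.
  have [hp p1 pM] := pp i id; split; first exact: submod_idealr.
  move=> u v; rewrite !unfold_in => /asboolP/pM[] ?; apply/orP; [left|right]; exact/asboolP.
have [sub [s [s1 s0]]] := pc i id; split=> [x|h].
  by rewrite !unfold_in => /asboolP/sub ?; apply/asboolP.
have : s \in (fun s => `[< p i s >] : bool) by apply: h; rewrite unfold_in; apply/asboolP.
by rewrite unfold_in => /asboolP.
Qed.

Lemma prime_chain_chain (S : comNzRingType) d : prime_chain S d -> exists p, @chain S d p.
Proof.
move=> [p [pp pc]]; exists (fun i s => s \in p i); split=> i id.
  have [hp pM] := pp i id; split; first exact: idealr_submod.
    by case: hp => _ /negP.
  by move=> a b /pM/orP.
have [sub ns] := pc i id; split=> //; apply: contrapT => h; apply: ns => s s1.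
by apply: contrapT => s0; apply: h; exists s; split.
Qed.

Lemma gldim_chain (S : comNzRingType) D e p : noetherian S -> gldim S D -> @chain S e p -> (e <= D)%N.
Proof.
move=> noethS hD [pp pc]; apply: (prime_chain_bound noethS pp pc) => C hC _ M fgM j jD.
exact (hD M fgM C hC j jD).
Qed.

(** * Local rings of finite global dimension *)

Section FiniteGldim.
Variables (S : comNzRingType) (n : {pred S}).
Hypotheses (noethS : noetherian S) (locS : local_ring n).
Let hn := local_ideal locS.

(** s embeds k in S with cokernel Q, and Ext^i(k) injects into Ext^(i+1)(Q) for i > 0; so the bound
    D drops to 0. Then k is a summand of S generated by a unit that n kills, and n = 0. *)
Lemma socle_gldim D (s : S) : s != 0 -> (forall x, x \in n -> x * s = 0) -> gldim S D ->
  forall x, x \in n -> x = 0.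
Proof.
move=> s0 ns; have [k [pk [pks pk0]]] := cyclic_quot hn.
have fgk := fg_surj pks (fg_regular S).
elim: D => [|D IH] gD x xn.
  have [si siE] := proj_section (epd0_proj fgk (gD k fgk)) pks.
  pose e : S := si (pk 1).
  have [|y ye] := @local_unit S n noethS locS e.
    apply/negP => en; have /negP := local_not1 locS; apply; apply/pk0.
    by rewrite -(siE (pk 1)); apply/pk0.
  have xe : x * e = 0.
    have -> : x * e = si (pk (x *: (1 : S^o))) by rewrite linZ linZ.
    have -> : x *: (1 : S^o) = x by apply: mulr1.
    by rewrite ((pk0 x).2 xn) linear0.
  by rewrite -[x]mulr1 -ye mulrCA xe mulr0.
apply: (IH _ x xn); apply: (gldim_local noethS locS pks pk0) => C hC j jD.
have L : linear (fun t : S^o => t * s : S^o) by move=> a t u; rewrite mulrDl -mulrA.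
have [|i iE] := fac_surj (f := lin L) pks; first by move=> t /pk0; apply: ns.
have ii : injective i.
  apply: inj0 => c; have [t <-] := pks c; rewrite iE => ts; apply/pk0.
  apply: contraT => /(local_unit noethS locS)[u ut]; case/eqP: s0.
  by rewrite -[s]mul1r -ut -mulrA [t * s]ts mulr0.
have [Q [q [qs qE]]] := coker_ex i.
have iq : short_exact i q by split; [exact: ii|exact: qE|exact: qs].
apply: (extU_left (mulset1 S) iq (hC j)); first exact (extU_proj (mulset1 S) (@proj_regular S)).
exact (gD Q (fg_surj qs (fg_regular S)) C hC j.+1 jD).
Qed.

(** The annihilator of s is maximal among annihilators of nonzero elements. These are the maximal
    associated primes of S, each handled through an element s. *)
Definition maxann (s : S) : Prop := s <> 0 /\
  forall t, t <> 0 -> (forall a, a * s = 0 -> a * t = 0) -> forall a, a * t = 0 -> a * s = 0.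

Lemma ann_ideal (s : S) : ideal (fun a => a * s = 0).
Proof.
split=> [|a x y xs ys]; first by rewrite mul0r.
by rewrite mulrDl ys addr0 -mulrA xs mulr0.
Qed.

Lemma maxann_prime s : maxann s -> prime (fun a => a * s = 0).
Proof.
move=> [s0 smax]; split; [exact: ann_ideal|by rewrite mul1r|move=> a b abs].
have [bs|bs] := eqVneq (b * s) 0; [by right|left].
apply: (smax (b * s)) => [|c cs|]; [exact/eqP|by rewrite mulrCA cs mulr0|by rewrite mulrA].
Qed.

Lemma zero_div_maxann y : ~ GRing.lreg y -> exists s, maxann s /\ y * s = 0.
Proof.
move=> yr; have [t [t0 yt]] : exists t, t <> 0 /\ y * t = 0.
  apply: contrapT => h; apply: yr => a b ab; apply/eqP; rewrite -subr_eq0; apply/eqP.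
  by apply: contrapT => d0; apply: h; exists (a - b); rewrite mulrBr ab subrr.
pose P (U : S^o -> Prop) := (forall a : S, a * t = 0 -> U a) /\
  exists s, s <> 0 /\ forall a : S, U a <-> a * s = 0.
have [|V [hV [tV [s [s0 sE]]] Vmax]] := noeth_max noethS (P := P) (fg_regular S) (ann_ideal t).
  by split=> //; exists t.
exists s; split; last exact/sE/tV.
split=> // u u0 su a au; apply/sE.
apply: (Vmax (fun a : S => a * u = 0) (ann_ideal u)) => [|b Vb|//]; last exact/su/sE.
by split=> [b bt|]; [apply/su/sE/tV|exists u].
Qed.

Lemma prime_avoid_seq (p : S -> Prop) (l : seq S) : prime p ->
  (forall t, t \in l -> exists a, a * t = 0 /\ ~ p a) ->
  exists a, ~ p a /\ forall t, t \in l -> a * t = 0.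
Proof.
move=> [hp p1 pM]; elim: l => [|t l IH] h; first by exists 1.
have [a [at0 pa]] := h t (mem_head t l).
have [|b [pb bl]] := IH; first by move=> u ul; apply: h; rewrite inE ul orbT.
exists (a * b); split=> [/pM[]//|u]; rewrite inE => /orP[/eqP ->|ul].
  by rewrite mulrAC at0 mul0r.
by rewrite -mulrA bl // mulr0.
Qed.

Fixpoint lspan (l : seq S) (x : S) : Prop :=
  if l is s :: l' then exists c y, lspan l' y /\ x = c * s + y else x = 0.

Lemma lspan_ideal l : ideal (lspan l).
Proof.
elim: l => [|s l [IH0 IHD]] /=; first by split=> // a x y -> ->; rewrite scaler0 addr0.
split=> [|a x y [c [u [lu ->]]] [d [v [lv ->]]]]; first by exists 0, 0; rewrite mul0r addr0.
exists (a * c + d), (a * u + v); split; first exact: IHD.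
by rewrite [a *: _]mulrDr mulrDl mulrA addrACA.
Qed.

Lemma lspan_ann l a x : (forall t, t \in l -> a * t = 0) -> lspan l x -> a * x = 0.
Proof.
elim: l x => [|s l IH] x h /=; first by move=> ->; rewrite mulr0.
case=> c [y [ly ->]]; rewrite mulrDr mulrCA (h s) ?mem_head // mulr0 add0r IH //.
by move=> t tl; apply: h; rewrite inE tl orbT.
Qed.

(** Take a list l with maximal span. Any further s lies in the span; if no annihilator from l
    contained that of s, a product of elements would kill l but not s. *)
Lemma maxann_finite : exists l : seq S, (forall s, s \in l -> maxann s) /\
  forall s, maxann s -> exists2 t, t \in l & forall a, a * s = 0 -> a * t = 0.
Proof.
pose P (U : S^o -> Prop) := exists l : seq S, (forall s, s \in l -> maxann s) /\
  forall x : S, U x <-> lspan l x.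
have [|V [hV [l [lm lE]] Vmax]] := noeth_max noethS (P := P) (fg_regular S) (lspan_ideal [::]).
  by exists [::].
exists l; split=> // s sm; have [s0 _] := sm.
have Vs : lspan l s.
  apply/lE; apply: (Vmax (lspan (s :: l)) (lspan_ideal (s :: l))) => [|x Vx|].
  - exists (s :: l); split=> // t; rewrite inE => /orP[/eqP -> //|]; exact: lm.
  - by exists 0, x; rewrite mul0r add0r; split=> //; apply/lE.
  - by exists 1, 0; rewrite mul1r addr0; split=> //; apply: (ideal0 (lspan_ideal l)).
apply: contrapT => h; have [|a [sa la]] := prime_avoid_seq (l := l) (maxann_prime sm).
  move=> t tl; apply: contrapT => h2; apply: h; exists t => //.
  apply: (lm t tl).2 => // a at0; apply: contrapT => as0; apply: h2; by exists a.
by apply: sa; apply: lspan_ann Vs.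
Qed.

(** Prime avoidance for the coset x + I: if x + z kills t, a multiple i a with i in I repairs this,
    where a kills the other elements of the list but not t. *)
Lemma avoid_maxann (l : seq S) (I : S -> Prop) (x : S) : ideal I ->
  (forall t, t \in l -> maxann t) ->
  (forall t, t \in l -> exists a, I a /\ a * t <> 0) ->
  exists z, I z /\ forall t, t \in l -> (x + z) * t <> 0.
Proof.
move=> hI; elim: l => [|t l IH] lm lI; first by exists 0; split=> //; apply: (ideal0 hI).
have lm' u : u \in l -> maxann u by move=> ul; apply: lm; rewrite inE ul orbT.
have [|z [Iz zl]] := IH lm'; first by move=> u ul; apply: lI; rewrite inE ul orbT.
have tm := lm t (mem_head t l); have [xt|xt] := eqVneq ((x + z) * t) 0; last first.
  by exists z; split=> // u; rewrite inE => /orP[/eqP ->|/zl //]; apply/eqP.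
have tp := maxann_prime tm.
have [|a [ta la]] := prime_avoid_seq (l := l) tp.
  move=> u ul; apply: contrapT => h; apply: (zl u ul); apply: (lm' u ul).2 xt; first by case: tm.
  by move=> a au; apply: contrapT => at0; apply: h; exists a.
have [i [Ii it]] := lI t (mem_head t l).
exists (z + i * a); split; first by apply: (idealD hI) => //; apply: (idealMr hI).
move=> u; rewrite inE addrA mulrDl => /orP[/eqP ->|ul]; last first.
  by rewrite -mulrA la // mulr0 addr0; apply: zl.
by rewrite xt add0r => /(let: And3 _ _ h := tp in h _ _)[].
Qed.

Section Step.
Variables (d : nat) (e : 'I_d.+1 -> S) (D : nat).
Hypotheses (eE : generated_by e n) (gD : gldim S D).
Hypothesis emin : forall m (f : 'I_m -> S), generated_by f n -> (d.+1 <= m)%N.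

(** The ideal n^2, expressed by coefficients in n on the chosen generators. *)
Let sq (z : S) : Prop := exists2 c : 'I_d.+1 -> S, forall i, c i \in n & z = \sum_i c i * e i.

Let e_in i : e i \in n.
Proof.
apply/eE; exists (fun k => if k == i then 1 else 0); rewrite (bigD1 i) //= eqxx mul1r big1 ?addr0 //.
by move=> k /negbTE ->; rewrite mul0r.
Qed.

Let sq_ideal : ideal sq.
Proof.
split=> [|a x y [b bn ->] [c cn ->]].
  exists (fun=> 0) => [i|]; first exact: (ideal0 hn).
  by rewrite big1 // => i _; rewrite mul0r.
exists (fun i => a * b i + c i) => [i|]; first by apply: (idealD hn) => //; apply: (idealM hn).
rewrite /GRing.scale /= mulr_sumr -big_split; apply: eq_bigr => i _.
by rewrite mulrDl mulrA.
Qed.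

Let sq_in z : sq z -> z \in n.
Proof. by case=> c _ ->; apply: (ideal_sum hn) => i _; apply: (idealM hn). Qed.

Let gens_nonzero : exists2 x, x \in n & x <> 0.
Proof.
apply: contrapT => h; suff /emin : generated_by (fun _ : 'I_0 => 0 : S) n by [].
move=> x; split=> [xn|[c ->]]; last by rewrite big_ord0; apply: (ideal0 hn).
by exists (fun=> 0); rewrite big_ord0; apply: contrapT => x0; apply: h; exists x.
Qed.

(** If n^2 killed t, then n would kill t because the annihilator is prime, and [socle_gldim] would
    give n = 0. *)
Let sq_ann t : maxann t -> exists a, sq a /\ a * t <> 0.
Proof.
move=> tm; apply: contrapT => h; have [_ _ tM] := maxann_prime tm.
have [x xn x0] := gens_nonzero; apply: x0; apply: (socle_gldim (s := t) _ _ gD) xn.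
  by apply/eqP; case: tm.
move=> y yn; suff /tM[] : y * y * t = 0 by [].
apply: contrapT => yt; apply: h; exists (y * y); split=> //.
have [c cE] := (eE y).1 yn; exists (fun i => y * c i) => [i|].
  by rewrite mulrC; apply: (idealM hn).
by rewrite {2}cE mulr_sumr; apply: eq_bigr => i _; rewrite mulrA.
Qed.

(** The coset of e 0 modulo n^2 contains an element outside all the finitely many maximal
    annihilators, and such an element is regular. *)
Lemma min_gen_regular : exists x, [/\ x \in n, GRing.lreg x & sq (x - e ord0)].
Proof.
have [l [lm lE]] := maxann_finite.
have [z [Iz zl]] := avoid_maxann (e ord0) sq_ideal lm (fun t tl => sq_ann (lm t tl)).
exists (e ord0 + z); split; last by rewrite addrC addKr.
  by apply: (idealD hn) => //; apply: sq_in.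
apply: contrapT => /zero_div_maxann[s [sm es]]; have [t tl st] := lE s sm.
by apply: (zl t tl); apply: st.
Qed.

Variable x : S.
Hypotheses (xn : x \in n) (xreg : GRing.lreg x) (xe : sq (x - e ord0)).

(** Nakayama's lemma: e 0 agrees with x up to an element of n^2. *)
Lemma gens_exchange y : y \in n ->
  exists t (c : 'I_d -> S), y = t * x + \sum_i c i * e (lift ord0 i).
Proof.
pose V (y : S^o) := exists t (c : 'I_d -> S), y = t * x + \sum_i c i * e (lift ord0 i).
have hV : submod V.
  split=> [|a u v [t [c ->]] [t' [c' ->]]].
    by exists 0, (fun=> 0); rewrite mul0r add0r big1 // => i _; rewrite mul0r.
  exists (a * t + t'), (fun i => a * c i + c' i).
  rewrite /GRing.scale /= mulrDr mulr_sumr mulrDl -mulrA addrACA -big_split.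
  by congr (_ + _); apply: eq_bigr => i _; rewrite mulrDl mulrA.
have [t [tn tV]] : exists t, (t - 1 ^+ d.+1 \in n) /\ forall i, V (t *: (e i : S^o)).
  apply: (nakayama (H := S^o) (V := V) (q := fun s => s \in n) (s := 1) (e := e) hV hn) => i.
  have [j ->|->] := unliftP ord0 i.
    exists (fun=> 0) => [k|]; first exact: (ideal0 hn).
    exists 0, (fun k => if k == j then 1 else 0).
    rewrite mul0r add0r (bigD1 j) //= eqxx mul1r [X in _ = _ + X]big1 ?addr0; last first.
      by move=> k /negbTE ->; rewrite mul0r.
    rewrite [X in _ - X]big1 ?subr0 ?scale1r // => k _; exact: scale0r.
  have [c cn cE] := xe; exists (fun k => - c k) => [k|]; first exact: (idealN hn).
  exists 1, (fun=> 0); rewrite mul1r [X in _ = _ + X]big1 ?addr0; last by move=> k _; rewrite mul0r.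
  rewrite scale1r (eq_bigr (fun k => - (c k * e k))); last by move=> k _; exact: mulNr.
  by rewrite sumrN opprK -cE addrC subrK.
have [|u ut] := local_unit noethS locS (x := t).
  apply/negP => tin; have := local_not1 locS; rewrite -(expr1n _ d.+1) => /negP; apply.
  by rewrite -[1 ^+ d.+1](subKr t); apply: (idealB hn).
have Ve i : V (e i).
  have -> : e i = u *: (t *: (e i : S^o)) by rewrite scalerA ut scale1r.
  exact: (submodZ hV).
move=> /eE[c ->]; apply: (submod_sum hV) => i _; exact: (submodZ hV).
Qed.

Lemma gens_exchange_min (c : 'I_d -> S) : x <> \sum_i c i * e (lift ord0 i).
Proof.
move=> xE; suff /emin : generated_by (fun i => e (lift ord0 i)) n by rewrite ltnn.
move=> y; split=> [/gens_exchange[t [b ->]]|[b ->]]; last first.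
  by apply: (ideal_sum hn) => i _; apply: (idealM hn).
exists (fun i => t * c i + b i); rewrite {1}xE mulr_sumr -big_split; apply: eq_bigr => i _.
by rewrite mulrDl mulrA.
Qed.

Variables (R : comNzRingType) (pi : {rmorphism S -> R}).
Hypothesis piP : is_quotient_by pi x.

Lemma quot_gens_min : exists f : 'I_d -> R, generated_by f (quot_max pi n) /\
  forall m (g : 'I_m -> R), generated_by g (quot_max pi n) -> (d <= m)%N.
Proof.
exists (fun i => pi (e (lift ord0 i))); split=> [r|m g gE]; last first.
  by have [g' g'E] := quot_gens piP locS xn gE; apply: (emin g'E).
have [y <-] := piP.1 r; rewrite (quot_maxP piP locS xn); split=> [/gens_exchange[t [c ->]]|[c cE]].
  exists (fun i => pi (c i)); rewrite rmorphD rmorphM (piw piP) mulr0 add0r rmorph_sum /=.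
  by apply: eq_bigr => i _; rewrite rmorphM.
have [b bE] := choice (fun i => piP.1 (c i)).
rewrite -(quot_maxP piP locS xn) cE (_ : \sum_i _ = pi (\sum_i b i * e (lift ord0 i))); last first.
  by rewrite rmorph_sum /=; apply: eq_bigr => i _; rewrite rmorphM bE.
by rewrite (quot_maxP piP locS xn); apply: (ideal_sum hn) => i _; apply: (idealM hn).
Qed.

(* n / (x) is a direct summand of n / x n, as x is part of a minimal system of
   generators of n. *)
Lemma quot_gldim : gldim R D.+1.
Proof.
have noethR := quot_noetherian piP noethS; have locR := quot_local piP noethS locS xn.
have [N [io [ioi ioE]]] := sub_ex (M := S^o) hn.
have io_in y : io y \in n by apply/ioE; exists y.
have [m' [mu [mui muE]]] := sub_ex (M := R^o) (local_ideal locR).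
have [N' [rho rN]] := red_ex piP N; have [rs r0] := rN.
pose pil := lin (residue_linear pi (lid (R^o : lmodType R))).
have [|q qE] := fac_inj (K := restr pi m') (i := rlin pi mu) (f := lcomp pil io) mui.
  by move=> y; apply/muE; rewrite (quot_maxP piP locS xn); apply: io_in.
have {}qE y : mu (q y) = pi (io y) by exact: qE.
have [|r rE] := fac_surj (f := q) rs.
  by move=> _ /r0[z <-]; rewrite linZ (restr_kill piP).
(* The other generators span U modulo x n. U maps onto n / (x) with kernel x n, which yields a
   section of n / x n -> n / (x). *)
pose U (v : N) := exists (c : 'I_d -> S) m, m \in n /\
  io v = \sum_i c i * e (lift ord0 i) + m * x.
have hU : submod U.
  split=> [|a u v [c [m [mn uE]]] [c' [m2 [mn2 vE]]]].
    exists (fun=> 0), 0; split; first exact: (ideal0 hn).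
    by rewrite linear0 mul0r addr0 big1 // => i _; rewrite mul0r.
  exists (fun i => a * c i + c' i), (a * m + m2); split.
    by apply: (idealD hn) => //; apply: (idealM hn).
  rewrite linearP uE vE /GRing.scale /= mulrDr mulr_sumr addrACA -big_split mulrDl mulrA.
  by congr (_ + _); apply: eq_bigr => i _; rewrite mulrDl mulrA.
have [VV [j [ji jE]]] := sub_ex hU.
have qjs : surj (lcomp q j).
  move=> c; have [y yE] := piP.1 (mu c).
  have /gens_exchange[t [b bE]] : y \in n.
    by rewrite -(quot_maxP piP locS xn) yE; apply/muE; exists c.
  have [v vE] : exists v, io v = \sum_i b i * e (lift ord0 i).
    by apply/ioE; apply: (ideal_sum hn) => i _; apply: (idealM hn).
  have [v' v'E] : exists v', j v' = v.
    by apply/jE; exists b, 0; rewrite mul0r addr0; split=> //; apply: (ideal0 hn).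
  exists v'; apply: mui; rewrite lE v'E qE vE -yE bE rmorphD rmorphM (piw piP) mulr0 add0r //.
have [|i iE] := fac_surj (f := lcomp rho j) qjs.
  move=> v; rewrite !lE => qv; have /piP.2[t tE] : pi (io (j v)) = 0 by rewrite -qE qv linear0.
  have [c [m [mn cE]]] : U (j v) by apply/jE; exists v.
  (* Otherwise t - m would be a unit and x would lie in the span of the other generators, against
     minimality. *)
  have tn : t \in n.
    apply: contraT => tn; have [|u uE] := local_unit noethS locS (x := t - m).
      by apply/negP => h; case/negP: tn; rewrite -[t](subrK m); apply: (idealD hn).
    case: (@gens_exchange_min (fun i => u * c i)).
    rewrite -[x]mul1r -uE -mulrA mulrBl -tE cE addrK mulr_sumr.
    by apply: eq_bigr => k _; rewrite mulrA.
  have [t' t'E] := (ioE t).1 tn.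
  by apply/r0; exists t'; apply: ioi; rewrite linZ t'E tE; apply: mulrC.
have ri c : ulin piP r (ulin piP i c) = c.
  have [v <-] := qjs c; change (r (i (lcomp q j v)) = lcomp q j v).
  by rewrite iE !lE rE.
have xN : injective (lscale x (lid N)).
  apply: inj0 => y; rewrite !lE => xy; apply: ioi; rewrite linear0; apply: xreg.
  by rewrite mulr0 -[x * io y]/(x *: (io y : S^o)) -linZ xy linear0.
have fgN : finitely_generated N by exact (fg_inj noethS ioi (fg_regular S)).
have eN' := red_epd piP xreg noethS rN xN fgN (gD fgN).
have em' := epd_retract ri eN'.
have [k' [pk [pks pk0]]] := cyclic_quot (local_ideal locR).
apply: (gldim_local noethR locR pks pk0).
apply/(epd_syz D (@proj_regular R) (i := mu) (p := pk)) => //.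
split=> // y; rewrite pk0; exact: muE.
Qed.

End Step.
End FiniteGldim.

Lemma gldim_regloc d (S : comNzRingType) (n : {pred S}) (e : 'I_d -> S) D :
  noetherian S -> local_ring n -> generated_by e n ->
  (forall m (f : 'I_m -> S), generated_by f n -> (d <= m)%N) -> gldim S D -> regloc d n.
Proof.
elim: d S n e D => [|d IH] S n e D noethS locS eE emin gD /=.
  by move=> x /eE[c ->]; rewrite big_ord0.
have [x [xn xreg xe]] := min_gen_regular noethS locS eE gD emin.
have [R [pi piP]] := quot_ring_ex locS xn.
exists x, R, pi; split=> //.
have [f [fE fmin]] := quot_gens_min noethS locS eE emin xn xe piP.
apply: (IH R _ f D.+1 (quot_noetherian piP noethS) (quot_local piP noethS locS xn) fE fmin).
exact (quot_gldim noethS locS eE gD emin xn xreg xe piP).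
Qed.

(** * Krull's principal ideal theorem *)

Section PrincipalIdealTheorem.
Variable S : comNzRingType.
Hypothesis noethS : noetherian S.

(* Localized at a prime P2 minimal over J, the ring S / J is artinian. *)
Lemma local_dcc (P2 J : S -> Prop) : prime P2 ->
  (forall Q, prime Q -> (forall s, J s -> Q s) -> (forall s, Q s -> P2 s) -> forall s, P2 s -> Q s) ->
  ideal J -> forall W : nat -> S -> Prop, (forall m, ideal (W m)) ->
  (forall m s, W m.+1 s -> W m s) -> (forall m s, J s -> W m s) ->
  exists N, forall m, (N <= m)%N -> forall a, W N a -> exists t, ~ P2 t /\ W m (t * a).
Proof.
move=> [hP2 P21 P2M] Jmin hJ.
pose P (U : S^o -> Prop) := (forall s : S, J s -> U s) -> forall W : nat -> S -> Prop,
  (forall m, ideal (W m)) -> (forall m s, W m.+1 s -> W m s) -> (forall m s, U s -> W m s) ->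
  exists N, forall m, (N <= m)%N -> forall a, W N a -> exists t, ~ P2 t /\ W m (t * a).
suff /(_ J hJ) : forall U, ideal U -> P U by apply.
apply: (noeth_ind noethS (fg_regular S)) => U hU IH JU W hW Wd UW.
have Wmono m m' s : (m <= m')%N -> W m' s -> W m s.
  by move=> mm; rewrite -(subnK mm); elim: (m' - m)%N => // k IHk; rewrite addSn => /Wd.
have [[t [Ut P2t]]|UP2] := pselect (exists t : S, U t /\ ~ P2 t).
  by exists 0%N => m _ a _; exists t; split=> //; apply: (idealMr (hW m)); apply: UW.
have {}UP2 s : U s -> P2 s by move=> Us; apply: contrapT => h; apply: UP2; exists s.
(* If U is not prime, the chain is controlled by its traces on U + (a) and on the colon ideal (U :
   a), both larger than U. *)
have [[a [b [ab Ua Ub]]]|Up] := pselect (exists a b : S, [/\ U (a * b), ~ U a & ~ U b]); last first.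
  (* U is prime, hence equal to P2 by minimality. After localization the chain either consists of
     unit ideals or equals U from some m0 on. *)
  have P2U : forall s, P2 s -> U s.
    apply: Jmin => //; split=> //; first by move=> /UP2.
    move=> a b ab; have [Ua|Ua] := pselect (U a); [by left|right].
    by apply: contrapT => Ub; apply: Up; exists a, b.
  have [h|/existsNP[m0 hm0]] := pselect (forall m, exists t, W m t /\ ~ P2 t).
    exists 0%N => m _ a _; have [t [Wt P2t]] := h m.
    by exists t; split=> //; apply: (idealMr (hW m)).
  exists m0 => m _ a Wa; exists 1; split=> //; rewrite mul1r; apply/UW/P2U.
  by apply: contrapT => nP; apply: hm0; exists a.
have [||s Js|||m s|N1 hN1] := IH _ (ideal_add a hU) _ _ _
    (fun m x => exists b c, W m b /\ x = b + c * a).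
- by move=> x Ux; exists x, 0; rewrite mul0r addr0.
- by exists a; split=> //; exists 0, 1; rewrite mul1r add0r; split=> //; apply: (ideal0 hU).
- by exists s, 0; rewrite mul0r addr0; split=> //; apply: JU.
- by move=> m; apply: ideal_add.
- by move=> m s [u [c [/Wd Wu ->]]]; exists u, c.
- by case=> u [c [Uu ->]]; exists u, c; split=> //; apply: UW.
have colon (V : S -> Prop) : ideal V -> ideal (fun c => V (c * a)).
  move=> hV; split=> [|r u v Vu Vv]; first by rewrite mul0r; apply: (ideal0 hV).
  by rewrite mulrDl -mulrA; apply: (idealD hV) => //; apply: (idealM hV).
have [||s Js|||m s|N2 hN2] := IH _ (colon _ hU) _ _ _ (fun m c => W m (c * a)).
- by move=> x Ux; apply: (idealMr hU).
- by exists b; split=> //; rewrite mulrC.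
- by apply: (idealMr hU); apply: JU.
- by move=> m; apply: colon.
- by move=> m s; apply: Wd.
- exact: UW.
exists (maxn N1 N2) => m; rewrite geq_max => /andP[m1 m2] al Wal.
have [|t [P2t [u [r [Wu tE]]]]] := hN1 m m1 al.
  by exists al, 0; rewrite mul0r addr0; split=> //; apply: Wmono Wal; apply: leq_maxl.
have [|t' [P2t' Wr]] := hN2 m m2 r.
  have -> : r * a = t * al - u by rewrite tE addrC addKr.
  apply: (idealB (hW _)); first by apply: (idealM (hW _)); apply: Wmono Wal; apply: leq_maxr.
  exact: Wmono Wu.
exists (t' * t); split; first by case/P2M.
rewrite -mulrA tE mulrDr mulrA; apply: (idealD (hW m)) => //.
exact: (idealM (hW m)).
Qed.

Lemma prime_pow (p : S -> Prop) s k : prime p -> ~ p s -> ~ p (s ^+ k).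
Proof.
move=> [_ p1 pM] ps; elim: k => [|k IH]; first by rewrite expr0.
by rewrite exprS => /pM[].
Qed.

(* Krull's principal ideal theorem: no prime chain of length two below a prime
   minimal over P0 + (x); symbolic powers of (y) replace those of P1. *)
Lemma prime_between (P0 P1 P2 : S -> Prop) (x : S) : prime P0 -> prime P1 -> prime P2 ->
  (forall s, P0 s -> P1 s) -> (exists s, P1 s /\ ~ P0 s) ->
  (forall s, P1 s -> P2 s) -> (exists s, P2 s /\ ~ P1 s) -> P2 x ->
  exists Q, [/\ prime Q, Q x, (forall s, P0 s -> Q s) /\ (exists s, Q s /\ ~ P0 s) &
    (forall s, Q s -> P2 s) /\ exists s, P2 s /\ ~ Q s].
Proof.
move=> hP0 hP1 hP2 P01 [y [P1y P0y]] P12 P2P1 P2x.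
have [P1x|P1x] := pselect (P1 x); first by exists P1; split=> //; split=> //; exists y.
have [iP0 _ P0M] := hP0; have [iP1 P11 P1M] := hP1; have [iP2 P21 P2M] := hP2.
apply: contrapT => none.
(* The contraction to S of the ideal (y^k) in the localization of S / P0 at P1. *)
pose Qs k (a : S) := exists s r, ~ P1 s /\ P0 (s * a - r * y ^+ k).
have Qid k : ideal (Qs k).
  split=> [|c a b [s [r [ns h]]] [s' [r' [ns' h']]]].
    by exists 1, 0; split=> //; rewrite mulr0 mul0r subrr; apply: (ideal0 iP0).
  exists (s * s'), (c * s' * r + s * r'); split; first by case/P1M.
  have -> : s * s' * (c * a + b) - (c * s' * r + s * r') * y ^+ k =
     c * s' * (s * a - r * y ^+ k) + s * (s' * b - r' * y ^+ k) by ring.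
  by apply: (idealD iP0); apply: (idealM iP0).
have Qd k a : Qs k.+1 a -> Qs k a.
  by move=> [s [r [ns h]]]; exists s, (r * y); rewrite -mulrA -exprS.
have P0Q k a : P0 a -> Qs k a.
  by move=> P0a; exists 1, 0; rewrite mul1r mul0r subr0.
have hJ := ideal_add x iP0.
have [|||m s|N hN] := local_dcc hP2 _ hJ (W := fun k z => exists b c, Qs k b /\ z = b + c * x).
- move=> Q hQ JQ QP2 s P2s; apply: contrapT => Qns; apply: none; exists Q.
  have Qx : Q x by apply: JQ; exists 0, 1; rewrite mul1r add0r; split=> //; apply: (ideal0 iP0).
  split=> //; split=> //; last by exists s.
    by move=> t P0t; apply: JQ; exists t, 0; rewrite mul0r addr0.
  by exists x; split=> // /P01.
- by move=> m; apply: ideal_add.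
- by move=> m s [b [c [/Qd Qb ->]]]; exists b, c.
- by case=> b [c [/(P0Q m) Qb ->]]; exists b, c.
have [l [f fE]] := fgsub_row (noeth_regular noethS (Qid N)).
pose e i : S := f (delta_mx 0 i).
have fsum k : f k = \sum_i k 0 i * e i :> S.
  by rewrite {1}[k]row_sum_delta linear_sum; apply: eq_bigr => i _; rewrite linZ.
have Qe i : Qs N (e i) by apply/fE; exists (delta_mx 0 i).
(* As x is outside P1, c x in Qs N forces c in Qs N. So, after localization at P2, Qs N is contained
   in Qs N.+1 + x Qs N, and Nakayama's lemma applies. *)
have /choice[t tP] i : exists t, ~ P2 t /\ exists k : 'rV[S]_l,
    Qs N.+1 (t * e i - x * \sum_j k 0 j * e j).
  have [|t [P2t [b [c [Qb tE]]]]] := hN N.+1 (leqnSn N) (e i).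
    by exists (e i), 0; rewrite mul0r addr0.
  have : Qs N (c * x).
    have -> : c * x = t * e i - b by rewrite tE addrC addKr.
    by apply: (idealB (Qid N)); [apply: (idealM (Qid N))|apply: Qd].
  case=> s [r [ns h]]; have /fE[k kE] : Qs N c.
    by exists (s * x), r; split; [case/P1M|rewrite -mulrA [x * c]mulrC].
  exists t; split=> //; exists k; rewrite -fsum kE tE mulrC addrK //.
pose s := \prod_i t i.
have [t0 [P2t0 Qt0]] : exists t0, P2 (t0 - s ^+ l) /\ forall i, Qs N.+1 (t0 *: (e i : S^o)).
  apply: (nakayama (H := S^o) (V := Qs N.+1) (e := e) (Qid _) iP2) => i.
  have [_ [k kQ]] := tP i; pose u := \prod_(j | j != i) t j.
  exists (fun j => u * x * k 0 j) => [j|]; first by apply: (idealMr iP2); apply: (idealM iP2).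
  have -> : s *: (e i : S^o) - \sum_j (u * x * k 0 j) *: (e j : S^o) =
      u * (t i * e i - x * \sum_j k 0 j * e j).
    rewrite /s (bigD1 i) //= -/u /GRing.scale /= mulrBr !mulr_sumr; congr (_ - _).
      by rewrite mulrA [u * _]mulrC.
    by apply: eq_bigr => j _; rewrite !mulrA.
  exact: (idealM (Qid _)).
have {}P2t0 : ~ P2 t0.
  move=> h; have /(prime_pow (k := l) hP2) : ~ P2 s by apply: (prod_notin hP2) => i; case: (tP i).
  by apply; rewrite -[s ^+ l](subKr t0); apply: (idealB iP2).
(* Now t0 y^N lies in Qs N.+1; cancelling y^N modulo P0 puts s' t0 in P1, although neither factor is
   there. *)
have /fE[k kE] : Qs N (y ^+ N) by exists 1, 1; rewrite subrr; split=> //; apply: (ideal0 iP0).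
have [s' [r [ns']]] : Qs N.+1 (t0 * y ^+ N).
  rewrite -kE fsum mulr_sumr; apply: (ideal_sum (Qid _)) => i _.
  by rewrite mulrCA; apply: (idealM (Qid _)); apply: Qt0.
have -> : s' * (t0 * y ^+ N) - r * y ^+ N.+1 = (s' * t0 - r * y) * y ^+ N by rewrite exprS; ring.
case/P0M => [/P01 h|]; last exact: prime_pow.
have /P1M[//|/P12 //] : P1 (s' * t0).
by rewrite -[s' * t0](subrK (r * y)); apply: (idealD iP1) => //; apply: (idealM iP1).
Qed.

(** [prime_between] replaces the prime just below p k by one that contains x; repeating this moves x
    down to index 1. *)
Lemma chain_move d p k (x : S) : @chain S d p -> (0 < k <= d)%N -> p k x ->
  exists p', chain d p' /\ p' 1%N x.
Proof.
elim: k p => // k IH p [pp pc] /andP[_ kd] pkx.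
have [k0|k0] := posnP k; first by subst k; exists p.
have [k' kE] : exists k', k = k'.+1 by exists k.-1; rewrite prednK.
subst k; have [s1 e1] := pc k' (ltnW kd); have [s2 e2] := pc k'.+1 kd.
have [Q [hQ Qx [P0Q eQ] [QP2 eQ2]]] :=
  prime_between (pp k' (ltnW (ltnW kd))) (pp k'.+1 (ltnW kd)) (pp k'.+2 kd) s1 e1 s2 e2 pkx.
apply: (IH (fun i => if i == k'.+1 then Q else p i)); last by rewrite eqxx.
  split=> i id; first by case: eqP => // _; apply: pp.
  have [->|ik] := eqVneq i k'.+1; first by rewrite (gtn_eqF (ltnSn k'.+1)).
  have [[ik']|ik'] := eqVneq i.+1 k'.+1; first by rewrite ik'.
  exact: pc.
exact: ltnW.
Qed.

End PrincipalIdealTheorem.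

Lemma quot_chain (S R : comNzRingType) (pi : {rmorphism S -> R}) (x : S) d q :
  is_quotient_by pi x -> @chain S d q -> (forall i, (i <= d)%N -> q i x) ->
  chain d (fun i r => exists s, pi s = r /\ q i s).
Proof.
move=> piP [qp qc] qx.
have sat i s s' : (i <= d)%N -> pi s = pi s' -> q i s -> q i s'.
  move=> id e h; have [hq _ _] := qp i id; apply: (idealBD hq _ h).
  have /piP.2[t ->] : pi (s' - s) = 0 by rewrite rmorphB e subrr.
  by apply: (idealM hq); apply: qx.
split=> i id.
  have [hq q1 qM] := qp i id; split.
  - split=> [|a r r' [s [<- qs]] [s' [<- qs']]].
      by exists 0; rewrite rmorph0; split=> //; apply: (ideal0 hq).
    have [b <-] := piP.1 a; exists (b * s + s'); rewrite rmorphD rmorphM; split=> //.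
    by apply: (idealD hq) => //; apply: (idealM hq).
  - by case=> s [s1 qs]; apply: q1; apply: sat qs => //; rewrite rmorph1.
  move=> a b; have [[s <-] [s' <-]] := (piP.1 a, piP.1 b).
  case=> t [tE qt]; have /qM[h|h] : q i (s * s') by apply: sat qt => //; rewrite rmorphM.
    by left; exists s.
  by right; exists s'.
have [sub [s [s1 s0]]] := qc i id; split=> [r [t [<- qt]]|]; first by exists t; split=> //; apply: sub.
exists (pi s); split; first by exists s.
by case=> t [tE qt]; apply: s0; apply: sat qt => //; apply: ltnW.
Qed.

(** The tower starts from x = e 0. Induction gives a tower for R = S / x, where chains have length
    at most d; this bound determines the two lowest primes of a chain through x and makes S a
    domain. *)
Lemma chain_regloc d (S : comNzRingType) (n : {pred S}) (e : 'I_d -> S) p :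
  noetherian S -> local_ring n -> generated_by e n -> @chain S d p -> regloc d n.
Proof.
elim: d S n e p => [|d IH] S n e p noethS locS eE pc /=.
  by move=> x /eE[c ->]; rewrite big_ord0.
have hn := local_ideal locS; pose x := e ord0.
have xn : x \in n.
  apply/eE; exists (fun k => if k == ord0 then 1 else 0); rewrite (bigD1 ord0) //= ?eqxx mul1r big1 ?addr0 //.
  by move=> k /negbTE ->; rewrite mul0r.
have pn (q : S -> Prop) s : prime q -> q s -> s \in n.
  move=> [hq q1 _] qs; apply: contraT => /(local_unit noethS locS)[u us].
  by case: q1; rewrite -us; apply: (idealM hq).
(* The top prime is replaced by n, so that it contains x, before x is moved down. *)
have [q [[qp qc] q1x]] : exists q, @chain S d.+1 q /\ q 1%N x.
  case: pc => pp pc.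
  refine (@chain_move S noethS d.+1 (fun i s => if i == d.+1 then s \in n : Prop else p i s) d.+1 x _ _ _).
  - split=> i id; case: eqP => id' //; try exact: pp.
    + exact: local_prime locS.
    + by rewrite id' ltnn in id.
    have [sub [s [s1 s0]]] := pc i id; case: eqP => id2; last by split=> //; exists s.
    split=> [t pt|]; first exact: pn (pp i (ltnW id)) pt.
    by exists s; split=> //; apply: pn (pp _ id) s1.
  - by rewrite leqnn.
  - by rewrite eqxx.
have [R [pi piP]] := quot_ring_ex locS xn.
have noethR := quot_noetherian piP noethS; have locR := quot_local piP noethS locS xn.
have qsub i s : (i <= d)%N -> q 1%N s -> q i.+1 s.
  by elim: i => // i IHi id h; apply: (qc i.+1 id).1; apply: IHi => //; apply: ltnW.
have rchain : @chain R d (fun i r => exists s, pi s = r /\ q i.+1 s).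
  apply: (@quot_chain S R pi x d (fun i => q i.+1) piP) => [|i id]; last exact: qsub.
  by split=> i id; [apply: qp|apply: qc].
have rR : regloc d (quot_max pi n).
  apply: (IH R _ (fun i => pi (e (lift ord0 i))) _ noethR locR _ rchain) => r.
  have [y <-] := piP.1 r; rewrite (quot_maxP piP locS xn); split=> [/eE[c ->]|[c cE]].
    exists (fun i => pi (c (lift ord0 i))); rewrite big_ord_recl rmorphD rmorphM (piw piP) mulr0 add0r.
    by rewrite rmorph_sum; apply: eq_bigr => i _; rewrite rmorphM.
  have [b bE] := choice (fun i => piP.1 (c i)).
  rewrite -(quot_maxP piP locS xn) cE (_ : \sum_i _ = pi (\sum_i b i * e (lift ord0 i))); last first.
    by rewrite rmorph_sum /=; apply: eq_bigr => i _; rewrite rmorphM bE.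
  rewrite (quot_maxP piP locS xn); apply: (ideal_sum hn) => i _; apply: (idealM hn).
  apply/eE; exists (fun k => if k == lift ord0 i then 1 else 0).
  rewrite (bigD1 (lift ord0 i)) //= eqxx mul1r big1 ?addr0 //.
  by move=> k /negbTE ->; rewrite mul0r.
have bound m r : @chain R m r -> (m <= d)%N.
  exact: gldim_chain noethR (regloc_gldim noethR locR rR).
(* Otherwise the whole chain q, of length d + 1, would survive in R. *)
have q0x : ~ q 0%N x.
  move=> q0x; have /bound : @chain R d.+1 (fun i r => exists s, pi s = r /\ q i s).
    apply: (@quot_chain S R pi x d.+1 q piP) => // -[|i] id //; exact: qsub.
  by rewrite ltnn.
(* R is a domain; were q 1 larger than (x), the zero ideal could be put below the chain in R and
   make it too long. *)
have q1E s : q 1%N s -> exists t, s = t * x.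
  move=> q1s; apply/piP.2; apply: contrapT => ps; have [rp rc] := rchain.
  have /bound : @chain R d.+1 (fun i r => if i is j.+1 then exists s, pi s = r /\ q j.+1 s else r = 0).
    split=> -[|i] id; [exact: regloc_domain rR|exact: rp| |exact: rc].
    have [h0 _ _] := rp 0%N isT; split=> [r ->|]; first exact: (ideal0 h0).
    by exists (pi s); split=> //; exists s.
  by rewrite ltnn.
have hq0 := qp 0%N isT; have [iq0 _ q0M] := hq0.
(* A nonzero element of q 0 is x^i a with a not divisible by x; since x is outside q 0, a lies in q
   0 and hence in q 1 = (x). *)
have q00 s : q 0%N s -> s = 0.
  move=> q0s; apply/eqP; apply: contraT => s0.
  have [i [a [sE na]]] := krull_factor noethS locS xn s0.
  move: q0s; rewrite sE => /q0M[/(prime_pow hq0 q0x) //|q0a].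
  by case: na; apply: q1E; apply: (qc 0%N isT).1.
exists x, R, pi; split=> // a b ab.
have /q0M[//|/q00/eqP] : q 0%N (x * (a - b)).
  by rewrite mulrBr ab subrr; apply: (ideal0 iq0).
by rewrite subr_eq0 => /eqP.
Qed.

(** * Regularity and finite global dimension *)

Section RegularRings.
Variables (S : comNzRingType) (n : {pred S}).
Hypotheses (noethS : noetherian S) (locS : local_ring n).

Lemma regular_gldim : regular_local n -> exists D, gldim S D.
Proof.
move=> [d [[/prime_chain_chain[p pc] _] [[e eE] _]]]; exists d.
exact (regloc_gldim noethS locS (chain_regloc noethS locS eE pc)).
Qed.

Lemma gldim_regular D : gldim S D -> regular_local n.
Proof.
move=> gD; have [m0 [e0 e0E]] := noethS locS.1.1.
have ex : exists m, `[< exists e : 'I_m -> S, generated_by e n >] by exists m0; apply/asboolP; exists e0.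
case: (ex_minnP ex) => d /asboolP[e eE] emin.
have dmin m (f : 'I_m -> S) : generated_by f n -> (d <= m)%N.
  by move=> fE; apply: emin; apply/asboolP; exists f.
have rd := gldim_regloc noethS locS eE dmin gD.
exists d; split; split.
- by have [p pc] := regloc_chain noethS locS rd; apply: chain_prime_chain pc.
- move=> m /prime_chain_chain[p pc].
  exact: gldim_chain noethS (regloc_gldim noethS locS rd) pc.
- by exists e.
- exact: dmin.
Qed.

Lemma gldim_gorenstein D : gldim S D -> gorenstein_ring S.
Proof.
move=> gD; have [C [C0 hC _]] := injres_ex (S^o : lmodType S).
apply/(gorenstein_ext noethS C0 hC); exists D => M fgM j jD.
exact (gD M fgM C hC j jD).
Qed.

(** A Gorenstein projective module is an arbitrarily high syzygy of modules of the same class, so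
    the common bound on their projective dimension descends to 0. *)
Lemma gldim_gproj D (G : fgmod S) : gldim S D -> gorenstein_projective G -> projective_module G.
Proof.
move=> gD hG; apply: epd0_proj; first exact: fg_prop.
have : forall G : fgmod S, gorenstein_projective G -> epd D G by move=> H _; apply/gD/fg_prop.
elim: D {gD} => [|D IH] h; first exact: h.
apply: IH => H hH; have [hn _ _] := gorenstein_gclass S.
have [H' gH' [P [i [p [hP ip]]]]] := hn H hH.
exact/(epd_syz D hP ip)/h.
Qed.

Variables (R : comNzRingType) (pi : {rmorphism S -> R}) (w : S).
Hypotheses (piP : is_quotient_by pi w) (wreg : GRing.lreg w) (wn : w \in n).

(* Cokernels of objects of Mon(w, P) have finite projective dimension over S; if
   the residue field k is isomorphic to one of them in D_sg(R), then
   Ext^m(k, Omega^m k) vanishes for large m, and Omega^(m-1) k is projective. *)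
Lemma incl_dense_gldim :
  @dense (stable_category (MonP w)) (Dsg R) (fun X => T0 piP (incl0 X)) -> exists D, gldim S D.
Proof.
move=> dT; have noethR := quot_noetherian piP noethS; have locR := quot_local piP noethS locS wn.
have [k' [pk [pks pk0]]] := cyclic_quot (local_ideal locR).
have fgk' := fg_surj pks (fg_regular R).
pose k := FgMod fgk'; pose pk' := lin (residue_linear pi pk).
have pks' : surj pk' by move=> c; have [r <-] := pks c; have [s <-] := piP.1 r; exists s.
have pk0' s : pk' s = 0 <-> s \in n by rewrite -(quot_maxP piP locS wn) -pk0.
have fgk := restr_fg piP fgk'.
have [X Xk] := dT (stalk k).
(* The index m.+1 matches [tors_injres], whose resolution starts at index 1. L m is the syzygy
   following K m, so the vanishing obtained below splits the presentation of K m. *)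
have /choice[K KP] m : exists K, syzn m.+1 K (restr pi k') /\ finitely_generated K.
  by have [K KM fgK] := syzn_ex noethS m.+1 fgk; exists K.
have /choice[L LK] m := syz_ex (KP m).2.
have /choice[C CP] m : exists C, C 0%N = L m /\ injres C.
  by have [C [C0 hC _]] := injres_ex (L m); exists C.
have /choice[T TP] m : exists T : nat -> lmodType R, exists t : forall j, {linear restr pi (T j) -> C m j},
    (forall j, injective (t j)) /\ forall j y, w *: y = 0 <-> exists z, t j z = y.
  have [T /dchoice[t tP]] := choice (fun j => tors_ex piP (C m j)).
  by exists T, t; split=> j; case: (tP j).
have hD m : injres (fun j => T m j.+1).
  by have [t [ti tE]] := TP m; apply: (tors_injres piP wreg (CP m).2 ti tE).
have TE m (M : lmodType R) j : ext1 M (T m j.+1) <-> ext1 (restr pi M) (C m j.+1).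
  by have [t [ti tE]] := TP m; apply: (tors_ext piP wreg (CP m).2 ti tE).
have [|m hm] := stalk_isom_ext hD (isom_sym Xk).
  exists 0%N => m _; apply/TE.
  have [iX X1 X0 _] := so_prop X.
  have ses : short_exact (mmap X) (cpr piP (incl0 X)).
    by split; [exact: iX|exact (@cpr0 S R pi w piP (incl0 X))|exact (@cpr_surj S R pi w piP (incl0 X))].
  have /(epd_syz 0 X0 ses) h := proj_epd (D := 0) X1.
  exact (h (C m) (CP m).2 m.+1 isT).
exists m.+1; apply: (gldim_local noethS locS pks' pk0').
have [KM fgK] := KP m; apply: (epd_syzn (D := 0) KM); apply: proj_epd.
have [r [i [p ip]]] := LK m; apply: (split_proj (@proj_row S r) ip).
have [C0 hC] := CP m; rewrite -C0; apply/(syzn_ext1 hC KM)/TE.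
exact (hm m (leqnn m)).
Qed.

End RegularRings.

Theorem theorem1p2 (S : comNzRingType) (n : {pred S}) (w : S)
    (R : comNzRingType) (pi : {rmorphism S -> R})
    (S_noetherian : noetherian S) (S_local : local_ring n)
    (w_in_n : w \in n) (w_regular : GRing.lreg w)
    (piP : is_quotient_by pi w)
    (shG : suspension (MonG w)) (shP : suspension (MonP w)) :
  let stMonG := stable_tricat shG in
  let stMonP := stable_tricat shP in
  let T_0 : stMonG -> Dsg R := T0 piP in
  let T_1 : forall X Y : stMonG, Mor X Y -> Mor (T_0 X) (T_0 Y) := T1 piP in
  let i_0 : stMonP -> stMonG := @incl0 S w in
  let i_1 : forall X Y : stMonP, Mor X Y -> Mor (i_0 X) (i_0 Y) := @incl1 S w in
  let Ti_0 : stMonP -> Dsg R := fun X => T_0 (i_0 X) in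
  let Ti_1 : forall X Y : stMonP, Mor X Y -> Mor (Ti_0 X) (Ti_0 Y) :=
    fun X Y f => T_1 (i_0 X) (i_0 Y) (i_1 X Y f) in
  ((triangle_functor T_1 /\ fully_faithful T_1) /\
   (dense T_0 <-> gorenstein_ring R) /\
   (gorenstein_ring R <-> gorenstein_ring S)) /\
  ((triangle_functor i_1 /\ fully_faithful i_1) /\
   (triangle_functor Ti_1 /\ fully_faithful Ti_1) /\
   (dense Ti_0 <-> regular_local n)).
Proof.
move=> stMonG stMonP T_0 T_1 i_0 i_1 Ti_0 Ti_1.
have Tt : triangle_functor T_1 by exact: T_triangle.
have Tf : fully_faithful T_1 by exact: T_fully_faithful.
have it : triangle_functor i_1 by exact (incl_triangle piP S_noetherian w_regular shG shP).
have if_ : fully_faithful i_1 by exact (incl_fully_faithful piP w_regular).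
have gor : gorenstein_ring R <-> gorenstein_ring S.
  exact: gorenstein_quot piP S_noetherian S_local w_in_n w_regular.
have dG : gorenstein_ring R -> dense T_0.
  exact: (gorenstein_T_dense piP S_noetherian w_regular S_local w_in_n shG).
split; [split=> //; split=> //; split=> //|split=> //; split; [split|split]].
- exact (T_dense_gorenstein S_noetherian w_regular S_local w_in_n).
- apply: (@triangle_functor_comp stMonP stMonG (Dsg R) i_0 i_1 T_0 T_1 _ it Tt).
  exact: dsg_dist_heq.
- exact: (fully_faithful_comp Tt.1 if_ Tf).
- by move=> /(incl_dense_gldim S_noetherian S_local w_regular w_in_n)[D]; apply: gldim_regular.
- move=> /(regular_gldim S_noetherian S_local)[D gD].
  apply: incl_dense => [G|]; first exact: gldim_gproj gD.
  by apply: dG; apply/gor; apply: gldim_gorenstein gD.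
Qed.
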